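(* Fix $L\in\mathbb Z_{\ge1}$ and real numbers $w_i^\circ,\theta_i^\circ,y_j^\circ,s_j^\circ$ for $|i|,|j|\le L$ with $w_i^\circ<y_j^\circ<(\theta_i^\circ)^{-2}w_i^\circ<(s_j^\circ)^{-2}y_j^\circ$ for all $i,j$. Take real global parameters $w_*\in(\min_i w_i^\circ,\max_i w_i^\circ)$, $\theta_*\in(\min_i\theta_i^\circ,\max_i\theta_i^\circ)$, $y_*\in(\min_jy_j^\circ,\max_jy_j^\circ)$, $s_*\in(\min_js_j^\circ,\max_js_j^\circ)$ such that, after setting $w_i^\circ=w_*$, $\theta_i^\circ=\theta_*$, $y_i^\circ=y_*$, $s_i^\circ=s_*$ for $|i|>L$, the inequalities $w_i^\circ<y_j^\circ<(\theta_i^\circ)^{-2}w_i^\circ<(s_j^\circ)^{-2}y_j^\circ$ hold for all $i,j\in\mathbb Z$. Fix $z\in\mathbb C$ with $\Im z>0$. Then for every real $x_*$ sufficiently close to $-\infty$ (in particular $x_*<w_*$) the following holds. Let $(\alpha,\tau)=(\alpha(z),\tau(z))$ be the global location corresponding to $z$ and to $x_*,w_*,\theta_*,y_*,s_*$ (see context). For each $N$, let $K_{\mathscr{AP}}$ be the correlation kernel (see context) of the ascending FG process with $x_i=x_*$ for $i=1,\ldots,N$, and $$w_i=w^\circ_{i-\lfloor\tau N\rfloor},\quad\theta_i=\theta^\circ_{i-\lfloor\tau N\rfloor}\quad(i\ge1),\qquad y_j=y^\circ_{j-\lfloor\alpha N\rfloor},\quad s_j=s^\circ_{j-\lfloor\alpha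 N\rfloor}\quad(j\ge1),$$ where the number $T$ of signatures in the process is large enough ($T\gg N$; the kernel does not depend on $T$). Then for any fixed $\mathsf t,\mathsf a,\mathsf t',\mathsf a'\in\mathbb Z$, $$\lim_{N\to+\infty}K_{\mathscr{AP}}\bigl(\mathsf t+\lfloor\tau N\rfloor,\mathsf a+\lfloor\alpha N\rfloor;\mathsf t'+\lfloor\tau N\rfloor,\mathsf a'+\lfloor\alpha N\rfloor\bigr)=K^z_{\mathrm{2d}}(\mathsf t,\mathsf a;\mathsf t',\mathsf a'),$$ where $K^z_{\mathrm{2d}}$ is the two-dimensional inhomogeneous discrete sine kernel (see context) with parameter sequences $w_i=w_i^\circ$, $\theta_i=\theta_i^\circ$, $y_j=y_j^\circ$, $s_j=s_j^\circ$, $i,j\in\mathbb Z$.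
   Context: Kernel of the ascending FG process. For parameters $x_1,\ldots,x_N$; $w_1,w_2,\ldots$; $\theta_1,\theta_2,\ldots$; $y_1,y_2,\ldots$; $s_1,s_2,\ldots$ and integers $t,a,t',a'\ge1$, $$\begin{aligned}K_{\mathscr{AP}}(t,a;t',a')=\frac1{(2\pi\mathbf i)^2}&\oint du\oint dv\,\frac1{u-v}\prod_{k=1}^N\frac{(u-y_k)(v-x_k)}{(u-x_k)(v-y_k)}\,\frac{y_a(1-s_a^{-2})}{v-s_a^{-2}y_a}\,\frac1{u-y_{a'}}\\&\times\prod_{j=1}^{a-1}\frac{v-y_j}{v-s_j^{-2}y_j}\prod_{j=1}^{a'-1}\frac{u-s_j^{-2}y_j}{u-y_j}\prod_{d=1}^t\frac{v-\theta_d^{-2}w_d}{v-w_d}\prod_{c=1}^{t'}\frac{u-w_c}{u-\theta_c^{-2}w_c}.\end{aligned}$$ The contours are positively oriented simple closed curves one inside the other (the $u$ contour is outside for $t\le t'$, the $v$ contour is outside for $t>t'$); the $u$ contour encircles all $y_i,\theta_j^{-2}w_j$ and none of the $x_k$; the $v$ contour encircles all $y_i,w_j$ and none of the $s_k^{-2}y_k$. (This is the correlation kernel of the determinantal point process associated with the ascending FG process. It does not depend on the remaining parameters $r_i$ of that process.) Global location. For $(\alpha,\tau)\in\mathbb R_{\ge0}^2$ let $\mathscr S(u)=-\log(u-x_* )+(1-\alpha)\log(u-y_* )+\alpha\log(u-s_*^{-2}y_* )+\tau\log(u-w_* )-\tau\log(u-\theta_*^{-2}w_* )$. After clearing denominators,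 the equation $\mathscr S'(u)=0$ becomes a real polynomial equation of degree at most three in $u$ (the $u^4$ terms cancel). Let $\mathscr L\subset\mathbb R_{\ge0}^2$ be the set of $(\alpha,\tau)$ for which the discriminant of this cubic is negative, so that it has a pair of nonreal complex conjugate roots; let $z(\alpha,\tau)$ be the root in the upper half plane. The map $(\alpha,\tau)\mapsto z(\alpha,\tau)$ is a diffeomorphism from $\mathscr L$ onto the open upper half plane, and $(\alpha(z),\tau(z))$ denotes the preimage of $z$. Inhomogeneous discrete sine kernel. For sequences $\mathbf b=\{b_i\}_{i\in\mathbb Z}$, $\mathbf c=\{c_i\}_{i\in\mathbb Z}$ and $n,n'\in\mathbb Z$ put $\mathcal P_{n,n'}(u\mid\mathbf b;\mathbf c)=\prod_{j=n+1}^{n'}\frac{u-b_j}{u-c_j}$ if $n<n'$, $=1$ if $n=n'$, and $=\prod_{j=n'+1}^{n}\frac{u-c_j}{u-b_j}$ if $n>n'$. Then $$K^z_{\mathrm{2d}}(t,a;t',a')=-\frac1{2\pi\mathbf i}\int_{\bar z}^z\frac{y_a(1-s_a^{-2})}{(u-y_a)(u-s_{a'}^{-2}y_{a'})}\,\mathcal P_{a,a'}(u\mid\mathbf s^{-2}\mathbf y;\mathbf y)\,\mathcal P_{t,t'}(u\mid\mathbf w;\boldsymbol\theta^{-2}\mathbf w)\,du,\qquad t,a,t',a'\in\mathbb Z,$$ where $\mathbf s^{-2}\mathbf y=\{s_j^{-2}y_j\}$, $\boldsymbol\theta^{-2}\mathbf w=\{\theta_i^{-2}w_i\}$, and the integration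 is over an arc from $\bar z$ to $z$ which crosses the real line to the left of all $w_i$ if $t'-t\ge0$, and between the points $\theta_i^{-2}w_i$ and the points $s_j^{-2}y_j$ (i.e., to the right of all $\theta_i^{-2}w_i$ and to the left of all $s_j^{-2}y_j$) if $t'-t<0$. *)

(* Defs.v *)
From Stdlib Require Import Reals ZArith List.
From Coquelicot Require Export Coquelicot.
Export ListNotations.

Open Scope R_scope.

(** * Finite ranges of integers *)

(** The list [m; m+1; ...; n], empty if [n < m]. *)
Definition Zrange (m n : Z) : list Z :=
  map (fun k : nat => (m + Z.of_nat k)%Z) (seq 0 (Z.to_nat (n - m + 1))).

Definition Cprod (m n : Z) (f : Z -> C) : C :=
  fold_right Cmult (RtoC 1) (map f (Zrange m n)).

(** Minimum and maximum of [f] over [|i| <= L], for [0 <= L]. *)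
Definition range_min (L : Z) (f : Z -> R) : R :=
  fold_right Rmin (f 0%Z) (map f (Zrange (- L) L)).

Definition range_max (L : Z) (f : Z -> R) : R :=
  fold_right Rmax (f 0%Z) (map f (Zrange (- L) L)).

(** [c^{-2} a], used for [theta^{-2} w] and [s^{-2} y]. *)
Definition sqdiv (c a : R) : R := / c ^ 2 * a.

(** * Contours *)

(** Only the parameter interval [[0, 1]] matters; a curve that is C^1 on
    [[0, 1]] extends to one that is C^1 on all of [R].  The velocity may vanish,
    so piecewise C^1 curves are covered: reparametrize them so that they stop at
    their corners. *)
Record C1path := {
  path :> R -> C;
  velocity : R -> C;
  path_derive :
    forall t : R, @is_derive R_AbsRing C_R_NormedModule path t (velocity t);
  velocity_continuous : forall t : R, continuous velocity t
}.

Definition path_integral (g : C1path) (f : C -> C) : C :=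
  RInt (V := C_R_CompleteNormedModule)
    (fun t : R => Cmult (f (g t)) (velocity g t)) 0 1.

Definition on_path (g : C1path) (p : C) : Prop :=
  exists t : R, 0 <= t <= 1 /\ g t = p.

Definition simple_closed (g : C1path) : Prop :=
  g 0 = g 1 /\
  forall t1 t2 : R, 0 <= t1 < 1 -> 0 <= t2 < 1 -> g t1 = g t2 -> t1 = t2.

Definition winding (g : C1path) (p : C) : C :=
  (/ (2 * PI * Ci) * path_integral g (fun u => / (u - p)))%C.

(** A simple closed curve has winding number 0 around the points outside it, and
    all points inside it have winding number +1 or all have -1, according to the
    orientation.  So [encircles g p] also says that [g] is positively oriented. *)
Definition encircles (g : C1path) (p : C) : Prop :=
  ~ on_path g p /\ winding g p = RtoC 1.

Definition excludes (g : C1path) (p : C) : Prop :=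
  ~ on_path g p /\ winding g p = RtoC 0.

Definition lies_inside (inner outer : C1path) : Prop :=
  (forall p : C, on_path inner p -> encircles outer p) /\
  (forall p : C, on_path outer p -> excludes inner p).

(** * Kernel of the ascending FG process *)

Section AscendingKernel.

(** The sequences are indexed from 1; their values at indices [<= 0] are not
    used when [1 <= t, a, t', a']. *)
Variables (N : nat) (x w theta y s : Z -> R).

Definition AP_contours (t t' : Z) (gu gv : C1path) : Prop :=
  simple_closed gu /\ simple_closed gv /\
  ((t <= t')%Z -> lies_inside gv gu) /\
  ((t' < t)%Z -> lies_inside gu gv) /\
  (forall i : Z, (1 <= i)%Z -> encircles gu (RtoC (y i))) /\
  (forall j : Z, (1 <= j)%Z -> encircles gu (RtoC (sqdiv (theta j) (w j)))) /\
  (forall k : Z, (1 <= k <= Z.of_nat N)%Z -> excludes gu (RtoC (x k))) /\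
  (forall i : Z, (1 <= i)%Z -> encircles gv (RtoC (y i))) /\
  (forall j : Z, (1 <= j)%Z -> encircles gv (RtoC (w j))) /\
  (forall k : Z, (1 <= k)%Z -> excludes gv (RtoC (sqdiv (s k) (y k)))).

Definition AP_integrand (t a t' a' : Z) (u v : C) : C :=
  (/ (u - v)
   * Cprod 1 (Z.of_nat N)
       (fun k => ((u - y k) * (v - x k)) / ((u - x k) * (v - y k)))
   * (RtoC (y a * (1 - / s a ^ 2)) / (v - sqdiv (s a) (y a)))
   * / (u - y a')
   * Cprod 1 (a - 1) (fun j => (v - y j) / (v - sqdiv (s j) (y j)))
   * Cprod 1 (a' - 1) (fun j => (u - sqdiv (s j) (y j)) / (u - y j))
   * Cprod 1 t (fun d => (v - sqdiv (theta d) (w d)) / (v - w d))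
   * Cprod 1 t' (fun c => (u - w c) / (u - sqdiv (theta c) (w c))))%C.

Definition AP_integral (t a t' a' : Z) (gu gv : C1path) : C :=
  (/ (2 * PI * Ci) ^ 2
   * path_integral gu (fun u =>
       path_integral gv (fun v => AP_integrand t a t' a' u v)))%C.

(** As for Coquelicot's [RInt], [iota P] is the unique value satisfying [P]:
    here, the common value of the integrals over all admissible contours. *)
Definition K_AP (t a t' a' : Z) : C :=
  Hierarchy.iota (T := C_R_CompleteNormedModule) (fun k =>
    exists gu gv : C1path,
      AP_contours t t' gu gv /\ k = AP_integral t a t' a' gu gv).

End AscendingKernel.

(** * Global location *)

Section GlobalLocation.

Variables x w theta y s : R.

(** The derivative of
    [S(u) = - log (u - x) + (1 - alpha) log (u - y) + alpha log (u - s^{-2} y)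
            + tau log (u - w) - tau log (u - theta^{-2} w)]. *)
Definition S_deriv (alpha tau : R) (u : C) : C :=
  (- (1 / (u - x)) + RtoC (1 - alpha) / (u - y)
   + RtoC alpha / (u - sqdiv s y)
   + RtoC tau / (u - w) - RtoC tau / (u - sqdiv theta w))%C.

Definition S_denominator (u : C) : C :=
  ((u - x) * (u - y) * (u - sqdiv s y) * (u - w) * (u - sqdiv theta w))%C.

Definition cubic (c3 c2 c1 c0 : R) (u : C) : C :=
  (c3 * u ^ 3 + c2 * u ^ 2 + c1 * u + c0)%C.

Definition cubic_discriminant (c3 c2 c1 c0 : R) : R :=
  18 * c3 * c2 * c1 * c0 - 4 * c2 ^ 3 * c0 + c2 ^ 2 * c1 ^ 2
  - 4 * c3 * c1 ^ 3 - 27 * c3 ^ 2 * c0 ^ 2.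

(** The cubic obtained from [S'(u)] by clearing denominators; this condition
    determines its coefficients. *)
Definition critical_cubic (alpha tau c3 c2 c1 c0 : R) : Prop :=
  forall u : C, S_denominator u <> RtoC 0 ->
    (S_deriv alpha tau u * S_denominator u)%C = cubic c3 c2 c1 c0 u.

(** [(alpha, tau)] is in the region where the discriminant is negative, and [z]
    is the root of the critical cubic in the upper half plane. *)
Definition is_global_location (z : C) (alpha tau : R) : Prop :=
  0 <= alpha /\ 0 <= tau /\
  exists c3 c2 c1 c0 : R,
    critical_cubic alpha tau c3 c2 c1 c0 /\
    cubic_discriminant c3 c2 c1 c0 < 0 /\
    cubic c3 c2 c1 c0 z = RtoC 0 /\ 0 < Im z.

Definition alpha_of (z : C) : R :=
  Hierarchy.iota (T := R_CompleteNormedModule)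
    (fun alpha => exists tau : R, is_global_location z alpha tau).

Definition tau_of (z : C) : R :=
  Hierarchy.iota (T := R_CompleteNormedModule)
    (fun tau => exists alpha : R, is_global_location z alpha tau).

End GlobalLocation.

(** * Two-dimensional inhomogeneous discrete sine kernel *)

Definition P_ratio (n n' : Z) (u : C) (b c : Z -> R) : C :=
  if (n <? n')%Z then Cprod (n + 1) n' (fun j => ((u - b j) / (u - c j))%C)
  else if (n =? n')%Z then RtoC 1
  else Cprod (n' + 1) n (fun j => ((u - c j) / (u - b j))%C).

Section SineKernel.

Variables (w theta y s : Z -> R) (z : C).

Definition sine_arc (t t' : Z) (g : C1path) : Prop :=
  g 0 = Cconj z /\ g 1 = z /\
  forall r : R, 0 <= r <= 1 -> Im (g r) = 0 ->
    ((0 <= t' - t)%Z -> forall i : Z, Re (g r) < w i) /\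
    ((t' - t < 0)%Z ->
       (forall i : Z, sqdiv (theta i) (w i) < Re (g r)) /\
       (forall j : Z, Re (g r) < sqdiv (s j) (y j))).

Definition sine_integrand (t a t' a' : Z) (u : C) : C :=
  (RtoC (y a * (1 - / s a ^ 2)) / ((u - y a) * (u - sqdiv (s a') (y a')))
   * P_ratio a a' u (fun j => sqdiv (s j) (y j)) y
   * P_ratio t t' u w (fun i => sqdiv (theta i) (w i)))%C.

(** The common value of the integral over all arcs from [conj z] to [z] that
    cross the real line in the prescribed interval. *)
Definition K_2d (t a t' a' : Z) : C :=
  Hierarchy.iota (T := C_R_CompleteNormedModule) (fun k =>
    exists g : C1path,
      sine_arc t t' g /\
      k = (- / (2 * PI * Ci) * path_integral g (sine_integrand t a t' a'))%C).

End SineKernel.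

(** * Shifted parameters *)

Definition shift_seq (m : Z) (f : Z -> R) : Z -> R := fun i => f (i - m)%Z.

(** [Int_part] is the floor function. *)
Definition floor_mult (c : R) (N : nat) : Z := Int_part (c * INR N).

(* Main.v *)
(** The kernel is a double integral of [A(u) B(v) / (u - v)] with proper rational
    functions [A] and [B].  Expanding one of them in partial fractions gives the
    inner integral, and leaves the integral of [A] times a part of [B] over one
    contour.  Since [A B] is the integrand of the sine kernel, moving the contour
    to arcs from [conj z] to [z] gives the sine kernel plus integrals of [A] times
    a part of [B] over two arcs along which [|A|] descends from the saddle [z].
    There the part of [B] is the Cauchy integral of [B] over a closed ridge
    through [z], on which [|B|] is at most of the order of [1 / |A(z)|].  The
    errors are exponentially small away from [z], and the pole where the arcs
    meet the ridge is harmless because they cross at an angle.  For [alpha > 1],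
    [A] and [B] are exchanged.

    The curves are found in the coordinate [zeta = (u - P0) / (u - Pinf)], with
    [(P0, Pinf) = (theta^{-2} w, x)] for [alpha <= 1] and [(s^{-2} y, w)] for
    [alpha > 1]: on the circle [|zeta| = |zeta(z)|], by concavity of [ln], the
    action is maximal at [z], and on every other circle about [0] its maximum is
    larger than its value at [z]. *)

(* The coordinate [zeta] sends the two negative charges of a logarithmic potential (Re S for alpha
   <= 1, -Re S for alpha > 1) to 0 and infinity. The remaining charges are positive, and every |zeta
   - p|^2 is affine in |zeta|^2 and Re zeta; this is the source of the concavity. Two cases arise
   because the charge 1 - alpha at y_* changes sign. At alpha = 1 it vanishes, and the charge tau at
   w_* is split into two halves so that three positive charges remain. The integrands are not
   expanded at the saddle. They are only bounded from above; the factor 1 / (u - v) is absorbed by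
   parametrizations that slow down at the saddle, and the decay comes from strict inequalities
   elsewhere. Both kernels are defined as the common value over all admissible contours, so the
   existence of contours and the independence of their choice are part of the proof. *)
Require Import Defs.
From Stdlib Require Import Reals ZArith Lra Lia List Classical ClassicalEpsilon FinFun.
From Coquelicot Require Import Coquelicot.
Open Scope R_scope.

(** * Calculus of complex-valued functions *)

(** Goals produced by Coquelicot state equality at a canonical-structure carrier; they are restated
    over [R] so that [ring] recognizes them. *)
Ltac Rring := intros; match goal with |- ?a = ?b => change (@eq R a b) end; ring.

Lemma continuous_C_iff {U : UniformSpace} (f : U -> C) (t : U) :
  continuous f t <->
  continuous (fun t => Re (f t)) t /\ continuous (fun t => Im (f t)) t.
Proof.
  split.
  - intros H; split; apply (continuous_comp f); trivial;
      [apply continuous_fst | apply continuous_snd].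
  - intros [H1 H2].
    apply (continuous_ext (fun t => (Re (f t), Im (f t)))).
    { intros s; destruct (f s); reflexivity. }
    apply (continuous_comp_2 (fun t => Re (f t)) (fun t => Im (f t)) (fun a b => (a, b)));
      trivial.
    apply (continuous_ext (fun x => x)); [intros []; reflexivity | apply continuous_id].
Qed.

Lemma continuous_Cplus {U : UniformSpace} (f g : U -> C) (t : U) :
  continuous f t -> continuous g t -> continuous (fun t => f t + g t)%C t.
Proof.
  rewrite !continuous_C_iff; intros [] []; split; simpl;
    apply (continuous_plus (V := R_NormedModule)); assumption.
Qed.

Lemma continuous_Copp {U : UniformSpace} (f : U -> C) (t : U) :
  continuous f t -> continuous (fun t => - f t)%C t.
Proof.
  rewrite !continuous_C_iff; intros []; split; simpl;
    apply (continuous_opp (V := R_NormedModule)); assumption.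
Qed.

Lemma continuous_Cminus {U : UniformSpace} (f g : U -> C) (t : U) :
  continuous f t -> continuous g t -> continuous (fun t => f t - g t)%C t.
Proof. intros; apply continuous_Cplus; [|apply continuous_Copp]; assumption. Qed.

Lemma continuous_Cmult {U : UniformSpace} (f g : U -> C) (t : U) :
  continuous f t -> continuous g t -> continuous (fun t => f t * g t)%C t.
Proof.
  rewrite !continuous_C_iff; intros [] []; split; simpl.
  - apply (continuous_minus (V := R_NormedModule));
      apply (continuous_mult (K := R_AbsRing)); assumption.
  - apply (continuous_plus (V := R_NormedModule));
      apply (continuous_mult (K := R_AbsRing)); assumption.
Qed.

Lemma C_neq_0_sq (z : C) : z <> RtoC 0 -> 0 < fst z ^ 2 + snd z ^ 2.
Proof.
  intros H. apply Cmod_gt_0 in H. unfold Cmod in H.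
  destruct (Rle_lt_dec (fst z ^ 2 + snd z ^ 2) 0) as [H'|]; [|assumption].
  rewrite sqrt_neg_0 in H; lra.
Qed.

Lemma continuous_Cinv {U : UniformSpace} (f : U -> C) (t : U) :
  f t <> RtoC 0 -> continuous f t -> continuous (fun t => / f t)%C t.
Proof.
  intros Hf. rewrite !continuous_C_iff; intros [H1 H2].
  assert (Hc : continuous (fun t => fst (f t) ^ 2 + snd (f t) ^ 2) t).
  { simpl. apply (continuous_plus (V := R_NormedModule)).
    - apply (continuous_ext (fun t => fst (f t) * fst (f t)));
        [Rring | apply (continuous_mult (K := R_AbsRing)); assumption].
    - apply (continuous_ext (fun t => snd (f t) * snd (f t)));
        [Rring | apply (continuous_mult (K := R_AbsRing)); assumption]. }
  pose proof (C_neq_0_sq _ Hf).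
  assert (Hi : continuous (fun t => / (fst (f t) ^ 2 + snd (f t) ^ 2)) t).
  { apply (continuous_comp (fun t => fst (f t) ^ 2 + snd (f t) ^ 2) Rinv); [assumption | apply continuous_Rinv; lra]. }
  split; simpl; unfold Rdiv; apply (continuous_mult (K := R_AbsRing)); try assumption.
  apply (continuous_opp (V := R_NormedModule)); assumption.
Qed.

Lemma continuous_Cmod {U : UniformSpace} (f : U -> C) (t : U) :
  continuous f t -> continuous (fun t => Cmod (f t)) t.
Proof.
  rewrite continuous_C_iff; intros [H1 H2]. unfold Cmod.
  apply (continuous_comp (fun t => fst (f t) ^ 2 + snd (f t) ^ 2) sqrt).
  - simpl. apply (continuous_plus (V := R_NormedModule)).
    + apply (continuous_ext (fun t => fst (f t) * fst (f t)));
        [Rring | apply (continuous_mult (K := R_AbsRing)); assumption].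
    + apply (continuous_ext (fun t => snd (f t) * snd (f t)));
        [Rring | apply (continuous_mult (K := R_AbsRing)); assumption].
  - apply continuous_sqrt.
Qed.

(** * Derivatives of complex-valued functions of a real variable *)

Definition Cderive (f : R -> C) (t : R) (l : C) : Prop :=
  @is_derive R_AbsRing C_R_NormedModule f t l.

Lemma Cderive_iff (f : R -> C) (t : R) (l : C) :
  Cderive f t l <->
  is_derive (fun t => Re (f t)) t (Re l) /\ is_derive (fun t => Im (f t)) t (Im l).
Proof.
  split.
  - intros H; split.
    + apply (filterdiff_ext_lin (K := R_AbsRing) (U := R_NormedModule) (V := R_NormedModule) _ (fun y : R => fst (@scal R_AbsRing C_R_NormedModule y l)));
        [|intros; reflexivity].
      apply (filterdiff_comp' (K := R_AbsRing) (V := C_R_NormedModule) f (fun p : C => fst p) t _ (fun p : C => fst p)); [exact H|].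
      apply (filterdiff_linear (U := C_R_NormedModule)).
      apply (@is_linear_fst R_AbsRing R_NormedModule R_NormedModule).
    + apply (filterdiff_ext_lin (K := R_AbsRing) (U := R_NormedModule) (V := R_NormedModule) _ (fun y : R => snd (@scal R_AbsRing C_R_NormedModule y l)));
        [|intros; reflexivity].
      apply (filterdiff_comp' (K := R_AbsRing) (V := C_R_NormedModule) f (fun p : C => snd p) t _ (fun p : C => snd p)); [exact H|].
      apply (filterdiff_linear (U := C_R_NormedModule)).
      apply (@is_linear_snd R_AbsRing R_NormedModule R_NormedModule).
  - intros [H1 H2].
    apply (filterdiff_ext (K := R_AbsRing) (V := C_R_NormedModule) (fun t => (Re (f t), Im (f t)))).
    { intros s; destruct (f s); reflexivity. }
    apply (filterdiff_ext_lin (K := R_AbsRing) (U := R_NormedModule) (V := C_R_NormedModule) _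
             (fun y : R => (y * Re l, y * Im l))).
    2: { intros y; destruct l; reflexivity. }
    apply (filterdiff_comp'_2 (K := R_AbsRing) (W := C_R_NormedModule)
             (fun t => Re (f t)) (fun t => Im (f t)) (fun a b => (a, b)) t
             (fun y : R => y * Re l) (fun y : R => y * Im l) (fun a b => (a, b)));
      try assumption.
    apply (filterdiff_ext_lin (K := R_AbsRing) (V := C_R_NormedModule) _ (fun p => p)).
    2: intros []; reflexivity.
    apply (filterdiff_ext (K := R_AbsRing) (V := C_R_NormedModule) (fun p => p)).
    { intros []; reflexivity. }
    apply filterdiff_id.
Qed.

Lemma Cderive_continuous (f : R -> C) t l : Cderive f t l -> continuous f t.
Proof. intros H; apply (ex_derive_continuous (V := C_R_NormedModule)); exists l; exact H. Qed.

Lemma Cderive_const (c : C) t : Cderive (fun _ => c) t 0%C.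
Proof. apply Cderive_iff; split; apply (is_derive_const (V := R_NormedModule)). Qed.

Lemma Cderive_plus (f g : R -> C) t l m :
  Cderive f t l -> Cderive g t m -> Cderive (fun t => f t + g t)%C t (l + m)%C.
Proof. intros; apply (is_derive_plus (V := C_R_NormedModule)); assumption. Qed.

Lemma Cderive_mult (f g : R -> C) t l m :
  Cderive f t l -> Cderive g t m ->
  Cderive (fun t => f t * g t)%C t (l * g t + f t * m)%C.
Proof.
  rewrite !Cderive_iff; intros [H1 H2] [H3 H4]; split; simpl.
  - evar_last. { apply (is_derive_minus (V := R_NormedModule));
      apply (is_derive_mult (K := R_AbsRing)); try eassumption; intros; apply Rmult_comm. }
    unfold minus, plus, opp, mult; simpl. unfold Re, Im. ring.
  - evar_last. { apply (is_derive_plus (V := R_NormedModule));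
      apply (is_derive_mult (K := R_AbsRing)); try eassumption; intros; apply Rmult_comm. }
    unfold minus, plus, opp, mult; simpl. unfold Re, Im. ring.
Qed.

Lemma Cderive_inv (f : R -> C) t l :
  f t <> RtoC 0 -> Cderive f t l -> Cderive (fun t => / f t)%C t (- l / (f t) ^ 2)%C.
Proof.
  intros Hf. rewrite !Cderive_iff; intros [H1 H2].
  pose proof (C_neq_0_sq _ Hf) as Hp. unfold Re, Im in *. simpl.
  destruct (f t) as [a b] eqn:E. destruct l as [la lb]. simpl in *.
  (* The positivity statement [D] below concerns the squared modulus of (f t)^2 in the form left by
     [simpl]; it equals (a^2 + b^2)^2. *)
  assert (Ha : fst (f t) = a) by (rewrite E; reflexivity).
  assert (Hb : snd (f t) = b) by (rewrite E; reflexivity).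
  assert (D : forall a b, 0 < a * (a * 1) + b * (b * 1) ->
     0 < (a * (a * 1 - b * 0) - b * (a * 0 + b * 1)) * ((a * (a * 1 - b * 0) - b * (a * 0 + b * 1)) * 1) +
         (a * (a * 0 + b * 1) + b * (a * 1 - b * 0)) * ((a * (a * 0 + b * 1) + b * (a * 1 - b * 0)) * 1)).
  { intros a' b' Hp'.
    replace (_ + _) with ((a' * (a' * 1) + b' * (b' * 1)) ^ 2) by ring.
    apply pow_lt; assumption. }
  specialize (D a b Hp).
  split.
  - evar_last. { apply (is_derive_div (fun t => fst (f t)) (fun t => fst (f t) * (fst (f t) * 1) + snd (f t) * (snd (f t) * 1))); [eassumption| |rewrite Ha, Hb; lra].
      apply (is_derive_plus (V := R_NormedModule)); apply (is_derive_mult (K := R_AbsRing)); try eassumption; try (intros; apply Rmult_comm);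
      apply (is_derive_mult (K := R_AbsRing)); try eassumption; try (intros; apply Rmult_comm); apply (is_derive_const (V := R_NormedModule)). }
    unfold plus, mult, zero; simpl. rewrite Ha, Hb. field. split; lra.
  - evar_last. { apply (is_derive_div (fun t => - snd (f t)) (fun t => fst (f t) * (fst (f t) * 1) + snd (f t) * (snd (f t) * 1))); [apply (is_derive_opp (V := R_NormedModule)); eassumption| |rewrite Ha, Hb; lra].
      apply (is_derive_plus (V := R_NormedModule)); apply (is_derive_mult (K := R_AbsRing)); try eassumption; try (intros; apply Rmult_comm);
      apply (is_derive_mult (K := R_AbsRing)); try eassumption; try (intros; apply Rmult_comm); apply (is_derive_const (V := R_NormedModule)). }
    unfold plus, mult, zero, opp; simpl. rewrite Ha, Hb. field. split; lra.
Qed.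

(** * Integrals over the unit interval *)

Notation isCint f l := (@is_RInt C_R_NormedModule f 0 1 l).
Notation Cint f := (@RInt C_R_CompleteNormedModule f 0 1).

Lemma isCint_iff (f : R -> C) (l : C) :
  isCint f l <-> is_RInt (fun t => Re (f t)) 0 1 (Re l) /\ is_RInt (fun t => Im (f t)) 0 1 (Im l).
Proof.
  split.
  - intros H; split;
    [ apply (is_RInt_fct_extend_fst (U := R_NormedModule) (V := R_NormedModule))
    | apply (is_RInt_fct_extend_snd (U := R_NormedModule) (V := R_NormedModule))]; exact H.
  - intros [H1 H2]; destruct l; apply (is_RInt_fct_extend_pair (U := R_NormedModule) (V := R_NormedModule)); assumption.
Qed.

Lemma isCint_unique f l : isCint f l -> Cint f = l.
Proof. intros H. apply (is_RInt_unique (V := C_R_CompleteNormedModule)). exact H. Qed.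

Lemma isCint_plus f g l m : isCint f l -> isCint g m -> isCint (fun t => f t + g t)%C (l + m)%C.
Proof. intros; apply (is_RInt_plus (V := C_R_NormedModule)); assumption. Qed.

Lemma isCint_Cmult c f l : isCint f l -> isCint (fun t => c * f t)%C (c * l)%C.
Proof.
  rewrite !isCint_iff; intros [H1 H2]; unfold Re, Im in *; split; simpl.
  - apply (is_RInt_minus (V := R_NormedModule)); apply (is_RInt_scal (V := R_NormedModule)); assumption.
  - apply (is_RInt_plus (V := R_NormedModule)); apply (is_RInt_scal (V := R_NormedModule)); assumption.
Qed.

Lemma isCint_ext f g l : (forall t, 0 <= t <= 1 -> f t = g t) -> isCint f l -> isCint g l.
Proof.
  intros H; apply (is_RInt_ext (V := C_R_NormedModule)).
  intros t; rewrite Rmin_left, Rmax_right by lra; intros; apply H; lra.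
Qed.

(** Needed for descent curves: they start at the saddle, which lies on the ridge, so identities
    involving the Cauchy integral over the ridge hold only inside the parameter interval. *)
Lemma isCint_ext_open f g l : (forall t, 0 < t < 1 -> f t = g t) -> isCint f l -> isCint g l.
Proof.
  intros H; apply (is_RInt_ext (V := C_R_NormedModule)).
  intros t; rewrite Rmin_left, Rmax_right by lra; intros; apply H; lra.
Qed.

Lemma isCint_derive f df :
  (forall t, 0 <= t <= 1 -> Cderive f t (df t)) ->
  (forall t, 0 <= t <= 1 -> continuous df t) ->
  isCint df (f 1 - f 0)%C.
Proof.
  intros; apply (is_RInt_derive (V := C_R_CompleteNormedModule) f df);
    rewrite Rmin_left, Rmax_right by lra; assumption.
Qed.

Lemma exCint f : (forall t, 0 <= t <= 1 -> continuous f t) -> isCint f (Cint f).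
Proof.
  intros H. apply (RInt_correct (V := C_R_CompleteNormedModule)).
  apply (ex_RInt_continuous (V := C_R_CompleteNormedModule)).
  rewrite Rmin_left, Rmax_right by lra; assumption.
Qed.

Lemma C_R_norm (z : C) : @norm R_AbsRing C_R_NormedModule z = Cmod z.
Proof.
  change (@norm R_AbsRing C_R_NormedModule z) with (sqrt (Rabs (fst z) ^ 2 + Rabs (snd z) ^ 2)).
  unfold Cmod. rewrite !pow2_abs. reflexivity.
Qed.

Lemma isCint_bound f l M :
  (forall t, 0 <= t <= 1 -> Cmod (f t) <= M) -> isCint f l -> Cmod l <= M.
Proof.
  intros H HI. rewrite <- C_R_norm.
  replace M with ((1 - 0) * M) by ring.
  apply (norm_RInt_le_const (V := C_R_NormedModule) f 0 1 l M); [lra| |exact HI].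
  intros; rewrite C_R_norm; apply H; assumption.
Qed.

Lemma isCint_le f g l m :
  (forall t, 0 <= t <= 1 -> Cmod (f t) <= g t) -> isCint f l -> is_RInt g 0 1 m -> Cmod l <= m.
Proof.
  intros H HI Hg. rewrite <- C_R_norm.
  apply (norm_RInt_le (V := C_R_NormedModule) f g 0 1 l m); [lra| |exact HI|exact Hg].
  intros; rewrite C_R_norm; apply H; assumption.
Qed.

(** * Chains, winding numbers and partial fractions *)

Lemma Csub_neq (a b : C) : a <> b -> (a - b)%C <> RtoC 0.
Proof. intros H E; apply H. replace a with ((a - b) + b)%C by ring. rewrite E; ring. Qed.

Lemma RtoC_neq (a b : R) : a <> b -> RtoC a <> RtoC b.
Proof. intros H E; apply H; injection E; trivial. Qed.

Lemma Cinv_0 : (/ 0)%C = RtoC 0.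
Proof. unfold Cinv, RtoC, Rdiv; simpl; f_equal; ring. Qed.

Lemma Cinv_mul (a b : C) : (/ (a * b) = / a * / b)%C.
Proof.
  destruct (classic (a = 0%C)) as [->|Ha]; [rewrite Cmult_0_l, Cinv_0; ring|].
  destruct (classic (b = 0%C)) as [->|Hb]; [rewrite Cmult_0_r, Cinv_0; ring|].
  field; split; assumption.
Qed.

Lemma two_pi_i_neq_0 : (2 * PI * Ci)%C <> RtoC 0.
Proof.
  pose proof PI_RGT_0. intros E; injection E; intros. lra.
Qed.

(** A chain is a formal combination of curves; only its integrals and its
    boundary matter. *)
Definition chain := list (R * C1path).

(** A relation rather than a total integral: a value [v] certifies integrability along every curve,
    so linearity and uniqueness carry no continuity conditions. *)
Fixpoint chain_int (l : chain) (f : C -> C) (v : C) : Prop :=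
  match l with
  | nil => v = RtoC 0
  | (c, g) :: l' => exists v1 v2,
      isCint (fun t => f (g t) * velocity g t)%C v1 /\ chain_int l' f v2 /\
      v = (RtoC c * v1 + v2)%C
  end.

(** The boundary acts on arbitrary functions [F]. Cancellation of end points between pieces is then
    plain algebra, and no end points have to be compared. *)
Fixpoint bdry (l : chain) (F : C -> C) : C :=
  match l with
  | nil => RtoC 0
  | (c, g) :: l' => (RtoC c * (F (g 1) - F (g 0)) + bdry l' F)%C
  end.

Definition cycle (l : chain) : Prop := forall F, bdry l F = RtoC 0.

Definition on_chain (l : chain) (p : C) : Prop :=
  exists c g t, In (c, g) l /\ 0 <= t <= 1 /\ g t = p.

Definition cint (l : chain) (f : C -> C) : C :=
  fold_right (fun cg acc => (RtoC (fst cg) * path_integral (snd cg) f + acc)%C) (RtoC 0) l.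

Definition wind (l : chain) (p : C) : C :=
  (/ (2 * PI * Ci) * cint l (fun u => / (u - p)))%C.

Lemma on_chain_cons c g l p :
  on_chain ((c, g) :: l) p <-> on_path g p \/ on_chain l p.
Proof.
  split.
  - intros (c' & g' & t & [E|Hin] & Ht & Hp).
    + injection E as -> ->. left; exists t; auto.
    + right; exists c', g', t; auto.
  - intros [(t & Ht & Hp) | (c' & g' & t & Hin & Ht & Hp)].
    + exists c, g, t; simpl; auto.
    + exists c', g', t; simpl; auto.
Qed.

Lemma on_chain_app l1 l2 p : on_chain (l1 ++ l2) p <-> on_chain l1 p \/ on_chain l2 p.
Proof.
  split.
  - intros (c & g & t & Hin & H). apply in_app_or in Hin as [|]; [left|right]; exists c, g, t; auto.
  - intros [(c & g & t & Hin & H)|(c & g & t & Hin & H)]; exists c, g, t; split; auto; apply in_or_app; auto.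
Qed.

Lemma chain_int_cint l f v : chain_int l f v -> cint l f = v.
Proof.
  revert v; induction l as [|[c g] l IH]; simpl; intros v H.
  - congruence.
  - destruct H as (v1 & v2 & H1 & H2 & ->). rewrite (IH _ H2).
    unfold path_integral. rewrite (isCint_unique _ _ H1). reflexivity.
Qed.

Lemma chain_int_unique l f v w : chain_int l f v -> chain_int l f w -> v = w.
Proof. intros H1 H2. rewrite <- (chain_int_cint _ _ _ H1). apply chain_int_cint, H2. Qed.

Lemma chain_int_plus l f g v w :
  chain_int l f v -> chain_int l g w -> chain_int l (fun u => f u + g u)%C (v + w)%C.
Proof.
  revert v w; induction l as [|[c h] l IH]; simpl; intros v w.
  - intros -> ->; ring.
  - intros (v1 & v2 & H1 & H2 & ->) (w1 & w2 & H3 & H4 & ->).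
    exists (v1 + w1)%C, (v2 + w2)%C. split; [|split]; [|apply IH; assumption|ring].
    eapply isCint_ext; [|apply isCint_plus; [exact H1|exact H3]]. intros; simpl. ring.
Qed.

Lemma chain_int_scal l f v k :
  chain_int l f v -> chain_int l (fun u => k * f u)%C (k * v)%C.
Proof.
  revert v; induction l as [|[c h] l IH]; simpl; intros v.
  - intros ->; ring.
  - intros (v1 & v2 & H1 & H2 & ->).
    exists (k * v1)%C, (k * v2)%C. split; [|split]; [|apply IH; assumption|ring].
    eapply isCint_ext; [|apply isCint_Cmult; exact H1]. intros; simpl. ring.
Qed.

Lemma chain_int_ext l f g v :
  (forall p, on_chain l p -> f p = g p) -> chain_int l f v -> chain_int l g v.
Proof.
  revert v; induction l as [|[c h] l IH]; simpl; intros v H; [trivial|].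
  intros (v1 & v2 & H1 & H2 & ->). exists v1, v2. split; [|split]; trivial.
  - eapply isCint_ext; [|exact H1]. intros t Ht; simpl. rewrite H; trivial.
    apply on_chain_cons; left; exists t; auto.
  - apply IH; trivial. intros; apply H, on_chain_cons; auto.
Qed.

Lemma chain_int_app l1 l2 f v w :
  chain_int l1 f v -> chain_int l2 f w -> chain_int (l1 ++ l2) f (v + w)%C.
Proof.
  revert v; induction l1 as [|[c h] l IH]; simpl; intros v.
  - intros -> H. replace (0 + w)%C with w by ring. exact H.
  - intros (v1 & v2 & H1 & H2 & ->) H. exists v1, (v2 + w)%C. split; [|split]; trivial.
    + apply IH; assumption.
    + ring.
Qed.

Lemma chain_int_zero l : chain_int l (fun _ => RtoC 0) (RtoC 0).
Proof.
  induction l as [|[c g] l IH]; simpl; [reflexivity|].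
  exists 0%C, 0%C. split; [|split; [exact IH|ring]].
  assert (H : isCint (fun _ => RtoC 0) (0 - 0)%C).
  { apply (isCint_derive (fun _ => RtoC 0)); intros; [apply Cderive_const|apply continuous_const]. }
  replace (0 - 0)%C with (RtoC 0) in H by ring.
  eapply isCint_ext; [|exact H]. intros; simpl; ring.
Qed.

Lemma bdry_app l1 l2 F : bdry (l1 ++ l2) F = (bdry l1 F + bdry l2 F)%C.
Proof. induction l1 as [|[c g] l IH]; simpl; [ring|rewrite IH; ring]. Qed.

Definition scale_chain (k : R) (l : chain) : chain := map (fun cg => (k * fst cg, snd cg)) l.

Lemma bdry_scale k l F : bdry (scale_chain k l) F = (RtoC k * bdry l F)%C.
Proof.
  induction l as [|[c g] l IH]; simpl; [ring|].
  fold (scale_chain k l). rewrite IH. rewrite RtoC_mult. ring.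
Qed.

Lemma chain_int_scale k l f v :
  chain_int l f v -> chain_int (scale_chain k l) f (RtoC k * v)%C.
Proof.
  revert v; induction l as [|[c g] l IH]; simpl; intros v.
  - intros ->; ring.
  - intros (v1 & v2 & H1 & H2 & ->). exists v1, (RtoC k * v2)%C.
    split; [|split]; trivial. { apply IH; trivial. } rewrite RtoC_mult. ring.
Qed.

Lemma on_chain_scale k l p : on_chain (scale_chain k l) p <-> on_chain l p.
Proof.
  split; intros (c & g & t & Hin & H).
  - unfold scale_chain in Hin. apply in_map_iff in Hin as ([c' g'] & E & Hin). injection E as _ <-.
    exists c', g', t; auto.
  - exists (k * c), g, t; split; trivial. unfold scale_chain.
    apply (in_map (fun cg => (k * fst cg, snd cg)) l (c, g) Hin).
Qed.

Lemma path_continuous (g : C1path) t : continuous g t.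
Proof. apply (Cderive_continuous g t (velocity g t)), path_derive. Qed.

Lemma chain_int_exists (l : chain) (f : C -> C) :
  (forall c g t, In (c, g) l -> 0 <= t <= 1 -> continuous (fun t => f (g t)) t) ->
  exists v, chain_int l f v.
Proof.
  induction l as [|[c g] l IH]; simpl; intros H; [eexists; reflexivity|].
  destruct IH as [v2 H2]. { intros; eapply H; eauto. }
  do 3 eexists. split; [apply exCint|split; [exact H2|reflexivity]].
  intros t Ht. apply continuous_Cmult; [|apply velocity_continuous].
  eapply H; eauto.
Qed.

Lemma chain_int_primitive (l : chain) (f F : C -> C) :
  (forall c g t, In (c, g) l -> 0 <= t <= 1 -> continuous (fun t => f (g t)) t) ->
  (forall c g t, In (c, g) l -> 0 <= t <= 1 ->
     Cderive (fun t => F (g t)) t (f (g t) * velocity g t)%C) ->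
  chain_int l f (bdry l F).
Proof.
  induction l as [|[c g] l IH]; simpl; intros Hc Hd; [reflexivity|].
  do 2 eexists. split; [|split]; [|apply IH; eauto|reflexivity].
  apply (isCint_derive (fun t => F (g t))); [eauto|].
  intros. apply continuous_Cmult; [eauto|apply velocity_continuous].
Qed.

Lemma continuous_Cpow {U : UniformSpace} (f : U -> C) (t : U) n : continuous f t -> continuous (fun t => (f t) ^ n)%C t.
Proof.
  intros H; induction n as [|n IH]; simpl; [apply continuous_const|].
  apply continuous_Cmult; assumption.
Qed.

Lemma Cpow_neq_0 (z : C) n : z <> RtoC 0 -> (z ^ n)%C <> RtoC 0.
Proof.
  intros H; induction n; simpl.
  - apply RtoC_neq; lra.
  - apply Cmult_neq_0; assumption.
Qed.

Lemma Cderive_shift (g : C1path) (p : C) t : Cderive (fun t => g t - p)%C t (velocity g t).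
Proof.
  replace (velocity g t) with (velocity g t + 0)%C by ring.
  apply Cderive_plus; [apply path_derive|apply Cderive_const].
Qed.

Lemma Cderive_inv_pow (g : C1path) (p : C) t n : g t <> p ->
  Cderive (fun t => / (g t - p) ^ n)%C t (- INR n * / (g t - p) ^ (S n) * velocity g t)%C.
Proof.
  intros H. pose proof (Csub_neq _ _ H) as Hn.
  induction n as [|n IH].
  - replace (_ * _)%C with (RtoC 0) by (simpl; ring).
    apply (is_derive_ext (V := C_R_NormedModule) (fun _ => (/ 1)%C)); [reflexivity|].
    apply Cderive_const.
  - pose proof (Cpow_neq_0 _ n Hn).
    apply (is_derive_ext (V := C_R_NormedModule) (fun t => / (g t - p) ^ n * / (g t - p))%C).
    { intros s. change (((/ (g s - p) ^ n * / (g s - p)) = / ((g s - p) * (g s - p) ^ n))%C).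
      rewrite Cinv_mul; ring. }
    evar_last.
    { apply Cderive_mult; [exact IH|]. apply Cderive_inv; [exact Hn|]. apply Cderive_shift. }
    rewrite S_INR, RtoC_plus. simpl. field. split; assumption.
Qed.

Lemma off_continuous_inv l p c (g : C1path) t :
  ~ on_chain l p -> In (c, g) l -> 0 <= t <= 1 -> continuous (fun t => / (g t - p))%C t.
Proof.
  intros Hp Hin Ht. apply continuous_Cinv.
  - apply Csub_neq. intros E; apply Hp. exists c, g, t; auto.
  - apply continuous_Cminus; [apply path_continuous|apply continuous_const].
Qed.

Lemma wind_int l p : ~ on_chain l p ->
  chain_int l (fun u => / (u - p))%C (2 * PI * Ci * wind l p)%C.
Proof.
  intros Hp. destruct (chain_int_exists l (fun u => / (u - p))%C) as [v Hv].
  { intros; eapply off_continuous_inv; eauto. }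
  unfold wind. rewrite (chain_int_cint _ _ _ Hv).
  pose proof two_pi_i_neq_0 as Hk. set (k := (2 * PI * Ci)%C) in *.
  replace (k * (/ k * v))%C with v by (field; exact Hk). exact Hv.
Qed.

(** A pole of order at least two has the single-valued primitive -1 / ((k + 1) (u - p)^(k + 1)),
    whose boundary term vanishes on a cycle. *)
Lemma pole_int l p k : cycle l -> ~ on_chain l p ->
  chain_int l (fun u => / (u - p) ^ (S (S k)))%C (RtoC 0).
Proof.
  intros Hl Hp.
  rewrite <- (Hl (fun u => / RtoC (- INR (S k)) * / (u - p) ^ (S k))%C).
  assert (Hk : RtoC (- INR (S k)) <> RtoC 0).
  { apply RtoC_neq. rewrite S_INR. pose proof (pos_INR k). lra. }
  assert (Hoff : forall c g t, In (c, g) l -> 0 <= t <= 1 -> g t <> p).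
  { intros c g t ? ? E; apply Hp; exists c, g, t; auto. }
  apply chain_int_primitive; intros c g t Hin Ht; specialize (Hoff c g t Hin Ht).
  - apply continuous_Cinv. { apply Cpow_neq_0, Csub_neq, Hoff. }
    apply continuous_Cpow, continuous_Cminus; [apply path_continuous|apply continuous_const].
  - evar_last. { apply Cderive_mult; [apply Cderive_const|]. apply Cderive_inv_pow, Hoff. }
    rewrite RtoC_opp in Hk |- *.
    pose proof (Cpow_neq_0 _ (S (S k)) (Csub_neq _ _ Hoff)) as HK.
    pose proof (Cpow_neq_0 _ (S k) (Csub_neq _ _ Hoff)) as HK'.
    revert Hk HK HK'. generalize (RtoC (INR (S k))) ((g t - p) ^ S (S k))%C ((g t - p) ^ S k)%C (velocity g t).
    intros a K K' V Ha HK HK'.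
    assert (a <> RtoC 0). { intros E; apply Ha; rewrite E; ring. }
    field. repeat split; assumption.
Qed.

(** Partial fractions [sum c / (u - p) ^ (k + 1)], stored as triples [(c, p, k)]. *)
Definition pfrac := list (C * R * nat).

Definition pterm (a : C * R * nat) (u : C) : C :=
  let '(c, p, k) := a in (c * / (u - RtoC p) ^ (S k))%C.

Definition pole (a : C * R * nat) : R := let '(c, p, k) := a in p.

Definition pf_eval (T : pfrac) (u : C) : C :=
  fold_right (fun a acc => (pterm a u + acc)%C) (RtoC 0) T.

(** Only simple poles have a residue. The weight [om] is a winding number in the residue theorem,
    and the constant 1 in the sum of all residues. *)
Definition pf_res (T : pfrac) (om : R -> C) : C :=
  fold_right (fun a acc => (match a with (c, p, O) => c * om p | _ => 0 end + acc)%C) (RtoC 0) T.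

Definition pf_poles (T : pfrac) (P : R -> Prop) : Prop := forall a, In a T -> P (pole a).

Lemma pf_eval_app T1 T2 u : pf_eval (T1 ++ T2) u = (pf_eval T1 u + pf_eval T2 u)%C.
Proof. induction T1; simpl; [ring|rewrite IHT1; ring]. Qed.

Lemma pf_res_app T1 T2 om : pf_res (T1 ++ T2) om = (pf_res T1 om + pf_res T2 om)%C.
Proof. induction T1; simpl; [ring|rewrite IHT1; ring]. Qed.

Lemma pf_poles_app T1 T2 P : pf_poles T1 P -> pf_poles T2 P -> pf_poles (T1 ++ T2) P.
Proof. intros H1 H2 a Ha; apply in_app_or in Ha as []; auto. Qed.

Lemma pf_poles_cons a T P : P (pole a) -> pf_poles T P -> pf_poles (a :: T) P.
Proof. intros H1 H2 b [<-|]; auto. Qed.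

Lemma pf_int l T : cycle l -> pf_poles T (fun p => ~ on_chain l (RtoC p)) ->
  chain_int l (pf_eval T) (2 * PI * Ci * pf_res T (fun p => wind l (RtoC p)))%C.
Proof.
  intros Hl; induction T as [|[[c p] k] T IH]; intros HT.
  - simpl. replace (_ * 0)%C with (RtoC 0) by ring. apply chain_int_zero.
  - assert (Hp : ~ on_chain l (RtoC p)) by (apply (HT (c, p, k)); left; reflexivity).
    assert (IH' := IH (fun a Ha => HT a (or_intror Ha))).
    simpl pf_res. rewrite Cmult_plus_distr_l.
    apply (chain_int_plus l (pterm (c, p, k))); [|exact IH'].
    destruct k as [|k].
    + apply (chain_int_ext l (fun u => c * / (u - RtoC p))%C).
      { intros; unfold pterm; simpl. rewrite Cmult_1_r. reflexivity. }
      replace (2 * PI * Ci * (c * wind l p))%C with (c * (2 * PI * Ci * wind l p))%C by ring.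
      apply chain_int_scal, wind_int, Hp.
    + replace (2 * PI * Ci * 0)%C with (c * 0)%C by ring.
      apply chain_int_scal, pole_int; assumption.
Qed.

(** Induction on the order through 1 / ((v - p) (u - v)) = (1 / (v - p) + 1 / (u - v)) / (u - p).
    The powers of v - p alone integrate to 0 when their order exceeds one, so only the two windings
    survive. *)
Lemma Cauchy_pterm l p u k : cycle l -> ~ on_chain l (RtoC p) -> ~ on_chain l u ->
  chain_int l (fun v => / (v - RtoC p) ^ (S k) * / (u - v))%C
    (2 * PI * Ci * ((wind l (RtoC p) - wind l u) * / (u - RtoC p) ^ (S k)))%C.
Proof.
  intros Hl Hp Hu.
  assert (Hv : forall v, on_chain l v -> (v - p)%C <> RtoC 0 /\ (u - v)%C <> RtoC 0).
  { intros v Hv; split; apply Csub_neq; intros E; [subst v|subst u]; auto. }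
  (* If [u] is the pole itself, the two windings cancel and the integrand is minus a single power of
     order [k + 2]. *)
  destruct (classic (u = RtoC p)) as [->|Hup].
  { replace (2 * PI * Ci * _)%C with ((-1) * 0)%C by (unfold Cminus; rewrite Cplus_opp_r; ring).
    eapply chain_int_ext; [|apply chain_int_scal, (pole_int l p k); assumption].
    intros v Hon. destruct (Hv v Hon) as [H _]. pose proof (Cpow_neq_0 _ k H).
    assert ((p - v)%C <> RtoC 0).
    { intros E; apply H. replace (v - p)%C with (- (p - v))%C by ring. rewrite E; ring. }
    simpl. field. repeat split; assumption. }
  pose proof (Csub_neq _ _ Hup) as Hd.
  induction k as [|k IH].
  - replace (2 * PI * Ci * ((wind l p - wind l u) * / (u - p) ^ 1))%C
      with (/ (u - p) * (2 * PI * Ci * wind l p + (-1) * (2 * PI * Ci * wind l u)))%C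
      by (simpl; field; exact Hd).
    eapply chain_int_ext; [|apply chain_int_scal, chain_int_plus;
      [apply wind_int, Hp|apply chain_int_scal, wind_int, Hu]].
    intros v Hon. destruct (Hv v Hon). simpl.
    assert (v - u <> 0)%C. { intros E; apply H0. replace (u - v)%C with (- (v - u))%C by ring. rewrite E; ring. }
    field. repeat split; assumption.
  - replace (2 * PI * Ci * ((wind l p - wind l u) * / (u - p) ^ S (S k)))%C
      with (/ (u - p) * (0 + 2 * PI * Ci * ((wind l p - wind l u) * / (u - p) ^ S k)))%C.
    2: { pose proof (Cpow_neq_0 _ k Hd). simpl. field. split; assumption. }
    eapply chain_int_ext; [|apply chain_int_scal, chain_int_plus;
      [apply (pole_int l p k); assumption|exact IH]].
    intros v Hon. destruct (Hv v Hon). pose proof (Cpow_neq_0 _ k H).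
    simpl. field. repeat split; assumption.
Qed.

(** In Cauchy's formula each term is multiplied by the winding of its pole minus the winding of the
    evaluation point; [om] carries this difference. *)
Fixpoint pf_weight (T : pfrac) (om : R -> C) (u : C) : C :=
  match T with
  | nil => RtoC 0
  | a :: T' => (om (pole a) * pterm a u + pf_weight T' om u)%C
  end.

Lemma Cauchy_pf l T u : cycle l -> ~ on_chain l u ->
  pf_poles T (fun p => ~ on_chain l (RtoC p)) ->
  chain_int l (fun v => pf_eval T v * / (u - v))%C
    (2 * PI * Ci * pf_weight T (fun p => wind l (RtoC p) - wind l u)%C u)%C.
Proof.
  intros Hl Hu. induction T as [|[[c p] k] T IH]; intros HT.
  - simpl. replace (2 * PI * Ci * 0)%C with (RtoC 0) by ring.
    eapply chain_int_ext; [|apply chain_int_zero]. intros; simpl; ring.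
  - assert (Hp : ~ on_chain l (RtoC p)) by (apply (HT (c, p, k)); left; reflexivity).
    specialize (IH (fun a Ha => HT a (or_intror Ha))).
    replace (2 * PI * Ci * _)%C with
      (c * (2 * PI * Ci * ((wind l (RtoC p) - wind l u) * / (u - RtoC p) ^ (S k)))
       + 2 * PI * Ci * pf_weight T (fun p => wind l (RtoC p) - wind l u) u)%C.
    2: { cbn [pf_weight pole pterm]. generalize (/ (u - RtoC p) ^ (S k))%C; intros I. ring. }
    eapply chain_int_ext; [|apply chain_int_plus;
      [apply chain_int_scal, (Cauchy_pterm l p u k); assumption|exact IH]].
    intros v _. change (pf_eval ((c, p, k) :: T) v) with (pterm (c, p, k) v + pf_eval T v)%C.
    cbv beta. unfold pterm. generalize (/ (v - RtoC p) ^ (S k))%C (/ (u - v))%C (pf_eval T v); intros. ring.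
Qed.

(** Iterates 1 / ((u - p) (u - q)) = (1 / (u - p) - 1 / (u - q)) / (p - q), which lowers the order
    at [p] by one. *)
Fixpoint div_term (c : C) (p : R) (k : nat) (q : R) : pfrac :=
  match k with
  | O => (c / (p - q), p, O)%C :: (- (c / (p - q)), q, O)%C :: nil
  | S k' => (c / (p - q), p, k)%C :: div_term (- (c / (p - q)))%C p k' q
  end.

Definition pf_div (T : pfrac) (q : R) : pfrac :=
  flat_map (fun a => let '(c, p, k) := a in
    if Req_dec_T p q then (c, p, S k) :: nil else div_term c p k q) T.

Lemma RtoC_sub_neq (p q : R) : p <> q -> (RtoC p - RtoC q)%C <> RtoC 0.
Proof. intros H; apply Csub_neq, RtoC_neq, H. Qed.

Lemma div_term_eval c p k q u : p <> q -> u <> RtoC p -> u <> RtoC q ->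
  pf_eval (div_term c p k q) u = (pterm (c, p, k) u * / (u - q))%C.
Proof.
  intros Hpq Hp Hq. pose proof (RtoC_sub_neq _ _ Hpq).
  apply Csub_neq in Hp, Hq. revert c; induction k as [|k IH]; intros c; simpl.
  - field. repeat split; assumption.
  - rewrite IH. pose proof (Cpow_neq_0 _ k Hp). simpl. field. repeat split; assumption.
Qed.

Lemma pf_div_eval T q u : pf_poles T (fun p => u <> RtoC p) -> u <> RtoC q ->
  pf_eval (pf_div T q) u = (pf_eval T u * / (u - q))%C.
Proof.
  intros HT Hq. induction T as [|[[c p] k] T IH]; simpl; [ring|].
  rewrite pf_eval_app, IH by (intros a Ha; apply HT; right; exact Ha).
  assert (Hp : u <> RtoC p) by (apply (HT (c, p, k)); left; reflexivity).
  destruct (Req_dec_T p q) as [->|Hpq].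
  - pose proof (Csub_neq _ _ Hp) as Hd. pose proof (Cpow_neq_0 _ k Hd).
    simpl. field. split; assumption.
  - rewrite div_term_eval by assumption. simpl. ring.
Qed.

Lemma div_term_poles c p k q (P : R -> Prop) : P p -> P q -> pf_poles (div_term c p k q) P.
Proof.
  intros Hp Hq. revert c; induction k; intros c; simpl; repeat apply pf_poles_cons; auto.
  intros a [].
Qed.

Lemma pf_div_poles T q P : pf_poles T P -> P q -> pf_poles (pf_div T q) P.
Proof.
  intros HT Hq a Ha. unfold pf_div in Ha. apply in_flat_map in Ha as ([[c p] k] & Hin & Ha).
  assert (Hp : P p) by (apply (HT _ Hin)).
  destruct (Req_dec_T p q).
  - destruct Ha as [<-|[]]. exact Hp.
  - revert Ha. apply div_term_poles; assumption.
Qed.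

Lemma div_term_res c p k q : p <> q -> pf_res (div_term c p k q) (fun _ => RtoC 1) = RtoC 0.
Proof.
  intros Hpq. pose proof (RtoC_sub_neq _ _ Hpq).
  revert c; induction k; intros c; simpl; [ring|]. rewrite IHk. ring.
Qed.

(** The quotient of a proper fraction by u - q is O(1 / u^2) at infinity. Algebraically, every
    simple pole created at [p] comes with the opposite one at [q]. *)
Lemma pf_div_res T q : pf_res (pf_div T q) (fun _ => RtoC 1) = RtoC 0.
Proof.
  induction T as [|[[c p] k] T IH]; simpl; [reflexivity|].
  rewrite pf_res_app, IH. destruct (Req_dec_T p q).
  - simpl. ring.
  - rewrite div_term_res by assumption. ring.
Qed.

Definition pf_scale (c : C) (T : pfrac) : pfrac :=
  map (fun a => let '(d, p, k) := a in ((c * d)%C, p, k)) T.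

Lemma pf_scale_eval c T u : pf_eval (pf_scale c T) u = (c * pf_eval T u)%C.
Proof.
  induction T as [|[[d p] k] T IH]; simpl; [ring|].
  fold (pf_scale c T). rewrite IH. ring.
Qed.

Lemma pf_scale_poles c T P : pf_poles T P -> pf_poles (pf_scale c T) P.
Proof.
  intros HT a Ha. unfold pf_scale in Ha. apply in_map_iff in Ha as ([[d p] k] & <- & Hin).
  exact (HT _ Hin).
Qed.

Lemma pf_scale_res c T om : pf_res (pf_scale c T) om = (c * pf_res T om)%C.
Proof.
  induction T as [|[[d p] k] T IH]; simpl; [ring|].
  fold (pf_scale c T). rewrite IH. destruct k; ring.
Qed.

Definition ratf (zs ps : list R) (u : C) : C :=
  (fold_right Cmult (RtoC 1) (map (fun q => u - RtoC q)%C zs)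
   * / fold_right Cmult (RtoC 1) (map (fun p => u - RtoC p)%C ps))%C.

Lemma pf_poles_impl T (P Q : R -> Prop) : (forall p, P p -> Q p) -> pf_poles T P -> pf_poles T Q.
Proof. intros H HT a Ha; apply H, HT, Ha. Qed.

(** Induction on the zeros through (u - q) / (u - p) = 1 + (p - q) / (u - p); without zeros the
    poles are divided out successively. *)
Lemma ratf_pf zs ps : (length zs < length ps)%nat ->
  exists T, pf_poles T (fun p => In p ps) /\
    forall u, (forall p, In p ps -> u <> RtoC p) -> pf_eval T u = ratf zs ps u.
Proof.
  revert ps; induction zs as [|q zs IH]; intros ps Hlen.
  - destruct ps as [|p ps]; [simpl in Hlen; lia|]. clear Hlen.
    revert p; induction ps as [|p' ps IH]; intros p.
    + exists ((RtoC 1, p, O) :: nil). split.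
      * intros a [<-|[]]; left; reflexivity.
      * intros u Hu. unfold ratf; simpl. rewrite !Cmult_1_r. ring.
    + destruct (IH p') as (T & HT & He). exists (pf_div T p). split.
      * apply pf_div_poles; [|left; reflexivity]. eapply pf_poles_impl; [|exact HT].
        intros r Hr; right; exact Hr.
      * intros u Hu. rewrite pf_div_eval.
        -- rewrite He by (intros; apply Hu; right; assumption).
           unfold ratf. cbn [map fold_right]. rewrite !Cinv_mul. ring.
        -- eapply pf_poles_impl; [|exact HT]. intros; apply Hu; right; assumption.
        -- apply Hu; left; reflexivity.
  - destruct ps as [|p ps]; [simpl in Hlen; lia|].
    destruct (IH ps) as (T & HT & He). { simpl in Hlen; lia. }
    exists (T ++ pf_scale (p - q)%C (pf_div T p)).
    assert (HT' : pf_poles T (fun r => In r (p :: ps))).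
    { eapply pf_poles_impl; [|exact HT]. intros; right; assumption. }
    split.
    + apply pf_poles_app; [exact HT'|]. apply pf_scale_poles, pf_div_poles; [exact HT'|left; reflexivity].
    + intros u Hu. rewrite pf_eval_app, pf_scale_eval, pf_div_eval.
      * rewrite He by (intros; apply Hu; right; assumption).
        assert (Hp : (u - p)%C <> RtoC 0). { apply Csub_neq, Hu; left; reflexivity. }
        unfold ratf. cbn [map fold_right]. rewrite !Cinv_mul.
        set (Z := fold_right Cmult _ _). set (P := fold_right Cmult _ _). set (I := (/ P)%C).
        field. exact Hp.
      * eapply pf_poles_impl; [|exact HT']. intros; apply Hu; assumption.
      * apply Hu; left; reflexivity.
Qed.

(** Multiplication by 1 / (u - p)^(k + 1) amounts to [k + 1] divisions, after each of which the
    residues sum to zero. The pole statement is for every [P], because the poles will be located by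
    different predicates. *)
Lemma pf_mul T1 T2 : exists T,
  (forall P, pf_poles T1 P -> pf_poles T2 P -> pf_poles T P) /\
  pf_res T (fun _ => RtoC 1) = RtoC 0 /\
  forall u, pf_poles T1 (fun p => u <> RtoC p) -> pf_poles T2 (fun p => u <> RtoC p) ->
    pf_eval T u = (pf_eval T1 u * pf_eval T2 u)%C.
Proof.
  induction T2 as [|[[c p] k] T2 (T & HP & HR & HE)].
  - exists nil. repeat split.
    + intros P _ _ a [].
    + intros; simpl; ring.
  - assert (HD : exists D, (forall P : R -> Prop, pf_poles T1 P -> P p -> pf_poles D P) /\
        pf_res D (fun _ => RtoC 1) = RtoC 0 /\
        forall u, pf_poles T1 (fun p => u <> RtoC p) -> u <> RtoC p ->
          pf_eval D u = (pf_eval T1 u * / (u - p) ^ (S k))%C).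
    { induction k as [|k (D & DP & DR & DE)].
      - exists (pf_div T1 p). split; [|split].
        + intros; apply pf_div_poles; assumption.
        + apply pf_div_res.
        + intros. rewrite pf_div_eval by assumption. simpl. rewrite Cmult_1_r. reflexivity.
      - exists (pf_div D p). split; [|split].
        + intros; apply pf_div_poles; auto.
        + apply pf_div_res.
        + intros. rewrite pf_div_eval by auto. rewrite DE by assumption.
          change ((u - p) ^ S (S k))%C with ((u - p) * (u - p) ^ S k)%C. rewrite Cinv_mul. ring. }
    destruct HD as (D & DP & DR & DE).
    exists (pf_scale c D ++ T). split; [|split].
    + intros P H1 H2. apply pf_poles_app.
      * apply pf_scale_poles, DP; [exact H1|]. apply (H2 (c, p, k)); left; reflexivity.
      * apply HP; [exact H1|]. intros a Ha; apply H2; right; exact Ha.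
    + rewrite pf_res_app, pf_scale_res, DR, HR. ring.
    + intros u H1 H2. rewrite pf_eval_app, pf_scale_eval, DE, HE; trivial.
      * cbn [pf_eval fold_right pterm]. fold (pf_eval T2 u). ring.
      * intros a Ha; apply H2; right; exact Ha.
      * apply (H2 (c, p, k)); left; reflexivity.
Qed.

Lemma pf_res_shift T om om' s : (forall a, In a T -> om (pole a) = (om' (pole a) + s)%C) ->
  pf_res T (fun _ => RtoC 1) = RtoC 0 -> pf_res T om = pf_res T om'.
Proof.
  intros H H0.
  assert (E : pf_res T om = (pf_res T om' + s * pf_res T (fun _ => 1))%C).
  { clear H0. induction T as [|[[c p] k] T IH]; simpl; [ring|].
    rewrite IH by (intros; apply H; right; assumption).
    destruct k; [|ring]. pose proof (H (c, p, O) (or_introl eq_refl)) as E; simpl in E. rewrite E. ring. }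
  rewrite E, H0. ring.
Qed.

(** Only windings modulo a common shift matter, because there is no residue at
    infinity. *)
Lemma pf_mul_int T1 T2 l l' s v : cycle l -> cycle l' ->
  pf_poles T1 (fun p => ~ on_chain l (RtoC p) /\ ~ on_chain l' (RtoC p) /\ wind l (RtoC p) = (wind l' (RtoC p) + s)%C) ->
  pf_poles T2 (fun p => ~ on_chain l (RtoC p) /\ ~ on_chain l' (RtoC p) /\ wind l (RtoC p) = (wind l' (RtoC p) + s)%C) ->
  chain_int l (fun u => pf_eval T1 u * pf_eval T2 u)%C v ->
  chain_int l' (fun u => pf_eval T1 u * pf_eval T2 u)%C v.
Proof.
  intros Hl Hl' H1 H2 Hv. destruct (pf_mul T1 T2) as (T & HP & HR & HE).
  assert (HT := HP _ H1 H2).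
  assert (Ev : forall l0, (forall T, pf_poles T (fun p => ~ on_chain l (RtoC p) /\ ~ on_chain l' (RtoC p) /\ wind l (RtoC p) = (wind l' (RtoC p) + s)%C) -> pf_poles T (fun p => ~ on_chain l0 (RtoC p))) ->
    forall u, on_chain l0 u -> pf_eval T u = (pf_eval T1 u * pf_eval T2 u)%C).
  { intros l0 Hl0 u Hu. apply HE; eapply pf_poles_impl; try (apply Hl0; eassumption);
      intros p Hp E; subst u; auto. }
  assert (V : v = (2 * PI * Ci * pf_res T (fun p => wind l (RtoC p)))%C).
  { eapply chain_int_unique; [exact Hv|].
    eapply chain_int_ext; [apply (Ev l)|apply pf_int; trivial].
    - intros T0; apply pf_poles_impl; intros p (Ha & Hb & _); assumption.
    - eapply pf_poles_impl; [|exact HT]; intros p (Ha & Hb & _); assumption. }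
  rewrite V, (pf_res_shift T _ (fun p => wind l' (RtoC p)) s); trivial.
  - eapply chain_int_ext; [apply (Ev l')|apply pf_int; trivial].
    + intros T0; apply pf_poles_impl; intros p (Ha & Hb & _); assumption.
    + eapply pf_poles_impl; [|exact HT]; intros p (Ha & Hb & _); assumption.
  - intros a Ha. apply (HT a Ha).
Qed.

(** Each contour, and later the ridge, has one winding number around all poles below [b] and another
    around the rest; the split turns Cauchy's formula into a combination of two partial sums. *)
Definition low (b : R) (T : pfrac) : pfrac := filter (fun a => if Rlt_dec (pole a) b then true else false) T.
Definition high (b : R) (T : pfrac) : pfrac := filter (fun a => if Rlt_dec (pole a) b then false else true) T.

Lemma low_high_eval b T u : pf_eval T u = (pf_eval (low b T) u + pf_eval (high b T) u)%C.
Proof.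
  induction T as [|a T IH]; simpl; [ring|].
  destruct (Rlt_dec (pole a) b); simpl; rewrite IH; ring.
Qed.

Lemma low_poles b T P : pf_poles T P -> pf_poles (low b T) (fun p => P p /\ p < b).
Proof.
  intros HT a Ha. apply filter_In in Ha as [Ha H]. destruct (Rlt_dec (pole a) b); [|discriminate].
  split; auto.
Qed.

Lemma high_poles b T P : pf_poles T P -> pf_poles (high b T) (fun p => P p /\ b <= p).
Proof.
  intros HT a Ha. apply filter_In in Ha as [Ha H]. destruct (Rlt_dec (pole a) b); [discriminate|].
  split; auto; lra.
Qed.

Lemma pf_weight_low_high b T om c1 c2 u :
  pf_poles T (fun p => (p < b -> om p = c1) /\ (b <= p -> om p = c2)) ->
  pf_weight T om u = (c1 * pf_eval (low b T) u + c2 * pf_eval (high b T) u)%C.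
Proof.
  induction T as [|a T IH]; simpl; intros HT; [ring|].
  destruct (HT a (or_introl eq_refl)) as [H1 H2].
  rewrite IH by (intros a' Ha'; apply HT; right; exact Ha').
  destruct (Rlt_dec (pole a) b); simpl; [rewrite H1 by assumption|rewrite H2 by lra]; ring.
Qed.

Lemma pf_eval_continuous {U : UniformSpace} T (f : U -> C) (t : U) :
  continuous f t -> pf_poles T (fun p => f t <> RtoC p) -> continuous (fun t => pf_eval T (f t)) t.
Proof.
  intros Hf. induction T as [|[[c p] k] T IH]; intros HT.
  - apply continuous_const.
  - apply (continuous_Cplus (fun t => pterm (c, p, k) (f t)) (fun t => pf_eval T (f t))).
    + apply continuous_Cmult; [apply continuous_const|]. apply continuous_Cinv.
      * apply Cpow_neq_0, Csub_neq, (HT (c, p, k)). left; reflexivity.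
      * apply continuous_Cpow, continuous_Cminus; [exact Hf|apply continuous_const].
    + apply IH. intros a Ha; apply HT; right; exact Ha.
Qed.

(** * Fubini *)

Lemma continuity_2d_section (f : R -> R -> R) x y : continuity_2d_pt f x y -> continuous (fun y => f x y) y.
Proof.
  intros H. apply continuity_2d_pt_filterlim in H.
  apply (continuous_comp (fun y => (x, y)) (fun p => f (fst p) (snd p))); [|exact H].
  apply (continuous_comp_2 (fun _ : R => x) (fun y : R => y) (fun a b => (a, b)));
    [apply continuous_const|apply continuous_id|].
  apply (continuous_ext (fun q => q)); [intros []; reflexivity|apply continuous_id].
Qed.

Lemma continuity_2d_swap (f : R -> R -> R) x y :
  continuity_2d_pt f x y -> continuity_2d_pt (fun y x => f x y) y x.
Proof.
  intros H eps. destruct (H eps) as [d Hd]. exists d. intros u v Hu Hv. apply Hd; assumption.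
Qed.

Lemma ex_RInt_section (f : R -> R -> R) x a b : (forall x y, continuity_2d_pt f x y) ->
  ex_RInt (fun y => f x y) a b.
Proof.
  intros Hf. apply (ex_RInt_continuous (V := R_CompleteNormedModule)).
  intros; apply continuity_2d_section, Hf.
Qed.

Lemma continuous_RInt_param (f : R -> R -> R) x : (forall x y, continuity_2d_pt f x y) ->
  continuous (fun x => RInt (fun y => f x y) 0 1) x.
Proof.
  intros Hf.
  apply continuity_pt_filterlim. intros eps Heps.
  destruct (uniform_continuity_2d_1d' f 0 1 x (fun y _ => Hf x y) (mkposreal (eps / 2) ltac:(lra))) as [d Hd].
  exists d. split; [apply cond_pos|]. intros x' [_ Hx']. unfold dist in *; simpl in *.
  unfold R_dist in *. 
  assert (E : RInt (fun y => f x' y) 0 1 - RInt (fun y => f x y) 0 1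
     = RInt (fun y => f x' y - f x y) 0 1).
  { symmetry. apply (RInt_minus (V := R_CompleteNormedModule)); apply ex_RInt_section, Hf. }
  rewrite E. apply Rle_lt_trans with (eps / 2); [|lra].
  replace (eps / 2) with ((1 - 0) * (eps / 2)) by ring.
  apply (norm_RInt_le_const (V := R_NormedModule) (fun y => f x' y - f x y) 0 1 _ (eps / 2)); [lra| |].
  - intros y Hy. apply Rlt_le. pose proof (cond_pos d). apply (Hd y x y x'); auto; try (split; lra).
    + apply Rabs_def2 in Hx'. split; lra.
    + rewrite Rminus_diag, Rabs_R0. apply cond_pos.
  - apply (RInt_correct (V := R_CompleteNormedModule)), (ex_RInt_minus (V := R_NormedModule)); apply ex_RInt_section, Hf.
Qed.

(** Cut the [x] integration at [T]: differentiation under the integral sign shows that the resulting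
    function [F] has derivative [g], so both iterated integrals equal F 1 - F 0. *)
Lemma RInt_Fubini (f : R -> R -> R) : (forall x y, continuity_2d_pt f x y) ->
  RInt (fun x => RInt (fun y => f x y) 0 1) 0 1 = RInt (fun y => RInt (fun x => f x y) 0 1) 0 1.
Proof.
  intros Hf. set (g := fun x => RInt (fun y => f x y) 0 1).
  assert (Hsec : forall y a b, ex_RInt (fun x => f x y) a b).
  { intros; apply (ex_RInt_section (fun y x => f x y)). intros; apply continuity_2d_swap, Hf. }
  assert (Hg : forall x, continuous g x) by (intros; apply continuous_RInt_param, Hf).
  set (F := fun T => RInt (fun y => RInt (fun x => f x y) 0 T) 0 1).
  assert (Hd : forall y T, is_derive (fun T => RInt (fun x => f x y) 0 T) T (f T y)).
  { intros y T. apply (is_derive_RInt (V := R_NormedModule) (fun x => f x y) _ 0 T).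
    - apply filter_forall. intros b. apply (RInt_correct (V := R_CompleteNormedModule)), Hsec.
    - apply (continuity_2d_section (fun y x => f x y)), continuity_2d_swap, Hf. }
  assert (Hcont : forall T y, continuous (fun y => RInt (fun x => f x y) 0 T) y).
  { intros T y.
    (* The substitution x = T t moves [T] from the bound into the integrand, which reduces
       continuity in [y] to integrals over [0, 1]. *)
    apply (continuous_ext (fun y => RInt (fun t => T * f (T * t) y) 0 1)).
    - intros y'. 
      transitivity (RInt (fun t => scal T ((fun x => f x y') (T * t + 0))) 0 1).
      + apply (RInt_ext (V := R_CompleteNormedModule)). intros t _. rewrite Rplus_0_r. reflexivity.
      + etransitivity.
        * apply (RInt_comp_lin (V := R_CompleteNormedModule) (fun x => f x y') T 0 0 1). apply Hsec.
        * f_equal; ring.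
    - apply (continuous_RInt_param (fun y t => T * f (T * t) y)).
      intros y0 t0. apply continuity_2d_pt_mult; [apply continuity_2d_pt_const|].
      apply continuity_2d_pt_filterlim.
      apply (continuous_comp_2 (fun p : R * R => T * snd p) (fun p : R * R => fst p) f).
      + apply (continuous_mult (K := R_AbsRing)); [apply continuous_const|apply continuous_snd].
      + apply continuous_fst.
      + apply continuity_2d_pt_filterlim, Hf. }
  assert (HF : forall T, is_derive F T (g T)).
  { intros T. unfold F, g.
    evar_last.
    - apply (is_derive_RInt_param (fun T y => RInt (fun x => f x y) 0 T) 0 1 T).
      + apply filter_forall. intros T' y _. eexists; apply Hd.
      + intros y _. apply (continuity_2d_pt_ext f); [|apply Hf].
        intros u v. symmetry; apply is_derive_unique, Hd.
      + apply filter_forall. intros T'. apply (ex_RInt_continuous (V := R_CompleteNormedModule)).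
        intros; apply Hcont.
    - simpl. apply (RInt_ext (V := R_CompleteNormedModule)). intros; apply is_derive_unique, Hd. }
  assert (E : is_RInt g 0 1 (minus (F 1) (F 0))).
  { apply (is_RInt_derive (V := R_CompleteNormedModule) F g); intros; auto. }
  rewrite (is_RInt_unique (V := R_CompleteNormedModule) _ _ _ _ E).
  unfold minus, plus, opp; simpl.
  replace (F 0) with 0; [unfold F; ring|].
  unfold F. symmetry. rewrite (RInt_ext (V := R_CompleteNormedModule) _ (fun _ => 0)).
  - rewrite RInt_const. apply Rmult_0_r.
  - intros; apply (RInt_point (V := R_CompleteNormedModule)).
Qed.

(** Retraction onto [0, 1]. It extends functions that are continuous only on the unit square to the
    whole plane without changing their integrals over it. *)
Definition clamp (t : R) : R := Rmax 0 (Rmin 1 t).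

Lemma clamp_id t : 0 <= t <= 1 -> clamp t = t.
Proof. intros; unfold clamp. rewrite Rmin_right, Rmax_right; lra. Qed.

Lemma clamp_range t : 0 <= clamp t <= 1.
Proof. unfold clamp, Rmax, Rmin. repeat destruct Rle_dec; lra. Qed.

Lemma clamp_continuous t : continuous clamp t.
Proof.
  apply continuity_pt_filterlim. intros eps Heps. exists eps; split; [exact Heps|].
  intros t' [_ H]. simpl in *. unfold R_dist in *.
  apply Rabs_def2 in H. apply Rabs_def1; unfold clamp, Rmax, Rmin; repeat destruct Rle_dec; lra.
Qed.

(** Stated for a projection [P] so that one argument serves both [Re] and [Im]. *)
Lemma Fubini_component (P : C -> R) (h : R -> R -> C) (k1 k2 : R -> C) v :
  (forall z : C, continuous P z) ->
  (forall f l, isCint f l -> is_RInt (fun t => P (f t)) 0 1 (P l)) ->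
  (forall x y, 0 <= x <= 1 -> 0 <= y <= 1 ->
     continuous (fun q : R * R => h (fst q) (snd q)) (x, y)) ->
  (forall x, 0 <= x <= 1 -> isCint (fun y => h x y) (k1 x)) ->
  (forall y, 0 <= y <= 1 -> isCint (fun x => h x y) (k2 y)) ->
  isCint k1 v -> is_RInt (fun y => P (k2 y)) 0 1 (P v).
Proof.
  intros HPc HP Hc H1 H2 Hv.
    set (f := fun x y => P (h (clamp x) (clamp y))).
    assert (Hf : forall x y, continuity_2d_pt f x y).
    { intros x y. apply continuity_2d_pt_filterlim.
      apply (continuous_comp (fun q : R * R => h (clamp (fst q)) (clamp (snd q))) P); [|apply HPc].
      apply (continuous_comp_2 (fun q : R * R => clamp (fst q)) (fun q => clamp (snd q)) h).
      - apply (continuous_comp (fun q : R * R => fst q) clamp); [apply continuous_fst|apply clamp_continuous].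
      - apply (continuous_comp (fun q : R * R => snd q) clamp); [apply continuous_snd|apply clamp_continuous].
      - apply Hc; apply clamp_range. }
    assert (E1 : forall x, 0 <= x <= 1 -> RInt (fun y => f x y) 0 1 = P (k1 x)).
    { intros x Hx. apply (is_RInt_unique (V := R_CompleteNormedModule)).
      eapply (is_RInt_ext (V := R_NormedModule)); [|apply HP, H1, Hx].
      rewrite Rmin_left, Rmax_right by lra. intros y Hy. unfold f. rewrite !clamp_id by lra. reflexivity. }
    assert (E2 : forall y, 0 <= y <= 1 -> RInt (fun x => f x y) 0 1 = P (k2 y)).
    { intros y Hy. apply (is_RInt_unique (V := R_CompleteNormedModule)).
      eapply (is_RInt_ext (V := R_NormedModule)); [|apply HP, H2, Hy].
      rewrite Rmin_left, Rmax_right by lra. intros x Hx. unfold f. rewrite !clamp_id by lra. reflexivity. }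
    assert (E3 : RInt (fun x => RInt (fun y => f x y) 0 1) 0 1 = P v).
    { apply (is_RInt_unique (V := R_CompleteNormedModule)).
      eapply (is_RInt_ext (V := R_NormedModule)); [|apply HP, Hv].
      rewrite Rmin_left, Rmax_right by lra. intros x Hx. symmetry; apply E1; lra. }
    rewrite <- E3, (RInt_Fubini f Hf).
    eapply (is_RInt_ext (V := R_NormedModule)); [|apply (RInt_correct (V := R_CompleteNormedModule))].
    - rewrite Rmin_left, Rmax_right by lra. intros y Hy. apply E2; lra.
    - apply (ex_RInt_continuous (V := R_CompleteNormedModule)). intros y _.
      apply (continuous_RInt_param (fun y x => f x y)). intros; apply continuity_2d_swap, Hf. 
Qed.

Lemma isCint_Fubini (h : R -> R -> C) (k1 k2 : R -> C) v :
  (forall x y, 0 <= x <= 1 -> 0 <= y <= 1 ->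
     continuous (fun q : R * R => h (fst q) (snd q)) (x, y)) ->
  (forall x, 0 <= x <= 1 -> isCint (fun y => h x y) (k1 x)) ->
  (forall y, 0 <= y <= 1 -> isCint (fun x => h x y) (k2 y)) ->
  isCint k1 v -> isCint k2 v.
Proof.
  intros Hc H1 H2 Hv. apply isCint_iff; split.
  - refine (Fubini_component Re h k1 k2 v _ _ Hc H1 H2 Hv).
    + intros; apply continuous_fst.
    + intros f l Hl. exact (proj1 (proj1 (isCint_iff f l) Hl)).
  - refine (Fubini_component Im h k1 k2 v _ _ Hc H1 H2 Hv).
    + intros; apply continuous_snd.
    + intros f l Hl. exact (proj2 (proj1 (isCint_iff f l) Hl)).
Qed.

(** * Arcs between conjugate points *)

Ltac Rfield := intros; match goal with |- ?a = ?b => change (@eq R a b) end; field.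

Lemma continuous_bounded (f : R -> R) : (forall t, 0 <= t <= 1 -> continuous f t) ->
  exists M, forall t, 0 <= t <= 1 -> f t <= M.
Proof.
  intros H. destruct (continuity_ab_maj f 0 1) as (m & Hm & _); [lra| |].
  - intros t Ht. apply continuity_pt_filterlim, H, Ht.
  - exists (f m). exact Hm.
Qed.

Lemma continuous_attains_min (f : R -> R) : (forall t, 0 <= t <= 1 -> continuous f t) ->
  exists m, 0 <= m <= 1 /\ forall t, 0 <= t <= 1 -> f m <= f t.
Proof.
  intros H. destruct (continuity_ab_min f 0 1) as (m & Hm & H1); [lra| |].
  - intros t Ht. apply continuity_pt_filterlim, H, Ht.
  - exists m. auto.
Qed.

(** * Local constancy of winding numbers *)

Lemma chain_bound l : exists K, 0 < K /\ forall f v M, 0 <= M ->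
  (forall p, on_chain l p -> Cmod (f p) <= M) -> chain_int l f v -> Cmod v <= M * K.
Proof.
  induction l as [|[c g] l (K & HK & IH)].
  - exists 1. split; [lra|]. intros f v M HM _ ->. rewrite Cmod_0. lra.
  - destruct (continuous_bounded (fun t => Cmod (velocity g t))) as [V HV].
    { intros; apply continuous_Cmod, velocity_continuous. }
    assert (HV0 : 0 <= V). { apply Rle_trans with (1 := Cmod_ge_0 (velocity g 0)), HV; lra. }
    exists (Rabs c * V + K). split. { pose proof (Rabs_pos c). nra. }
    intros f v M HM Hf (v1 & v2 & H1 & H2 & ->).
    apply Rle_trans with (1 := Cmod_triangle _ _). rewrite Rmult_plus_distr_l.
    apply Rplus_le_compat.
    + rewrite Cmod_mult, Cmod_R.
      assert (Cmod v1 <= M * V).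
      { apply (isCint_bound (fun t => f (g t) * velocity g t)%C); [|exact H1].
        intros t Ht. rewrite Cmod_mult. apply Rmult_le_compat; try apply Cmod_ge_0; auto.
        apply Hf, on_chain_cons; left; exists t; auto. }
      pose proof (Rabs_pos c). nra.
    + apply IH with f; trivial. intros; apply Hf, on_chain_cons; auto.
Qed.

Lemma chain_dist l u : ~ on_chain l u -> exists d, 0 < d /\ forall q, on_chain l q -> d <= Cmod (u - q).
Proof.
  induction l as [|[c g] l IH]; intros Hu.
  - exists 1. split; [lra|]. intros q (c & g & t & [] & _).
  - destruct IH as (d1 & Hd1 & H1). { intros H; apply Hu, on_chain_cons; auto. }
    destruct (continuous_attains_min (fun t => Cmod (u - g t))) as (m & Hm & H2).
    { intros; apply continuous_Cmod, continuous_Cminus; [apply continuous_const|apply path_continuous]. }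
    assert (0 < Cmod (u - g m)).
    { apply Cmod_gt_0, Csub_neq. intros E; apply Hu, on_chain_cons; left; exists m; auto. }
    exists (Rmin d1 (Cmod (u - g m))). split; [apply Rmin_glb_lt; assumption|].
    intros q Hq. apply on_chain_cons in Hq as [(t & Ht & <-)|Hq].
    + apply Rle_trans with (1 := Rmin_r _ _), H2, Ht.
    + apply Rle_trans with (1 := Rmin_l _ _), H1, Hq.
Qed.

Lemma Cderive_lipschitz (f : R -> C) t l : Cderive f t l ->
  exists d M, 0 < d /\ 0 <= M /\ forall h, Rabs h < d -> Cmod (f (t + h)%R - f t) <= M * Rabs h.
Proof.
  rewrite Cderive_iff; intros [H1 H2]. apply is_derive_Reals in H1, H2.
  destruct (H1 1 ltac:(lra)) as [d1 Hd1]. destruct (H2 1 ltac:(lra)) as [d2 Hd2].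
  set (M1 := Rabs (Re l) + 1). set (M2 := Rabs (Im l) + 1).
  assert (B : forall a h k, h <> 0 -> Rabs (a / h - k) < 1 -> Rabs a <= (Rabs k + 1) * Rabs h).
  { intros a h k Hh Ha.
    replace a with ((a / h - k + k) * h) at 1 by (field; exact Hh). rewrite Rabs_mult.
    apply Rmult_le_compat_r; [apply Rabs_pos|].
    pose proof (Rabs_triang (a / h - k) k). lra. }
  exists (Rmin d1 d2), (M1 + M2). split; [apply Rmin_glb_lt; apply cond_pos|].
  split. { pose proof (Rabs_pos (Re l)). pose proof (Rabs_pos (Im l)). unfold M1, M2; lra. }
  intros h Hh. destruct (Req_dec_T h 0) as [->|Hn].
  { rewrite Rplus_0_r. replace (f t - f t)%C with (RtoC 0) by ring. rewrite Cmod_0, Rabs_R0. lra. }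
  assert (A1 := B _ _ _ Hn (Hd1 h Hn (Rlt_le_trans _ _ _ Hh (Rmin_l _ _)))).
  assert (A2 := B _ _ _ Hn (Hd2 h Hn (Rlt_le_trans _ _ _ Hh (Rmin_r _ _)))).
  fold M1 in A1. fold M2 in A2.
  replace (f (t + h)%R - f t)%C with (RtoC (Re (f (t + h)%R) - Re (f t)) + Ci * RtoC (Im (f (t + h)%R) - Im (f t)))%C.
  - apply Rle_trans with (1 := Cmod_triangle _ _). rewrite Cmod_mult, Cmod_Ci, !Cmod_R. lra.
  - unfold Cminus, Cplus, Cmult, Copp, Ci, RtoC, Re, Im; simpl. f_equal; ring.
Qed.

Lemma Cderive_zero (f : R -> C) t d K : 0 < d ->
  (forall h, Rabs h < d -> Cmod (f (t + h)%R - f t) <= K * Rabs h * Rabs h) -> Cderive f t (RtoC 0).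
Proof.
  intros Hd H.
  assert (B : forall F : R -> R, (forall h, Rabs h < d -> Rabs (F (t + h)%R - F t) <= K * Rabs h * Rabs h) -> is_derive F t 0).
  { intros F HF. apply is_derive_Reals. intros eps Heps.
    assert (HK : 0 < Rabs K + 1) by (pose proof (Rabs_pos K); lra).
    assert (Hdd : 0 < Rmin d (eps / (Rabs K + 1))).
    { apply Rmin_glb_lt; [exact Hd|]. apply Rdiv_lt_0_compat; lra. }
    exists (mkposreal _ Hdd). simpl. intros h Hn Hh. rewrite Rminus_0_r.
    unfold Rdiv. rewrite Rabs_mult, Rabs_inv.
    assert (0 < Rabs h) by (apply Rabs_pos_lt; exact Hn).
    apply Rle_lt_trans with (K * Rabs h).
    - apply Rmult_le_reg_r with (Rabs h); [assumption|].
      rewrite Rmult_assoc, Rinv_l, Rmult_1_r by lra. apply HF.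
      apply Rlt_le_trans with (1 := Hh), Rmin_l.
    - assert (Rabs h < eps / (Rabs K + 1)) by (apply Rlt_le_trans with (1 := Hh), Rmin_r).
      apply Rle_lt_trans with ((Rabs K + 1) * Rabs h).
      + apply Rmult_le_compat_r; [lra|]. pose proof (RRle_abs K). lra.
      + apply Rmult_lt_reg_l with (/ (Rabs K + 1)); [apply Rinv_0_lt_compat; lra|].
        rewrite <- Rmult_assoc, Rinv_l, Rmult_1_l by lra. unfold Rdiv in *. lra. }
  apply Cderive_iff; split; apply B; intros h Hh; apply Rle_trans with (2 := H h Hh).
  - apply (re_le_Cmod (f (t + h)%R - f t)).
  - replace (Im (f (t + h)%R) - Im (f t)) with (Im (f (t + h)%R - f t)%C) by reflexivity.
    apply Rle_trans with (2 := Rmax_Cmod _). apply Rmax_r.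
Qed.

(** The first-order term of the winding number in u' - u is the integral of 1 / (v - u)^2, which is
    0 on a cycle. Constancy thus follows from a vanishing derivative, and integrality is not
    involved. *)
Lemma wind_quadratic l u : cycle l -> ~ on_chain l u ->
  exists d K, 0 < d /\ 0 <= K /\
  forall u', Cmod (u' - u) < d -> ~ on_chain l u' /\ Cmod (wind l u' - wind l u) <= K * Cmod (u' - u) * Cmod (u' - u).
Proof.
  intros Hl Hu. destruct (chain_dist l u Hu) as (d & Hd & Hdist).
  destruct (chain_bound l) as (K & HK & Hb).
  assert (Hk : 0 < Cmod (2 * PI * Ci)) by (apply Cmod_gt_0, two_pi_i_neq_0).
  exists (d / 2), (/ Cmod (2 * PI * Ci) * (2 / d ^ 3 * K)). split; [lra|]. split.
  { apply Rmult_le_pos; [apply Rlt_le, Rinv_0_lt_compat, Hk|].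
    apply Rmult_le_pos; [|lra]. apply Rlt_le, Rdiv_lt_0_compat; [lra|]. apply pow_lt, Hd. }
  intros u' Hu'.
  assert (Hu'd : forall q, on_chain l q -> d / 2 <= Cmod (u' - q)).
  { intros q Hq. pose proof (Hdist q Hq). pose proof (Cmod_triangle (u - u') (u' - q)).
    replace (u - u' + (u' - q))%C with (u - q)%C in H0 by ring.
    replace (u - u')%C with (- (u' - u))%C in H0 by ring. rewrite Cmod_opp in H0. lra. }
  assert (Hoff : ~ on_chain l u').
  { intros H. specialize (Hu'd _ H). replace (u' - u')%C with (RtoC 0) in Hu'd by ring. rewrite Cmod_0 in Hu'd. lra. }
  split; [exact Hoff|].
  (* 1 / (v - u') - 1 / (v - u) - (u' - u) / (v - u)^2 equals (u' - u)^2 / ((v - u') (v - u)^2). *)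
  assert (HI : chain_int l (fun v => (u' - u) ^ 2 * (/ (v - u') * / (v - u) ^ 2))%C
     (2 * PI * Ci * wind l u' + (-1) * (2 * PI * Ci * wind l u) + - (u' - u) * 0)%C).
  { eapply chain_int_ext; [|apply chain_int_plus; [apply chain_int_plus;
      [apply wind_int, Hoff|apply chain_int_scal, wind_int, Hu]|apply chain_int_scal, (pole_int l u 0 Hl Hu)]].
    intros v Hv.
    assert (v - u' <> 0)%C by (apply Csub_neq; intros E; subst; auto).
    assert (v - u <> 0)%C by (apply Csub_neq; intros E; subst; auto).
    simpl. field. split; assumption. }
  apply Hb with (M := Cmod (u' - u) * Cmod (u' - u) * (2 / d ^ 3)) in HI.
  - replace (wind l u' - wind l u)%C with (/ (2 * PI * Ci) * (2 * PI * Ci * wind l u' + -1 * (2 * PI * Ci * wind l u) + - (u' - u) * 0))%C.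
    + rewrite Cmod_mult, Cmod_inv by apply two_pi_i_neq_0.
      apply Rle_trans with (/ Cmod (2 * PI * Ci) * (Cmod (u' - u) * Cmod (u' - u) * (2 / d ^ 3) * K)).
      * apply Rmult_le_compat_l; [apply Rlt_le, Rinv_0_lt_compat, Hk|exact HI].
      * right; ring.
    + pose proof two_pi_i_neq_0 as H2. generalize dependent (2 * PI * Ci)%C. intros; field; assumption.
  - apply Rmult_le_pos; [apply Rmult_le_pos; apply Cmod_ge_0|].
    apply Rlt_le, Rdiv_lt_0_compat; [lra|]. apply pow_lt, Hd.
  - intros v Hv. pose proof (Hdist v Hv) as D1. pose proof (Hu'd v Hv) as D2.
    assert (N1 : (v - u' <> 0)%C) by (apply Csub_neq; intros E; subst; auto).
    assert (N2 : (v - u <> 0)%C) by (apply Csub_neq; intros E; subst; auto).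
    replace (u - v)%C with (- (v - u))%C in D1 by ring. rewrite Cmod_opp in D1.
    replace (u' - v)%C with (- (v - u'))%C in D2 by ring. rewrite Cmod_opp in D2.
    rewrite !Cmod_mult, Cmod_pow, !Cmod_inv, Cmod_pow by (try apply Cpow_neq_0; assumption).
    replace (Cmod (u' - u) ^ 2) with (Cmod (u' - u) * Cmod (u' - u)) by ring.
    apply Rmult_le_compat_l; [apply Rmult_le_pos; apply Cmod_ge_0|].
    rewrite <- Rinv_mult.
    replace (2 / d ^ 3) with (/ (d / 2 * d ^ 2)) by (field; lra).
    apply Rinv_le_contravar. { apply Rmult_lt_0_compat; [lra|apply pow_lt, Hd]. }
    apply Rmult_le_compat; try lra. { apply pow_le; lra. } apply pow_incr; lra.
Qed.

Lemma wind_constant l (c : R -> C) (dc : R -> C) a b : cycle l -> a <= b ->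
  (forall s, a <= s <= b -> Cderive c s (dc s)) ->
  (forall s, a <= s <= b -> ~ on_chain l (c s)) ->
  wind l (c a) = wind l (c b).
Proof.
  intros Hl [Hab|<-] Hd Hoff; [|reflexivity].
  apply (eq_is_derive (V := C_R_NormedModule) (fun s => wind l (c s))); [|exact Hab].
  intros s Hs.
  destruct (wind_quadratic l (c s) Hl (Hoff s Hs)) as (d & K & Hd0 & HK & HW).
  destruct (Cderive_lipschitz _ _ _ (Hd s Hs)) as (d' & M & Hd' & HM & HL).
  assert (Hdd : 0 < Rmin d' (d / (M + 1))).
  { apply Rmin_glb_lt; [exact Hd'|]. apply Rdiv_lt_0_compat; lra. }
  apply (Cderive_zero _ s (Rmin d' (d / (M + 1))) (K * (M * M))); [exact Hdd|].
  intros h Hh.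
  assert (H1 : Cmod (c (s + h)%R - c s) <= M * Rabs h).
  { apply HL. apply Rlt_le_trans with (1 := Hh), Rmin_l. }
  assert (H2 : Rabs h < d / (M + 1)) by (apply Rlt_le_trans with (1 := Hh), Rmin_r).
  assert (H3 : Rabs h * (M + 1) < d).
  { apply Rmult_lt_compat_r with (r := M + 1) in H2; [|lra].
    unfold Rdiv in H2. rewrite Rmult_assoc, Rinv_l, Rmult_1_r in H2 by lra. exact H2. }
  pose proof (Rabs_pos h). pose proof (Cmod_ge_0 (c (s + h)%R - c s)).
  destruct (HW (c (s + h)%R)) as [_ HW']; [nra|].
  apply Rle_trans with (1 := HW').
  replace (K * (M * M) * Rabs h * Rabs h) with (K * ((M * Rabs h) * (M * Rabs h))) by ring.
  rewrite Rmult_assoc. apply Rmult_le_compat_l; [exact HK|]. apply Rmult_le_compat; assumption.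
Qed.

(** The principal logarithm, with the argument written by the half-angle formula; this single
    expression is differentiable on the whole plane slit along the nonpositive reals. *)
Definition Clog (u : C) : C := (ln (Cmod u), 2 * atan (Im u / (Re u + Cmod u))).

Lemma Cmod_plus_re_pos u : ~ (Im u = 0 /\ Re u <= 0) -> 0 < Re u + Cmod u.
Proof.
  intros H. pose proof (Cmod_ge_0 u) as H0. pose proof (Cmod2_alt u) as H2.
  pose proof (re_le_Cmod u) as H1.
  assert (H3 : - Re u <= Cmod u). { apply Rle_trans with (2 := H1). rewrite <- Rabs_Ropp. apply RRle_abs. }
  destruct (Rle_lt_or_eq_dec _ _ H3) as [|E]; [lra|].
  exfalso; apply H. rewrite <- E in H2. split; [nra|lra].
Qed.

Lemma Cderive_Clog (h : R -> C) t dh : Cderive h t dh -> ~ (Im (h t) = 0 /\ Re (h t) <= 0) ->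
  Cderive (fun t => Clog (h t)) t (dh / h t)%C.
Proof.
  intros H Hs. pose proof (Cmod_plus_re_pos _ Hs) as Hp.
  assert (Hz : h t <> RtoC 0). { intros E; apply Hs; rewrite E; simpl; split; lra. }
  pose proof (C_neq_0_sq _ Hz) as Hq. apply Cmod_gt_0 in Hz.
  apply Cderive_iff in H as [H1 H2].
  assert (Hm : is_derive (fun t => Cmod (h t)) t ((Re (h t) * Re dh + Im (h t) * Im dh) / Cmod (h t))).
  { unfold Cmod at 1.
    evar_last. { apply (is_derive_sqrt (fun t => fst (h t) ^ 2 + snd (h t) ^ 2)); [|exact Hq].
      apply (is_derive_plus (V := R_NormedModule)); apply is_derive_pow; eassumption. }
    unfold plus; simpl. change (sqrt (fst (h t) * (fst (h t) * 1) + snd (h t) * (snd (h t) * 1))) with (Cmod (h t)).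
    unfold Re, Im. Rfield. lra. }
  pose proof (Cmod2_alt (h t)) as Hsq.
  apply Cderive_iff; split; simpl.
  - evar_last. { apply is_derive_comp; [apply is_derive_ln, Hz|exact Hm]. }
    unfold scal; simpl; unfold mult; simpl. unfold Re, Im in *.
    replace (fst (h t) * (fst (h t) * 1) + snd (h t) * (snd (h t) * 1)) with (Cmod (h t) * Cmod (h t)) by (simpl in Hsq; lra).
    Rfield. lra.
  - evar_last. { apply is_derive_scal. apply (is_derive_comp atan).
      - apply is_derive_atan.
      - apply (is_derive_div (fun t => Im (h t)) (fun t => Re (h t) + Cmod (h t))); [exact H2| |lra].
        apply (is_derive_plus (V := R_NormedModule)); [exact H1|exact Hm]. }
    unfold scal; simpl; unfold mult, plus; simpl. unfold Re, Im in *.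
    set (r := Cmod (h t)) in *. destruct (h t) as [x y]; destruct dh as [dx dy]; simpl in *.
    assert (Hr : x * x + y * y = r * r) by lra.
    replace (x * (x * 1) + y * (y * 1)) with (r * r) by lra.
    (* For t = y / (x + r), the tangent of half the argument, this says that 1 + t^2 = 2 r / (x +
       r). *)
    assert (Hd : (x + r) * (x + r) + y * y = 2 * r * (x + r)) by nra.
    assert (Hd' : 1 + (y / (x + r))² = 2 * r / (x + r)).
    { replace (2 * r / (x + r)) with ((2 * r * (x + r)) / ((x + r) * (x + r))) by (field; lra).
      rewrite <- Hd. unfold Rsqr. field; lra. }
    rewrite Hd'.
    replace (dy * (x + r) - y * (dx + (x * dx + y * dy) / r)) with ((x + r) * (x * dy - y * dx) / r).
    + Rfield. lra.
    + transitivity ((dy * (x + r) * r - y * dx * r - x * y * dx - (y * y) * dy) / r); [|field; lra].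
      replace (y * y) with (r * r - x * x) by lra. field; lra.
Qed.

(** The half-angle tangents of [u] and [-u] are t and -1 / t with t > 0, and atan t + atan (1 / t) =
    PI / 2. *)
Lemma Clog_opp u : 0 < Im u -> (Clog u - Clog (- u) = RtoC PI * Ci)%C.
Proof.
  intros Hu. unfold Clog. rewrite Cmod_opp. destruct u as [x y]; simpl in *.
  set (r := Cmod (x, y)).
  assert (H1 : 0 < x + r) by (apply (Cmod_plus_re_pos (x, y)); simpl; lra).
  assert (H2 : 0 < - x + r).
  { unfold r. rewrite <- Cmod_opp. apply (Cmod_plus_re_pos (- (x, y))%C); simpl; lra. }
  assert (Hr : x * x + y * y = r * r).
  { pose proof (Cmod2_alt (x, y)) as H; simpl in H. unfold r. lra. }
  assert (Ha : atan (- y / (- x + r)) = - (PI / 2 - atan (y / (x + r)))).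
  { replace (- y / (- x + r)) with (- (/ (y / (x + r)))).
    - rewrite atan_opp, atan_inv; [reflexivity|]. apply Rdiv_lt_0_compat; lra.
    - replace (/ (y / (x + r))) with ((x + r) / y) by (field; lra).
      apply Rminus_diag_uniq.
      replace (- ((x + r) / y) - - y / (- x + r)) with ((y * y - (r * r - x * x)) / (y * (- x + r))) by (field; lra).
      replace (y * y - (r * r - x * x)) with 0 by lra. unfold Rdiv; ring. }
  rewrite Ha. unfold Cminus, Cplus, Copp, Cmult, RtoC, Ci; simpl. f_equal; lra.
Qed.

(** The integral of 1 / (u - p) along an arc from the conjugate of [z] to [z] that crosses the real
    line to the right of [p]; it is the reference value for all such arcs. *)
Definition arc_log (z : C) (p : R) : C := (Clog (z - p) - Clog (Cconj z - p))%C.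

(** A chain that behaves like an arc from the conjugate of [z] to [z]: only its boundary and its
    real points are recorded, so it may consist of many pieces, reflected or reversed. *)
Definition crossing (l : chain) (z : C) (P : R -> Prop) : Prop :=
  (forall F, bdry l F = (F z - F (Cconj z))%C) /\
  (forall q, on_chain l q -> Im q = 0 -> P (Re q)).

(** The sign [k] chooses the branch cut of the primitive: to the left of [p] for k = 1, to the right
    for k = -1. *)
Lemma chain_int_Clog l p k F : (k = 1 \/ k = -1) ->
  (forall q, on_chain l q -> ~ (Im (k * (q - RtoC p)) = 0 /\ Re (k * (q - RtoC p)) <= 0)) ->
  F = (fun q => Clog (RtoC k * (q - RtoC p))) ->
  chain_int l (fun u => / (u - RtoC p))%C (bdry l F).
Proof.
  intros Hk Hq ->.
  assert (Hk' : RtoC k <> RtoC 0) by (apply RtoC_neq; destruct Hk as [-> | ->]; lra).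
  assert (Hn : forall c g t, In (c, g) l -> 0 <= t <= 1 -> (g t - p)%C <> RtoC 0).
  { intros c g t Hin Ht E. apply (Hq (g t)). { exists c, g, t; auto. }
    rewrite E. rewrite Cmult_0_r. simpl; lra. }
  apply chain_int_primitive; intros c g t Hin Ht.
  - apply continuous_Cinv; [eauto|].
    apply continuous_Cminus; [apply path_continuous|apply continuous_const].
  - evar_last. { apply (Cderive_Clog (fun t => RtoC k * (g t - RtoC p))%C).
      - apply Cderive_mult; [apply Cderive_const|apply Cderive_shift].
      - apply Hq. exists c, g, t; auto. }
    simpl. field. split; eauto.
Qed.

Lemma crossing_int_right l z p : crossing l z (fun x => p < x) ->
  chain_int l (fun u => / (u - RtoC p))%C (arc_log z p).
Proof.
  intros [Hb Hq]. unfold arc_log.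
  assert (E := Hb (fun q => Clog (RtoC 1 * (q - RtoC p)))). simpl in E.
  rewrite !Cmult_1_l in E. rewrite <- E.
  apply (chain_int_Clog l p 1 _ (or_introl eq_refl)); [|reflexivity].
  intros q Hon [Hi Hr]. rewrite Cmult_1_l in Hi, Hr.
  destruct q as [x y]; simpl in *. specialize (Hq (x, y) Hon); simpl in Hq.
  assert (p < x) by (apply Hq; lra). lra.
Qed.

(** The primitive with its cut to the right of [p] applies. At each end point it differs from the
    principal one by i PI up to sign, by [Clog_opp], which gives the 2 PI i in total. *)
Lemma crossing_int_left l z p : 0 < Im z -> crossing l z (fun x => x < p) ->
  chain_int l (fun u => / (u - RtoC p))%C (arc_log z p - 2 * PI * Ci)%C.
Proof.
  intros Hz [Hb Hq]. unfold arc_log.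
  assert (E := Hb (fun q => Clog (RtoC (-1) * (q - RtoC p)))).
  replace (Clog (z - p) - Clog (Cconj z - p) - 2 * PI * Ci)%C with (Clog (RtoC (-1) * (z - RtoC p)) - Clog (RtoC (-1) * (Cconj z - RtoC p)))%C.
  - rewrite <- E.
    apply (chain_int_Clog l p (-1) _ (or_intror eq_refl)); [|reflexivity].
    intros q Hon [Hi Hr].
    destruct q as [x y]; simpl in *. specialize (Hq (x, y) Hon); simpl in Hq.
    assert (x < p) by (apply Hq; lra). lra.
  - assert (E1 := Clog_opp (z - p)). assert (E2 := Clog_opp (- (Cconj z - p))).
    replace (RtoC (-1) * (z - p))%C with (- (z - p))%C by ring.
    replace (RtoC (-1) * (Cconj z - p))%C with (- (Cconj z - p))%C by ring.
    replace (- - (Cconj z - p))%C with (Cconj z - p)%C in E2 by ring.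
    unfold Im in *. assert (E1' := E1 ltac:(simpl; lra)). assert (E2' := E2 ltac:(simpl; lra)).
    replace (2 * PI * Ci)%C with ((PI * Ci) + (PI * Ci))%C by ring.
    rewrite <- E1' at 1. rewrite <- E2'. ring.
Qed.

(** The number of times, counted modulo the common value [arc_log z p], that
    a chain from [conj z] to [z] passes to the left of [p]. *)
Definition passes (l : chain) (z : C) (p : R) (k : R) : Prop :=
  ~ on_chain l (RtoC p) /\
  chain_int l (fun u => / (u - RtoC p))%C (arc_log z p - RtoC k * (2 * PI * Ci))%C.

Lemma crossing_passes l z (P : R -> Prop) p : 0 < Im z -> crossing l z P ->
  ((forall x, P x -> p < x) -> passes l z p 0) /\ ((forall x, P x -> x < p) -> passes l z p 1).
Proof.
  intros Hz [Hb Hq]. split; intros HP; split.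
  - intros Hon. specialize (HP _ (Hq _ Hon eq_refl)). simpl in HP; lra.
  - replace (arc_log z p - 0 * (2 * PI * Ci))%C with (arc_log z p) by ring.
    apply crossing_int_right. split; auto.
  - intros Hon. specialize (HP _ (Hq _ Hon eq_refl)). simpl in HP; lra.
  - replace (arc_log z p - 1 * (2 * PI * Ci))%C with (arc_log z p - 2 * PI * Ci)%C by ring.
    apply crossing_int_left; trivial. split; auto.
Qed.

Definition diff_chain (l l' : chain) : chain := l ++ scale_chain (-1) l'.

Lemma on_diff_chain l l' q : on_chain (diff_chain l l') q <-> on_chain l q \/ on_chain l' q.
Proof. unfold diff_chain. rewrite on_chain_app, on_chain_scale. tauto. Qed.

Lemma chain_int_diff l l' f v w : chain_int l f v -> chain_int l' f w ->
  chain_int (diff_chain l l') f (v - w)%C.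
Proof.
  intros H1 H2. replace (v - w)%C with (v + RtoC (-1) * w)%C by ring.
  apply chain_int_app; [exact H1|apply chain_int_scale, H2].
Qed.

Lemma cycle_diff l l' z P P' : crossing l z P -> crossing l' z P' -> cycle (diff_chain l l').
Proof.
  intros [H _] [H' _] F. unfold diff_chain. rewrite bdry_app, bdry_scale, H, H'. ring.
Qed.

(** The reference value [arc_log] cancels in the difference of two arcs, so windings are obtained
    without evaluating any logarithm. *)
Lemma wind_diff l l' z p k k' : passes l z p k -> passes l' z p k' ->
  ~ on_chain (diff_chain l l') (RtoC p) /\ wind (diff_chain l l') (RtoC p) = RtoC (k' - k).
Proof.
  intros [H1 H2] [H1' H2']. split. { rewrite on_diff_chain; tauto. }
  unfold wind. rewrite (chain_int_cint _ _ _ (chain_int_diff _ _ _ _ _ H2 H2')).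
  pose proof two_pi_i_neq_0 as Hn. rewrite RtoC_minus. generalize dependent (2 * PI * Ci)%C.
  intros; field; assumption.
Qed.

(** * The double integral over two contours *)

Definition sing (g : C1path) : chain := (1, g) :: nil.

Lemma on_sing (g : C1path) p : on_chain (sing g) p <-> on_path g p.
Proof.
  unfold sing. rewrite on_chain_cons. split; [intros [|(c & h & t & [] & _)]; trivial|auto].
Qed.

Lemma wind_sing g p : wind (sing g) p = winding g p.
Proof. unfold wind, winding; simpl. ring. Qed.

Lemma sing_int (g : C1path) (f : C -> C) v : chain_int (sing g) f v <-> isCint (fun t => f (g t) * velocity g t)%C v.
Proof.
  simpl. split.
  - intros (v1 & v2 & H & -> & ->). replace (1 * v1 + 0)%C with v1 by ring. exact H.
  - intros H. exists v, (RtoC 0). repeat split; trivial. ring.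
Qed.

Lemma cycle_sing (g : C1path) : g 0 = g 1 -> cycle (sing g).
Proof. intros H F; simpl. rewrite H. ring. Qed.

Section TwoContours.
Variables gu gv : C1path.
Hypothesis disjoint : forall s t, 0 <= s <= 1 -> 0 <= t <= 1 -> gu s <> gv t.

(** Disjointness keeps 1 / (u - v) continuous on the parameter square, as Fubini requires. The inner
    integrals [kA] and [kB] are supplied in closed form, so only single integrals remain. *)
Lemma swap_int (fA fB kA kB : C -> C) I :
  (forall s, 0 <= s <= 1 -> continuous (fun s => fA (gu s)) s) ->
  (forall t, 0 <= t <= 1 -> continuous (fun t => fB (gv t)) t) ->
  (forall u, on_path gu u -> chain_int (sing gv) (fun v => fB v * / (u - v))%C (kB u)) ->
  (forall v, on_path gv v -> chain_int (sing gu) (fun u => fA u * / (u - v))%C (kA v)) ->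
  chain_int (sing gu) (fun u => fA u * kB u)%C I ->
  chain_int (sing gv) (fun v => fB v * kA v)%C I.
Proof.
  intros HA HB HkB HkA HI. apply sing_int in HI. apply sing_int.
  apply (isCint_Fubini (fun s t => / (gu s - gv t) * (fA (gu s) * velocity gu s) * (fB (gv t) * velocity gv t))%C
           (fun s => fA (gu s) * kB (gu s) * velocity gu s)%C
           (fun t => fB (gv t) * kA (gv t) * velocity gv t)%C I); trivial.
  - intros s t Hs Ht.
    assert (Fst : forall h : R -> C, continuous h s -> continuous (fun q : R * R => h (fst q)) (s, t)).
    { intros h Hh. apply (continuous_comp (fun q : R * R => fst q) h); [apply continuous_fst|exact Hh]. }
    assert (Snd : forall h : R -> C, continuous h t -> continuous (fun q : R * R => h (snd q)) (s, t)).
    { intros h Hh. apply (continuous_comp (fun q : R * R => snd q) h); [apply continuous_snd|exact Hh]. }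
    apply continuous_Cmult; [apply continuous_Cmult|].
    + apply continuous_Cinv; [apply Csub_neq, disjoint; assumption|].
      apply continuous_Cminus; [apply (Fst gu)|apply (Snd gv)]; apply path_continuous.
    + apply (Fst (fun s => fA (gu s) * velocity gu s)%C).
      apply continuous_Cmult; [apply HA, Hs|apply velocity_continuous].
    + apply (Snd (fun t => fB (gv t) * velocity gv t)%C).
      apply continuous_Cmult; [apply HB, Ht|apply velocity_continuous].
  - intros s Hs.
    assert (H := HkB (gu s) (ex_intro _ s (conj Hs eq_refl))). apply sing_int in H.
    apply isCint_Cmult with (c := (fA (gu s) * velocity gu s)%C) in H.
    replace (fA (gu s) * kB (gu s) * velocity gu s)%C with (fA (gu s) * velocity gu s * kB (gu s))%C by ring.
    eapply isCint_ext; [|exact H]. intros t Ht; simpl; ring.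
  - intros t Ht.
    assert (H := HkA (gv t) (ex_intro _ t (conj Ht eq_refl))). apply sing_int in H.
    apply isCint_Cmult with (c := (fB (gv t) * velocity gv t)%C) in H.
    replace (fB (gv t) * kA (gv t) * velocity gv t)%C with (fB (gv t) * velocity gv t * kA (gv t))%C by ring.
    eapply isCint_ext; [|exact H]. intros s Hs; simpl; ring.
Qed.
End TwoContours.

Lemma off_continuous_sing (g : C1path) p t : ~ on_path g p -> 0 <= t <= 1 -> continuous (fun t => / (g t - p))%C t.
Proof.
  intros Hp Ht. apply continuous_Cinv.
  - apply Csub_neq. intros E; apply Hp. exists t; auto.
  - apply continuous_Cminus; [apply path_continuous|apply continuous_const].
Qed.

(** Fubini for 1 / ((u - v) (v - p)), with [u] on the outer and [v] on the inner curve. One order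
    gives the product of both windings of [p], the other the inner winding alone. Hence a point
    encircled by the inner curve is encircled by the outer one, and a point outside the outer curve
    is outside the inner one. *)
Lemma lies_inside_wind (gi go : C1path) p : gi 0 = gi 1 -> go 0 = go 1 ->
  lies_inside gi go -> ~ on_path gi p -> ~ on_path go p ->
  (winding gi p * (winding go p - 1) = 0)%C.
Proof.
  intros Hci Hco [H1 H2] Hpi Hpo.
  assert (K := swap_int go gi).
  assert (Hd : forall s t, 0 <= s <= 1 -> 0 <= t <= 1 -> go s <> gi t).
  { intros s t Hs Ht E. destruct (H1 (gi t)) as [H _]; [exists t; auto|]. apply H. exists s; auto. }
  specialize (K Hd (fun _ => RtoC 1) (fun v => / (v - p))%C
    (fun _ => 2 * PI * Ci)%C (fun u => 2 * PI * Ci * winding gi p * / (u - p))%C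
    (2 * PI * Ci * winding gi p * (2 * PI * Ci * winding go p))%C).
  assert (E : (2 * PI * Ci * (2 * PI * Ci * winding gi p) = 2 * PI * Ci * winding gi p * (2 * PI * Ci * winding go p))%C).
  { apply (chain_int_unique (sing gi) (fun v => / (v - p) * (2 * PI * Ci))%C).
    - rewrite <- (wind_sing gi). eapply chain_int_ext; [|apply chain_int_scal, (wind_int (sing gi) p)].
      + intros; simpl; ring.
      + rewrite on_sing; exact Hpi.
    - apply K.
      + intros; apply continuous_const.
      + intros; apply off_continuous_sing; assumption.
      + intros u Hu.
        destruct (H2 u Hu) as [Hn Hw].
        assert (Hup : (u - p)%C <> RtoC 0). { apply Csub_neq; intros ->; auto. }
        replace (2 * PI * Ci * winding gi p * / (u - p))%C with
          (/ (u - p) * (2 * PI * Ci * wind (sing gi) p + (-1) * (2 * PI * Ci * wind (sing gi) u)))%C.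
        2: { rewrite !wind_sing, Hw. ring. }
        eapply chain_int_ext; [|apply chain_int_scal, chain_int_plus;
          [apply wind_int; rewrite on_sing; exact Hpi|apply chain_int_scal, wind_int; rewrite on_sing; exact Hn]].
        intros v Hv. apply on_sing in Hv.
        assert ((v - p)%C <> RtoC 0) by (apply Csub_neq; intros ->; auto).
        assert ((v - u)%C <> RtoC 0) by (apply Csub_neq; intros ->; auto).
        assert ((u - v)%C <> RtoC 0) by (apply Csub_neq; intros ->; auto).
        simpl. field. repeat split; assumption.
      + intros v Hv. destruct (H1 v Hv) as [Hn Hw].
        replace (2 * PI * Ci)%C with (2 * PI * Ci * wind (sing go) v)%C.
        2: { rewrite wind_sing, Hw. ring. }
        eapply chain_int_ext; [|apply wind_int; rewrite on_sing; exact Hn].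
        intros; simpl; ring.
      + rewrite <- wind_sing with (g := go).
        eapply chain_int_ext; [|apply chain_int_scal, wind_int; rewrite on_sing; exact Hpo].
        intros; simpl; ring. }
  pose proof two_pi_i_neq_0 as Hn. generalize dependent (2 * PI * Ci)%C. intros k K E Hk.
  replace (winding gi p * (winding go p - 1))%C with
    (/ k * / k * (k * winding gi p * (k * winding go p) - k * (k * winding gi p)))%C by (field; exact Hk).
  rewrite E. ring.
Qed.

Section DoubleIntegral.
Variables gu gv : C1path.
Hypothesis gu_closed : gu 0 = gu 1.
Hypothesis gv_closed : gv 0 = gv 1.
Variables TA TB : pfrac.
Variables alo blo : R.

Definition double_int : C :=
  path_integral gu (fun u => path_integral gv (fun v =>
    / (u - v) * (pf_eval TA u * pf_eval TB v))%C).

(** The same value [V] arises from integrating [v] first or [u] first. The first form serves alpha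
    <= 1, the second alpha > 1. *)
Lemma double_int_weights (kB kA : C -> C) :
  (forall s t, 0 <= s <= 1 -> 0 <= t <= 1 -> gu s <> gv t) ->
  pf_poles TA (fun p => ~ on_path gu (RtoC p)) ->
  pf_poles TB (fun p => ~ on_path gv (RtoC p)) ->
  (forall u, on_path gu u -> pf_weight TB (fun p => wind (sing gv) (RtoC p) - wind (sing gv) u)%C u = kB u) ->
  (forall v, on_path gv v -> pf_weight TA (fun p => wind (sing gu) v - wind (sing gu) (RtoC p))%C v = kA v) ->
  (forall s, 0 <= s <= 1 -> continuous (fun s => kB (gu s)) s) ->
  exists V, (double_int = 2 * PI * Ci * V)%C /\
    chain_int (sing gu) (fun u => pf_eval TA u * kB u)%C V /\
    chain_int (sing gv) (fun v => pf_eval TB v * kA v)%C V.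
Proof.
  intros Hd HA HB HkB HkA Hc.
  assert (CA : forall s, 0 <= s <= 1 -> continuous (fun s => pf_eval TA (gu s)) s).
  { intros s Hs. apply (pf_eval_continuous TA gu); [apply path_continuous|].
    eapply pf_poles_impl; [|exact HA]. intros p Hp E. apply Hp. exists s; auto. }
  assert (CB : forall s, 0 <= s <= 1 -> continuous (fun s => pf_eval TB (gv s)) s).
  { intros s Hs. apply (pf_eval_continuous TB gv); [apply path_continuous|].
    eapply pf_poles_impl; [|exact HB]. intros p Hp E. apply Hp. exists s; auto. }
  destruct (chain_int_exists (sing gu) (fun u => pf_eval TA u * kB u)%C) as [V HV].
  { intros c g t [E|[]] Ht. injection E as <- <-. apply continuous_Cmult; auto. }
  assert (IB : forall u, on_path gu u ->
     chain_int (sing gv) (fun v => pf_eval TB v * / (u - v))%C (2 * PI * Ci * kB u)%C).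
  { intros u Hu. rewrite <- HkB by exact Hu. apply Cauchy_pf.
    - apply cycle_sing, gv_closed.
    - rewrite on_sing. destruct Hu as (s & Hs & <-). intros (t & Ht & E). apply (Hd s t); auto.
    - eapply pf_poles_impl; [|exact HB]. intros p; rewrite on_sing; trivial. }
  assert (IA : forall v, on_path gv v ->
     chain_int (sing gu) (fun u => pf_eval TA u * / (u - v))%C (2 * PI * Ci * kA v)%C).
  { intros v Hv. rewrite <- HkA by exact Hv.
    replace (2 * PI * Ci * pf_weight TA (fun p => wind (sing gu) v - wind (sing gu) p) v)%C
      with ((-1) * (2 * PI * Ci * pf_weight TA (fun p => wind (sing gu) p - wind (sing gu) v) v))%C.
    (* Since 1 / (u - v) is odd, exchanging the variables reverses the sign of the relative
       winding. *)
    2: { assert (E : forall T, (pf_weight T (fun p => wind (sing gu) p - wind (sing gu) v) v = (-1) * pf_weight T (fun p => wind (sing gu) v - wind (sing gu) p) v)%C).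
         { induction T; simpl; [ring|rewrite IHT; ring]. }
         rewrite E. ring. }
    assert (Hn : ~ on_path gu v). { destruct Hv as (t & Ht & <-). intros (s & Hs & E). apply (Hd s t); auto. }
    eapply chain_int_ext; [|apply chain_int_scal, Cauchy_pf].
    - intros u Hu. apply on_sing in Hu.
      assert ((v - u)%C <> RtoC 0) by (apply Csub_neq; intros ->; auto).
      assert ((u - v)%C <> RtoC 0) by (apply Csub_neq; intros ->; auto).
      simpl. field. split; assumption.
    - apply cycle_sing, gu_closed.
    - rewrite on_sing; exact Hn.
    - eapply pf_poles_impl; [|exact HA]. intros p; rewrite on_sing; trivial. }
  assert (HV' : chain_int (sing gu) (fun u => pf_eval TA u * (2 * PI * Ci * kB u))%C (2 * PI * Ci * V)%C).
  { eapply chain_int_ext; [|apply chain_int_scal, HV]. intros; simpl; ring. }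
  exists V. split; [|split].
  - unfold double_int, path_integral at 1. apply isCint_unique.
    apply sing_int in HV'. eapply isCint_ext; [|exact HV'].
    intros s Hs. simpl. f_equal.
    specialize (IB (gu s) (ex_intro _ s (conj Hs eq_refl))). apply sing_int in IB.
    unfold path_integral. symmetry. apply isCint_unique.
    apply isCint_Cmult with (c := pf_eval TA (gu s)) in IB.
    eapply isCint_ext; [|exact IB]. intros; simpl; ring.
  - exact HV.
  - apply (swap_int gu gv Hd) with (fB := pf_eval TB) (kA := fun v => (2 * PI * Ci * kA v)%C) (kB := fun v => (2 * PI * Ci * kB v)%C) in HV'; auto.
    pose proof two_pi_i_neq_0 as Hn.
    assert (HV'' := chain_int_scal _ _ _ (/ (2 * PI * Ci))%C HV').
    replace (/ (2 * PI * Ci) * (2 * PI * Ci * V))%C with V in HV'' by (generalize dependent (2 * PI * Ci)%C; intros; field; assumption).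
    eapply chain_int_ext; [|exact HV'']. intros v _. simpl.
    generalize dependent (2 * PI * Ci)%C; intros; field; assumption.
Qed.

Hypothesis A_off : pf_poles TA (fun p => (p < alo -> excludes gu (RtoC p)) /\ (alo <= p -> encircles gu (RtoC p))).
Hypothesis B_off : pf_poles TB (fun p => (p < blo -> encircles gv (RtoC p)) /\ (blo <= p -> excludes gv (RtoC p))).

Lemma A_off_gu : pf_poles TA (fun p => ~ on_path gu (RtoC p)).
Proof.
  eapply pf_poles_impl; [|exact A_off]. intros p [H1 H2].
  destruct (Rlt_dec p alo); [apply H1; assumption|apply H2; lra].
Qed.

Lemma B_off_gv : pf_poles TB (fun p => ~ on_path gv (RtoC p)).
Proof.
  eapply pf_poles_impl; [|exact B_off]. intros p [H1 H2].
  destruct (Rlt_dec p blo); [apply H1; assumption|apply H2; lra].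
Qed.

(** On [gu] the winding of [gv] is 0, so the inner integral keeps the poles of [TB] inside [gv], the
    low ones. On [gv] the winding of [gu] is 1, so the other order keeps the poles of [TA] outside
    [gu], again the low ones. *)
Lemma double_int_inside : lies_inside gv gu ->
  pf_poles (low blo TB) (fun p => encircles gu (RtoC p)) /\
  pf_poles (low alo TA) (fun p => excludes gv (RtoC p)) /\
  exists V, (double_int = 2 * PI * Ci * V)%C /\
    chain_int (sing gu) (fun u => pf_eval TA u * pf_eval (low blo TB) u)%C V /\
    chain_int (sing gv) (fun v => pf_eval TB v * pf_eval (low alo TA) v)%C V.
Proof.
  intros Hin. pose proof Hin as [H1 H2].
  assert (PB : pf_poles (low blo TB) (fun p => encircles gu (RtoC p))).
  { eapply pf_poles_impl; [|apply low_poles, B_off]. intros p [[H _] Hp]. destruct (H Hp) as [Hn Hw].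
    assert (Hnu : ~ on_path gu p).
    { intros Hu. destruct (H2 _ Hu) as [_ E]. rewrite Hw in E. injection E; lra. }
    split; [exact Hnu|].
    assert (E := lies_inside_wind gv gu (RtoC p) gv_closed gu_closed Hin Hn Hnu).
    rewrite Hw in E. replace (winding gu p) with (1 * (winding gu p - 1) + 1)%C by ring. rewrite E. ring. }
  assert (PA : pf_poles (low alo TA) (fun p => excludes gv (RtoC p))).
  { eapply pf_poles_impl; [|apply low_poles, A_off]. intros p [[H _] Hp]. destruct (H Hp) as [Hn Hw].
    assert (Hnv : ~ on_path gv p).
    { intros Hu. destruct (H1 _ Hu) as [_ E]. rewrite Hw in E. injection E; lra. }
    split; [exact Hnv|].
    assert (E := lies_inside_wind gv gu (RtoC p) gv_closed gu_closed Hin Hnv Hn).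
    rewrite Hw in E. replace (winding gv p) with (- (winding gv p * (0 - 1)))%C by ring. rewrite E. ring. }
  split; [exact PB|]. split; [exact PA|].
  apply double_int_weights.
  - intros s t Hs Ht E. destruct (H1 (gv t)) as [H _]; [exists t; auto|]. apply H. exists s; auto.
  - apply A_off_gu.
  - apply B_off_gv.
  - intros u Hu. rewrite (pf_weight_low_high blo TB _ 1 0); [ring|].
    rewrite wind_sing. destruct (H2 u Hu) as [_ ->].
    eapply pf_poles_impl; [|exact B_off]. intros p [K1 K2]. rewrite wind_sing. split; intros Hp.
    + destruct (K1 Hp) as [_ ->]. ring.
    + destruct (K2 Hp) as [_ ->]. ring.
  - intros v Hv. rewrite (pf_weight_low_high alo TA _ 1 0); [ring|].
    rewrite wind_sing. destruct (H1 v Hv) as [_ ->].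
    eapply pf_poles_impl; [|exact A_off]. intros p [K1 K2]. rewrite wind_sing. split; intros Hp.
    + destruct (K1 Hp) as [_ ->]. ring.
    + destruct (K2 Hp) as [_ ->]. ring.
  - intros s Hs. apply (pf_eval_continuous (low blo TB) gu); [apply path_continuous|].
    eapply pf_poles_impl; [|exact PB]. intros p [Hp _] E. apply Hp. exists s; auto.
Qed.

(** With the nesting reversed the winding of [gv] on [gu] is 1, and that of [gu] on [gv] is 0. The
    low poles now have weight 0 and the high ones weight -1. *)
Lemma double_int_outside : lies_inside gu gv ->
  pf_poles (high blo TB) (fun p => excludes gu (RtoC p)) /\
  pf_poles (high alo TA) (fun p => encircles gv (RtoC p)) /\
  exists V, (double_int = - (2 * PI * Ci * V))%C /\
    chain_int (sing gu) (fun u => pf_eval TA u * pf_eval (high blo TB) u)%C V /\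
    chain_int (sing gv) (fun v => pf_eval TB v * pf_eval (high alo TA) v)%C V.
Proof.
  intros Hin. pose proof Hin as [H1 H2].
  assert (PB : pf_poles (high blo TB) (fun p => excludes gu (RtoC p))).
  { eapply pf_poles_impl; [|apply high_poles, B_off]. intros p [[_ H] Hp]. destruct (H Hp) as [Hn Hw].
    assert (Hnu : ~ on_path gu p).
    { intros Hu. destruct (H1 _ Hu) as [_ E]. rewrite Hw in E. injection E; lra. }
    split; [exact Hnu|].
    assert (E := lies_inside_wind gu gv (RtoC p) gu_closed gv_closed Hin Hnu Hn).
    rewrite Hw in E. replace (winding gu p) with (- (winding gu p * (0 - 1)))%C by ring. rewrite E. ring. }
  assert (PA : pf_poles (high alo TA) (fun p => encircles gv (RtoC p))).
  { eapply pf_poles_impl; [|apply high_poles, A_off]. intros p [[_ H] Hp]. destruct (H Hp) as [Hn Hw].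
    assert (Hnv : ~ on_path gv p).
    { intros Hu. destruct (H2 _ Hu) as [_ E]. rewrite Hw in E. injection E; lra. }
    split; [exact Hnv|].
    assert (E := lies_inside_wind gu gv (RtoC p) gu_closed gv_closed Hin Hn Hnv).
    rewrite Hw in E. replace (winding gv p) with (1 * (winding gv p - 1) + 1)%C by ring. rewrite E. ring. }
  split; [exact PB|]. split; [exact PA|].
  destruct (double_int_weights (fun u => - pf_eval (high blo TB) u)%C (fun v => - pf_eval (high alo TA) v)%C) as (V & E & VA & VB).
  - intros s t Hs Ht E. destruct (H1 (gu s)) as [H _]; [exists s; auto|]. apply H. exists t; auto.
  - apply A_off_gu.
  - apply B_off_gv.
  - intros u Hu. rewrite (pf_weight_low_high blo TB _ 0 (-1)); [ring|].
    rewrite wind_sing. destruct (H1 u Hu) as [_ ->].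
    eapply pf_poles_impl; [|exact B_off]. intros p [K1 K2]. rewrite wind_sing. split; intros Hp.
    + destruct (K1 Hp) as [_ ->]. ring.
    + destruct (K2 Hp) as [_ ->]. ring.
  - intros v Hv. rewrite (pf_weight_low_high alo TA _ 0 (-1)); [ring|].
    rewrite wind_sing. destruct (H2 v Hv) as [_ ->].
    eapply pf_poles_impl; [|exact A_off]. intros p [K1 K2]. rewrite wind_sing. split; intros Hp.
    + destruct (K1 Hp) as [_ ->]. ring.
    + destruct (K2 Hp) as [_ ->]. ring.
  - intros s Hs. apply (continuous_Copp (fun s => pf_eval (high blo TB) (gu s))).
    apply (pf_eval_continuous (high blo TB) gu); [apply path_continuous|].
    eapply pf_poles_impl; [|exact PB]. intros p [Hp _] E. apply Hp. exists s; auto.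
  - exists (- V)%C. split; [rewrite E; ring|].
    replace (- V)%C with ((-1) * V)%C by ring.
    split; (eapply chain_int_ext; [|apply chain_int_scal; eassumption]); intros; simpl; ring.
Qed.
End DoubleIntegral.

(** * Geometry of the energy in polar coordinates *)

Lemma Rmult_neg_neg a b : a < 0 -> b < 0 -> 0 < a * b.
Proof. intros; nra. Qed.

Lemma Rmult_pos_neg a b : 0 < a -> b < 0 -> a * b < 0.
Proof. intros; nra. Qed.

Lemma pos_factor a b : 0 < a -> 0 < a * b -> 0 < b.
Proof. intros; nra. Qed.

Lemma neg_factor a b : a < 0 -> 0 < a * b -> b < 0.
Proof. intros; nra. Qed.

Lemma one_minus_sq_pos X : -1 < X < 1 -> 0 < 1 - X ^ 2.
Proof. intros; nra. Qed.

(** |zeta - p|^2 for zeta of modulus [r] with cosine [X] of its argument; it is affine in the pair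
    (r^2, r X). *)
Definition ell (p r X : R) : R := r ^ 2 + p ^ 2 - 2 * p * r * X.

Lemma ell_pos p r X : p <> 0 -> -1 < X < 1 -> 0 < ell p r X.
Proof.
  intros Hp HX. unfold ell.
  replace (r ^ 2 + p ^ 2 - 2 * p * r * X) with ((r - p * X) ^ 2 + p ^ 2 * (1 - X ^ 2)) by ring.
  assert (0 < p ^ 2 * (1 - X ^ 2)). { apply Rmult_lt_0_compat; [|nra]. apply pow2_gt_0, Hp. }
  pose proof (pow2_ge_0 (r - p * X)). lra.
Qed.

(** Here [m] and [rho] stand for the real part and the squared modulus of the saddle. The expression
    multiplied by [k] in [c k p] is then |saddle - p|^2, so [c] recovers a charge from its weight at
    the saddle, and [D] is |saddle - z|^2 for real z. *)
Lemma axis_radial_identity z m rho p1 p2 p3 k1 k2 k3 :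
  z - p1 <> 0 -> z - p2 <> 0 -> z - p3 <> 0 -> k1 * p1 + k2 * p2 + k3 * p3 = 0 ->
  let D := z * z - 2 * z * m + rho in
  let c k p := k * (D + 2 * (z - p) * (m - z) + (z - p) ^ 2) in
  c k1 p1 * z / (z - p1) + c k2 p2 * z / (z - p2) + c k3 p3 * z / (z - p3) - (k1 + k2 + k3) * rho
  = D * (k1 * p1 / (z - p1) + k2 * p2 / (z - p2) + k3 * p3 / (z - p3)).
Proof.
  intros N1 N2 N3 H D c. apply Rminus_diag_uniq.
  transitivity (- z * (k1 * p1 + k2 * p2 + k3 * p3)); [|rewrite H; ring].
  unfold c, D. field. repeat split; assumption.
Qed.

Lemma axis_angular_identity z m rho p1 p2 p3 k1 k2 k3 :
  z - p1 <> 0 -> z - p2 <> 0 -> z - p3 <> 0 -> k1 * p1 + k2 * p2 + k3 * p3 = 0 ->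
  let D := z * z - 2 * z * m + rho in
  let c k p := k * (D + 2 * (z - p) * (m - z) + (z - p) ^ 2) in
  z * (c k1 p1 * p1 / (z - p1) ^ 2 + c k2 p2 * p2 / (z - p2) ^ 2 + c k3 p3 * p3 / (z - p3) ^ 2)
  = (k1 * p1 / (z - p1) + k2 * p2 / (z - p2) + k3 * p3 / (z - p3)) * (rho - z * z)
    + D * (k1 * p1 ^ 2 / (z - p1) ^ 2 + k2 * p2 ^ 2 / (z - p2) ^ 2 + k3 * p3 ^ 2 / (z - p3) ^ 2).
Proof.
  intros N1 N2 N3 H D c. apply Rminus_diag_uniq.
  transitivity (z * (k1 * p1 + k2 * p2 + k3 * p3)); [|rewrite H; ring].
  unfold c, D. field. repeat split; assumption.
Qed.

Lemma left_increasing_le (m : R -> R) a b : a < b ->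
  (forall x eps, a <= x <= b -> 0 < eps -> exists d, 0 < d /\ forall y, a <= y <= b -> Rabs (y - x) < d -> m x - eps < m y) ->
  (forall x, a < x <= b -> exists d, 0 < d /\ forall y, a <= y < x -> x - d < y -> m y < m x) ->
  m a <= m b.
Proof.
  intros Hab Hlsc Hinc.
  set (P := fun s => 0 <= s <= b - a /\ forall r, b - s <= r <= b -> m r <= m b).
  destruct (completeness P) as [s [Hub Hlub]].
  { exists (b - a). intros s [Hs _]; lra. }
  { exists 0. split; [lra|]. intros r Hr. replace r with b by lra. lra. }
  assert (Hs0 : 0 <= s). { apply Hub. split; [lra|]. intros r Hr. replace r with b by lra. lra. }
  assert (Hsb : s <= b - a). { apply Hlub. intros s' [Hs' _]; lra. }
  assert (HPlt : forall r, b - s < r <= b -> m r <= m b).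
  { intros r Hr. destruct (classic (exists s', P s' /\ b - s' <= r)) as [(s' & [Hs' HP] & Hle)|Hn].
    - apply HP; lra.
    - exfalso. assert (s <= b - r); [|lra]. apply Hlub. intros s' Hs'.
      destruct (Rle_lt_dec s' (b - r)); [assumption|]. exfalso; apply Hn. exists s'. split; [exact Hs'|lra]. }
  assert (HPs : m (b - s) <= m b).
  { destruct (Rle_lt_dec (m (b - s)) (m b)) as [|Hlt]; [assumption|exfalso].
    destruct (Req_dec_T s 0) as [E|Hne]. { rewrite E, Rminus_0_r in Hlt. lra. }
    destruct (Hlsc (b - s) (m (b - s) - m b)) as (d & Hd & H); [lra|lra|].
    set (y := Rmin (b - s + d / 2) b).
    assert (b - s < y <= b). { unfold y; split; [apply Rmin_glb_lt; lra|apply Rmin_r]. }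
    assert (y <= b - s + d / 2) by apply Rmin_l.
    specialize (H y ltac:(lra)). rewrite Rabs_right in H by lra. specialize (H ltac:(lra)).
    specialize (HPlt y ltac:(lra)). lra. }
  assert (Es : s = b - a).
  { destruct (Req_dec_T s (b - a)) as [|Hne]; [assumption|exfalso].
    destruct (Hinc (b - s)) as (d & Hd & H); [lra|].
    set (s' := Rmin (s + d / 2) (b - a)).
    assert (s < s' <= b - a). { unfold s'; split; [apply Rmin_glb_lt; lra|apply Rmin_r]. }
    assert (s' <= s + d / 2) by apply Rmin_l.
    assert (P s'); [|specialize (Hub s' H2); lra].
    split; [lra|]. intros r Hr.
    destruct (Rlt_le_dec (b - s) r); [apply HPlt; lra|].
    destruct (Req_dec_T r (b - s)) as [->|]; [exact HPs|].
    specialize (H r ltac:(lra) ltac:(lra)). lra. }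
  replace a with (b - s) by lra. exact HPs.
Qed.

Lemma left_increasing_lt (m : R -> R) a b : a < b ->
  (forall x eps, a <= x <= b -> 0 < eps -> exists d, 0 < d /\ forall y, a <= y <= b -> Rabs (y - x) < d -> m x - eps < m y) ->
  (forall x, a < x <= b -> exists d, 0 < d /\ forall y, a <= y < x -> x - d < y -> m y < m x) ->
  m a < m b.
Proof.
  intros Hab Hlsc Hinc. destruct (Hinc b) as (d & Hd & H); [lra|].
  set (y := Rmax (b - d / 2) ((a + b) / 2)).
  assert (a < y < b). { unfold y; split; [apply Rlt_le_trans with ((a + b) / 2); [lra|apply Rmax_r]|apply Rmax_lub_lt; lra]. }
  assert (b - d / 2 <= y) by apply Rmax_l.
  specialize (H y ltac:(lra) ltac:(lra)).
  apply Rle_lt_trans with (m y); [|exact H]. apply left_increasing_le; [lra| |].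
  - intros x eps Hx Heps. destruct (Hlsc x eps ltac:(lra) Heps) as (d' & Hd' & H'). exists d'. split; [exact Hd'|].
    intros z Hz; apply H'; lra.
  - intros x Hx. apply Hinc; lra.
Qed.

(** Connection by a polygonal line along which [P] holds. *)
Inductive pconn (P : R -> R -> Prop) : R -> R -> R -> R -> Prop :=
| pconn_refl r x : P r x -> pconn P r x r x
| pconn_step r x r' x' r'' x'' :
    (forall k, 0 <= k <= 1 -> P (r + k * (r' - r)) (x + k * (x' - x))) ->
    pconn P r' x' r'' x'' -> pconn P r x r'' x''.

Lemma pconn_trans P r x r' x' r'' x'' : pconn P r x r' x' -> pconn P r' x' r'' x'' -> pconn P r x r'' x''.
Proof. induction 1; [trivial|intros; econstructor; eauto]. Qed.

Lemma pconn_imp (P Q : R -> R -> Prop) r x r' x' : (forall r x, P r x -> Q r x) -> pconn P r x r' x' -> pconn Q r x r' x'.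
Proof.
  intros H. induction 1; [apply pconn_refl; auto|].
  eapply pconn_step; [|exact IHpconn]. intros; apply H; auto.
Qed.

Lemma pconn_sym P r x r' x' : pconn P r x r' x' -> pconn P r' x' r x.
Proof.
  induction 1 as [|r x r' x' r'' x'' H _ IH]; [apply pconn_refl; assumption|].
  apply pconn_trans with r' x'; [exact IH|]. apply pconn_step with r x.
  - intros k Hk. replace (r' + k * (r - r')) with (r + (1 - k) * (r' - r)) by ring.
    replace (x' + k * (x - x')) with (x + (1 - k) * (x' - x)) by ring. apply H; lra.
  - apply pconn_refl. specialize (H 0 ltac:(lra)). rewrite !Rmult_0_l, !Rplus_0_r in H. exact H.
Qed.

Lemma pconn_one (P : R -> R -> Prop) r x r' x' :
  (forall k, 0 <= k <= 1 -> P (r + k * (r' - r)) (x + k * (x' - x))) -> pconn P r x r' x'.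
Proof.
  intros H. apply pconn_step with r' x'; [exact H|]. apply pconn_refl.
  specialize (H 1 ltac:(lra)). replace (r + 1 * (r' - r)) with r' in H by ring.
  replace (x + 1 * (x' - x)) with x' in H by ring. exact H.
Qed.

Lemma cos_open x : 0 < x < PI -> -1 < cos x < 1.
Proof.
  intros Hx. split.
  - rewrite <- cos_PI. apply cos_decreasing_1; lra.
  - rewrite <- cos_0. apply cos_decreasing_1; lra.
Qed.

Section Saddle.
Variables p1 p2 p3 c1 c2 c3 t0 r0 X0 : R.
Hypothesis Hp : p1 <= p2 < 0 /\ 0 < p3.
Hypothesis Hc : 0 < c1 /\ 0 < c2 /\ 0 < c3.
Hypothesis Ht0 : 0 < t0.
Hypothesis Hr0 : 0 < r0.
Hypothesis HX0 : -1 < X0 < 1.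

(** The potential of charges [c1], [c2], [c3] at [p1], [p2], [p3] and of -t0 at the origin, halved
    because [ell] is a squared distance. For fixed [r] it is concave in [X]. *)
Definition energy (r X : R) : R :=
  (c1 * ln (ell p1 r X) + c2 * ln (ell p2 r X) + c3 * ln (ell p3 r X)) / 2 - t0 * ln r.

(** The derivative of the energy is [- r * angular] in the direction of [X] and
    [radial / r] in the direction of [r]. *)
Definition angular (r X : R) : R :=
  c1 * p1 / ell p1 r X + c2 * p2 / ell p2 r X + c3 * p3 / ell p3 r X.

Definition radial (r X : R) : R :=
  r * (c1 * (r - p1 * X) / ell p1 r X + c2 * (r - p2 * X) / ell p2 r X + c3 * (r - p3 * X) / ell p3 r X) - t0.

Hypothesis saddle_angular : angular r0 X0 = 0.
Hypothesis saddle_radial :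
  c1 / ell p1 r0 X0 + c2 / ell p2 r0 X0 + c3 / ell p3 r0 X0 = t0 / r0 ^ 2.

Definition regular (r X : R) : Prop :=
  0 < r /\ -1 <= X <= 1 /\ 0 < ell p1 r X /\ 0 < ell p2 r X /\ 0 < ell p3 r X.

Lemma regular_interior r X : 0 < r -> -1 < X < 1 -> regular r X.
Proof. intros; repeat split; try lra; apply ell_pos; lra. Qed.

(** In terms of the weights q_i = c_i / |saddle - p_i|^2 the saddle equations become linear: the
    first moment of the q_i is 0 and their sum is t0 / r0^2. *)
Notation q1 := (c1 / ell p1 r0 X0).
Notation q2 := (c2 / ell p2 r0 X0).
Notation q3 := (c3 / ell p3 r0 X0).
Notation D0 := (r0 ^ 2).

Lemma l0_pos : 0 < ell p1 r0 X0 /\ 0 < ell p2 r0 X0 /\ 0 < ell p3 r0 X0.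
Proof. repeat split; apply ell_pos; lra. Qed.

Lemma q_pos : 0 < q1 /\ 0 < q2 /\ 0 < q3.
Proof. pose proof l0_pos. repeat split; apply Rdiv_lt_0_compat; lra. Qed.

Lemma q_first_moment : q1 * p1 + q2 * p2 + q3 * p3 = 0.
Proof. pose proof l0_pos. rewrite <- saddle_angular. unfold angular. field. lra. Qed.

(** Put a = r^2 - r0^2, b = r X - r0 X0, M_k = sum q_i p_i^k / ell_i and Q = sum q_i. The angular
    equation becomes 2 b M2 = a M1. Eliminating b gives the radial derivative as a (Q M2 - r^2 (M0
    M2 - M1^2)) / M2, whose second factor is (1 - X^2) M2^2 + (r M1 - X M2)^2 > 0. So a maximum
    inside the half circle slopes away from [r0]. *)
Lemma radial_sign_interior r X : 0 < r -> -1 < X < 1 -> angular r X = 0 ->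
  exists k, 0 < k /\ radial r X = k * (r ^ 2 - r0 ^ 2).
Proof.
  intros Hr HX HF.
  assert (L : 0 < ell p1 r X /\ 0 < ell p2 r X /\ 0 < ell p3 r X) by (repeat split; apply ell_pos; lra).
  pose proof q_pos as (Q1 & Q2 & Q3). pose proof q_first_moment as HM. pose proof l0_pos as L0.
  set (a := r ^ 2 - r0 ^ 2). set (b := r * X - r0 * X0).
  assert (C : forall c p, 0 < ell p r0 X0 -> 0 < ell p r X ->
     c / ell p r X = c / ell p r0 X0 * (1 - (a - 2 * p * b) / ell p r X)).
  { intros c p H1 H2.
    replace (1 - (a - 2 * p * b) / ell p r X) with ((ell p r X - (a - 2 * p * b)) / ell p r X) by (field; lra).
    replace (ell p r X - (a - 2 * p * b)) with (ell p r0 X0) by (unfold ell, a, b; ring).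
    field; lra. }
  assert (C1 := C c1 p1 ltac:(lra) ltac:(lra)). assert (C2 := C c2 p2 ltac:(lra) ltac:(lra)).
  assert (C3 := C c3 p3 ltac:(lra) ltac:(lra)). clear C.
  assert (HF' : c1 / ell p1 r X * p1 + c2 / ell p2 r X * p2 + c3 / ell p3 r X * p3 = 0).
  { rewrite <- HF. unfold angular. field. lra. }
  assert (HR : radial r X = r ^ 2 * (c1 / ell p1 r X + c2 / ell p2 r X + c3 / ell p3 r X)
                - r * X * (c1 / ell p1 r X * p1 + c2 / ell p2 r X * p2 + c3 / ell p3 r X * p3) - t0).
  { unfold radial. field. lra. }
  assert (HT : t0 = (q1 + q2 + q3) * r0 ^ 2). { rewrite saddle_radial. field. lra. }
  rewrite HF', C1, C2, C3 in HR. rewrite C1, C2, C3 in HF'.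
  clear C1 C2 C3. rewrite HT in HR.
  set (l1 := ell p1 r X) in *. set (l2 := ell p2 r X) in *. set (l3 := ell p3 r X) in *.
  assert (E1 : (r - X * p1) ^ 2 = l1 - p1 ^ 2 * (1 - X ^ 2)) by (unfold l1, ell; ring).
  assert (E2 : (r - X * p2) ^ 2 = l2 - p2 ^ 2 * (1 - X ^ 2)) by (unfold l2, ell; ring).
  assert (E3 : (r - X * p3) ^ 2 = l3 - p3 ^ 2 * (1 - X ^ 2)) by (unfold l3, ell; ring).
  set (M0 := q1 / l1 + q2 / l2 + q3 / l3).
  set (M1 := q1 * p1 / l1 + q2 * p2 / l2 + q3 * p3 / l3).
  set (M2 := q1 * p1 ^ 2 / l1 + q2 * p2 ^ 2 / l2 + q3 * p3 ^ 2 / l3).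
  set (Q := q1 + q2 + q3) in *.
  assert (HM2 : 0 < M2).
  { unfold M2.
    assert (0 < q1 * p1 ^ 2 / l1) by (apply Rdiv_lt_0_compat; [apply Rmult_lt_0_compat; [lra|nra]|lra]).
    assert (0 < q2 * p2 ^ 2 / l2) by (apply Rdiv_lt_0_compat; [apply Rmult_lt_0_compat; [lra|nra]|lra]).
    assert (0 < q3 * p3 ^ 2 / l3) by (apply Rdiv_lt_0_compat; [apply Rmult_lt_0_compat; [lra|nra]|lra]).
    lra. }
  assert (HF'' : 2 * b * M2 = a * M1).
  { unfold M1, M2. clearbody a b.
    apply Rminus_diag_uniq. rewrite <- HF'.
    replace (q1 * (1 - (a - 2 * p1 * b) / l1) * p1 + q2 * (1 - (a - 2 * p2 * b) / l2) * p2 + q3 * (1 - (a - 2 * p3 * b) / l3) * p3)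
      with ((q1 * p1 + q2 * p2 + q3 * p3) - (a * (q1 * p1 / l1 + q2 * p2 / l2 + q3 * p3 / l3)) + 2 * b * (q1 * p1 ^ 2 / l1 + q2 * p2 ^ 2 / l2 + q3 * p3 ^ 2 / l3)) by (field; lra).
    rewrite HM. ring. }
  assert (HR' : radial r X = a * Q - r ^ 2 * a * M0 + 2 * b * r ^ 2 * M1).
  { rewrite HR. unfold Q, M0, M1. unfold a. field. lra. }
  (* The weighted sum of (r - X p_i)^2 / ell_i = 1 - p_i^2 (1 - X^2) / ell_i. *)
  assert (HS : r ^ 2 * M0 - 2 * r * X * M1 + X ^ 2 * M2 = Q - (1 - X ^ 2) * M2).
  { unfold M0, M1, M2, Q.
    transitivity (q1 * ((r - X * p1) ^ 2 / l1) + q2 * ((r - X * p2) ^ 2 / l2) + q3 * ((r - X * p3) ^ 2 / l3)).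
    - field. lra.
    - rewrite E1, E2, E3. field. lra. }
  exists ((Q * M2 - r ^ 2 * (M0 * M2 - M1 ^ 2)) / M2). split.
  - apply Rdiv_lt_0_compat; [|exact HM2].
    assert (0 < (1 - X ^ 2) * M2 ^ 2). { apply Rmult_lt_0_compat; [nra|apply pow_lt, HM2]. }
    assert (Q * M2 - r ^ 2 * (M0 * M2 - M1 ^ 2) = (1 - X ^ 2) * M2 ^ 2 + (r * M1 - X * M2) ^ 2).
    { replace Q with (r ^ 2 * M0 - 2 * r * X * M1 + X ^ 2 * M2 + (1 - X ^ 2) * M2) by lra. ring. }
    pose proof (pow2_ge_0 (r * M1 - X * M2)). lra.
  - fold a. rewrite HR'.
    replace (2 * b * r ^ 2 * M1) with (r ^ 2 * M1 * (2 * b * M2) / M2) by (field; lra).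
    rewrite HF''. field. lra.
Qed.

(** On the real axis [ell] is the square (z - p)^2, and substituting the charges through the weights
    gives closed forms. The positive term D V ties the sign of [T] to that of the angular
    derivative. *)
Lemma real_axis_identities e r : (e = 1 \/ e = -1) -> regular r e ->
  let z := e * r in
  let D := r ^ 2 + r0 ^ 2 - 2 * z * r0 * X0 in
  let T := q1 * p1 / (z - p1) + q2 * p2 / (z - p2) + q3 * p3 / (z - p3) in
  let V := q1 * p1 ^ 2 / (z - p1) ^ 2 + q2 * p2 ^ 2 / (z - p2) ^ 2 + q3 * p3 ^ 2 / (z - p3) ^ 2 in
  0 < D /\ 0 < V /\ z - p1 <> 0 /\ z - p2 <> 0 /\ z - p3 <> 0 /\
  radial r e = D * T /\ z * angular r e = T * (r0 ^ 2 - r ^ 2) + D * V.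
Proof.
  intros He (Hr & _ & R1 & R2 & R3) z D T V.
  pose proof q_pos as (Q1 & Q2 & Q3). pose proof q_first_moment as HM. pose proof l0_pos as L0.
  assert (He2 : e * e = 1) by (destruct He as [-> | ->]; ring).
  assert (Hz : z * z = r ^ 2). { unfold z. replace (e * r * (e * r)) with (e * e * r ^ 2) by ring. rewrite He2. ring. }
  assert (N : forall p, ell p r e = (z - p) ^ 2). { intros p. unfold ell. replace ((z - p) ^ 2) with (z * z + p ^ 2 - 2 * p * z) by ring. rewrite Hz. unfold z. ring. }
  rewrite N in R1, R2, R3.
  assert (Z : forall p, 0 < (z - p) ^ 2 -> z - p <> 0). { intros p H E. rewrite E in H. lra. }
  assert (N1 := Z p1 R1). assert (N2 := Z p2 R2). assert (N3 := Z p3 R3).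
  assert (HD : 0 < D).
  { unfold D. replace (r ^ 2 + r0 ^ 2 - 2 * z * r0 * X0) with ((z - r0 * X0) ^ 2 + r0 ^ 2 * (1 - X0 ^ 2)) by (rewrite <- Hz; ring).
    assert (0 < r0 ^ 2 * (1 - X0 ^ 2)) by (apply Rmult_lt_0_compat; [apply pow_lt, Hr0|apply one_minus_sq_pos, HX0]).
    pose proof (pow2_ge_0 (z - r0 * X0)). lra. }
  assert (HV : 0 < V).
  { unfold V.
    assert (0 < q1 * p1 ^ 2 / (z - p1) ^ 2) by (apply Rdiv_lt_0_compat; [apply Rmult_lt_0_compat; [lra|apply pow2_gt_0; lra]|lra]).
    assert (0 < q2 * p2 ^ 2 / (z - p2) ^ 2) by (apply Rdiv_lt_0_compat; [apply Rmult_lt_0_compat; [lra|apply pow2_gt_0; lra]|lra]).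
    assert (0 < q3 * p3 ^ 2 / (z - p3) ^ 2) by (apply Rdiv_lt_0_compat; [apply Rmult_lt_0_compat; [lra|apply pow2_gt_0; lra]|lra]).
    lra. }
  assert (HT : t0 = (q1 + q2 + q3) * r0 ^ 2). { rewrite saddle_radial. field. lra. }
  assert (HC : forall c p, 0 < ell p r0 X0 -> c = c / ell p r0 X0 * (D + 2 * (z - p) * (r0 * X0 - z) + (z - p) ^ 2)).
  { intros c p H. unfold D. rewrite <- Hz.
    replace (z * z + r0 ^ 2 - 2 * z * r0 * X0 + 2 * (z - p) * (r0 * X0 - z) + (z - p) ^ 2) with (ell p r0 X0) by (unfold ell; ring).
    field; lra. }
  assert (HC1 := HC c1 p1 ltac:(lra)). assert (HC2 := HC c2 p2 ltac:(lra)). assert (HC3 := HC c3 p3 ltac:(lra)). clear HC.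
  repeat split; trivial.
  - transitivity (c1 * z / (z - p1) + c2 * z / (z - p2) + c3 * z / (z - p3) - t0).
    { unfold radial. rewrite !N. f_equal.
      assert (G : forall p, r * (r - p * e) = z * (z - p)).
      { intros p. replace (z * (z - p)) with (z * z - z * p) by ring. rewrite Hz. unfold z. ring. }
      transitivity (c1 * (r * (r - p1 * e)) / (z - p1) ^ 2 + c2 * (r * (r - p2 * e)) / (z - p2) ^ 2 + c3 * (r * (r - p3 * e)) / (z - p3) ^ 2).
      - field. repeat split; assumption.
      - rewrite !G. field. repeat split; assumption. }
    rewrite HT.
    assert (I := axis_radial_identity z (r0 * X0) (r0 ^ 2) p1 p2 p3 _ _ _ N1 N2 N3 HM). cbv zeta beta in I.
    replace (z * z - 2 * z * (r0 * X0) + r0 ^ 2) with D in I by (unfold D; rewrite <- Hz; ring).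
    rewrite <- HC1, <- HC2, <- HC3 in I. exact I.
  - assert (I := axis_angular_identity z (r0 * X0) (r0 ^ 2) p1 p2 p3 _ _ _ N1 N2 N3 HM). cbv zeta beta in I.
    replace (z * z - 2 * z * (r0 * X0) + r0 ^ 2) with D in I by (unfold D; rewrite <- Hz; ring).
    rewrite <- HC1, <- HC2, <- HC3 in I. rewrite Hz in I. unfold angular. rewrite !N. exact I.
Qed.

(** Concavity in [X]: ln t <= t - 1 is applied to the ratio of the two values of each [ell], which
    is affine in [X]. *)
Lemma energy_tangent r X Y : regular r X -> regular r Y -> energy r Y <= energy r X - r * angular r X * (Y - X).
Proof.
  intros (Hr & HX & A1 & A2 & A3) (_ & HY & B1 & B2 & B3).
  assert (L : forall x, 0 < x -> ln x <= x - 1).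
  { intros x Hx. pose proof (exp_ineq1_le (ln x)). rewrite exp_ln in H by exact Hx. lra. }
  assert (G : forall c p, 0 < c -> 0 < ell p r X -> 0 < ell p r Y ->
    c * ln (ell p r Y) <= c * ln (ell p r X) - 2 * r * (c * p / ell p r X) * (Y - X)).
  { intros c p Hcp H1 H2.
    assert (H := L (ell p r Y / ell p r X) ltac:(apply Rdiv_lt_0_compat; lra)).
    rewrite ln_div in H by lra.
    replace (ell p r Y / ell p r X - 1) with (- (2 * r * p / ell p r X) * (Y - X)) in H
      by (replace (ell p r Y) with (ell p r X - 2 * r * p * (Y - X)) by (unfold ell; ring); field; lra).
    replace (2 * r * (c * p / ell p r X) * (Y - X)) with (c * ((2 * r * p / ell p r X) * (Y - X))) by (field; lra).
    nra. }
  assert (G1 := G c1 p1 ltac:(lra) A1 B1). assert (G2 := G c2 p2 ltac:(lra) A2 B2). assert (G3 := G c3 p3 ltac:(lra) A3 B3).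
  unfold energy, angular. 
  replace (r * (c1 * p1 / ell p1 r X + c2 * p2 / ell p2 r X + c3 * p3 / ell p3 r X) * (Y - X))
    with (r * (c1 * p1 / ell p1 r X) * (Y - X) + r * (c2 * p2 / ell p2 r X) * (Y - X) + r * (c3 * p3 / ell p3 r X) * (Y - X)) by ring.
  lra.
Qed.

(** The tangent bound in both variables: [ell] is affine in (r^2, r X), so the positive charges have
    a linear majorant, while the negative charge t0 ln r is kept exactly. *)
Lemma energy_super r X r' X' : regular r X -> regular r' X' ->
  energy r' X' <= energy r X + (c1 / ell p1 r X + c2 / ell p2 r X + c3 / ell p3 r X) / 2 * (r' ^ 2 - r ^ 2)
    - angular r X * (r' * X' - r * X) - t0 * ln (r' / r).
Proof.
  intros (Hr & HX & A1 & A2 & A3) (Hr' & HY & B1 & B2 & B3).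
  assert (L : forall x, 0 < x -> ln x <= x - 1).
  { intros x Hx. pose proof (exp_ineq1_le (ln x)). rewrite exp_ln in H by exact Hx. lra. }
  assert (G : forall c p, 0 < c -> 0 < ell p r X -> 0 < ell p r' X' ->
    c * ln (ell p r' X') <= c * ln (ell p r X) + c / ell p r X * (r' ^ 2 - r ^ 2) - 2 * (c * p / ell p r X) * (r' * X' - r * X)).
  { intros c p Hcp H1 H2.
    assert (H := L (ell p r' X' / ell p r X) ltac:(apply Rdiv_lt_0_compat; lra)).
    rewrite ln_div in H by lra.
    assert (E : c * (ell p r' X' / ell p r X - 1) = c / ell p r X * (r' ^ 2 - r ^ 2) - 2 * (c * p / ell p r X) * (r' * X' - r * X)).
    { replace (ell p r' X') with (ell p r X + (r' ^ 2 - r ^ 2) - 2 * p * (r' * X' - r * X)) by (unfold ell; ring). field; lra. }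
    apply Rmult_le_compat_l with (r := c) in H; lra. }
  assert (G1 := G c1 p1 ltac:(lra) A1 B1). assert (G2 := G c2 p2 ltac:(lra) A2 B2). assert (G3 := G c3 p3 ltac:(lra) A3 B3).
  unfold energy, angular. rewrite ln_div by assumption. lra.
Qed.

(** Strictness comes from the third charge, whose [ell] takes different values at [X] and [X0]. *)
Lemma energy_tangent_strict X : -1 <= X <= 1 -> X <> X0 -> regular r0 X -> energy r0 X < energy r0 X0.
Proof.
  intros HX Hne (Hr & _ & B1 & B2 & B3). pose proof l0_pos as (A1 & A2 & A3).
  assert (L : forall x, 0 < x -> ln x <= x - 1).
  { intros x Hx. pose proof (exp_ineq1_le (ln x)). rewrite exp_ln in H by exact Hx. lra. }
  assert (L' : forall x, 0 < x -> x <> 1 -> ln x < x - 1).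
  { intros x Hx Hx1. assert (ln x <> 0). { intros E. apply Hx1. rewrite <- (exp_ln x Hx), E. apply exp_0. }
    pose proof (exp_ineq1 (ln x) H). rewrite exp_ln in H0 by exact Hx. lra. }
  assert (EQ : forall c p, 0 < ell p r0 X0 -> c * (ell p r0 X / ell p r0 X0 - 1) = - 2 * (c * p / ell p r0 X0) * (r0 * (X - X0))).
  { intros c p H. replace (ell p r0 X) with (ell p r0 X0 - 2 * p * r0 * (X - X0)) by (unfold ell; ring). field; lra. }
  assert (G : forall c p, 0 < c -> 0 < ell p r0 X0 -> 0 < ell p r0 X ->
    c * ln (ell p r0 X) <= c * ln (ell p r0 X0) - 2 * (c * p / ell p r0 X0) * (r0 * (X - X0))).
  { intros c p Hcp H1 H2. specialize (EQ c p H1).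
    assert (H := L (ell p r0 X / ell p r0 X0) ltac:(apply Rdiv_lt_0_compat; lra)).
    rewrite ln_div in H by lra. nra. }
  assert (G1 := G c1 p1 ltac:(lra) A1 B1). assert (G2 := G c2 p2 ltac:(lra) A2 B2).
  assert (G3 : c3 * ln (ell p3 r0 X) < c3 * ln (ell p3 r0 X0) - 2 * (c3 * p3 / ell p3 r0 X0) * (r0 * (X - X0))).
  { specialize (EQ c3 p3 A3).
    assert (H := L' (ell p3 r0 X / ell p3 r0 X0) ltac:(apply Rdiv_lt_0_compat; lra)).
    rewrite ln_div in H by lra.
    assert (ell p3 r0 X / ell p3 r0 X0 <> 1).
    { intros E. apply Hne. assert (E' : ell p3 r0 X = ell p3 r0 X0).
      { replace (ell p3 r0 X) with (ell p3 r0 X / ell p3 r0 X0 * ell p3 r0 X0) by (field; lra). rewrite E; ring. }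
      unfold ell in E'. apply Rmult_eq_reg_l with (2 * p3 * r0); [lra|]. apply Rmult_integral_contrapositive_currified; [|lra].
      apply Rmult_integral_contrapositive_currified; lra. }
    specialize (H H0). nra. }
  assert (S := saddle_angular). unfold angular in S. unfold energy.
  assert ((c1 * p1 / ell p1 r0 X0) * (r0 * (X - X0)) + (c2 * p2 / ell p2 r0 X0) * (r0 * (X - X0)) + (c3 * p3 / ell p3 r0 X0) * (r0 * (X - X0)) = 0).
  { rewrite <- !Rmult_plus_distr_r, S. ring. }
  lra.
Qed.

Lemma ell_continuous_r p r X : continuous (fun r => ell p r X) r.
Proof. apply (ex_derive_continuous (V := R_NormedModule)). unfold ell. auto_derive. trivial. Qed.

Lemma energy_derive_r r X : regular r X -> is_derive (fun r => energy r X) r (radial r X / r).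
Proof.
  intros (Hr & HX & A1 & A2 & A3). unfold energy, radial, ell in *. auto_derive.
  - repeat split; lra.
  - field. repeat split; lra.
Qed.

Lemma energy_continuous_X r X : regular r X -> continuous (fun X => energy r X) X.
Proof.
  intros (Hr & HX & A1 & A2 & A3). apply (ex_derive_continuous (V := R_NormedModule)).
  unfold energy, ell in *. auto_derive. repeat split; lra.
Qed.

Lemma locally_pos (f : R -> R) x : continuous f x -> 0 < f x -> exists d, 0 < d /\ forall y, Rabs (y - x) < d -> 0 < f y.
Proof.
  intros Hf Hx. destruct (Hf (fun y => 0 < y)) as [d Hd].
  { exists (mkposreal _ Hx). intros y Hy. unfold ball in Hy; simpl in Hy. unfold AbsRing_ball, abs, minus, plus, opp in Hy; simpl in Hy.
    apply Rabs_def2 in Hy. lra. }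
  exists d. split; [apply cond_pos|]. intros y Hy. apply Hd. exact Hy.
Qed.

Lemma energy_gt_near_r r X e : regular r X -> e < energy r X ->
  exists d, 0 < d /\ forall r', Rabs (r' - r) < d -> regular r' X /\ e < energy r' X.
Proof.
  intros HR He. pose proof HR as (Hr & HX & A1 & A2 & A3).
  destruct (locally_pos (fun r => r) r (continuous_id r) Hr) as (d0 & Hd0 & H0).
  destruct (locally_pos (fun r => ell p1 r X) r (ell_continuous_r _ _ _) A1) as (d1 & Hd1 & H1).
  destruct (locally_pos (fun r => ell p2 r X) r (ell_continuous_r _ _ _) A2) as (d2 & Hd2 & H2).
  destruct (locally_pos (fun r => ell p3 r X) r (ell_continuous_r _ _ _) A3) as (d3 & Hd3 & H3).
  destruct (locally_pos (fun r => energy r X - e) r) as (d4 & Hd4 & H4); [|lra|].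
  { apply (continuous_minus (V := R_NormedModule)); [|apply continuous_const].
    apply (ex_derive_continuous (V := R_NormedModule)). eexists; apply energy_derive_r, HR. }
  exists (Rmin (Rmin d0 d1) (Rmin (Rmin d2 d3) d4)). split; [repeat apply Rmin_glb_lt; assumption|].
  intros r' H.
  assert (Rabs (r' - r) < Rmin d0 d1 /\ Rabs (r' - r) < Rmin (Rmin d2 d3) d4) as [K1 K2].
  { split; eapply Rlt_le_trans; try exact H; [apply Rmin_l|apply Rmin_r]. }
  assert (Rabs (r' - r) < Rmin d2 d3 /\ Rabs (r' - r) < d4) as [K3 K4].
  { split; eapply Rlt_le_trans; try exact K2; [apply Rmin_l|apply Rmin_r]. }
  assert (Rabs (r' - r) < d0 /\ Rabs (r' - r) < d1) as [K5 K6].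
  { split; eapply Rlt_le_trans; try exact K1; [apply Rmin_l|apply Rmin_r]. }
  assert (Rabs (r' - r) < d2 /\ Rabs (r' - r) < d3) as [K7 K8].
  { split; eapply Rlt_le_trans; try exact K3; [apply Rmin_l|apply Rmin_r]. }
  split; [split; [apply H0, K5|]; split; [exact HX|]; repeat split; auto|]. specialize (H4 r' K4). lra.
Qed.

(** First-order conditions on [-1, 1], which by concavity characterize the maxima of the energy on
    the circle. The last two cases put the maximum on the real axis. *)
Definition argmax (r X : R) : Prop := regular r X /\
  (angular r X = 0 /\ -1 < X < 1 \/ X = -1 /\ 0 <= angular r X \/ X = 1 /\ angular r X <= 0).

Lemma argmax_max r X Y : argmax r X -> regular r Y -> energy r Y <= energy r X.
Proof.
  intros [HR H] HY. pose proof (energy_tangent r X Y HR HY). destruct HR as (Hr & _). destruct HY as (_ & HY & _).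
  assert (0 <= r * angular r X * (Y - X)); [|lra].
  rewrite Rmult_assoc. apply Rmult_le_pos; [lra|].
  destruct H as [[-> _]|[[-> H]|[-> H]]]; nra.
Qed.

(** At a real maximum the end-point condition makes z times the angular derivative nonpositive. The
    identity z angular = T (r0^2 - r^2) + D V then forces [T], hence the radial derivative D T, to
    have the sign of r - r0. *)
Lemma argmax_radial r X : argmax r X -> r <> r0 -> 0 < (r - r0) * radial r X.
Proof.
  intros [HR H] Hne. pose proof HR as (Hr & _).
  assert (B : forall e, (e = 1 \/ e = -1) -> X = e -> e * angular r X <= 0 -> 0 < (r - r0) * radial r X).
  { intros e He -> Ha. destruct (real_axis_identities e r He HR) as (HD & HV & _ & _ & _ & E1 & E2).
    set (D := r ^ 2 + r0 ^ 2 - 2 * (e * r) * r0 * X0) in *.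
    set (T := q1 * p1 / (e * r - p1) + q2 * p2 / (e * r - p2) + q3 * p3 / (e * r - p3)) in *.
    set (V := q1 * p1 ^ 2 / (e * r - p1) ^ 2 + q2 * p2 ^ 2 / (e * r - p2) ^ 2 + q3 * p3 ^ 2 / (e * r - p3) ^ 2) in *.
    rewrite E1.
    assert (0 < D * V) by (apply Rmult_lt_0_compat; assumption).
    assert (e * r * angular r e <= 0). { replace (e * r * angular r e) with (r * (e * angular r e)) by ring. nra. }
    assert (HT : 0 < T * ((r - r0) * (r + r0))). { replace (T * ((r - r0) * (r + r0))) with (- (T * (r0 ^ 2 - r ^ 2))) by ring. lra. }
    assert (0 < T * (r - r0)).
    { replace (T * ((r - r0) * (r + r0))) with ((T * (r - r0)) * (r + r0)) in HT by ring.
      apply Rmult_lt_reg_r with (r + r0); [lra|]. lra. }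
    replace ((r - r0) * (D * T)) with (D * (T * (r - r0))) by ring. apply Rmult_lt_0_compat; assumption. }
  destruct H as [[HF HX]|[[-> H]|[-> H]]].
  - destruct (radial_sign_interior r X Hr HX HF) as (k & Hk & ->).
    replace ((r - r0) * (k * (r ^ 2 - r0 ^ 2))) with (k * ((r - r0) * (r - r0)) * (r + r0)) by ring.
    apply Rmult_lt_0_compat; [|lra]. apply Rmult_lt_0_compat; [exact Hk|]. nra.
  - apply (B (-1)); auto; lra.
  - apply (B 1); auto; lra.
Qed.

Lemma angular_continuous r X : 0 < ell p1 r X -> 0 < ell p2 r X -> 0 < ell p3 r X ->
  continuous (fun X => angular r X) X.
Proof.
  intros A1 A2 A3. apply (ex_derive_continuous (V := R_NormedModule)).
  unfold angular, ell in *. auto_derive. repeat split; lra.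
Qed.

(** Either the angular derivative changes sign inside, or the energy is monotone and the maximum is
    at an end point. The latter must be regular: next to a charge on the circle the angular
    derivative would have the opposite sign. *)
Lemma argmax_exists r : 0 < r -> exists X, argmax r X.
Proof.
  intros Hr.
  assert (Hint : forall X, -1 < X < 1 -> 0 < ell p1 r X /\ 0 < ell p2 r X /\ 0 < ell p3 r X).
  { intros; repeat split; apply ell_pos; lra. }
  destruct (classic (exists a, -1 < a < 1 /\ angular r a < 0)) as [(a & Ha & Fa)|Hno].
  - destruct (classic (exists b, -1 < b < 1 /\ 0 < angular r b)) as [(b & Hb & Fb)|Hno].
    + assert (IV : exists X, -1 < X < 1 /\ angular r X = 0).
      { destruct (Rtotal_order a b) as [Hab|[->|Hab]]; [|lra|].
        - destruct (Ranalysis5.IVT_interv (fun X => angular r X) a b) as (X & HX & HX0'); trivial.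
          + intros y Hy. apply continuity_pt_filterlim. destruct (Hint y ltac:(lra)) as (?&?&?). apply angular_continuous; trivial.
          + exists X. split; [lra|exact HX0'].
        - destruct (Ranalysis5.IVT_interv (fun X => - angular r X) b a) as (X & HX & HX0'); try lra.
          + intros y Hy. apply continuity_pt_filterlim. destruct (Hint y ltac:(lra)) as (?&?&?).
            apply (continuous_opp (V := R_NormedModule)). apply angular_continuous; trivial.
          + exists X. split; [lra|]. simpl in HX0'. lra. }
      destruct IV as (X & HX & HF). exists X. split; [apply regular_interior; assumption|left; auto].
    + exists 1.
      assert (Hle : forall X, -1 < X < 1 -> angular r X <= 0).
      { intros X HX. destruct (Rle_lt_dec (angular r X) 0); [assumption|]. exfalso; apply Hno. exists X; auto. }
      assert (R1 : 0 < ell p1 r 1). { unfold ell. replace (_ - _) with ((r - p1) ^ 2) by ring. apply pow2_gt_0; lra. }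
      assert (R2 : 0 < ell p2 r 1). { unfold ell. replace (_ - _) with ((r - p2) ^ 2) by ring. apply pow2_gt_0; lra. }
      assert (R3 : 0 < ell p3 r 1).
      { unfold ell. replace (_ - _) with ((r - p3) ^ 2) by ring. apply pow2_gt_0. intros E. assert (Er : r = p3) by lra. clear E.
        (* If r = p3, the third term at X = 1 - h is c3 / (2 r h), while the others are at least -k
           / r^2 in total; [h] is chosen so that 2 k h < c3 r. *)
        set (k := c1 * - p1 + c2 * - p2). assert (Hk : 0 < k) by (unfold k; nra).
        set (h := Rmin 1 (c3 * r / (4 * k))).
        assert (Hh : 0 < h). { unfold h. apply Rmin_glb_lt; [lra|]. apply Rdiv_lt_0_compat; nra. }
        assert (Hh1 : h <= 1) by apply Rmin_l. assert (Hh2 : h <= c3 * r / (4 * k)) by apply Rmin_r.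
        assert (Hh3 : h * (4 * k) <= c3 * r).
        { apply Rmult_le_compat_r with (r := 4 * k) in Hh2; [|lra].
          replace (c3 * r / (4 * k) * (4 * k)) with (c3 * r) in Hh2 by (field; lra). exact Hh2. }
        specialize (Hle (1 - h) ltac:(lra)). destruct (Hint (1 - h) ltac:(lra)) as (I1 & I2 & I3).
        assert (B : forall c p, 0 < c -> p < 0 -> 0 < ell p r (1 - h) -> - (c * - p / r ^ 2) <= c * p / ell p r (1 - h)).
        { intros c p Hcp Hpn Hl. 
          assert (r ^ 2 <= ell p r (1 - h)). { unfold ell. assert (0 <= - p * r * (1 - h)) by (repeat apply Rmult_le_pos; lra). pose proof (pow2_ge_0 p). lra. }
          replace (c * p / ell p r (1 - h)) with (- (c * - p / ell p r (1 - h))) by (field; lra).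
          apply Ropp_le_contravar. apply Rmult_le_compat_l; [nra|]. apply Rinv_le_contravar; [apply pow_lt; lra|assumption]. }
        assert (B1 := B c1 p1 ltac:(lra) ltac:(lra) I1). assert (B2 := B c2 p2 ltac:(lra) ltac:(lra) I2).
        assert (B3 : c3 * p3 / ell p3 r (1 - h) = c3 / (2 * r * h)).
        { replace (ell p3 r (1 - h)) with (2 * r ^ 2 * h) by (unfold ell; rewrite <- Er; ring). rewrite <- Er. field. lra. }
        unfold angular in Hle. rewrite B3 in Hle.
        assert (K : c1 * - p1 / r ^ 2 + c2 * - p2 / r ^ 2 = k / r ^ 2) by (unfold k; field; lra).
        assert (K' : k / r ^ 2 < c3 / (2 * r * h)); [|lra].
        apply Rmult_lt_reg_r with (2 * r ^ 2 * h). { repeat apply Rmult_lt_0_compat; lra. }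
        replace (k / r ^ 2 * (2 * r ^ 2 * h)) with (2 * k * h) by (field; lra).
        replace (c3 / (2 * r * h) * (2 * r ^ 2 * h)) with (c3 * r) by (field; lra). nra. }
      split; [repeat split; lra|]. right; right. split; [reflexivity|].
      destruct (Rle_lt_dec (angular r 1) 0) as [|Hlt]; [assumption|exfalso].
      destruct (locally_pos (fun X => angular r X) 1 (angular_continuous _ _ R1 R2 R3) Hlt) as (d & Hd & H).
      set (h := Rmin (d / 2) 1). assert (0 < h) by (apply Rmin_glb_lt; lra).
      assert (h <= d / 2) by apply Rmin_l. assert (h <= 1) by apply Rmin_r.
      specialize (H (1 - h)). replace (1 - h - 1) with (- h) in H by ring. rewrite Rabs_Ropp, Rabs_right in H by lra.
      specialize (H ltac:(lra)). specialize (Hle (1 - h) ltac:(lra)). lra.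
  - exists (-1).
    assert (Hge : forall X, -1 < X < 1 -> 0 <= angular r X).
    { intros X HX. destruct (Rle_lt_dec 0 (angular r X)); [assumption|]. exfalso; apply Hno. exists X; auto. }
    assert (R3 : 0 < ell p3 r (-1)). { unfold ell. replace (_ - _) with ((r + p3) ^ 2) by ring. apply pow2_gt_0; lra. }
    assert (RN : forall h, 0 < h <= 1 -> angular r (-1 + h) <= c1 * p1 / ell p1 r (-1 + h) + c3 * p3 / r ^ 2 /\
                                       angular r (-1 + h) <= c2 * p2 / ell p2 r (-1 + h) + c3 * p3 / r ^ 2).
    { intros h Hh. destruct (Hint (-1 + h) ltac:(lra)) as (I1 & I2 & I3).
      assert (N1 : c1 * p1 / ell p1 r (-1 + h) < 0).
      { replace (c1 * p1 / ell p1 r (-1 + h)) with (- (c1 * - p1 / ell p1 r (-1 + h))) by (field; lra).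
        assert (0 < c1 * - p1 / ell p1 r (-1 + h)) by (apply Rdiv_lt_0_compat; nra). lra. }
      assert (N2 : c2 * p2 / ell p2 r (-1 + h) < 0).
      { replace (c2 * p2 / ell p2 r (-1 + h)) with (- (c2 * - p2 / ell p2 r (-1 + h))) by (field; lra).
        assert (0 < c2 * - p2 / ell p2 r (-1 + h)) by (apply Rdiv_lt_0_compat; nra). lra. }
      assert (N3 : c3 * p3 / ell p3 r (-1 + h) <= c3 * p3 / r ^ 2).
      { apply Rmult_le_compat_l; [nra|]. apply Rinv_le_contravar; [apply pow_lt; lra|].
        unfold ell. assert (0 <= p3 * r * (1 - h)) by (repeat apply Rmult_le_pos; lra). pose proof (pow2_ge_0 p3). lra. }
      unfold angular. lra. }
    assert (RP : forall c p, 0 < c -> p < 0 -> (forall h, 0 < h <= 1 -> angular r (-1 + h) <= c * p / ell p r (-1 + h) + c3 * p3 / r ^ 2) -> 0 < ell p r (-1)).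
    (* The mirror case: a negative charge position with r = -p contributes -c / (2 r h) at X = -1 +
       h, which outweighs the bounded term of [p3]. *)
    { intros c p Hcp Hpn HB. unfold ell. replace (_ - _) with ((r + p) ^ 2) by ring. apply pow2_gt_0. intros E. assert (Er : p = - r) by lra.
      clear E. set (k := c3 * p3). assert (Hk : 0 < k) by (unfold k; nra).
      set (h := Rmin 1 (c * r / (4 * k))).
      assert (Hh : 0 < h). { unfold h. apply Rmin_glb_lt; [lra|]. apply Rdiv_lt_0_compat; nra. }
      assert (Hh1 : h <= 1) by apply Rmin_l. assert (Hh2 : h <= c * r / (4 * k)) by apply Rmin_r.
      assert (Hh3 : h * (4 * k) <= c * r).
      { apply Rmult_le_compat_r with (r := 4 * k) in Hh2; [|lra].
        replace (c * r / (4 * k) * (4 * k)) with (c * r) in Hh2 by (field; lra). exact Hh2. }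
      specialize (HB h ltac:(lra)). specialize (Hge (-1 + h) ltac:(lra)).
      replace (ell p r (-1 + h)) with (2 * r ^ 2 * h) in HB by (unfold ell; rewrite Er; ring).
      fold k in HB. replace (c * p / (2 * r ^ 2 * h)) with (- (c / (2 * r * h))) in HB by (rewrite Er; field; lra).
      assert (K' : k / r ^ 2 < c / (2 * r * h)); [|lra].
      apply Rmult_lt_reg_r with (2 * r ^ 2 * h). { repeat apply Rmult_lt_0_compat; lra. }
      replace (k / r ^ 2 * (2 * r ^ 2 * h)) with (2 * k * h) by (field; lra).
      replace (c / (2 * r * h) * (2 * r ^ 2 * h)) with (c * r) by (field; lra). nra. }
    assert (R1 := RP c1 p1 ltac:(lra) ltac:(lra) (fun h Hh => proj1 (RN h Hh))).
    assert (R2 := RP c2 p2 ltac:(lra) ltac:(lra) (fun h Hh => proj2 (RN h Hh))).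
    split; [repeat split; lra|]. right; left. split; [reflexivity|].
    destruct (Rle_lt_dec 0 (angular r (-1))) as [|Hlt]; [assumption|exfalso].
    destruct (locally_pos (fun X => - angular r X) (-1)) as (d & Hd & H); [|lra|].
    { apply (continuous_opp (V := R_NormedModule)). apply angular_continuous; assumption. }
    set (h := Rmin (d / 2) 1). assert (0 < h) by (apply Rmin_glb_lt; lra).
    assert (h <= d / 2) by apply Rmin_l. assert (h <= 1) by apply Rmin_r.
    specialize (H (-1 + h)). replace (-1 + h - -1) with h in H by ring. rewrite Rabs_right in H by lra.
    specialize (H ltac:(lra)). specialize (Hge (-1 + h) ltac:(lra)). lra.
Qed.

(** The majorant [energy_super] at a maximizer reduces to a function [phi] of r' alone: its angular
    part is dropped by the maximality condition. The derivative of [phi] at r is the radial one, so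
    every point of a nearby circle closer to [r0] lies lower. *)
Lemma argmax_super_neg r X : argmax r X -> r <> r0 -> exists d, 0 < d /\ forall r' X', regular r' X' ->
  Rabs (r' - r) < d -> (r' - r) * (r - r0) < 0 -> energy r' X' < energy r X.
Proof.
  intros HA Hne. pose proof HA as [HR HAng]. pose proof HR as (Hr & HX & A1 & A2 & A3).
  pose proof (argmax_radial r X HA Hne) as Hrad.
  set (Q := c1 / ell p1 r X + c2 / ell p2 r X + c3 / ell p3 r X).
  set (phi := fun r' => Q / 2 * (r' ^ 2 - r ^ 2) - angular r X * X * (r' - r) - t0 * ln (r' / r)).
  assert (Hphi : is_derive phi r (radial r X / r)).
  { unfold phi, radial, angular, Q, ell in *. auto_derive.
    - repeat split; try lra; try (apply Rdiv_lt_0_compat; lra).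
    - field. repeat split; lra. }
  apply is_derive_Reals in Hphi.
  assert (Hs : 0 < Rabs (radial r X / r)).
  { apply Rabs_pos_lt. intros E. assert (radial r X = 0). { replace (radial r X) with (radial r X / r * r) by (field; lra). rewrite E; ring. } nra. }
  (* With the modulus of the derivative itself as tolerance, the difference quotients keep its
     sign. *)
  destruct (Hphi _ Hs) as [d Hd].
  exists d. split; [apply cond_pos|]. intros r' X' HR' Hdist Hsign.
  assert (Hneg : phi r' < 0).
  { assert (Hn : r' - r <> 0) by (intros E; rewrite E in Hsign; lra).
    specialize (Hd (r' - r) Hn Hdist). replace (r + (r' - r)) with r' in Hd by ring.
    assert (Hphir : phi r = 0). { unfold phi. replace (r / r) with 1 by (field; lra). rewrite ln_1. ring. }
    rewrite Hphir, Rminus_0_r in Hd.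
    assert (Hr1 : 0 < (r - r0) * (radial r X / r)).
    { replace ((r - r0) * (radial r X / r)) with ((r - r0) * radial r X * / r) by (field; lra). apply Rmult_lt_0_compat; [lra|apply Rinv_0_lt_compat, Hr]. }
    set (w := radial r X / r) in *.
    replace (phi r') with (phi r' / (r' - r) * (r' - r)) by (field; lra). set (v := phi r' / (r' - r)) in *.
    destruct (Rlt_le_dec r0 r).
    - assert (0 < w) by (apply (pos_factor (r - r0)); lra). rewrite (Rabs_right w) in Hd by lra. apply Rabs_def2 in Hd.
      assert (r' - r < 0) by (apply (neg_factor (- (r - r0))); lra). apply Rmult_pos_neg; lra.
    - assert (w < 0). { destruct (Req_dec_T r r0) as [->|]; [lra|]. apply (neg_factor (r - r0)); lra. }
      rewrite (Rabs_left w) in Hd by lra. apply Rabs_def2 in Hd.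
      assert (0 < r' - r). { apply (pos_factor (- (r - r0))); [|lra]. destruct (Req_dec_T r r0); lra. }
      rewrite <- (Ropp_involutive (v * _)), <- Ropp_mult_distr_l_reverse. apply Ropp_lt_gt_0_contravar, Rmult_lt_0_compat; lra. }
  pose proof (energy_super r X r' X' HR HR') as HE. fold Q in HE.
  assert (HB : 0 <= angular r X * (r' * X' - r * X) - angular r X * X * (r' - r)).
  { replace (angular r X * (r' * X' - r * X) - angular r X * X * (r' - r)) with (r' * (angular r X * (X' - X))) by ring.
    destruct HR' as (Hr' & HX' & _). apply Rmult_le_pos; [lra|].
    destruct HAng as [[-> _]|[[-> H]|[-> H]]]; nra. }
  unfold phi in Hneg. lra.
Qed.

(** * Maxima of the energy on circles *)

Definition peak (r : R) : R :=
  Hierarchy.iota (T := R_CompleteNormedModule) (fun v => exists X, argmax r X /\ v = energy r X).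

Lemma peak_argmax r X : argmax r X -> peak r = energy r X.
Proof.
  intros H. apply (iota_unique (V := R_CompleteNormedModule)).
  - intros v (Y & HY & ->). apply Rle_antisym; apply argmax_max; trivial; [apply HY|apply H].
  - exists X; auto.
Qed.

Lemma peak_max r X : regular r X -> energy r X <= peak r.
Proof.
  intros H. destruct (argmax_exists r) as [Y HY]; [apply H|]. rewrite (peak_argmax r Y HY). apply argmax_max; assumption.
Qed.

Lemma argmax_saddle : argmax r0 X0.
Proof. split; [apply regular_interior; assumption|left; auto]. Qed.

(** A maximizer stays regular on nearby circles and bounds their maxima from below; this one-sided
    estimate is enough for the real induction. *)
Lemma peak_lsc r eps : 0 < r -> 0 < eps ->
  exists d, 0 < d /\ forall r', Rabs (r' - r) < d -> peak r - eps < peak r'.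
Proof.
  intros Hr Heps. destruct (argmax_exists r Hr) as [X HX]. rewrite (peak_argmax r X HX).
  destruct (energy_gt_near_r r X (energy r X - eps)) as (d & Hd & H); [apply HX|lra|].
  exists d. split; [exact Hd|]. intros r' Hr'. destruct (H r' Hr') as [HR HE].
  apply Rlt_le_trans with (1 := HE). apply peak_max, HR.
Qed.

Lemma peak_decrease r : 0 < r -> r <> r0 -> exists d, 0 < d /\ forall r', 0 < r' ->
  Rabs (r' - r) < d -> (r' - r) * (r - r0) < 0 -> peak r' < peak r.
Proof.
  intros Hr Hne. destruct (argmax_exists r Hr) as [X HX]. rewrite (peak_argmax r X HX).
  destruct (argmax_super_neg r X HX Hne) as (d & Hd & H). exists d. split; [exact Hd|].
  intros r' Hr' H1 H2. destruct (argmax_exists r' Hr') as [Y HY]. rewrite (peak_argmax r' Y HY).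
  apply H; trivial. apply HY.
Qed.

(** The peak decreases strictly as the radius moves towards [r0]. On the inner side the function is
    reflected, so that the same increasing lemma applies. *)
Lemma peak_gt r : 0 < r -> r <> r0 -> energy r0 X0 < peak r.
Proof.
  intros Hr Hne. rewrite <- (peak_argmax _ _ argmax_saddle).
  destruct (Rtotal_order r r0) as [Hlt|[|Hgt]]; [|lra|].
  - replace r0 with (- - r0) by ring. replace r with (- - r) by ring.
    apply (left_increasing_lt (fun x => peak (- x)) (- r0) (- r)); [lra| |].
    + intros x eps Hx Heps. destruct (peak_lsc (- x) eps ltac:(lra) Heps) as (d & Hd & H).
      exists d. split; [exact Hd|]. intros y Hy Hxy. apply H.
      replace (- y - - x) with (- (y - x)) by ring. rewrite Rabs_Ropp. exact Hxy.
    + intros x Hx. destruct (peak_decrease (- x) ltac:(lra) ltac:(lra)) as (d & Hd & H).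
      exists d. split; [exact Hd|]. intros y Hy Hxy. apply H; [lra| |nra].
      rewrite Rabs_right; lra.
  - apply (left_increasing_lt peak r0 r); [lra| |].
    + intros x eps Hx Heps. destruct (peak_lsc x eps ltac:(lra) Heps) as (d & Hd & H).
      exists d. split; [exact Hd|]. intros y Hy Hxy. apply H, Hxy.
    + intros x Hx. destruct (peak_decrease x ltac:(lra) ltac:(lra)) as (d & Hd & H).
      exists d. split; [exact Hd|]. intros y Hy Hxy. apply H; [lra| |nra].
      rewrite Rabs_left; lra.
Qed.

(** The maximizer may be real; a small displacement of [X] into the open interval keeps the energy
    above the saddle. *)
Lemma exists_higher r : 0 < r -> r <> r0 -> exists X, -1 < X < 1 /\ energy r0 X0 < energy r X.
Proof.
  intros Hr Hne. pose proof (peak_gt r Hr Hne) as H.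
  destruct (argmax_exists r Hr) as [X HX]. rewrite (peak_argmax r X HX) in H.
  destruct HX as [HR _]. pose proof HR as (_ & HX & _).
  destruct (locally_pos (fun X => energy r X - energy r0 X0) X) as (d & Hd & HH); [|lra|].
  { apply (continuous_minus (V := R_NormedModule)); [apply energy_continuous_X, HR|apply continuous_const]. }
  set (h := Rmin (d / 2) (1 / 2)). assert (0 < h) by (apply Rmin_glb_lt; lra).
  assert (h <= d / 2) by apply Rmin_l. assert (h <= 1 / 2) by apply Rmin_r.
  destruct (Rlt_le_dec X 0).
  - exists (X + h). split; [lra|]. specialize (HH (X + h)). replace (X + h - X) with h in HH by ring.
    rewrite Rabs_right in HH by lra. specialize (HH ltac:(lra)). lra.
  - exists (X - h). split; [lra|]. specialize (HH (X - h)). replace (X - h - X) with (- h) in HH by ring.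
    rewrite Rabs_Ropp, Rabs_right in HH by lra. specialize (HH ltac:(lra)). lra.
Qed.

(** On the ray through the saddle the factor r - r0 splits off explicitly once the charges are
    replaced by their weights. *)
Lemma radial_at_saddle_angle r : 0 < r ->
  radial r X0 / r = (r - r0) * (
    q1 * ((r + r0) / r - (r + r0 - 2 * p1 * X0) * (r - p1 * X0) / ell p1 r X0) +
    q2 * ((r + r0) / r - (r + r0 - 2 * p2 * X0) * (r - p2 * X0) / ell p2 r X0) +
    q3 * ((r + r0) / r - (r + r0 - 2 * p3 * X0) * (r - p3 * X0) / ell p3 r X0)).
Proof.
  intros Hr. destruct (regular_interior r X0 Hr HX0) as (_ & _ & A1 & A2 & A3).
  pose proof l0_pos as L0. pose proof q_first_moment as HM.
  assert (HT : t0 = (q1 + q2 + q3) * r0 ^ 2). { rewrite saddle_radial. field. lra. }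
  assert (HC : forall c p, 0 < ell p r0 X0 -> c = c / ell p r0 X0 * (ell p r X0 - (r - r0) * (r + r0 - 2 * p * X0))).
  { intros c p H. replace (ell p r X0 - (r - r0) * (r + r0 - 2 * p * X0)) with (ell p r0 X0) by (unfold ell; ring). field; lra. }
  assert (HC1 := HC c1 p1 ltac:(lra)). assert (HC2 := HC c2 p2 ltac:(lra)). assert (HC3 := HC c3 p3 ltac:(lra)). clear HC.
  assert (GEN : forall k1 k2 k3 l1 l2 l3, l1 <> 0 -> l2 <> 0 -> l3 <> 0 -> k1 * p1 + k2 * p2 + k3 * p3 = 0 ->
    (r * (k1 * (l1 - (r - r0) * (r + r0 - 2 * p1 * X0)) * (r - p1 * X0) / l1
        + k2 * (l2 - (r - r0) * (r + r0 - 2 * p2 * X0)) * (r - p2 * X0) / l2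
        + k3 * (l3 - (r - r0) * (r + r0 - 2 * p3 * X0)) * (r - p3 * X0) / l3) - (k1 + k2 + k3) * r0 ^ 2) / r
    = (r - r0) * (
    k1 * ((r + r0) / r - (r + r0 - 2 * p1 * X0) * (r - p1 * X0) / l1) +
    k2 * ((r + r0) / r - (r + r0 - 2 * p2 * X0) * (r - p2 * X0) / l2) +
    k3 * ((r + r0) / r - (r + r0 - 2 * p3 * X0) * (r - p3 * X0) / l3))).
  { intros k1 k2 k3 l1 l2 l3 N1 N2 N3 H. apply Rminus_diag_uniq.
    transitivity (- X0 * (k1 * p1 + k2 * p2 + k3 * p3)); [|rewrite H; ring].
    field. repeat split; lra. }
  rewrite <- (GEN q1 q2 q3 (ell p1 r X0) (ell p2 r X0) (ell p3 r X0)) by lra.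
  unfold radial. rewrite <- HC1, <- HC2, <- HC3, <- HT. reflexivity.
Qed.

Lemma higher_near_saddle : exists d, 0 < d < r0 /\ forall r, 0 < Rabs (r - r0) <= d -> energy r0 X0 < energy r X0.
Proof.
  set (B := fun r => q1 * ((r + r0) / r - (r + r0 - 2 * p1 * X0) * (r - p1 * X0) / ell p1 r X0) +
    q2 * ((r + r0) / r - (r + r0 - 2 * p2 * X0) * (r - p2 * X0) / ell p2 r X0) +
    q3 * ((r + r0) / r - (r + r0 - 2 * p3 * X0) * (r - p3 * X0) / ell p3 r X0)).
  pose proof q_pos as (Q1 & Q2 & Q3). pose proof l0_pos as (L1 & L2 & L3).
  destruct (locally_pos B r0) as (d & Hd & HB).
  { apply (ex_derive_continuous (V := R_NormedModule)). unfold B, ell in *. auto_derive. repeat split; lra. }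
  (* At r = r0 each bracket equals 2 p^2 (1 - X0^2) / ell, so the saddle is a strict minimum along
     its ray. *)
  { assert (G : forall p, p <> 0 -> 0 < ell p r0 X0 -> 0 < (r0 + r0) / r0 - (r0 + r0 - 2 * p * X0) * (r0 - p * X0) / ell p r0 X0).
    { intros p Hpn Hl. replace ((r0 + r0) / r0 - (r0 + r0 - 2 * p * X0) * (r0 - p * X0) / ell p r0 X0)
        with (2 * (p ^ 2 * (1 - X0 ^ 2)) / ell p r0 X0) by (unfold ell in *; field; lra).
      apply Rdiv_lt_0_compat; [|exact Hl].
      assert (0 < p ^ 2) by (apply pow2_gt_0; exact Hpn). assert (0 < 1 - X0 ^ 2) by nra. nra. }
    pose proof (G p1 ltac:(lra) L1). pose proof (G p2 ltac:(lra) L2). pose proof (G p3 ltac:(lra) L3).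
    unfold B. repeat apply Rplus_lt_0_compat; apply Rmult_lt_0_compat; assumption. }
  set (d' := Rmin (d / 2) (r0 / 2)). assert (0 < d') by (apply Rmin_glb_lt; lra).
  assert (d' <= d / 2) by apply Rmin_l. assert (d' <= r0 / 2) by apply Rmin_r.
  exists d'. split; [lra|]. intros r Hr.
  assert (Hr' : Rabs (r - r0) <= d' /\ r <> r0). { split; [lra|]. intros ->. rewrite Rminus_diag, Rabs_R0 in Hr; lra. }
  destruct Hr' as [Hr' Hne].
  assert (Hrange : r0 - d' <= r <= r0 + d').
  { assert (- (r - r0) <= Rabs (r - r0)) by (rewrite <- Rabs_Ropp; apply RRle_abs). pose proof (RRle_abs (r - r0)). lra. }
  assert (Hder : forall x, r0 - d' <= x <= r0 + d' -> derivable_pt_lim (fun r => energy r X0) x (radial x X0 / x)).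
  { intros x Hx. apply is_derive_Reals, energy_derive_r, regular_interior; lra. }
  assert (Hsgn : forall x, r0 - d' <= x <= r0 + d' -> 0 < B x).
  { intros x Hx. apply HB. apply Rabs_def1; lra. }
  destruct (Rlt_le_dec r0 r).
  - destruct (MVT_cor2 (fun r => energy r X0) (fun r => radial r X0 / r) r0 r) as (c & E & Hcr); [lra|intros; apply Hder; lra|].
    rewrite radial_at_saddle_angle in E by lra. fold (B c) in E.
    assert (0 < (c - r0) * B c * (r - r0)). { specialize (Hsgn c ltac:(lra)). repeat apply Rmult_lt_0_compat; lra. }
    lra.
  - destruct (MVT_cor2 (fun r => energy r X0) (fun r => radial r X0 / r) r r0) as (c & E & Hcr); [lra|intros; apply Hder; lra|].
    rewrite radial_at_saddle_angle in E by lra. fold (B c) in E.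
    assert (0 < (r0 - c) * B c * (r0 - r)). { specialize (Hsgn c ltac:(lra)). repeat apply Rmult_lt_0_compat; lra. }
    lra.
Qed.

(** Here and below [(r, x)] are polar coordinates, and [X] stands for [cos x]. *)
Definition higher (a b r x : R) : Prop := a <= r <= b /\ 0 < x < PI /\ energy r0 X0 < energy r (cos x).

(** Concavity makes the superlevel sets on a circle intervals in [X], hence in the angle, since
    cosine is monotone there. *)
Lemma energy_between r X Y Z e : 0 < r -> -1 < X < 1 -> -1 < Y < 1 -> -1 < Z < 1 ->
  (X <= Y <= Z \/ Z <= Y <= X) -> e < energy r X -> e < energy r Z -> e < energy r Y.
Proof.
  intros Hr HX HY HZ H E1 E2.
  pose proof (energy_tangent r Y X (regular_interior _ _ Hr HY) (regular_interior _ _ Hr HX)).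
  pose proof (energy_tangent r Y Z (regular_interior _ _ Hr HY) (regular_interior _ _ Hr HZ)).
  set (w := r * angular r Y) in *.
  destruct (Rle_lt_dec 0 w); destruct H; nra.
Qed.

Lemma higher_arc a b r x x' : 0 < a -> higher a b r x -> higher a b r x' -> pconn (higher a b) r x r x'.
Proof.
  intros Ha (H1 & H2 & H3) (_ & H4 & H5). apply pconn_one. intros k Hk.
  replace (r + k * (r - r)) with r by ring.
  assert (Hm : (x <= x + k * (x' - x) <= x' \/ x' <= x + k * (x' - x) <= x)).
  { destruct (Rle_lt_dec x x'); [left|right]; nra. }
  assert (Hm' : 0 < x + k * (x' - x) < PI) by lra.
  split; [exact H1|]. split; [exact Hm'|].
  apply (energy_between r (cos x) _ (cos x')); try apply cos_open; try assumption; [lra|].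
  destruct Hm; [right|left]; split; apply cos_decr_1; lra.
Qed.

Lemma higher_exists r : 0 < r -> r <> r0 -> exists x, 0 < x < PI /\ energy r0 X0 < energy r (cos x).
Proof.
  intros Hr Hne. destruct (exists_higher r Hr Hne) as (X & HX & HE).
  exists (acos X). rewrite cos_acos by lra. split; [|exact HE]. apply acos_bound_lt. exact HX.
Qed.

(** Real induction along [r]: the slices of the region above the saddle level
    are intervals, so it suffices to move radially by small steps. *)
Lemma higher_connected a b xa : 0 < a -> a < b -> (r0 < a \/ b < r0) -> higher a b a xa ->
  exists xb, pconn (higher a b) a xa b xb.
Proof.
  intros Ha Hab Hr Hxa.
  assert (Hstep : forall r, a <= r <= b -> exists d x, 0 < d /\ 0 < x < PI /\
     forall r', Rabs (r' - r) < d -> energy r0 X0 < energy r' (cos x)).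
  { intros r Hr'. destruct (higher_exists r) as (x & Hx & HE); [lra|lra|].
    destruct (energy_gt_near_r r (cos x) _ (regular_interior r (cos x) ltac:(lra) (cos_open x Hx)) HE) as (d & Hd & H).
    exists d, x. split; [exact Hd|]. split; [exact Hx|]. intros r' Hr1. apply H, Hr1. }
  assert (Hrad : forall r r' x d, a <= r <= b -> a <= r' <= b -> 0 < x < PI -> Rabs (r' - r) < d ->
     (forall r', Rabs (r' - r) < d -> energy r0 X0 < energy r' (cos x)) -> pconn (higher a b) r x r' x /\ pconn (higher a b) r' x r x).
  { intros r r' x d H1 H2 Hx Hd H.
    assert (K : forall k, 0 <= k <= 1 -> higher a b (r + k * (r' - r)) x).
    { intros k Hk. split; [split; nra|]. split; [exact Hx|]. apply H.
      replace (r + k * (r' - r) - r) with (k * (r' - r)) by ring. rewrite Rabs_mult, (Rabs_right k) by lra.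
      pose proof (Rabs_pos (r' - r)). nra. }
    split; apply pconn_one; intros k Hk.
    - replace (x + k * (x - x)) with x by ring. apply K, Hk.
    - replace (x + k * (x - x)) with x by ring.
      replace (r' + k * (r - r')) with (r + (1 - k) * (r' - r)) by ring. apply K; lra. }
  set (P := fun s => 0 <= s <= b - a /\ forall r, a <= r <= a + s -> exists x, higher a b r x /\ pconn (higher a b) a xa r x).
  assert (P0 : P 0).
  { split; [lra|]. intros r Hr'. replace r with a by lra. exists xa. split; [exact Hxa|apply pconn_refl, Hxa]. }
  destruct (completeness P) as [s [Hub Hlub]].
  { exists (b - a). intros s [Hs _]; lra. }
  { exists 0; exact P0. }
  assert (Hs0 : 0 <= s) by (apply Hub, P0).
  assert (Hsb : s <= b - a). { apply Hlub. intros s' [Hs' _]; lra. }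
  assert (HPlt : forall r, a <= r < a + s -> exists x, higher a b r x /\ pconn (higher a b) a xa r x).
  { intros r Hr'. destruct (classic (exists s', P s' /\ r <= a + s')) as [(s' & [Hs' HP] & Hle)|Hn].
    - apply HP; lra.
    - exfalso. assert (s <= r - a); [|lra]. apply Hlub. intros s' Hs'.
      destruct (Rle_lt_dec s' (r - a)); [assumption|]. exfalso; apply Hn. exists s'. split; [exact Hs'|lra]. }
  destruct (Hstep (a + s)) as (d & x & Hd & Hx & HE); [lra|].
  assert (HPs : pconn (higher a b) a xa (a + s) x).
  { destruct (Req_dec_T s 0) as [E|Hne].
    - rewrite E, Rplus_0_r in *. apply higher_arc; trivial. split; [lra|]. split; [exact Hx|]. apply HE. rewrite Rminus_diag, Rabs_R0; exact Hd.
    - set (r := Rmax a (a + s - d / 2)). assert (a <= r < a + s) by (unfold r; split; [apply Rmax_l|apply Rmax_lub_lt; lra]).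
      assert (a + s - d / 2 <= r) by apply Rmax_r.
      destruct (HPlt r ltac:(lra)) as (y & Hy & Hconn).
      assert (Hdist : Rabs (r - (a + s)) < d) by (rewrite Rabs_left; lra).
      destruct (Hrad (a + s) r x d ltac:(lra) ltac:(lra) Hx Hdist HE) as [_ Hback].
      apply pconn_trans with r y; [exact Hconn|]. apply pconn_trans with r x; [|exact Hback].
      apply higher_arc; trivial. split; [lra|]. split; [exact Hx|]. apply HE, Hdist. }
  destruct (Req_dec_T s (b - a)) as [E|Hne].
  { exists x. replace (a + s) with b in HPs by lra. exact HPs. }
  exfalso. set (s' := Rmin (s + d / 2) (b - a)).
  assert (Hs' : s < s' <= b - a). { unfold s'; split; [apply Rmin_glb_lt; lra|apply Rmin_r]. }
  assert (Hs'd : s' <= s + d / 2) by apply Rmin_l.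
  assert (HP' : P s'); [|specialize (Hub s' HP'); lra].
  split; [lra|]. intros r Hr'. destruct (Rlt_le_dec r (a + s)); [apply HPlt; lra|].
  assert (Hdist : Rabs (r - (a + s)) < d) by (rewrite Rabs_right; lra).
  exists x. split. { split; [lra|]. split; [exact Hx|]. apply HE, Hdist. }
  destruct (Hrad (a + s) r x d ltac:(lra) ltac:(lra) Hx Hdist HE) as [Hfwd _].
  apply pconn_trans with (a + s) x; assumption.
Qed.

(** sum c_i = sum q_i |saddle - p_i|^2. The cross terms vanish with the first moment, leaving t0 +
    sum q_i p_i^2. *)
Lemma total_charge : t0 < c1 + c2 + c3.
Proof.
  pose proof q_pos as (Q1 & Q2 & Q3). pose proof l0_pos as L0. pose proof q_first_moment as HM.
  assert (HT : t0 = (q1 + q2 + q3) * r0 ^ 2). { rewrite saddle_radial. field. lra. }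
  assert (HC : forall c p, 0 < ell p r0 X0 -> c = c / ell p r0 X0 * (r0 ^ 2 + p ^ 2 - 2 * p * (r0 * X0))).
  { intros c p H. replace (r0 ^ 2 + p ^ 2 - 2 * p * (r0 * X0)) with (ell p r0 X0) by (unfold ell; ring). field; lra. }
  assert (HC1 := HC c1 p1 ltac:(lra)). assert (HC2 := HC c2 p2 ltac:(lra)). assert (HC3 := HC c3 p3 ltac:(lra)).
  rewrite HC1, HC2, HC3. rewrite HT. 
  replace (q1 * (r0 ^ 2 + p1 ^ 2 - 2 * p1 * (r0 * X0)) + q2 * (r0 ^ 2 + p2 ^ 2 - 2 * p2 * (r0 * X0)) + q3 * (r0 ^ 2 + p3 ^ 2 - 2 * p3 * (r0 * X0)))
    with ((q1 + q2 + q3) * r0 ^ 2 + (q1 * p1 ^ 2 + q2 * p2 ^ 2 + q3 * p3 ^ 2) - 2 * (r0 * X0) * (q1 * p1 + q2 * p2 + q3 * p3)) by ring.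
  rewrite HM.
  assert (0 < q1 * p1 ^ 2) by (apply Rmult_lt_0_compat; [lra|apply pow2_gt_0; lra]).
  assert (0 < q2 * p2 ^ 2) by (apply Rmult_lt_0_compat; [lra|apply pow2_gt_0; lra]).
  assert (0 < q3 * p3 ^ 2) by (apply Rmult_lt_0_compat; [lra|apply pow2_gt_0; lra]).
  lra.
Qed.

(** * The energy near infinity and near the origin *)

Lemma ell_ge p r X : -1 <= X <= 1 -> 0 < r -> (Rabs p - r) ^ 2 <= ell p r X.
Proof.
  intros HX Hr. unfold ell. rewrite <- (pow2_abs p).
  assert (p * X <= Rabs p). { pose proof (RRle_abs p). pose proof (RRle_abs (- p)) as H'. rewrite Rabs_Ropp in H'. pose proof (Rabs_pos p). destruct (Rle_lt_dec 0 X); nra. }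
  nra.
Qed.

Lemma energy_large : exists R0, forall r X, R0 < r -> -1 <= X <= 1 -> regular r X /\ energy r0 X0 < energy r X.
Proof.
  pose proof total_charge as HQ. set (P := - p1 + p3). set (K := (energy r0 X0 + (c1 + c2 + c3) * ln 2) / (c1 + c2 + c3 - t0)).
  exists (Rmax (2 * P) (exp K)). intros r X Hr HX.
  assert (H1 : 2 * P < r) by (eapply Rle_lt_trans; [apply Rmax_l|exact Hr]).
  assert (H2 : exp K < r) by (eapply Rle_lt_trans; [apply Rmax_r|exact Hr]).
  assert (HP : 0 < P) by (unfold P; lra). assert (Hr0' : 0 < r) by lra.
  assert (G : forall p, Rabs p <= P -> (r / 2) ^ 2 <= ell p r X).
  { intros p Hpp. pose proof (ell_ge p r X HX Hr0'). pose proof (Rabs_pos p).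
    apply Rle_trans with ((Rabs p - r) ^ 2); [|assumption]. nra. }
  assert (G1 := G p1 ltac:(unfold P; rewrite Rabs_left; lra)).
  assert (G2 := G p2 ltac:(unfold P; rewrite Rabs_left; lra)).
  assert (G3 := G p3 ltac:(unfold P; rewrite Rabs_right; lra)).
  assert (Hpos : 0 < (r / 2) ^ 2) by (apply pow_lt; lra).
  split; [repeat split; lra|].
  assert (LN : ln ((r / 2) ^ 2) = 2 * (ln r - ln 2)).
  { simpl. rewrite Rmult_1_r, ln_mult by lra. unfold Rdiv. rewrite ln_mult, ln_Rinv by lra. ring. }
  assert (L1 : ln ((r / 2) ^ 2) <= ln (ell p1 r X)) by (apply ln_le; assumption).
  assert (L2 : ln ((r / 2) ^ 2) <= ln (ell p2 r X)) by (apply ln_le; assumption).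
  assert (L3 : ln ((r / 2) ^ 2) <= ln (ell p3 r X)) by (apply ln_le; assumption).
  rewrite LN in L1, L2, L3.
  assert (HK : K < ln r). { rewrite <- (ln_exp K). apply ln_increasing; [apply exp_pos|exact H2]. }
  assert (HK' : energy r0 X0 + (c1 + c2 + c3) * ln 2 < (c1 + c2 + c3 - t0) * ln r).
  { replace (energy r0 X0 + (c1 + c2 + c3) * ln 2) with (K * (c1 + c2 + c3 - t0)) by (unfold K; field; lra).
    rewrite Rmult_comm. apply Rmult_lt_compat_l; lra. }
  assert (E : (c1 + c2 + c3) * (ln r - ln 2) - t0 * ln r <= energy r X) by (unfold energy; nra).
  lra.
Qed.

Lemma energy_small : exists R0, 0 < R0 /\ forall r X, 0 < r < R0 -> -1 <= X <= 1 -> regular r X /\ energy r0 X0 < energy r X.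
Proof.
  set (m := Rmin (- p2) p3). assert (Hm : 0 < m) by (apply Rmin_glb_lt; lra).
  assert (Hm1 : m <= - p2) by apply Rmin_l. assert (Hm2 : m <= p3) by apply Rmin_r.
  set (K := ((c1 + c2 + c3) * ln (m / 2) - energy r0 X0) / t0).
  exists (Rmin (m / 2) (exp K)). split; [apply Rmin_glb_lt; [lra|apply exp_pos]|]. intros r X [Hr0' Hr] HX.
  assert (H1 : r < m / 2) by (eapply Rlt_le_trans; [exact Hr|apply Rmin_l]).
  assert (H2 : r < exp K) by (eapply Rlt_le_trans; [exact Hr|apply Rmin_r]).
  assert (G : forall p, m <= Rabs p -> (m / 2) ^ 2 <= ell p r X).
  { intros p Hpp. pose proof (ell_ge p r X HX Hr0').
    apply Rle_trans with ((Rabs p - r) ^ 2); [|assumption]. apply pow_incr; lra. }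
  assert (G1 := G p1 ltac:(rewrite Rabs_left; lra)).
  assert (G2 := G p2 ltac:(rewrite Rabs_left; lra)).
  assert (G3 := G p3 ltac:(rewrite Rabs_right; lra)).
  assert (Hpos : 0 < (m / 2) ^ 2) by (apply pow_lt; lra).
  split; [repeat split; lra|].
  assert (LN : ln ((m / 2) ^ 2) = 2 * ln (m / 2)).
  { simpl. rewrite Rmult_1_r, ln_mult by lra. ring. }
  assert (L1 : ln ((m / 2) ^ 2) <= ln (ell p1 r X)) by (apply ln_le; assumption).
  assert (L2 : ln ((m / 2) ^ 2) <= ln (ell p2 r X)) by (apply ln_le; assumption).
  assert (L3 : ln ((m / 2) ^ 2) <= ln (ell p3 r X)) by (apply ln_le; assumption).
  rewrite LN in L1, L2, L3.
  assert (HK : ln r < K). { rewrite <- (ln_exp K). apply ln_increasing; assumption. }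
  assert (HK' : t0 * ln r < (c1 + c2 + c3) * ln (m / 2) - energy r0 X0).
  { replace ((c1 + c2 + c3) * ln (m / 2) - energy r0 X0) with (t0 * K) by (unfold K; field; lra).
    apply Rmult_lt_compat_l; lra. }
  assert (E : (c1 + c2 + c3) * ln (m / 2) - t0 * ln r <= energy r X) by (unfold energy; nra).
  lra.
Qed.

(** The last clause keeps a path in the open upper half plane except at its real end point (rc, xe),
    so that a curve and its mirror image meet the real line only there. *)
Definition above (rc xe r x : R) : Prop :=
  regular r (cos x) /\ energy r0 X0 < energy r (cos x) /\ (0 < x < PI \/ x = xe /\ r = rc).

Definition below (rc xe r x : R) : Prop :=
  regular r (cos x) /\ energy r (cos x) < energy r0 X0 /\ (0 < x < PI \/ x = xe /\ r = rc).

Lemma higher_above a b rc r x : 0 < a -> higher a b r x -> above rc PI r x.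
Proof.
  intros Ha (H1 & H2 & H3). split; [apply regular_interior; [lra|apply cos_open, H2]|]. auto.
Qed.

Variable x0 : R.
Hypothesis Hx0 : 0 < x0 < PI.
Hypothesis cos_x0 : cos x0 = X0.

Lemma closing_arc rc x : 0 < rc -> 0 < x < PI ->
  (forall X, -1 <= X <= 1 -> regular rc X /\ energy r0 X0 < energy rc X) -> pconn (above rc PI) rc x rc PI.
Proof.
  intros Hrc Hx H. apply pconn_one. intros k Hk. replace (rc + k * (rc - rc)) with rc by ring.
  destruct (H (cos (x + k * (PI - x)))) as [H1 H2]; [apply COS_bound|].
  split; [exact H1|]. split; [exact H2|].
  destruct (Req_dec_T k 1) as [->|]; [right; split; [ring|reflexivity]|left; nra].
Qed.

(** The superlevel set is followed to a circle lying entirely above the saddle level, along which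
    the path can turn to the negative axis. [higher_connected] runs towards larger radii, so the
    inner branch is built from a small circle outwards and then reversed. *)
Lemma ridge d : 0 < d < r0 -> (forall r, 0 < Rabs (r - r0) <= d -> energy r0 X0 < energy r X0) ->
  (forall B, exists R, B < R /\ pconn (above R PI) (r0 + d) x0 R PI) /\
  (forall B, 0 < B -> exists r, 0 < r < B /\ pconn (above r PI) (r0 - d) x0 r PI).
Proof.
  intros Hd Hnear. split.
  - intros B. destruct energy_large as [R0 HR0].
    set (R := Rmax (Rmax B R0) (r0 + d) + 1).
    assert (HB : B < R). { unfold R. pose proof (Rmax_l (Rmax B R0) (r0 + d)). pose proof (Rmax_l B R0). lra. }
    assert (HR : R0 < R). { unfold R. pose proof (Rmax_l (Rmax B R0) (r0 + d)). pose proof (Rmax_r B R0). lra. }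
    assert (Hd' : r0 + d < R). { unfold R. pose proof (Rmax_r (Rmax B R0) (r0 + d)). lra. }
    assert (Hst : higher (r0 + d) R (r0 + d) x0).
    { split; [lra|]. split; [exact Hx0|]. rewrite cos_x0. apply Hnear. rewrite Rabs_right; lra. }
    destruct (higher_connected (r0 + d) R x0) as [xb Hxb]; [lra|lra|lra|exact Hst|].
    assert (Hend : 0 < xb < PI).
    { assert (L : forall r x r' x', pconn (higher (r0 + d) R) r x r' x' -> 0 < x' < PI); [|exact (L _ _ _ _ Hxb)].
      intros r x r' x'. induction 1 as [r x (_ & H & _)|]; assumption. }
    exists R. split; [exact HB|].
    apply pconn_trans with R xb.
    + eapply pconn_imp; [|exact Hxb]. intros; eapply higher_above; [|eassumption]. lra.
    + apply closing_arc; [lra|exact Hend|]. intros; apply HR0; assumption.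
  - intros B HB. destruct energy_small as (R0 & HR0p & HR0).
    set (r := Rmin (Rmin B R0) (r0 - d) / 2).
    assert (Hmin : 0 < Rmin (Rmin B R0) (r0 - d)) by (repeat apply Rmin_glb_lt; lra).
    assert (Hr1 : r < B). { unfold r. pose proof (Rmin_l (Rmin B R0) (r0 - d)). pose proof (Rmin_l B R0). lra. }
    assert (Hr2 : r < R0). { unfold r. pose proof (Rmin_l (Rmin B R0) (r0 - d)). pose proof (Rmin_r B R0). lra. }
    assert (Hr3 : r < r0 - d). { unfold r. pose proof (Rmin_r (Rmin B R0) (r0 - d)). lra. }
    assert (Hr : 0 < r) by (unfold r; lra).
    set (xa := PI / 2). assert (Hxa : 0 < xa < PI) by (unfold xa; pose proof PI_RGT_0; lra).
    destruct (HR0 r (cos xa)) as [_ HE]; [lra|apply COS_bound|].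
    destruct (higher_connected r (r0 - d) xa) as [xb Hxb]; [lra|lra|lra| |].
    { split; [lra|]. split; [exact Hxa|exact HE]. }
    assert (Hend : higher r (r0 - d) (r0 - d) xb).
    { assert (L : forall r1 x r' x', pconn (higher r (r0 - d)) r1 x r' x' -> higher r (r0 - d) r' x'); [|exact (L _ _ _ _ Hxb)].
      intros r1 x r' x'. induction 1 as [r1 x H|]; assumption. }
    assert (Hst : higher r (r0 - d) (r0 - d) x0).
    { split; [lra|]. split; [exact Hx0|]. rewrite cos_x0. apply Hnear. rewrite Rabs_left; lra. }
    exists r. split; [lra|].
    apply pconn_trans with r xa; [|apply closing_arc; [lra|exact Hxa|intros; apply HR0; [lra|assumption]]].
    apply pconn_trans with (r0 - d) xb.
    + eapply pconn_imp; [|apply (higher_arc r (r0 - d) (r0 - d) x0 xb); trivial]. intros; eapply higher_above; [|eassumption]. lra.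
    + apply pconn_sym. eapply pconn_imp; [|exact Hxb]. intros; eapply higher_above; [|eassumption]. lra.
Qed.

(** For z between [p2] and [p3] each of the three terms of [T] is negative. *)
Lemma radial_neg_axis e r : (e = 1 /\ r < p3 \/ e = -1 /\ r < - p2) -> regular r e -> radial r e < 0.
Proof.
  intros He HR. pose proof q_pos as (Q1 & Q2 & Q3). pose proof HR as (Hr & _).
  assert (He' : e = 1 \/ e = -1) by (destruct He as [[]|[]]; auto).
  destruct (real_axis_identities e r He' HR) as (HD & HV & N1 & N2 & N3 & -> & _).
  assert (Hz : p2 < e * r < p3) by (destruct He as [[-> ?]|[-> ?]]; lra).
  assert (T1 : q1 * p1 / (e * r - p1) < 0). { apply Rdiv_neg_pos; [apply Rmult_pos_neg|]; lra. }
  assert (T2 : q2 * p2 / (e * r - p2) < 0). { apply Rdiv_neg_pos; [apply Rmult_pos_neg|]; lra. }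
  assert (T3 : q3 * p3 / (e * r - p3) < 0). { apply Rdiv_pos_neg; [apply Rmult_lt_0_compat|]; lra. }
  apply Rmult_pos_neg; [exact HD|lra].
Qed.

(** The vanishing first moment gives T = (1 / z) sum q_i p_i^2 / (z - p_i); beyond all charges on
    its side, every 1 / (z - p_i) has the sign of z. *)
Lemma radial_pos_axis e r : (e = 1 /\ p3 < r \/ e = -1 /\ - p1 < r) -> regular r e -> 0 < radial r e.
Proof.
  intros He HR. pose proof q_pos as (Q1 & Q2 & Q3). pose proof HR as (Hr & _). pose proof q_first_moment as HM.
  assert (He' : e = 1 \/ e = -1) by (destruct He as [[]|[]]; auto).
  destruct (real_axis_identities e r He' HR) as (HD & HV & N1 & N2 & N3 & -> & _).
  set (z := e * r) in *.
  assert (Hz0 : z <> 0). { unfold z; destruct He' as [-> | ->]; lra. }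
  assert (E : q1 * p1 / (z - p1) + q2 * p2 / (z - p2) + q3 * p3 / (z - p3)
      = / z * (q1 * p1 ^ 2 / (z - p1) + q2 * p2 ^ 2 / (z - p2) + q3 * p3 ^ 2 / (z - p3))).
  { assert (GEN : forall k1 k2 k3, k1 * p1 + k2 * p2 + k3 * p3 = 0 -> k1 * p1 / (z - p1) + k2 * p2 / (z - p2) + k3 * p3 / (z - p3)
      = / z * (k1 * p1 ^ 2 / (z - p1) + k2 * p2 ^ 2 / (z - p2) + k3 * p3 ^ 2 / (z - p3))).
    { intros k1 k2 k3 H. apply Rminus_diag_uniq. transitivity (/ z * (k1 * p1 + k2 * p2 + k3 * p3)); [|rewrite H; ring].
      field. repeat split; assumption. }
    apply GEN, HM. }
  rewrite E. apply Rmult_lt_0_compat; [exact HD|].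
  assert (S1 : 0 < q1 * p1 ^ 2) by (apply Rmult_lt_0_compat; [lra|apply pow2_gt_0; lra]).
  assert (S2 : 0 < q2 * p2 ^ 2) by (apply Rmult_lt_0_compat; [lra|apply pow2_gt_0; lra]).
  assert (S3 : 0 < q3 * p3 ^ 2) by (apply Rmult_lt_0_compat; [lra|apply pow2_gt_0; lra]).
  destruct He as [[He Hr']|[He Hr']].
  - assert (Hz : p3 < z) by (unfold z; rewrite He; lra).
    apply Rmult_lt_0_compat; [apply Rinv_0_lt_compat; lra|].
    repeat apply Rplus_lt_0_compat; apply Rdiv_lt_0_compat; lra.
  - assert (Hz : z < p1) by (unfold z; rewrite He; lra).
    assert (q1 * p1 ^ 2 / (z - p1) < 0) by (apply Rdiv_pos_neg; lra).
    assert (q2 * p2 ^ 2 / (z - p2) < 0) by (apply Rdiv_pos_neg; lra).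
    assert (q3 * p3 ^ 2 / (z - p3) < 0) by (apply Rdiv_pos_neg; lra).
    assert (/ z < 0) by (apply Rinv_lt_0_compat; lra). apply Rmult_neg_neg; lra.
Qed.

(** A path may touch the axis only at its end, so a descent along the axis is carried out at a small
    angle. The tangent bound, with a constant uniform over the compact range of radii, shows that it
    stays low. *)
Lemma near_axis e lo hi Es : (e = 1 \/ e = -1) -> lo <= hi -> Es < energy r0 X0 ->
  (forall r, lo <= r <= hi -> regular r e /\ energy r e <= Es) ->
  exists h, 0 < h /\ forall r X, lo <= r <= hi -> -1 <= X <= 1 -> Rabs (X - e) < h -> regular r X -> energy r X < energy r0 X0.
Proof.
  intros He Hlh HEs H.
  destruct (continuity_ab_maj (fun r => Rabs (r * angular r e)) lo hi Hlh) as (m & Hm & _).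
  { intros r Hr. destruct (H r Hr) as ((Hr0' & _ & A1 & A2 & A3) & _). apply continuity_pt_filterlim.
    apply (continuous_comp (fun r => r * angular r e) Rabs); [|apply continuous_Rabs].
    apply (ex_derive_continuous (V := R_NormedModule)). unfold angular, ell in *. auto_derive. repeat split; lra. }
  set (M := Rabs (m * angular m e)) in *. assert (HM : 0 <= M) by apply Rabs_pos.
  exists ((energy r0 X0 - Es) / (M + 1)). split; [apply Rdiv_lt_0_compat; lra|].
  intros r X Hr HX Hclose HR. destruct (H r Hr) as [HRe HE].
  pose proof (energy_tangent r e X HRe HR) as HT. specialize (Hm r Hr).
  assert (- (r * angular r e * (X - e)) <= M * Rabs (X - e)).
  { apply Rle_trans with (Rabs (r * angular r e * (X - e))); [rewrite <- Rabs_Ropp; apply RRle_abs|].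
    rewrite Rabs_mult. apply Rmult_le_compat_r; [apply Rabs_pos|exact Hm]. }
  assert (M * Rabs (X - e) < energy r0 X0 - Es); [|lra].
  assert (K : Rabs (X - e) * (M + 1) < energy r0 X0 - Es).
  { apply Rmult_lt_compat_r with (r := M + 1) in Hclose; [|lra].
    replace ((energy r0 X0 - Es) / (M + 1) * (M + 1)) with (energy r0 X0 - Es) in Hclose by (field; lra). exact Hclose. }
  pose proof (Rabs_pos (X - e)). nra.
Qed.

(** * Valleys from the saddle to the real axis *)

Lemma avoid_list (l : list R) a b : a < b -> exists x, a < x < b /\ ~ In x l.
Proof.
  revert a b; induction l as [|y l IH]; intros a b Hab.
  - exists ((a + b) / 2). split; [lra|intros []].
  - destruct (Rle_lt_dec y ((a + b) / 2)) as [H|H].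
    + destruct (IH ((a + b) / 2) b) as (x & Hx & Hn); [lra|]. exists x. split; [lra|]. intros [E|Hin]; [lra|auto].
    + destruct (IH a ((a + b) / 2)) as (x & Hx & Hn); [lra|]. exists x. split; [lra|]. intros [E|Hin]; [lra|auto].
Qed.

Lemma convex_between a b k : 0 <= k <= 1 -> a <= a + k * (b - a) <= b \/ b <= a + k * (b - a) <= a.
Proof. intros Hk. destruct (Rle_lt_dec a b); [left|right]; split; nra. Qed.

Lemma convex_inside a b k : 0 < a < PI -> 0 <= b <= PI -> 0 <= k < 1 -> 0 < a + k * (b - a) < PI.
Proof.
  intros Ha Hb Hk. assert (0 < (1 - k) * a) by (apply Rmult_lt_0_compat; lra).
  assert (0 < (1 - k) * (PI - a)) by (apply Rmult_lt_0_compat; lra). split; nra.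
Qed.

(** By concavity, an energy that has fallen between [X0] and [X1] cannot rise again beyond [X1]. *)
Lemma energy_beyond r X1 Y : 0 < r -> -1 < X1 < 1 -> energy r X1 < energy r X0 -> regular r Y ->
  (X0 < X1 <= Y \/ Y <= X1 < X0) -> energy r Y <= energy r X1.
Proof.
  intros Hr HX1 HE HY H.
  pose proof (energy_tangent r X1 Y (regular_interior _ _ Hr HX1) HY).
  pose proof (energy_tangent r X1 X0 (regular_interior _ _ Hr HX1) (regular_interior _ _ Hr HX0)).
  set (w := r * angular r X1) in *. destruct H; nra.
Qed.

Lemma energy_lt_near_r r X e : regular r X -> energy r X < e ->
  exists d, 0 < d /\ forall r', Rabs (r' - r) < d -> energy r' X < e.
Proof.
  intros HR He. destruct (locally_pos (fun r => e - energy r X) r) as (d & Hd & H); [|lra|].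
  - apply (continuous_minus (V := R_NormedModule)); [apply continuous_const|].
    apply (ex_derive_continuous (V := R_NormedModule)). eexists; apply energy_derive_r, HR.
  - exists d. split; [exact Hd|]. intros r' Hr'. specialize (H r' Hr'). lra.
Qed.

Lemma regular_axis e r : (e = 1 \/ e = -1) -> 0 < r -> r <> p3 -> r <> - p2 -> r <> - p1 -> regular r e.
Proof.
  intros He Hr N3 N2 N1.
  assert (G : forall p, r <> e * p -> 0 < ell p r e).
  { intros p H. unfold ell. replace (r ^ 2 + p ^ 2 - 2 * p * r * e) with ((r - e * p) ^ 2 + (1 - e * e) * p ^ 2) by ring.
    replace (1 - e * e) with 0 by (destruct He as [-> | ->]; ring).
    rewrite Rmult_0_l, Rplus_0_r. apply pow2_gt_0; lra. }
  split; [exact Hr|]. split; [destruct He; lra|].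
  repeat split; apply G; destruct He as [-> | ->]; lra.
Qed.

(** The curve leaves the circle [r = r0] just after the saddle, in order to
    choose where it meets the real axis; it then goes along the axis if needed. *)
Lemma valley e xe klo khi l : (e = 1 /\ xe = 0 \/ e = -1 /\ xe = PI) ->
  0 <= klo -> (e = 1 -> klo < p3 < khi) -> (e = -1 -> klo < - p2 /\ - p1 < khi) ->
  exists x1 rc, 0 < x1 < PI /\ x1 <> x0 /\
    (forall k, 0 < k <= 1 -> 0 < x0 + k * (x1 - x0) < PI /\ energy r0 (cos (x0 + k * (x1 - x0))) < energy r0 X0) /\
    klo < rc < khi /\ ~ In rc l /\ pconn (below rc xe) r0 x1 rc xe.
Proof.
  intros He Hklo Hk1 Hk2. pose proof PI_RGT_0 as HPI.
  (* Stopping halfway keeps the first piece strictly off the real axis. *)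
  set (x1 := (x0 + xe) / 2).
  assert (Hxe : 0 <= xe <= PI) by (destruct He as [[_ ->]|[_ ->]]; lra).
  assert (Hcxe : cos xe = e) by (destruct He as [[-> ->]|[-> ->]]; [apply cos_0|apply cos_PI]).
  assert (He' : e = 1 \/ e = -1) by (destruct He as [[]|[]]; auto).
  assert (Hx1 : 0 < x1 < PI) by (unfold x1; lra).
  assert (Hx1' : x1 <> x0) by (unfold x1; destruct He as [[_ ->]|[_ ->]]; lra).
  assert (Hfirst : forall k, 0 < k <= 1 -> 0 < x0 + k * (x1 - x0) < PI /\ energy r0 (cos (x0 + k * (x1 - x0))) < energy r0 X0).
  { intros k Hk. assert (Hr : 0 < x0 + k * (x1 - x0) < PI) by (destruct (convex_between x0 x1 k ltac:(lra)); lra). split; [exact Hr|].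
    apply energy_tangent_strict; [apply COS_bound| |apply regular_interior; [exact Hr0|apply cos_open, Hr]].
    rewrite <- cos_x0. intros E. apply cos_inj in E; [|lra|lra].
    assert (N : k * (x1 - x0) <> 0) by (apply Rmult_integral_contrapositive_currified; lra). lra. }
  set (X1 := cos x1).
  assert (HX1 : -1 < X1 < 1) by (apply cos_open, Hx1).
  assert (HE1 : energy r0 X1 < energy r0 X0).
  { destruct (Hfirst 1 ltac:(lra)) as [_ H]. replace (x0 + 1 * (x1 - x0)) with x1 in H by ring. exact H. }
  assert (Hside : forall x, (x1 <= x <= xe \/ xe <= x <= x1) -> X0 < X1 <= cos x \/ cos x <= X1 < X0).
  { intros x Hx. rewrite <- cos_x0. unfold X1. destruct He as [[_ Exe]|[_ Exe]].
    - left. assert (x <= x1 < x0) by (unfold x1 in *; lra). split; [apply cos_decreasing_1; lra|].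
      destruct (Req_dec_T x x1) as [->|]; [lra|]. apply Rlt_le, cos_decreasing_1; lra.
    - right. assert (x0 < x1 <= x) by (unfold x1 in *; lra). split; [|apply cos_decreasing_1; lra].
      destruct (Req_dec_T x x1) as [->|]; [lra|]. apply Rlt_le, cos_decreasing_1; lra. }
  (* At nearby radii the energy at [X1] stays below this level and at [X0] above it, so the energy
     still falls beyond [X1] on the new circle. *)
  set (mid := (energy r0 X1 + energy r0 X0) / 2).
  destruct (energy_lt_near_r r0 X1 mid (regular_interior _ _ Hr0 HX1)) as (d1 & Hd1 & N1); [unfold mid; lra|].
  destruct (energy_gt_near_r r0 X0 mid (regular_interior _ _ Hr0 HX0)) as (d2 & Hd2 & N2); [unfold mid; lra|].
  destruct (avoid_list (p3 :: - p2 :: - p1 :: l) r0 (r0 + Rmin d1 d2)) as (r' & Hr' & Hav).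
  { pose proof (Rmin_glb_lt _ _ _ Hd1 Hd2). lra. }
  assert (Hd1' : r' - r0 < d1) by (pose proof (Rmin_l d1 d2); lra).
  assert (Hd2' : r' - r0 < d2) by (pose proof (Rmin_r d1 d2); lra).
  assert (HE1' : energy r' X1 < energy r' X0).
  { destruct (N2 r') as [_ H]; [rewrite Rabs_right; lra|]. specialize (N1 r'). rewrite Rabs_right in N1 by lra. specialize (N1 Hd1'). lra. }
  assert (Hmid : mid < energy r0 X0) by (unfold mid; lra).
  assert (Hr'e : regular r' e).
  { apply regular_axis; [exact He'|lra|..]; intros E; apply Hav; simpl; auto. }
  assert (Hr'l : ~ In r' l). { intros H; apply Hav; simpl; auto. }
  assert (Arc : forall x, (x1 <= x <= xe \/ xe <= x <= x1) -> regular r' (cos x) /\ energy r' (cos x) < mid).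
  { intros x Hx. assert (R : regular r' (cos x)).
    { destruct (Req_dec_T x xe) as [->|Hn]; [rewrite Hcxe; exact Hr'e|].
      apply regular_interior; [lra|]. apply cos_open. destruct He as [[_ Exe]|[_ Exe]]; lra. }
    split; [exact R|]. apply Rle_lt_trans with (energy r' X1).
    - apply energy_beyond; trivial; [lra|apply Hside, Hx].
    - apply N1. rewrite Rabs_right; lra. }
  assert (Conn0 : forall rc, pconn (below rc xe) r0 x1 r' x1).
  { intros rc. apply pconn_one. intros k Hk. replace (x1 + k * (x1 - x1)) with x1 by ring.
    assert (Hk' : 0 <= k * (r' - r0) <= r' - r0) by (destruct (convex_between 0 (r' - r0) k Hk); lra).
    assert (0 < r0 + k * (r' - r0)) by lra.
    split; [apply regular_interior; [assumption|exact HX1]|]. split; [|left; exact Hx1].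
    apply Rlt_trans with mid; [|exact Hmid]. apply N1. replace (r0 + k * (r' - r0) - r0) with (k * (r' - r0)) by ring.
    rewrite Rabs_right; lra. }
  assert (HEe : energy r' e < mid). { destruct (Arc xe) as [_ H]; [destruct He as [[_ Exe]|[_ Exe]]; unfold x1 in *; lra|]. rewrite Hcxe in H; exact H. }
  destruct (classic (klo < r' < khi)) as [Hin|Hout].
  { exists x1, r'. repeat (split; trivial).
    apply pconn_trans with r' x1; [apply Conn0|]. apply pconn_one. intros k Hk.
    replace (r' + k * (r' - r')) with r' by ring.
    assert (Hx : x1 <= x1 + k * (xe - x1) <= xe \/ xe <= x1 + k * (xe - x1) <= x1).
    { apply convex_between, Hk. }
    destruct (Arc _ Hx) as [R E]. split; [exact R|]. split; [lra|].
    destruct (Req_dec_T k 1) as [->|]; [right; split; [ring|reflexivity]|left; apply convex_inside; lra]. }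
  (* If the circle meets the axis outside the window, the energy decreases along the axis towards
     the nearest charge in the window. The end point is chosen before that charge and inside the
     window. *)
  assert (Detour : exists rc, klo < rc < khi /\ ~ In rc (p3 :: - p2 :: - p1 :: l) /\
     forall r, Rmin r' rc <= r <= Rmax r' rc -> regular r e /\ energy r e <= mid).
  { assert (Hder : forall r, regular r e -> derivable_pt_lim (fun r => energy r e) r (radial r e / r)).
    { intros r HR. apply is_derive_Reals, energy_derive_r, HR. }
    destruct (Rle_lt_dec r' klo) as [Hlow|Hhigh].
    - set (a := match Rlt_dec e 0 with left _ => - p2 | right _ => p3 end).
      assert (Ha : klo < a < khi /\ (e = 1 /\ a = p3 \/ e = -1 /\ a = - p2)).
      { unfold a. destruct He as [[-> _]|[-> _]]; destruct Rlt_dec; try (exfalso; lra).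
        - specialize (Hk1 eq_refl). split; [lra|left; auto].
        - specialize (Hk2 eq_refl). split; [lra|right; auto]. }
      destruct Ha as [Ha Hae].
      destruct (avoid_list (p3 :: - p2 :: - p1 :: l) klo a) as (rc & Hrc & Hrcl); [lra|].
      exists rc. split; [lra|]. split; [exact Hrcl|].
      rewrite Rmin_left, Rmax_right by lra.
      assert (Hreg : forall r, r' <= r <= rc -> regular r e).
      { intros r Hr. pose proof Hr'e as (_ & _ & _).
        split; [lra|]. split; [destruct He'; lra|].
        assert (G : forall p, r <> e * p -> 0 < ell p r e).
        { intros p H. unfold ell. replace (r ^ 2 + p ^ 2 - 2 * p * r * e) with ((r - e * p) ^ 2 + (1 - e * e) * p ^ 2) by ring.
          replace (1 - e * e) with 0 by (destruct He' as [-> | ->]; ring).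
          rewrite Rmult_0_l, Rplus_0_r. apply pow2_gt_0; lra. }
        repeat split; apply G; destruct Hae as [[-> ?]|[-> ?]]; lra. }
      intros r Hr. split; [apply Hreg, Hr|].
      destruct (Req_dec_T r r') as [->|Hne]; [lra|].
      destruct (MVT_cor2 (fun r => energy r e) (fun r => radial r e / r) r' r) as (c & E & Hc'); [lra|intros; apply Hder, Hreg; lra|].
      assert (radial c e < 0). { apply radial_neg_axis; [destruct Hae as [[-> ?]|[-> ?]]; [left|right]; lra|apply Hreg; lra]. }
      assert (radial c e / c < 0) by (apply Rdiv_neg_pos; lra).
      assert (0 <= (- (radial c e / c)) * (r - r')). { apply Rmult_le_pos. lra. lra. } lra.
    - assert (Hge : khi <= r') by (destruct (Rle_lt_dec khi r'); [assumption|exfalso; apply Hout; lra]).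
      set (b := match Rlt_dec e 0 with left _ => - p1 | right _ => p3 end).
      assert (Hb : klo < b < khi /\ 0 < b /\ (e = 1 /\ b = p3 \/ e = -1 /\ b = - p1)).
      { unfold b. destruct He as [[-> _]|[-> _]]; destruct Rlt_dec; try (exfalso; lra).
        - specialize (Hk1 eq_refl). split; [lra|]. split; [lra|left; auto].
        - specialize (Hk2 eq_refl). split; [lra|]. split; [lra|right; auto]. }
      destruct Hb as (Hb & Hb0 & Hbe).
      destruct (avoid_list (p3 :: - p2 :: - p1 :: l) b khi) as (rc & Hrc & Hrcl); [lra|].
      exists rc. split; [lra|]. split; [exact Hrcl|].
      rewrite Rmin_right, Rmax_left by lra.
      assert (Hreg : forall r, rc <= r <= r' -> regular r e).
      { intros r Hr. split; [lra|]. split; [destruct He'; lra|].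
        assert (G : forall p, r <> e * p -> 0 < ell p r e).
        { intros p H. unfold ell. replace (r ^ 2 + p ^ 2 - 2 * p * r * e) with ((r - e * p) ^ 2 + (1 - e * e) * p ^ 2) by ring.
          replace (1 - e * e) with 0 by (destruct He' as [-> | ->]; ring).
          rewrite Rmult_0_l, Rplus_0_r. apply pow2_gt_0; lra. }
        repeat split; apply G; destruct Hbe as [[-> ?]|[-> ?]]; lra. }
      intros r Hr. split; [apply Hreg, Hr|].
      destruct (Req_dec_T r r') as [->|Hne]; [lra|].
      destruct (MVT_cor2 (fun r => energy r e) (fun r => radial r e / r) r r') as (c & E & Hc'); [lra|intros; apply Hder, Hreg; lra|].
      assert (0 < radial c e). { apply radial_pos_axis; [destruct Hbe as [[-> ?]|[-> ?]]; [left|right]; lra|apply Hreg; lra]. }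
      assert (0 < radial c e / c) by (apply Rdiv_lt_0_compat; lra).
      assert (0 <= radial c e / c * (r' - r)) by (apply Rmult_le_pos; lra). lra. }
  destruct Detour as (rc & Hrc & Hrcl & Haxis).
  assert (Hrcl' : ~ In rc l) by (intros H; apply Hrcl; simpl; auto).
  assert (Hrc0 : 0 < rc) by lra.
  assert (Hrc_e : regular rc e).
  { apply regular_axis; [exact He'|lra|..]; intros E; apply Hrcl; simpl; auto. }
  assert (Hlh : Rmin r' rc <= Rmax r' rc) by (eapply Rle_trans; [apply Rmin_l|apply Rmax_l]).
  destruct (near_axis e (Rmin r' rc) (Rmax r' rc) mid He' Hlh Hmid Haxis) as (h & Hh & Hnear).
  (* The angle at which the radial part of the detour runs: close enough to the axis for
     [near_axis], and positive distance away from it. *)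
  assert (Hx2 : exists x2, 0 < x2 < PI /\ (x1 <= x2 < xe \/ xe < x2 <= x1) /\
     forall x, (x2 <= x <= xe \/ xe <= x <= x2) -> Rabs (cos x - e) < h).
  { assert (Hcc : continuity_pt cos xe) by apply continuity_cos.
    destruct (Hcc h Hh) as (d & Hd & Hcd). simpl in Hcd. unfold R_dist in Hcd.
    set (s := Rmin (d / 2) (Rabs (x1 - xe))).
    assert (Hne : x1 - xe <> 0) by (destruct He as [[_ Exe]|[_ Exe]]; lra).
    assert (Hs : 0 < s) by (apply Rmin_glb_lt; [lra|apply Rabs_pos_lt, Hne]).
    assert (Hs1 : s <= d / 2) by apply Rmin_l. assert (Hs2 : s <= Rabs (x1 - xe)) by apply Rmin_r.
    assert (Hclose : forall x, Rabs (x - xe) <= s -> Rabs (cos x - e) < h).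
    { intros x Hx. destruct (Req_dec_T x xe) as [->|Hn]; [rewrite Hcxe, Rminus_diag, Rabs_R0; exact Hh|].
      rewrite <- Hcxe. apply Hcd. split; [split; [exact I|auto]|lra]. }
    destruct (Rlt_le_dec xe x1) as [Hlt|Hle].
    - rewrite Rabs_right in Hs2 by lra. exists (xe + s). split; [lra|]. split; [right; lra|].
      intros x Hx. apply Hclose. rewrite Rabs_right; lra.
    - rewrite Rabs_left in Hs2 by lra. exists (xe - s). split; [lra|]. split; [left; lra|].
      intros x Hx. apply Hclose. rewrite Rabs_left1; lra. }
  destruct Hx2 as (x2 & Hx2 & Hx2b & Hx2c).
  exists x1, rc. repeat (split; trivial).
  apply pconn_trans with r' x1; [apply Conn0|].
  apply pconn_trans with r' x2.
  { apply pconn_one. intros k Hk. replace (r' + k * (r' - r')) with r' by ring.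
    assert (Hx : x1 <= x1 + k * (x2 - x1) <= xe \/ xe <= x1 + k * (x2 - x1) <= x1).
    { destruct (convex_between x1 x2 k Hk), Hx2b; lra. }
    destruct (Arc _ Hx) as [R E]. split; [exact R|]. split; [lra|]. left. destruct (convex_between x1 x2 k Hk); lra. }
  apply pconn_trans with rc x2.
  { apply pconn_one. intros k Hk. replace (x2 + k * (x2 - x2)) with x2 by ring.
    assert (Hr : Rmin r' rc <= r' + k * (rc - r') <= Rmax r' rc).
    { destruct (convex_between r' rc k Hk) as [Hcb|Hcb]; [rewrite Rmin_left, Rmax_right|rewrite Rmin_right, Rmax_left]; lra. }
    assert (R : regular (r' + k * (rc - r')) (cos x2)).
    { apply regular_interior; [|apply cos_open, Hx2]. destruct (Haxis _ Hr) as [(H & _) _]. exact H. }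
    split; [exact R|]. split; [|left; exact Hx2].
    apply Hnear; trivial; [apply COS_bound|]. apply Hx2c. destruct Hx2b; [left|right]; lra. }
  apply pconn_one. intros k Hk. replace (rc + k * (rc - rc)) with rc by ring.
  assert (Hx : x2 <= x2 + k * (xe - x2) <= xe \/ xe <= x2 + k * (xe - x2) <= x2).
  { destruct (convex_between x2 xe k Hk), Hx2b; lra. }
  assert (R : regular rc (cos (x2 + k * (xe - x2)))).
  { destruct (Req_dec_T (x2 + k * (xe - x2)) xe) as [->|Hn]; [rewrite Hcxe; exact Hrc_e|].
    apply regular_interior; [exact Hrc0|]. apply cos_open. destruct He as [[_ Exe]|[_ Exe]]; lra. }
  split; [exact R|]. split; [|destruct (Req_dec_T k 1) as [->|]; [right; split; [ring|reflexivity]|left; apply convex_inside; lra]].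
  apply Hnear; trivial; [|apply COS_bound|apply Hx2c, Hx].
  split; [apply Rmin_r|apply Rmax_r].
Qed.
End Saddle.

(** * Moebius images of polar paths *)

(** Reparametrization with zero speed at both ends. Segments can then be concatenated at corners,
    and the slow start at the saddle compensates the pole of 1 / (u - v). *)
Definition smooth (t : R) : R := sin (PI / 2 * t) ^ 2.
Definition dsmooth (t : R) : R := PI * sin (PI / 2 * t) * cos (PI / 2 * t).

Lemma smooth_range t : 0 <= smooth t <= 1.
Proof.
  unfold smooth. split; [apply pow2_ge_0|].
  pose proof (sin2_cos2 (PI / 2 * t)). unfold Rsqr in H. pose proof (pow2_ge_0 (cos (PI / 2 * t))). nra.
Qed.

Lemma smooth_0 : smooth 0 = 0.
Proof. unfold smooth. rewrite Rmult_0_r, sin_0. ring. Qed.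

Lemma smooth_1 : smooth 1 = 1.
Proof. unfold smooth. rewrite Rmult_1_r, sin_PI2. ring. Qed.

Lemma smooth_pos t : 0 < t <= 1 -> 0 < smooth t.
Proof.
  intros Ht. unfold smooth. apply pow_lt. pose proof PI_RGT_0. apply sin_gt_0; nra.
Qed.

Lemma smooth_derive t : is_derive smooth t (dsmooth t).
Proof. unfold smooth, dsmooth. auto_derive; [trivial|]. simpl. field. Qed.

Lemma dsmooth_continuous t : continuous dsmooth t.
Proof.
  apply (ex_derive_continuous (V := R_NormedModule)). unfold dsmooth. auto_derive. trivial.
Qed.

(** The speed vanishes at the end points like the square root of the distance. *)
Lemma dsmooth_bound t : dsmooth t ^ 2 <= PI ^ 2 * smooth t.
Proof.
  unfold dsmooth, smooth. pose proof (sin2_cos2 (PI / 2 * t)). unfold Rsqr in H.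
  set (s := sin (PI / 2 * t)) in *. set (c := cos (PI / 2 * t)) in *.
  replace ((PI * s * c) ^ 2) with (PI ^ 2 * (s ^ 2 * c ^ 2)) by ring.
  apply Rmult_le_compat_l; [apply pow2_ge_0|]. assert (0 <= s ^ 2) by apply pow2_ge_0. nra.
Qed.

Definition polar (r x : R) : C := (r * cos x, r * sin x).

(** Inverse of zeta = (u - P0) / (u - Pinf). The value zeta = 1 corresponds to u = infinity and has
    to be avoided by every path. *)
Definition moebius_inv (P0 Pinf : R) (zeta : C) : C :=
  (RtoC Pinf + RtoC (Pinf - P0) * / (zeta - 1))%C.

Section PolarPath.
Variables P0 Pinf r x r' x' : R.

Definition pseg (t : R) : C := polar (r + smooth t * (r' - r)) (x + smooth t * (x' - x)).

Definition dpseg (t : R) : C :=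
  let R := r + smooth t * (r' - r) in let X := x + smooth t * (x' - x) in
  (dsmooth t * ((r' - r) * cos X - R * (x' - x) * sin X),
   dsmooth t * ((r' - r) * sin X + R * (x' - x) * cos X)).

Lemma pseg_derive t : Cderive pseg t (dpseg t).
Proof.
  assert (H := smooth_derive t).
  assert (HR : is_derive (fun t => r + smooth t * (r' - r)) t (dsmooth t * (r' - r))).
  { evar_last. { apply (is_derive_plus (V := R_NormedModule)); [apply (is_derive_const (V := R_NormedModule))|].
      apply (is_derive_mult smooth); [exact H|apply (is_derive_const (V := R_NormedModule))|intros; apply Rmult_comm]. }
    unfold plus, mult, zero; simpl. ring. }
  assert (HX : is_derive (fun t => x + smooth t * (x' - x)) t (dsmooth t * (x' - x))).
  { evar_last. { apply (is_derive_plus (V := R_NormedModule)); [apply (is_derive_const (V := R_NormedModule))|].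
      apply (is_derive_mult smooth); [exact H|apply (is_derive_const (V := R_NormedModule))|intros; apply Rmult_comm]. }
    unfold plus, mult, zero; simpl. ring. }
  apply Cderive_iff; split; simpl.
  - evar_last. { apply (is_derive_mult (fun t => r + smooth t * (r' - r)) (fun t => cos (x + smooth t * (x' - x)))).
      exact HR. apply (is_derive_comp cos); [apply is_derive_cos|exact HX]. intros; apply Rmult_comm. }
    unfold plus, scal; simpl. unfold mult; simpl. ring.
  - evar_last. { apply (is_derive_mult (fun t => r + smooth t * (r' - r)) (fun t => sin (x + smooth t * (x' - x)))).
      exact HR. apply (is_derive_comp sin); [apply is_derive_sin|exact HX]. intros; apply Rmult_comm. }
    unfold plus, scal; simpl. unfold mult; simpl. ring.
Qed.

Lemma dpseg_continuous t : continuous dpseg t.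
Proof.
  assert (H := smooth_derive t).
  assert (C1 : continuous smooth t) by (apply (ex_derive_continuous (V := R_NormedModule)); eexists; exact H).
  assert (C2 := dsmooth_continuous t).
  assert (HR : continuous (fun t => r + smooth t * (r' - r)) t).
  { apply (continuous_plus (V := R_NormedModule)); [apply continuous_const|].
    apply (continuous_mult (K := R_AbsRing)); [exact C1|apply continuous_const]. }
  assert (HX : continuous (fun t => x + smooth t * (x' - x)) t).
  { apply (continuous_plus (V := R_NormedModule)); [apply continuous_const|].
    apply (continuous_mult (K := R_AbsRing)); [exact C1|apply continuous_const]. }
  assert (Hc : continuous (fun t => cos (x + smooth t * (x' - x))) t).
  { apply (continuous_comp (fun t => x + smooth t * (x' - x)) cos); [exact HX|apply continuous_cos]. }
  assert (Hs : continuous (fun t => sin (x + smooth t * (x' - x))) t).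
  { apply (continuous_comp (fun t => x + smooth t * (x' - x)) sin); [exact HX|apply continuous_sin]. }
  apply continuous_C_iff; split; simpl.
  - apply (continuous_mult (K := R_AbsRing)); [exact C2|].
    apply (continuous_minus (V := R_NormedModule)).
    + apply (continuous_mult (K := R_AbsRing)); [apply continuous_const|exact Hc].
    + apply (continuous_mult (K := R_AbsRing)); [|exact Hs].
      apply (continuous_mult (K := R_AbsRing)); [exact HR|apply continuous_const].
  - apply (continuous_mult (K := R_AbsRing)); [exact C2|].
    apply (continuous_plus (V := R_NormedModule)).
    + apply (continuous_mult (K := R_AbsRing)); [apply continuous_const|exact Hs].
    + apply (continuous_mult (K := R_AbsRing)); [|exact Hc].
      apply (continuous_mult (K := R_AbsRing)); [exact HR|apply continuous_const].
Qed.

Hypothesis pseg_ne_1 : forall k, 0 <= k <= 1 ->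
  polar (r + k * (r' - r)) (x + k * (x' - x)) <> RtoC 1.

Lemma pseg_sub_neq t : (pseg t - 1)%C <> RtoC 0.
Proof. apply Csub_neq, pseg_ne_1, smooth_range. Qed.

Lemma polar_path_derive t : Cderive (fun t => moebius_inv P0 Pinf (pseg t)) t
  (RtoC (Pinf - P0) * (- dpseg t / (pseg t - 1) ^ 2))%C.
Proof.
  unfold moebius_inv.
  evar_last. { apply Cderive_plus; [apply Cderive_const|].
    apply Cderive_mult; [apply Cderive_const|]. apply Cderive_inv; [apply pseg_sub_neq|].
    apply Cderive_plus; [apply pseg_derive|apply Cderive_const]. }
  pose proof (pseg_sub_neq t). simpl. field. assumption.
Qed.

Lemma polar_path_velocity t : continuous (fun t => RtoC (Pinf - P0) * (- dpseg t / (pseg t - 1) ^ 2))%C t.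
Proof.
  apply continuous_Cmult; [apply continuous_const|].
  apply continuous_Cmult; [apply continuous_Copp, dpseg_continuous|].
  apply continuous_Cinv; [apply Cpow_neq_0, pseg_sub_neq|].
  apply continuous_Cpow, continuous_Cminus; [|apply continuous_const].
  apply (Cderive_continuous _ _ _ (pseg_derive t)).
Qed.

Definition polar_path : C1path :=
  {| path := fun t => moebius_inv P0 Pinf (pseg t);
     velocity := fun t => (RtoC (Pinf - P0) * (- dpseg t / (pseg t - 1) ^ 2))%C;
     path_derive := polar_path_derive;
     velocity_continuous := polar_path_velocity |}.

Lemma pseg_0 : pseg 0 = polar r x.
Proof. unfold pseg. rewrite smooth_0, !Rmult_0_l, !Rplus_0_r. reflexivity. Qed.

Lemma pseg_1 : pseg 1 = polar r' x'.
Proof. unfold pseg. rewrite smooth_1, !Rmult_1_l. f_equal; ring. Qed.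
End PolarPath.

Lemma Cderive_conj (f : R -> C) t l : Cderive f t l -> Cderive (fun t => Cconj (f t)) t (Cconj l).
Proof.
  rewrite !Cderive_iff. intros [H1 H2]; split; simpl; [exact H1|].
  apply (is_derive_opp (V := R_NormedModule)), H2.
Qed.

Lemma continuous_Cconj {U : UniformSpace} (f : U -> C) (t : U) :
  continuous f t -> continuous (fun t => Cconj (f t)) t.
Proof.
  rewrite !continuous_C_iff. intros [H1 H2]; split; simpl; [exact H1|].
  apply (continuous_opp (V := R_NormedModule)), H2.
Qed.

Definition conj_path (g : C1path) : C1path :=
  {| path := fun t => Cconj (g t);
     velocity := fun t => Cconj (velocity g t);
     path_derive := fun t => Cderive_conj g t _ (path_derive g t);
     velocity_continuous := fun t => continuous_Cconj _ t (velocity_continuous g t) |}.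

Inductive linked (P : C -> Prop) : C -> C -> list C1path -> Prop :=
| linked_nil p : P p -> linked P p p nil
| linked_cons (g : C1path) q l : (forall t, 0 <= t <= 1 -> P (g t)) ->
    linked P (g 1) q l -> linked P (g 0) q (g :: l).

Lemma linked_points P p q l : linked P p q l -> forall g t, In g l -> 0 <= t <= 1 -> P (g t).
Proof.
  induction 1 as [|g q l Hg _ IH]; intros h t Hin Ht; [destruct Hin|].
  destruct Hin as [<-|Hin]; auto.
Qed.

Lemma linked_conj P p q l : linked P p q l ->
  linked (fun u => P (Cconj u)) (Cconj p) (Cconj q) (map conj_path l).
Proof.
  induction 1 as [p H|g q l Hg _ IH]; simpl.
  - apply linked_nil. rewrite Cconj_conj. exact H.
  - apply (linked_cons _ (conj_path g)); [|exact IH].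
    intros t Ht; simpl. rewrite Cconj_conj. apply Hg, Ht.
Qed.

Definition pieces (k : R) (l : list C1path) : chain := map (fun g => (k, g)) l.

Lemma linked_bdry P p q l k F : linked P p q l -> bdry (pieces k l) F = (RtoC k * (F q - F p))%C.
Proof. induction 1 as [|g q l _ _ IH]; simpl; [ring|]. fold (pieces k l). rewrite IH. ring. Qed.

Lemma pconn_linked P0 Pinf (P : R -> R -> Prop) (Q : C -> Prop) r x r' x' :
  (forall r x, P r x -> polar r x <> RtoC 1 /\ Q (moebius_inv P0 Pinf (polar r x))) ->
  pconn P r x r' x' ->
  exists l, linked Q (moebius_inv P0 Pinf (polar r x)) (moebius_inv P0 Pinf (polar r' x')) l.
Proof.
  intros HPQ. induction 1 as [r x H|r x r' x' r'' x'' H _ (l & IH)].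
  - exists nil. apply linked_nil, HPQ, H.
  - assert (N : forall k, 0 <= k <= 1 -> polar (r + k * (r' - r)) (x + k * (x' - x)) <> RtoC 1).
    { intros k Hk. apply (HPQ _ _ (H k Hk)). }
    set (g := polar_path P0 Pinf r x r' x' N).
    exists (g :: l).
    replace (moebius_inv P0 Pinf (polar r x)) with (g 0) by (simpl; rewrite pseg_0; reflexivity).
    apply linked_cons.
    + intros t Ht. apply (HPQ _ _ (H (smooth t) (smooth_range t))).
    + simpl. rewrite pseg_1. exact IH.
Qed.

(** [l] runs from an upper point to a real point. Its mirror image followed by [l] backwards is an
    arc from the conjugate point to the upper one. *)
Definition arc_chain (l : list C1path) : chain := pieces 1 (map conj_path l) ++ pieces (-1) l.

Lemma in_pieces k l c g : In (c, g) (pieces k l) <-> c = k /\ In g l.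
Proof.
  unfold pieces. rewrite in_map_iff. split.
  - intros (h & E & Hin). injection E as <- <-. auto.
  - intros [-> Hin]. exists g; auto.
Qed.

Lemma in_arc_chain l c g : In (c, g) (arc_chain l) ->
  (c = 1 \/ c = -1) /\ exists h, In h l /\ (g = h \/ g = conj_path h).
Proof.
  unfold arc_chain. intros H. apply in_app_or in H as [H|H]; apply in_pieces in H as [-> H].
  - apply in_map_iff in H as (h & <- & H). split; [auto|]. exists h; auto.
  - split; [auto|]. exists g; auto.
Qed.

Lemma arc_chain_bdry P s b l F : linked P s (RtoC b) l -> bdry (arc_chain l) F = (F s - F (Cconj s))%C.
Proof.
  intros H. unfold arc_chain. rewrite bdry_app, (linked_bdry _ _ _ _ _ _ (linked_conj _ _ _ _ H)), (linked_bdry _ _ _ _ _ _ H).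
  replace (Cconj (RtoC b)) with (RtoC b) by (unfold Cconj, RtoC; simpl; f_equal; ring). ring.
Qed.

(** * Decay of integrals over crossing curves *)

(** Compactness of [0, 1], in the form of a supremum argument, for a condition that persists when
    [e] shrinks. *)
Lemma compact_uniform (P : R -> R -> Prop) :
  (forall e e' s, 0 < e' <= e -> P e s -> P e' s) ->
  (forall s, 0 <= s <= 1 -> exists d e, 0 < d /\ 0 < e /\ forall s', 0 <= s' <= 1 -> Rabs (s' - s) < d -> P e s') ->
  exists e, 0 < e /\ forall s, 0 <= s <= 1 -> P e s.
Proof.
  intros Hmono Hloc.
  set (Q := fun b => 0 <= b <= 1 /\ exists e, 0 < e /\ forall s, 0 <= s <= b -> P e s).
  assert (Q0 : Q 0).
  { split; [lra|]. destruct (Hloc 0) as (d & e & Hd & He & H); [lra|]. exists e. split; [exact He|].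
    intros s Hs. apply H; [lra|]. replace s with 0 by lra. rewrite Rminus_diag, Rabs_R0. exact Hd. }
  destruct (completeness Q) as [b [Hub Hlub]].
  { exists 1. intros b [Hb _]; lra. }
  { exists 0; exact Q0. }
  assert (Hb0 : 0 <= b) by (apply Hub, Q0).
  assert (Hb1 : b <= 1). { apply Hlub. intros b' [Hb' _]; lra. }
  destruct (Hloc b) as (d & e & Hd & He & H); [lra|].
  assert (HQ : exists b', Q b' /\ b - d < b').
  { apply NNPP. intros Hn. assert (b <= b - d); [|lra]. apply Hlub. intros b' Hb'.
    destruct (Rle_lt_dec b' (b - d)); [assumption|]. exfalso; apply Hn; exists b'; auto. }
  destruct HQ as (b' & [Hb' (e' & He' & HP)] & Hbd).
  assert (Hext : forall s, 0 <= s <= Rmin (b + d / 2) 1 -> P (Rmin e e') s).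
  { intros s Hs. assert (Hm : 0 < Rmin e e') by (apply Rmin_glb_lt; assumption).
    assert (s <= b + d / 2) by (apply Rle_trans with (1 := proj2 Hs), Rmin_l).
    assert (s <= 1) by (apply Rle_trans with (1 := proj2 Hs), Rmin_r).
    destruct (Rle_lt_dec s b').
    - apply Hmono with e'; [split; [exact Hm|apply Rmin_r]|apply HP; lra].
    - apply Hmono with e; [split; [exact Hm|apply Rmin_l]|]. apply H; [lra|]. apply Rabs_def1; lra. }
  assert (HQ1 : Q (Rmin (b + d / 2) 1)).
  { split; [split; [apply Rmin_glb; lra|apply Rmin_r]|]. exists (Rmin e e'). split; [apply Rmin_glb_lt; assumption|exact Hext]. }
  assert (Hmin : Rmin (b + d / 2) 1 = 1).
  { pose proof (Hub _ HQ1) as K. unfold Rmin in *. destruct Rle_dec; [lra|reflexivity]. }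
  rewrite Hmin in Hext. exists (Rmin e e'). split; [apply Rmin_glb_lt; assumption|exact Hext].
Qed.

(** Says that 1 / (c s - g t) times both velocities is bounded. This holds even where the curves
    cross, if they do so at an angle and their speeds vanish there like the square root of the
    distance. *)
Definition good (c g : C1path) : Prop := exists K, 0 <= K /\
  forall s t, 0 <= s <= 1 -> 0 <= t <= 1 ->
    Cmod (velocity c s) * Cmod (velocity g t) <= K * Cmod (c s - g t).

Lemma path_near (c : C1path) s e : 0 < e -> exists d, 0 < d /\ forall s', Rabs (s' - s) < d -> Cmod (c s' - c s) < e.
Proof.
  intros He. destruct (Cderive_lipschitz c s _ (path_derive c s)) as (d & M & Hd & HM & H).
  exists (Rmin d (e / (M + 1))). split; [apply Rmin_glb_lt; [exact Hd|apply Rdiv_lt_0_compat; lra]|].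
  intros s' Hs'.
  assert (H1 : Rabs (s' - s) < d) by (eapply Rlt_le_trans; [exact Hs'|apply Rmin_l]).
  assert (H2 : Rabs (s' - s) < e / (M + 1)) by (eapply Rlt_le_trans; [exact Hs'|apply Rmin_r]).
  specialize (H (s' - s) H1). replace (s + (s' - s)) with s' in H by ring.
  apply Rle_lt_trans with (1 := H).
  apply Rmult_lt_compat_r with (r := M + 1) in H2; [|lra].
  replace (e / (M + 1) * (M + 1)) with e in H2 by (field; lra). pose proof (Rabs_pos (s' - s)). nra.
Qed.

Lemma good_disjoint (c g : C1path) :
  (forall s t, 0 <= s <= 1 -> 0 <= t <= 1 -> c s <> g t) -> good c g.
Proof.
  intros Hd.
  destruct (compact_uniform (fun e s => forall t, 0 <= t <= 1 -> e <= Cmod (c s - g t))) as (e & He & H).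
  - intros e e' s He H t Ht. specialize (H t Ht). lra.
  - intros s Hs.
    destruct (continuous_attains_min (fun t => Cmod (c s - g t))) as (m & Hm & Hmin).
    { intros t Ht. apply continuous_Cmod, continuous_Cminus; [apply continuous_const|apply path_continuous]. }
    assert (Hpos : 0 < Cmod (c s - g m)) by (apply Cmod_gt_0, Csub_neq, Hd; assumption).
    destruct (path_near c s (Cmod (c s - g m) / 2)) as (d & Hd0 & Hnear); [lra|].
    exists d, (Cmod (c s - g m) / 2). split; [exact Hd0|]. split; [lra|].
    intros s' Hs' Hclose t Ht. specialize (Hnear s' Hclose). specialize (Hmin t Ht).
    pose proof (Cmod_triangle (c s - c s') (c s' - g t)) as T.
    replace (c s - c s' + (c s' - g t))%C with (c s - g t)%C in T by ring.
    replace (c s - c s')%C with (- (c s' - c s))%C in T by ring. rewrite Cmod_opp in T. lra.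
  - destruct (continuous_bounded (fun t => Cmod (velocity c t))) as [V1 HV1].
    { intros; apply continuous_Cmod, velocity_continuous. }
    destruct (continuous_bounded (fun t => Cmod (velocity g t))) as [V2 HV2].
    { intros; apply continuous_Cmod, velocity_continuous. }
    assert (0 <= V1). { apply Rle_trans with (1 := Cmod_ge_0 (velocity c 0)), HV1; lra. }
    assert (0 <= V2). { apply Rle_trans with (1 := Cmod_ge_0 (velocity g 0)), HV2; lra. }
    exists (V1 * V2 / e). split; [apply Rmult_le_pos; [nra|apply Rlt_le, Rinv_0_lt_compat, He]|].
    intros s t Hs Ht. specialize (H s Hs t Ht).
    apply Rle_trans with (V1 * V2); [apply Rmult_le_compat; try apply Cmod_ge_0; auto|].
    apply Rmult_le_reg_r with e; [exact He|].
    replace (V1 * V2 / e * Cmod (c s - g t) * e) with (V1 * V2 * Cmod (c s - g t)) by (field; lra).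
    apply Rmult_le_compat_l; nra.
Qed.

Lemma good_conj c g : good c g -> good (conj_path c) (conj_path g).
Proof.
  intros (K & HK & H). exists K. split; [exact HK|]. intros s t Hs Ht. simpl.
  replace (Cconj (c s) - Cconj (g t))%C with (Cconj (c s - g t)).
  - rewrite !Cmod_conj. apply H; assumption.
  - unfold Cminus. rewrite Cplus_conj, Copp_conj. reflexivity.
Qed.

(** 2 (1 - cos y) = (2 sin (y / 2))^2, and the mean value theorem bounds the sine from below by (y /
    2) cos (z / 2). *)
Lemma half_angle_bound y z : 0 <= y -> y <= z -> z < PI -> (y * cos (z / 2)) ^ 2 <= 2 * (1 - cos y).
Proof.
  intros Hy Hyz Hz. pose proof PI_RGT_0.
  assert (E : 2 * (1 - cos y) = (2 * sin (y / 2)) ^ 2).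
  { replace y with (2 * (y / 2)) at 1 by field. rewrite cos_2a_sin. ring. }
  rewrite E. apply pow_incr. split.
  { apply Rmult_le_pos; [exact Hy|]. apply cos_ge_0; lra. }
  destruct (Req_dec_T y 0) as [->|Hn]. { replace (0 / 2) with 0 by field. rewrite sin_0. lra. }
  destruct (MVT_cor2 sin cos 0 (y / 2)) as (c & Ec & Hc); [lra|intros; apply derivable_pt_lim_sin|].
  rewrite sin_0 in Ec. assert (cos (z / 2) <= cos c) by (apply cos_decr_1; lra). nra.
Qed.

(** An arc and a ray leaving the same point, with displacements b in angle and a in radius. Their
    distance squared is at least of order a^2 + b^2, while by [dsmooth_bound] the product of the
    squared speeds is of order |a b|. The Moebius map changes both only by bounded factors, since
    zeta stays away from 1. *)
Lemma good_polar P0 Pinf r0 x0 x1 r1 N1 N2 : 0 < r0 -> 0 < r1 -> Pinf <> P0 -> Rabs (x1 - x0) < PI ->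
  good (polar_path P0 Pinf r0 x0 r0 x1 N1) (polar_path P0 Pinf r0 x0 r1 x0 N2).
Proof.
  intros Hr0 Hr1 HP HX. pose proof PI_RGT_0 as HPI.
  set (m := Rmin r0 r1). assert (Hm : 0 < m) by (apply Rmin_glb_lt; assumption).
  (* Positive because the arc is shorter than a half turn; it compares the chord with the angle. *)
  set (k := cos (Rabs (x1 - x0) / 2)).
  assert (Hk : 0 < k) by (apply cos_gt_0; pose proof (Rabs_pos (x1 - x0)); lra).
  set (kap := Rmin 1 (r0 * m * k ^ 2)).
  assert (Hkap : 0 < kap). { apply Rmin_glb_lt; [lra|]. repeat apply Rmult_lt_0_compat; trivial; lra. }
  assert (Hk1 : kap <= 1) by apply Rmin_l. assert (Hk2 : kap <= r0 * m * k ^ 2) by apply Rmin_r.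
  set (Dx := x1 - x0) in *. set (Dr := r1 - r0).
  set (K2 := PI ^ 4 * r0 ^ 2 * (Rabs Dx * Rabs Dr) / (2 * kap)).
  assert (HK2 : 0 <= K2).
  { unfold K2. apply Rmult_le_pos; [|apply Rlt_le, Rinv_0_lt_compat; lra].
    apply Rmult_le_pos; [apply Rmult_le_pos; apply pow_le; lra|apply Rmult_le_pos; apply Rabs_pos]. }
  set (zc := pseg r0 x0 r0 x1). set (zg := pseg r0 x0 r1 x0).
  set (dzc := dpseg r0 x0 r0 x1). set (dzg := dpseg r0 x0 r1 x0).
  assert (Main : forall s t, Cmod (dzc s) * Cmod (dzg t) <= sqrt K2 * Cmod (zc s - zg t)).
  { intros s t. pose proof (smooth_range s) as Ss. pose proof (smooth_range t) as St.
    set (a := smooth t * Dr). set (b := smooth s * Dx).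
    assert (E1 : Cmod (dzc s) ^ 2 = dsmooth s ^ 2 * (r0 ^ 2 * Dx ^ 2)).
    { rewrite Cmod2_alt. unfold dzc, dpseg, Re, Im; simpl fst; simpl snd. fold Dx.
      set (X := x0 + smooth s * Dx). pose proof (sin2_cos2 X) as T. unfold Rsqr in T.
      replace (r0 - r0) with 0 by ring. rewrite !Rmult_0_l, !Rmult_0_r, Rplus_0_r, Rplus_0_l.
      transitivity (dsmooth s ^ 2 * (r0 ^ 2 * Dx ^ 2) * (sin X * sin X + cos X * cos X)); [ring|rewrite T; ring]. }
    assert (E2 : Cmod (dzg t) ^ 2 = dsmooth t ^ 2 * Dr ^ 2).
    { rewrite Cmod2_alt. unfold dzg, dpseg, Re, Im; simpl fst; simpl snd. fold Dr.
      replace (x0 - x0) with 0 by ring. rewrite !Rmult_0_r, !Rmult_0_l, Rplus_0_r.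
      pose proof (sin2_cos2 x0) as T. unfold Rsqr in T.
      transitivity (dsmooth t ^ 2 * Dr ^ 2 * (sin x0 * sin x0 + cos x0 * cos x0)); [ring|rewrite T; ring]. }
    assert (E3 : Cmod (zc s - zg t) ^ 2 = a ^ 2 + 2 * r0 * (r0 + a) * (1 - cos b)).
    { rewrite Cmod2_alt. unfold zc, zg, pseg, polar, Cminus, Cplus, Copp, Re, Im; simpl fst; simpl snd. fold Dx Dr. fold a b.
      replace (r0 - r0) with 0 by ring. replace (x0 - x0) with 0 by ring. rewrite !Rmult_0_r, !Rplus_0_r.
      set (X := x0 + b). replace b with (X - x0) by (unfold X; ring). rewrite cos_minus.
      pose proof (sin2_cos2 x0) as T0. pose proof (sin2_cos2 X) as T1. unfold Rsqr in T0, T1.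
      transitivity (r0 * r0 * (sin X * sin X + cos X * cos X) + (r0 + a) * (r0 + a) * (sin x0 * sin x0 + cos x0 * cos x0) - 2 * r0 * (r0 + a) * (cos X * cos x0 + sin X * sin x0)); [ring|].
      rewrite T0, T1. ring. }
    assert (Ha : m <= r0 + a). { unfold a, Dr, m. unfold Rmin. destruct Rle_dec; nra. }
    assert (Hb : (Rabs b * k) ^ 2 <= 2 * (1 - cos b)).
    { replace (cos b) with (cos (Rabs b)). 
      - apply half_angle_bound; [apply Rabs_pos| |exact HX]. unfold b. rewrite Rabs_mult, (Rabs_right (smooth s)) by lra.
        pose proof (Rabs_pos Dx). nra.
      - unfold Rabs. destruct Rcase_abs; [apply cos_neg|reflexivity]. }
    assert (Hb2 : (Rabs b * k) ^ 2 = b ^ 2 * k ^ 2) by (rewrite Rpow_mult_distr, pow2_abs; reflexivity).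
    assert (Hcos : 0 <= 1 - cos b) by (pose proof (COS_bound b); lra).
    assert (Hdist : kap * (a ^ 2 + b ^ 2) <= Cmod (zc s - zg t) ^ 2).
    { rewrite E3. assert (r0 * m * (b ^ 2 * k ^ 2) <= 2 * r0 * (r0 + a) * (1 - cos b)).
      { rewrite <- Hb2. apply Rle_trans with (r0 * m * (2 * (1 - cos b))); [apply Rmult_le_compat_l; [nra|exact Hb]|].
        assert (0 <= r0 * (1 - cos b)) by nra. nra. }
      assert (kap * b ^ 2 <= r0 * m * k ^ 2 * b ^ 2) by (apply Rmult_le_compat_r; [apply pow2_ge_0|exact Hk2]).
      assert (kap * a ^ 2 <= 1 * a ^ 2) by (apply Rmult_le_compat_r; [apply pow2_ge_0|exact Hk1]). lra. }
    assert (Hsp : (Cmod (dzc s) * Cmod (dzg t)) ^ 2 <= PI ^ 4 * r0 ^ 2 * (Rabs Dx * Rabs Dr) * (Rabs a * Rabs b)).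
    { rewrite Rpow_mult_distr, E1, E2. unfold a, b. rewrite !Rabs_mult, (Rabs_right (smooth s)), (Rabs_right (smooth t)) by lra.
      pose proof (dsmooth_bound s). pose proof (dsmooth_bound t).
      rewrite <- (pow2_abs Dx), <- (pow2_abs Dr).
      replace (dsmooth s ^ 2 * (r0 ^ 2 * Rabs Dx ^ 2) * (dsmooth t ^ 2 * Rabs Dr ^ 2)) with ((dsmooth s ^ 2 * dsmooth t ^ 2) * (r0 ^ 2 * Rabs Dx ^ 2 * Rabs Dr ^ 2)) by ring.
      replace (PI ^ 4 * r0 ^ 2 * (Rabs Dx * Rabs Dr) * (smooth t * Rabs Dr * (smooth s * Rabs Dx)))
        with ((PI ^ 2 * smooth s * (PI ^ 2 * smooth t)) * (r0 ^ 2 * Rabs Dx ^ 2 * Rabs Dr ^ 2)) by ring.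
      apply Rmult_le_compat_r.
      - apply Rmult_le_pos; [apply Rmult_le_pos|]; apply pow_le; try apply Rabs_pos; lra.
      - apply Rmult_le_compat; try apply pow2_ge_0; assumption. }
    assert (Hab : 2 * (Rabs a * Rabs b) <= a ^ 2 + b ^ 2).
    { rewrite <- (pow2_abs a), <- (pow2_abs b). pose proof (pow2_ge_0 (Rabs a - Rabs b)). nra. }
    assert (Hfin : (Cmod (dzc s) * Cmod (dzg t)) ^ 2 <= (sqrt K2 * Cmod (zc s - zg t)) ^ 2).
    { rewrite (Rpow_mult_distr (sqrt K2)). rewrite pow2_sqrt by exact HK2.
      apply Rle_trans with (1 := Hsp).
      replace (PI ^ 4 * r0 ^ 2 * (Rabs Dx * Rabs Dr) * (Rabs a * Rabs b)) with (K2 * (kap * (2 * (Rabs a * Rabs b)))) by (unfold K2; field; lra).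
      apply Rmult_le_compat_l; [exact HK2|]. apply Rle_trans with (2 := Hdist). apply Rmult_le_compat_l; lra. }
    assert (P1 : 0 <= Cmod (dzc s) * Cmod (dzg t)) by (apply Rmult_le_pos; apply Cmod_ge_0).
    assert (P2 : 0 <= sqrt K2 * Cmod (zc s - zg t)) by (apply Rmult_le_pos; [apply sqrt_pos|apply Cmod_ge_0]).
    apply Rsqr_incr_0; unfold Rsqr; nra. }
  assert (Cont : forall r x r' x' t, continuous (fun t => Cmod (pseg r x r' x' t - 1)) t).
  { intros. apply continuous_Cmod, continuous_Cminus; [|apply continuous_const]. apply (Cderive_continuous _ _ _ (pseg_derive r x r' x' t)). }
  destruct (continuous_attains_min (fun t => Cmod (zc t - 1))) as (m1 & Hm1 & Hmin1); [intros; apply Cont|].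
  destruct (continuous_attains_min (fun t => Cmod (zg t - 1))) as (m2 & Hm2 & Hmin2); [intros; apply Cont|].
  assert (Hp1 : 0 < Cmod (zc m1 - 1)) by (apply Cmod_gt_0, pseg_sub_neq, N1).
  assert (Hp2 : 0 < Cmod (zg m2 - 1)) by (apply Cmod_gt_0, pseg_sub_neq, N2).
  set (P := Rabs (Pinf - P0)). assert (HPp : 0 < P) by (apply Rabs_pos_lt; lra).
  exists (P * sqrt K2 / (Cmod (zc m1 - 1) * Cmod (zg m2 - 1))). split.
  { apply Rmult_le_pos; [apply Rmult_le_pos; [lra|apply sqrt_pos]|apply Rlt_le, Rinv_0_lt_compat, Rmult_lt_0_compat; assumption]. }
  intros s t Hs Ht. specialize (Hmin1 s Hs). specialize (Hmin2 t Ht). specialize (Main s t).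
  assert (Nc : (zc s - 1)%C <> RtoC 0) by (apply pseg_sub_neq, N1).
  assert (Ng : (zg t - 1)%C <> RtoC 0) by (apply pseg_sub_neq, N2).
  assert (Ec : Cmod (RtoC (Pinf - P0) * (- dzc s / (zc s - 1) ^ 2))%C = P * (Cmod (dzc s) / Cmod (zc s - 1) ^ 2)).
  { rewrite Cmod_mult, Cmod_R, Cmod_div, Cmod_opp, Cmod_pow by (apply Cpow_neq_0, Nc). reflexivity. }
  assert (Eg : Cmod (RtoC (Pinf - P0) * (- dzg t / (zg t - 1) ^ 2))%C = P * (Cmod (dzg t) / Cmod (zg t - 1) ^ 2)).
  { rewrite Cmod_mult, Cmod_R, Cmod_div, Cmod_opp, Cmod_pow by (apply Cpow_neq_0, Ng). reflexivity. }
  assert (Ed : Cmod (moebius_inv P0 Pinf (zc s) - moebius_inv P0 Pinf (zg t)) = P * (Cmod (zc s - zg t) / (Cmod (zc s - 1) * Cmod (zg t - 1)))).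
  { unfold moebius_inv.
    replace (RtoC Pinf + RtoC (Pinf - P0) * / (zc s - 1) - (RtoC Pinf + RtoC (Pinf - P0) * / (zg t - 1)))%C
      with (RtoC (Pinf - P0) * (- (zc s - zg t) / ((zc s - 1) * (zg t - 1))))%C by (field; split; assumption).
    rewrite Cmod_mult, Cmod_R, Cmod_div, Cmod_opp, Cmod_mult by (apply Cmult_neq_0; assumption). reflexivity. }
  change (Cmod (RtoC (Pinf - P0) * (- dzc s / (zc s - 1) ^ 2))%C * Cmod (RtoC (Pinf - P0) * (- dzg t / (zg t - 1) ^ 2))%C
    <= P * sqrt K2 / (Cmod (zc m1 - 1) * Cmod (zg m2 - 1)) * Cmod (moebius_inv P0 Pinf (zc s) - moebius_inv P0 Pinf (zg t))).
  rewrite Ec, Eg, Ed. clear Ec Eg Ed.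
  set (A := Cmod (zc s - 1)) in *. set (B := Cmod (zg t - 1)) in *.
  set (m1' := Cmod (zc m1 - 1)) in *. set (m2' := Cmod (zg m2 - 1)) in *.
  set (X := Cmod (dzc s)) in *. set (Y := Cmod (dzg t)) in *. set (Z := Cmod (zc s - zg t)) in *.
  assert (HZ : 0 <= sqrt K2 * Z) by (apply Rmult_le_pos; [apply sqrt_pos|apply Cmod_ge_0]).
  replace (P * (X / A ^ 2) * (P * (Y / B ^ 2))) with (P * P / (A * B) * (X * Y * / (A * B))) by (field; lra).
  replace (P * sqrt K2 / (m1' * m2') * (P * (Z / (A * B)))) with (P * P / (A * B) * (sqrt K2 * Z * / (m1' * m2'))) by (field; lra).
  apply Rmult_le_compat_l.
  { apply Rlt_le, Rdiv_lt_0_compat; apply Rmult_lt_0_compat; lra. }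
  apply Rle_trans with (sqrt K2 * Z * / (A * B)).
  - apply Rmult_le_compat_r; [apply Rlt_le, Rinv_0_lt_compat, Rmult_lt_0_compat; lra|exact Main].
  - apply Rmult_le_compat_l; [exact HZ|]. apply Rinv_le_contravar; [apply Rmult_lt_0_compat; lra|].
    apply Rmult_le_compat; lra.
Qed.

(** * Decay of Cauchy integrals along a descent curve *)

Definition chain_norm (l : chain) : R := fold_right (fun cg acc => Rabs (fst cg) + acc) 0 l.

Lemma chain_norm_pos l : 0 <= chain_norm l.
Proof. induction l as [|[c g] l IH]; simpl; [lra|]. pose proof (Rabs_pos c). lra. Qed.

Lemma chain_int_le (l : chain) (f : C -> C) v M : 0 <= M ->
  (forall c g t, In (c, g) l -> 0 <= t <= 1 -> Cmod (f (g t) * velocity g t) <= M) ->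
  chain_int l f v -> Cmod v <= M * chain_norm l.
Proof.
  intros HM. revert v. induction l as [|[c g] l IH]; simpl; intros v H Hv.
  - rewrite Hv, Cmod_0. lra.
  - destruct Hv as (v1 & v2 & H1 & H2 & ->).
    apply Rle_trans with (1 := Cmod_triangle _ _). rewrite Rmult_plus_distr_l. apply Rplus_le_compat.
    + rewrite Cmod_mult, Cmod_R, Rmult_comm. apply Rmult_le_compat_r; [apply Rabs_pos|].
      apply (isCint_bound (fun t => f (g t) * velocity g t)%C); [|exact H1]. intros t Ht. apply (H c g t); auto.
    + apply IH; [|exact H2]. intros c' g' t Hin Ht. apply (H c' g' t); auto.
Qed.

Lemma exp_le x y : x <= y -> exp x <= exp y.
Proof. intros [H| ->]; [left; apply exp_increasing, H|right; reflexivity]. Qed.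

(** The exponent vanishes only at 0. On [0, a] the integrand is at most 1 and the length at most eps
    / 2; on [a, 1] the exponent has a positive minimum d x, and exp (- N d x) <= 1 / (N d x) <= eps
    / 2 for the chosen [N]. *)
Lemma exp_decay_integral (d : R -> R) eps : (forall s, 0 <= s <= 1 -> continuous d s) ->
  (forall s, 0 <= s <= 1 -> 0 <= d s) -> (forall s, 0 < s <= 1 -> 0 < d s) -> 0 < eps ->
  exists N0 : nat, forall N : nat, (N0 <= N)%nat -> exists m,
    is_RInt (fun s => exp (- (INR N * d s))) 0 1 m /\ m <= eps.
Proof.
  intros Hc H0 Hpos Heps.
  set (a := Rmin (eps / 2) (1 / 2)). assert (Ha : 0 < a) by (apply Rmin_glb_lt; lra).
  assert (Ha1 : a <= eps / 2) by apply Rmin_l. assert (Ha2 : a <= 1 / 2) by apply Rmin_r.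
  destruct (continuity_ab_min d a 1) as (x & Hx & Hxr); [lra|intros; apply continuity_pt_filterlim, Hc; lra|].
  assert (He : 0 < d x) by (apply Hpos; lra).
  destruct (nfloor_ex (2 / (eps * d x))) as (N0 & HN0 & HN1).
  { apply Rlt_le, Rdiv_lt_0_compat; [lra|apply Rmult_lt_0_compat; lra]. }
  exists (S N0). intros N HN. apply le_INR in HN. rewrite S_INR in HN.
  assert (Hcf : forall s, 0 <= s <= 1 -> continuous (fun s => exp (- (INR N * d s))) s).
  { intros s Hs. apply (continuous_comp (fun s => - (INR N * d s)) exp).
    - apply (continuous_opp (V := R_NormedModule)), (continuous_mult (K := R_AbsRing)); [apply continuous_const|apply Hc, Hs].
    - apply continuous_exp. }
  assert (I1 : ex_RInt (fun s => exp (- (INR N * d s))) 0 a).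
  { apply (ex_RInt_continuous (V := R_CompleteNormedModule)). rewrite Rmin_left, Rmax_right by lra. intros; apply Hcf; lra. }
  assert (I2 : ex_RInt (fun s => exp (- (INR N * d s))) a 1).
  { apply (ex_RInt_continuous (V := R_CompleteNormedModule)). rewrite Rmin_left, Rmax_right by lra. intros; apply Hcf; lra. }
  destruct I1 as [m1 I1]. destruct I2 as [m2 I2].
  exists (m1 + m2). split; [apply (is_RInt_Chasles (V := R_NormedModule)) with a; assumption|].
  assert (HN' : 0 <= INR N) by apply pos_INR.
  assert (B1 : m1 <= a * 1).
  { apply Rle_trans with (Rabs m1); [apply RRle_abs|].
    replace (a * 1) with ((a - 0) * 1) by ring.
    apply (norm_RInt_le_const (V := R_NormedModule) (fun s => exp (- (INR N * d s))) 0 a m1 1); [lra| |exact I1].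
    intros s Hs. change (Rabs (exp (- (INR N * d s))) <= 1). rewrite Rabs_right by (left; apply exp_pos).
    rewrite <- exp_0. apply exp_le. specialize (H0 s ltac:(lra)). nra. }
  assert (B2 : m2 <= (1 - a) * (eps / 2)).
  { apply Rle_trans with (Rabs m2); [apply RRle_abs|].
    apply (norm_RInt_le_const (V := R_NormedModule) (fun s => exp (- (INR N * d s))) a 1 m2 (eps / 2)); [lra| |exact I2].
    intros s Hs. change (Rabs (exp (- (INR N * d s))) <= eps / 2). rewrite Rabs_right by (left; apply exp_pos).
    apply Rle_trans with (exp (- (INR N * d x))).
    - apply exp_le. specialize (Hx s Hs). nra.
    - rewrite exp_Ropp. pose proof (exp_ineq1_le (INR N * d x)).
      assert (Hbig : 2 / eps <= INR N * d x).
      { replace (2 / eps) with (2 / (eps * d x) * d x) by (field; lra). apply Rmult_le_compat_r; lra. }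
      assert (0 < 2 / eps) by (apply Rdiv_lt_0_compat; lra).
      replace (eps / 2) with (/ (2 / eps)) by (field; lra). apply Rinv_le_contravar; lra. }
  nra.
Qed.

(** [kap * H N] is the Cauchy integral of [G N] over [gam]. The velocity of [c] is moved inside that
    integral, where [good] cancels the pole. The remaining bound M exp (- N d s) is integrable to a
    small value. *)
Lemma piece_limit (gam : chain) (c : C1path) (F G H : nat -> C -> C) (kap : C) (C0 : R) (d : R -> R) :
  (forall k g, In (k, g) gam -> good c g) -> kap <> RtoC 0 -> 0 <= C0 ->
  (forall s, 0 <= s <= 1 -> continuous d s) ->
  (forall s, 0 <= s <= 1 -> 0 <= d s) -> (forall s, 0 < s <= 1 -> 0 < d s) ->
  (exists N0, forall N, (N0 <= N)%nat ->
    (forall s k g t, 0 < s < 1 -> In (k, g) gam -> 0 <= t <= 1 ->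
      Cmod (F N (c s)) * Cmod (G N (g t)) <= C0 * exp (- (INR N * d s))) /\
    (forall s k g t, 0 < s < 1 -> In (k, g) gam -> 0 <= t <= 1 -> c s <> g t) /\
    (forall s, 0 < s < 1 -> chain_int gam (fun v => G N v * / (c s - v))%C (kap * H N (c s))%C)) ->
  forall eps, 0 < eps -> exists N1, forall N, (N1 <= N)%nat ->
    forall V, isCint (fun s => F N (c s) * H N (c s) * velocity c s)%C V -> Cmod V <= eps.
Proof.
  intros Hgood Hkap HC0 Hdc Hd0 Hd1 (N0 & HN0) eps Heps.
  assert (HK : exists K, 0 <= K /\ forall k g s t, In (k, g) gam -> 0 <= s <= 1 -> 0 <= t <= 1 ->
     Cmod (velocity c s) * Cmod (velocity g t) <= K * Cmod (c s - g t)).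
  { clear - Hgood. induction gam as [|[k g] l IH].
    - exists 0. split; [lra|]. intros k g s t [].
    - destruct IH as (K & HK & IH). { intros k' g' Hin; apply (Hgood k' g'); right; exact Hin. }
      destruct (Hgood k g (or_introl eq_refl)) as (K' & HK' & H').
      exists (K + K'). split; [lra|]. intros k0 g0 s t [E|Hin] Hs Ht.
      + injection E as <- <-. specialize (H' s t Hs Ht). pose proof (Cmod_ge_0 (c s - g t)). nra.
      + specialize (IH k0 g0 s t Hin Hs Ht). pose proof (Cmod_ge_0 (c s - g0 t)). nra. }
  destruct HK as (K & HK & HKb).
  assert (Hk : 0 < Cmod kap) by (apply Cmod_gt_0, Hkap).
  set (M := C0 * K * chain_norm gam / Cmod kap).
  assert (HM : 0 <= M).
  { unfold M. apply Rmult_le_pos; [|apply Rlt_le, Rinv_0_lt_compat, Hk].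
    apply Rmult_le_pos; [nra|apply chain_norm_pos]. }
  destruct (exp_decay_integral d (eps / (M + 1)) Hdc Hd0 Hd1) as (N2 & HN2); [apply Rdiv_lt_0_compat; lra|].
  exists (max N0 N2). intros N HN V HV.
  destruct (HN0 N) as (HFG & Hoff & HI); [lia|]. destruct (HN2 N) as (m & Hm & Hme); [lia|].
  assert (Hpt : forall s, 0 < s < 1 -> Cmod (F N (c s) * H N (c s) * velocity c s) <= M * exp (- (INR N * d s))).
  { intros s Hs. specialize (HI s Hs). pose proof (fun k g t => Hoff s k g t Hs) as Hoff'.
    apply chain_int_scal with (k := (F N (c s) * velocity c s)%C) in HI.
    apply chain_int_le with (M := C0 * exp (- (INR N * d s)) * K) in HI.
    - rewrite !Cmod_mult in HI. rewrite !Cmod_mult. unfold M.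
      apply Rmult_le_reg_l with (Cmod kap); [exact Hk|].
      replace (Cmod kap * (C0 * K * chain_norm gam / Cmod kap * exp (- (INR N * d s)))) with (C0 * exp (- (INR N * d s)) * K * chain_norm gam) by (field; lra).
      apply Rle_trans with (2 := HI). right; ring.
    - apply Rmult_le_pos; [|exact HK]. apply Rmult_le_pos; [exact HC0|left; apply exp_pos].
    - intros k g t Hin Ht.
      assert (Hne : (c s - g t)%C <> RtoC 0) by (apply Csub_neq, (Hoff' k g t); assumption).
      pose proof (proj1 (Cmod_gt_0 _) Hne) as Hpos.
      rewrite !Cmod_mult, Cmod_inv by exact Hne.
      specialize (HFG s k g t Hs Hin Ht). specialize (HKb k g s t Hin ltac:(lra) Ht).
      replace (Cmod (F N (c s)) * Cmod (velocity c s) * (Cmod (G N (g t)) * / Cmod (c s - g t)) * Cmod (velocity g t))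
        with ((Cmod (F N (c s)) * Cmod (G N (g t))) * (Cmod (velocity c s) * Cmod (velocity g t) * / Cmod (c s - g t))) by ring.
      apply Rmult_le_compat; trivial.
      + apply Rmult_le_pos; apply Cmod_ge_0.
      + apply Rmult_le_pos; [apply Rmult_le_pos; apply Cmod_ge_0|apply Rlt_le, Rinv_0_lt_compat, Hpos].
      + apply Rmult_le_reg_r with (Cmod (c s - g t)); [exact Hpos|].
        rewrite Rmult_assoc, Rinv_l, Rmult_1_r by lra. exact HKb. }
  (* The bounds are known only inside the interval, since the curve may start on [gam]; the
     integrand is set to 0 at the end points. *)
  set (f := fun s => if Rlt_dec 0 s then if Rlt_dec s 1 then (F N (c s) * H N (c s) * velocity c s)%C else RtoC 0 else RtoC 0).
  assert (HV' : isCint f V).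
  { eapply isCint_ext_open; [|exact HV]. intros s Hs; unfold f. destruct Rlt_dec; [|lra]. destruct Rlt_dec; [reflexivity|lra]. }
  apply (is_RInt_scal (V := R_NormedModule) _ _ _ M) in Hm.
  apply Rle_trans with (M * m).
  - apply (isCint_le f (fun s => M * exp (- (INR N * d s)))); [|exact HV'|exact Hm].
    intros s Hs. unfold f.
    assert (0 <= M * exp (- (INR N * d s))) by (apply Rmult_le_pos; [exact HM|left; apply exp_pos]).
    destruct Rlt_dec; [destruct Rlt_dec; [apply Hpt; lra|]|]; rewrite Cmod_0; assumption.
  - apply Rle_trans with (M * (eps / (M + 1))); [apply Rmult_le_compat_l; assumption|].
    apply Rmult_le_reg_r with (M + 1); [lra|].
    replace (M * (eps / (M + 1)) * (M + 1)) with (M * eps) by (field; lra). nra.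
Qed.

(** * Descent curves and ridges *)

Definition touches (b : R) (u : C) : Prop := 0 < Im u \/ u = RtoC b.

(** The strict condition [P] fails at the start [z] itself, which is why the first curve is singled
    out and constrained only for positive times. *)
Definition path_to (P : C -> Prop) (z : C) (b : R) (l : list C1path) : Prop :=
  exists g l', l = g :: l' /\ g 0 = z /\ (forall s, 0 < s <= 1 -> P (g s) /\ touches b (g s)) /\
    linked (fun u => P u /\ touches b u) (g 1) (RtoC b) l'.

Lemma good_conj_l c g : good c (conj_path g) -> good (conj_path c) g.
Proof.
  intros (K & HK & H). exists K. split; [exact HK|]. intros s t Hs Ht. specialize (H s t Hs Ht). simpl in *.
  rewrite Cmod_conj in *. replace (Cconj (c s) - g t)%C with (Cconj (c s - Cconj (g t))).
  - rewrite Cmod_conj. exact H.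
  - unfold Cminus. rewrite Cplus_conj, Copp_conj, Cconj_conj. reflexivity.
Qed.

Definition moebius_real (P0 Pinf r : R) : R := Pinf + (Pinf - P0) / (r - 1).

Lemma moebius_inv_real P0 Pinf r x e : e <> 1 -> polar r x = RtoC e ->
  moebius_inv P0 Pinf (polar r x) = RtoC (moebius_real P0 Pinf e).
Proof.
  intros He ->. unfold moebius_inv, moebius_real. rewrite RtoC_plus. f_equal.
  unfold Rdiv. rewrite RtoC_mult, <- RtoC_minus, RtoC_inv by lra. reflexivity.
Qed.

Lemma moebius_inv_im P0 Pinf u : u <> RtoC 1 ->
  Im (moebius_inv P0 Pinf u) = (P0 - Pinf) * Im u / Cmod (u - 1) ^ 2.
Proof.
  intros Hu. assert (N := Csub_neq _ _ Hu). pose proof (proj1 (Cmod_gt_0 _) N) as Hp.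
  rewrite Cmod2_alt in *. unfold moebius_inv. destruct u as [a b].
  assert (0 < (a - 1) ^ 2 + b ^ 2).
  { pose proof (pow_lt _ 2 Hp) as H. rewrite Cmod2_alt in H. simpl in H. simpl. lra. }
  simpl. field. simpl in *. lra.
Qed.

Lemma moebius_real_neq P0 Pinf r q l : Pinf <> P0 -> In q l -> r <> 1 ->
  ~ In r (map (fun q => (q - P0) / (q - Pinf)) l) -> moebius_real P0 Pinf r <> q.
Proof.
  intros HP Hq Hr Hn E. apply Hn. apply in_map_iff. exists q. split; [|exact Hq].
  rewrite <- E. unfold moebius_real. field. repeat split; lra.
Qed.

Lemma list_bound (l : list R) : exists M, 0 < M /\ forall q, In q l -> Rabs q < M.
Proof.
  induction l as [|p l (M & HM & IH)]; [exists 1; split; [lra|intros q []]|].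
  exists (M + Rabs p + 1). pose proof (Rabs_pos p). split; [lra|]. intros q [<-|Hq]; [lra|]. specialize (IH q Hq). lra.
Qed.

(** Zero entries are allowed because [P0] itself is sent to 0; the small radius chosen later is
    positive and so avoids them anyway. *)
Lemma list_away (l : list R) : exists e, 0 < e /\ forall q, In q l -> q <> 0 -> e <= Rabs q.
Proof.
  induction l as [|p l (e & He & IH)]; [exists 1; split; [lra|intros q []]|].
  destruct (Req_dec_T p 0) as [Hp|Hp].
  - exists e. split; [exact He|]. intros q [<-|Hq] Hn; [contradiction|auto].
  - exists (Rmin e (Rabs p)). split; [apply Rmin_glb_lt; [exact He|apply Rabs_pos_lt, Hp]|].
    intros q [<-|Hq] Hn; [apply Rmin_r|]. apply Rle_trans with e; [apply Rmin_l|auto].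
Qed.

Section Steepest.
Variables p1 p2 p3 c1 c2 c3 t0 r0 X0 : R.
Hypothesis Hp : p1 <= p2 < 0 /\ 0 < p3.
Hypothesis Hc : 0 < c1 /\ 0 < c2 /\ 0 < c3.
Hypothesis Ht0 : 0 < t0.
Hypothesis Hr0 : 0 < r0.
Hypothesis HX0 : -1 < X0 < 1.
Hypothesis saddle_angular : angular p1 p2 p3 c1 c2 c3 r0 X0 = 0.
Hypothesis saddle_radial :
  c1 / ell p1 r0 X0 + c2 / ell p2 r0 X0 + c3 / ell p3 r0 X0 = t0 / r0 ^ 2.
Notation energy := (energy p1 p2 p3 c1 c2 c3 t0).
Notation regular := (regular p1 p2 p3).
Variables P0 Pinf : R.
Hypothesis HP : Pinf < P0.
Variable U : C -> R.
Variable k0 : R.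
Hypothesis U_energy : forall r x, regular r (cos x) -> polar r x <> RtoC 1 ->
  U (moebius_inv P0 Pinf (polar r x)) = energy r (cos x) + k0.
Hypothesis U_conj : forall u, U (Cconj u) = U u.
Variable x0 : R.
Hypothesis Hx0 : 0 < x0 < PI.
Hypothesis cos_x0 : cos x0 = X0.

Notation z := (moebius_inv P0 Pinf (polar r0 x0)).

Lemma polar_off_axis r x : 0 < r -> 0 < x < PI -> polar r x <> RtoC 1 /\ 0 < Im (moebius_inv P0 Pinf (polar r x)).
Proof.
  intros Hr Hx. assert (Hs : 0 < r * sin x) by (apply Rmult_lt_0_compat; [exact Hr|apply sin_gt_0; lra]).
  assert (N : polar r x <> RtoC 1). { intros E. injection E as _ E. lra. }
  split; [exact N|]. rewrite moebius_inv_im by exact N.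
  apply Rdiv_lt_0_compat.
  - apply Rmult_lt_0_compat; [lra|exact Hs].
  - apply pow_lt, Cmod_gt_0, Csub_neq, N.
Qed.

Lemma U_saddle : U z = energy r0 X0 + k0.
Proof.
  rewrite U_energy, cos_x0; [reflexivity| |apply polar_off_axis; assumption].
  rewrite cos_x0. apply regular_interior; assumption.
Qed.

Section Target.
Variables rc xe e : R.
Hypothesis He : (e = 1 /\ xe = 0) \/ (e = -1 /\ xe = PI).
Hypothesis Hrc : e * rc <> 1.

Lemma touching r x : 0 < r -> (0 < x < PI \/ x = xe /\ r = rc) ->
  polar r x <> RtoC 1 /\ touches (moebius_real P0 Pinf (e * rc)) (moebius_inv P0 Pinf (polar r x)).
Proof.
  intros Hr [Hx|[-> ->]].
  - destruct (polar_off_axis r x Hr Hx). split; [assumption|left; assumption].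
  - assert (E : polar rc xe = RtoC (e * rc)).
    { unfold polar, RtoC. destruct He as [[-> ->]|[-> ->]]; [rewrite cos_0, sin_0|rewrite cos_PI, sin_PI]; f_equal; ring. }
    split; [rewrite E; apply RtoC_neq, Hrc|]. right. apply moebius_inv_real; [exact Hrc|exact E].
Qed.

Lemma end_point : moebius_inv P0 Pinf (polar rc xe) = RtoC (moebius_real P0 Pinf (e * rc)).
Proof.
  apply moebius_inv_real; [exact Hrc|]. unfold polar, RtoC.
  destruct He as [[-> ->]|[-> ->]]; [rewrite cos_0, sin_0|rewrite cos_PI, sin_PI]; f_equal; ring.
Qed.

Lemma descend_linked x1 : pconn (below p1 p2 p3 c1 c2 c3 t0 r0 X0 rc xe) r0 x1 rc xe ->
  exists l, linked (fun u => U u < U z /\ touches (moebius_real P0 Pinf (e * rc)) u)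
    (moebius_inv P0 Pinf (polar r0 x1)) (RtoC (moebius_real P0 Pinf (e * rc))) l.
Proof.
  intros H. rewrite <- end_point. eapply pconn_linked; [|exact H].
  intros r x (HR & HE & HT). destruct (touching r x (proj1 HR) HT) as [N T].
  split; [exact N|]. split; [|exact T]. rewrite U_saddle, U_energy by assumption. lra.
Qed.

Lemma ascend_linked r1 : xe = PI -> pconn (above p1 p2 p3 c1 c2 c3 t0 r0 X0 rc PI) r1 x0 rc PI ->
  exists l, linked (fun u => U z < U u /\ touches (moebius_real P0 Pinf (e * rc)) u)
    (moebius_inv P0 Pinf (polar r1 x0)) (RtoC (moebius_real P0 Pinf (e * rc))) l.
Proof.
  intros Hxe H. rewrite <- end_point, Hxe. eapply pconn_linked; [|exact H].
  intros r x (HR & HE & HT). destruct (touching r x (proj1 HR)) as [N T]; [rewrite Hxe; exact HT|].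
  split; [exact N|]. split; [|exact T]. rewrite U_saddle, U_energy by assumption. lra.
Qed.
End Target.

(** The pairs of first pieces meet at the saddle; all others are separated by the energy. *)
Definition descending (c : C1path) : Prop :=
  (forall s, 0 <= s <= 1 -> U (c s) < U z) \/
  exists x1 N, Rabs (x1 - x0) < PI /\ c = polar_path P0 Pinf r0 x0 r0 x1 N /\
   forall s, 0 <= s <= 1 -> U (c s) <= U z /\ 0 < Im (c s).

Definition ascending (c : C1path) : Prop :=
  (forall s, 0 <= s <= 1 -> U z < U (c s)) \/
  exists r1 N, 0 < r1 /\ c = polar_path P0 Pinf r0 x0 r1 x0 N /\
   forall s, 0 <= s <= 1 -> U z <= U (c s) /\ 0 < Im (c s).

(** Unless both are first pieces, the strict energy inequality on one of them separates the curves.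
    Two first pieces are an arc and a ray; a first piece and a reflected one are separated by the
    real axis. *)
Lemma descending_good c g : descending c -> ascending g -> good c g /\ good c (conj_path g).
Proof.
  intros Hd Ha.
  assert (Hc' : forall s, 0 <= s <= 1 -> U (c s) <= U z).
  { intros s Hs. destruct Hd as [H|(x1 & N & _ & _ & H)]; [left; auto|apply H, Hs]. }
  assert (Hg' : forall s, 0 <= s <= 1 -> U z <= U (g s)).
  { intros s Hs. destruct Ha as [H|(x1 & N & _ & _ & H)]; [left; auto|apply H, Hs]. }
  destruct Hd as [Hd|(x1 & N & Hx1 & -> & Hd)].
  { split; apply good_disjoint; intros s t Hs Ht E; specialize (Hd s Hs); specialize (Hg' t Ht); simpl in *.
    - rewrite E in Hd. lra.
    - rewrite E, U_conj in Hd. lra. }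
  destruct Ha as [Ha|(r1 & N' & Hr1 & -> & Ha)].
  { split; apply good_disjoint; intros s t Hs Ht E; specialize (Ha t Ht); specialize (Hc' s Hs).
    - rewrite E in Hc'. lra.
    - rewrite E in Hc'. cbn [path conj_path] in Hc'. rewrite U_conj in Hc'. lra. }
  split; [apply good_polar; trivial; lra|].
  apply good_disjoint. intros s t Hs Ht E. specialize (Hd s Hs). specialize (Ha t Ht).
  rewrite E in Hd. destruct Hd as [_ Hd]. destruct Ha as [_ Ha]. simpl in Hd, Ha. lra.
Qed.

Lemma valley_path e xe klo khi l : (e = 1 /\ xe = 0 \/ e = -1 /\ xe = PI) ->
  0 <= klo -> (e = 1 -> klo < p3 < khi) -> (e = -1 -> klo < - p2 /\ - p1 < khi) ->
  exists rc lc, klo < rc < khi /\ ~ In rc (1 :: l) /\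
    path_to (fun u => U u < U z) z (moebius_real P0 Pinf (e * rc)) lc /\ (forall c, In c lc -> descending c).
Proof.
  intros He Hk H1 H2.
  destruct (valley p1 p2 p3 c1 c2 c3 t0 r0 X0) with (x0 := x0) (e := e) (xe := xe) (klo := klo) (khi := khi) (l := 1 :: l)
    as (x1 & rc & Hx1 & Hne & Hfirst & Hrc & Hl & Hconn); trivial.
  assert (Hrc1 : e * rc <> 1).
  { intros E. destruct He as [[-> _]|[-> _]]; [apply Hl; left; lra|lra]. }
  destruct (descend_linked rc xe e He Hrc1 x1 Hconn) as (l' & Hl').
  assert (N : forall k, 0 <= k <= 1 -> polar (r0 + k * (r0 - r0)) (x0 + k * (x1 - x0)) <> RtoC 1).
  { intros k Hk'. apply polar_off_axis; [rewrite Rminus_diag, Rmult_0_r; lra|].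
    destruct (convex_between x0 x1 k Hk'); lra. }
  assert (F : forall s, 0 < smooth s <= 1 -> U (moebius_inv P0 Pinf (pseg r0 x0 r0 x1 s)) < U z /\
     0 < Im (moebius_inv P0 Pinf (pseg r0 x0 r0 x1 s))).
  { intros s Hs. unfold pseg. replace (r0 + smooth s * (r0 - r0)) with r0 by ring.
    destruct (Hfirst (smooth s) Hs) as [Hr HE]. destruct (polar_off_axis r0 _ Hr0 Hr) as [Hn Him].
    split; [|exact Him]. rewrite U_saddle, U_energy; [lra| |exact Hn].
    apply regular_interior; trivial. apply cos_open, Hr. }
  exists rc, (polar_path P0 Pinf r0 x0 r0 x1 N :: l'). split; [exact Hrc|]. split; [exact Hl|].
  split.
  - exists (polar_path P0 Pinf r0 x0 r0 x1 N), l'. split; [reflexivity|]. split; [simpl; rewrite pseg_0; reflexivity|].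
    split.
    + intros s Hs. destruct (F s) as [F1 F2]; [split; [apply smooth_pos, Hs|apply smooth_range]|].
      split; [exact F1|left; exact F2].
    + simpl path. rewrite pseg_1. exact Hl'.
  - intros c [<-|Hin].
    + right. exists x1, N. split; [|split; [reflexivity|]].
      * apply Rabs_def1; lra.
      * intros s Hs. destruct (Req_dec_T (smooth s) 0) as [E0|Hs0].
        -- assert (E : pseg r0 x0 r0 x1 s = polar r0 x0) by (unfold pseg; rewrite E0, !Rmult_0_l, !Rplus_0_r; reflexivity).
           change (U (moebius_inv P0 Pinf (pseg r0 x0 r0 x1 s)) <= U z /\ 0 < Im (moebius_inv P0 Pinf (pseg r0 x0 r0 x1 s))).
           rewrite E. split; [apply Rle_refl|exact (proj2 (polar_off_axis r0 x0 Hr0 Hx0))].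
        -- pose proof (smooth_range s). destruct (F s) as [F1 F2]; [lra|]. split; [left; exact F1|exact F2].
    + left. intros s Hs. apply (linked_points _ _ _ _ Hl' c s Hin Hs).
Qed.

Lemma ridge_path d r1 rc : 0 < d < r0 -> (forall r, 0 < Rabs (r - r0) <= d -> energy r0 X0 < energy r X0) ->
  (r1 = r0 + d \/ r1 = r0 - d) -> 0 < rc ->
  pconn (above p1 p2 p3 c1 c2 c3 t0 r0 X0 rc PI) r1 x0 rc PI ->
  exists lc, path_to (fun u => U z < U u) z (moebius_real P0 Pinf (- rc)) lc /\ (forall c, In c lc -> ascending c).
Proof.
  intros Hd Hnear Hr1 Hrc Hconn.
  assert (Hrc1 : -1 * rc <> 1) by lra.
  destruct (ascend_linked rc PI (-1)) with (r1 := r1) as (l' & Hl'); trivial; [right; auto|].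
  replace (-1 * rc) with (- rc) in Hl' by ring.
  assert (R : forall k, 0 <= k <= 1 -> 0 < r0 + k * (r1 - r0) /\ (0 < k -> 0 < Rabs (r0 + k * (r1 - r0) - r0) <= d)).
  { intros k Hk. destruct Hr1 as [-> | ->].
    - replace (r0 + d - r0) with d by ring. assert (0 <= k * d) by nra. split; [lra|]. intros Hk0.
      replace (r0 + k * d - r0) with (k * d) by ring. rewrite Rabs_right by lra. split; nra.
    - replace (r0 - d - r0) with (- d) by ring. assert (k * d <= d) by nra. split; [lra|]. intros Hk0.
      replace (r0 + k * - d - r0) with (- (k * d)) by ring. rewrite Rabs_Ropp, Rabs_right by nra. split; nra. }
  assert (N : forall k, 0 <= k <= 1 -> polar (r0 + k * (r1 - r0)) (x0 + k * (x0 - x0)) <> RtoC 1).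
  { intros k Hk'. apply polar_off_axis; [apply R, Hk'|]. replace (x0 + k * (x0 - x0)) with x0 by ring. exact Hx0. }
  assert (F : forall s, U z < U (moebius_inv P0 Pinf (pseg r0 x0 r1 x0 s)) \/ smooth s = 0).
  { intros s. destruct (Req_dec_T (smooth s) 0) as [E0|Hs0]; [right; exact E0|left].
    pose proof (smooth_range s) as Hs. unfold pseg. replace (x0 + smooth s * (x0 - x0)) with x0 by ring.
    destruct (R (smooth s) Hs) as [R1 R2]. specialize (R2 ltac:(lra)).
    rewrite U_saddle, U_energy.
    - rewrite cos_x0. specialize (Hnear _ R2). lra.
    - rewrite cos_x0. apply regular_interior; assumption.
    - apply polar_off_axis; assumption. }
  assert (F' : forall s, 0 < Im (moebius_inv P0 Pinf (pseg r0 x0 r1 x0 s))).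
  { intros s. unfold pseg. replace (x0 + smooth s * (x0 - x0)) with x0 by ring.
    apply polar_off_axis; [apply R, smooth_range|exact Hx0]. }
  assert (Hr1p : 0 < r1) by (destruct Hr1; lra).
  exists (polar_path P0 Pinf r0 x0 r1 x0 N :: l'). split.
  - exists (polar_path P0 Pinf r0 x0 r1 x0 N), l'. split; [reflexivity|]. split; [simpl; rewrite pseg_0; reflexivity|].
    split.
    + intros s Hs. split; [|left; apply F']. destruct (F s) as [|E]; [assumption|].
      pose proof (smooth_pos s Hs). lra.
    + simpl path. rewrite pseg_1. exact Hl'.
  - intros c [<-|Hin].
    + right. exists r1, N. split; [exact Hr1p|]. split; [reflexivity|]. intros s Hs. split; [|apply F'].
      destruct (F s) as [|E]; [left; assumption|].
      assert (E' : pseg r0 x0 r1 x0 s = polar r0 x0) by (unfold pseg; rewrite E, !Rmult_0_l, !Rplus_0_r; reflexivity).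
      change (U z <= U (moebius_inv P0 Pinf (pseg r0 x0 r1 x0 s))). rewrite E'. apply Rle_refl.
    + left. intros s Hs. apply (linked_points _ _ _ _ Hl' c s Hin Hs).
Qed.

(** The windows contain the positive charges, where the energy tends to minus infinity, so a descent
    can always be made to end in them. They are left free, to be matched with the gaps between the
    parameters; [Q] lists the points the crossings must miss. [ri] and [ro] are as small and as
    large as required, so that the ridge encloses the prescribed poles. *)
Theorem steepest_curves (Q : list R) klop khip klom khim eps M :
  0 <= klop -> klop < p3 < khip -> 0 <= klom -> klom < - p2 -> - p1 < khim -> 0 < eps ->
  exists lp lm gi go rp rm ri ro,
    klop < rp < khip /\ klom < rm < khim /\ 0 < ri < eps /\ M < ro /\ ri < rm < ro /\
    path_to (fun u => U u < U z) z (moebius_real P0 Pinf rp) lp /\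
    path_to (fun u => U u < U z) z (moebius_real P0 Pinf (- rm)) lm /\
    path_to (fun u => U z < U u) z (moebius_real P0 Pinf (- ri)) gi /\
    path_to (fun u => U z < U u) z (moebius_real P0 Pinf (- ro)) go /\
    rp <> 1 /\
    (forall q, In q Q -> moebius_real P0 Pinf rp <> q /\ moebius_real P0 Pinf (- rm) <> q /\
       moebius_real P0 Pinf (- ri) <> q /\ moebius_real P0 Pinf (- ro) <> q) /\
    forall c g, In c lp \/ In c lm -> In g gi \/ In g go -> good c g /\ good c (conj_path g).
Proof.
  intros Hk1 Hk2 Hk3 Hk4 Hk5 Heps.
  set (ZQ := map (fun q => (q - P0) / (q - Pinf)) Q).
  destruct (list_bound ZQ) as (MQ & HMQ & HbM). destruct (list_away ZQ) as (eQ & HeQ & Hbe).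
  destruct (valley_path 1 0 klop khip ZQ) as (rp & lp & Hrp & Hrpl & Pp & Dp); [auto|lra|intros; lra|intros; lra|].
  destruct (valley_path (-1) PI klom khim (map Ropp ZQ)) as (rm & lm & Hrm & Hrml & Pm & Dm); [auto|lra|intros; lra|intros; lra|].
  rewrite Rmult_1_l in Pp. replace (-1 * rm) with (- rm) in Pm by ring.
  destruct (higher_near_saddle p1 p2 p3 c1 c2 c3 t0 r0 X0) as (d & Hd & Hnear); trivial.
  destruct (ridge p1 p2 p3 c1 c2 c3 t0 r0 X0) with (x0 := x0) (d := d) as [Ro Ri]; trivial.
  destruct (Ro (Rmax (Rmax M MQ) rm)) as (ro & Hro & Co).
  destruct (Ri (Rmin (Rmin eps eQ) rm)) as (ri & Hri & Ci); [repeat apply Rmin_glb_lt; lra|].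
  assert (ro > M /\ ro > MQ /\ ro > rm) as (Hro1 & Hro2 & Hro3).
  { pose proof (Rmax_l (Rmax M MQ) rm). pose proof (Rmax_r (Rmax M MQ) rm). pose proof (Rmax_l M MQ). pose proof (Rmax_r M MQ). lra. }
  assert (ri < eps /\ ri < eQ /\ ri < rm) as (Hri1 & Hri2 & Hri3).
  { pose proof (Rmin_l (Rmin eps eQ) rm). pose proof (Rmin_r (Rmin eps eQ) rm). pose proof (Rmin_l eps eQ). pose proof (Rmin_r eps eQ). lra. }
  destruct (ridge_path d (r0 + d) ro) as (go & Po & Ao); trivial; [auto|lra|].
  destruct (ridge_path d (r0 - d) ri) as (gi & Pi & Ai); trivial; [auto|lra|].
  exists lp, lm, gi, go, rp, rm, ri, ro.
  assert (Hrp1 : rp <> 1). { intros E. apply Hrpl. left; auto. }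
  repeat (split; [first [assumption|lra]|]). split.
  - intros q Hq. assert (HPn : Pinf <> P0) by lra.
    repeat split; (eapply moebius_real_neq; [exact HPn|exact Hq|lra|]); fold ZQ.
    + intros H. apply Hrpl. right. exact H.
    + intros H. apply Hrml. right. apply in_map_iff. exists (- rm). split; [ring|exact H].
    + intros H. specialize (Hbe _ H ltac:(lra)). rewrite Rabs_Ropp, Rabs_right in Hbe by lra. lra.
    + intros H. specialize (HbM _ H). rewrite Rabs_Ropp, Rabs_right in HbM by lra. lra.
  - intros c g Hc' Hg'. apply descending_good; [destruct Hc'; auto|destruct Hg'; auto].
Qed.
End Steepest.

(** * Vanishing of the error integrals *)

Lemma path_to_points P z b l : path_to P z b l -> forall g s, In g l -> 0 <= s <= 1 ->
  g s = z \/ P (g s) /\ touches b (g s).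
Proof.
  intros (g0 & l' & -> & E0 & H0 & Hl) g s [<-|Hin] Hs.
  - destruct (Req_dec_T s 0) as [->|Hn]; [left; exact E0|right; apply H0; lra].
  - right. apply (linked_points _ _ _ _ Hl g s Hin Hs).
Qed.

Lemma path_to_open P z b l : path_to P z b l -> forall g s, In g l -> 0 < s < 1 -> P (g s).
Proof.
  intros (g0 & l' & -> & E0 & H0 & Hl) g s [<-|Hin] Hs; [apply H0; lra|].
  apply (linked_points _ _ _ _ Hl g s Hin); lra.
Qed.

Lemma on_arc_chain l q : on_chain (arc_chain l) q <->
  exists g s, In g l /\ 0 <= s <= 1 /\ (q = g s \/ q = Cconj (g s)).
Proof.
  split.
  - intros (c & g & s & Hin & Hs & <-). apply in_arc_chain in Hin as (_ & h & Hh & [->| ->]).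
    + exists h, s; auto.
    + exists h, s; auto.
  - intros (g & s & Hin & Hs & Hq). unfold arc_chain. rewrite on_chain_app. destruct Hq as [->| ->].
    + right. exists (-1), g, s. split; [apply in_pieces; auto|auto].
    + left. exists 1, (conj_path g), s. split; [apply in_pieces; split; [reflexivity|apply in_map, Hin]|auto].
Qed.

Lemma path_to_crossing P z b l : 0 < Im z -> path_to P z b l -> crossing (arc_chain l) z (fun x => x = b).
Proof.
  intros Hz H. split.
  - destruct H as (g0 & l' & -> & E0 & H0 & Hl). intros F.
    rewrite <- E0. apply (arc_chain_bdry (fun _ => True) (g0 0) b).
    apply linked_cons; [trivial|]. clear - Hl. induction Hl; constructor; trivial.
  - intros q Hq Him. apply on_arc_chain in Hq as (g & s & Hin & Hs & Hq).
    destruct (path_to_points _ _ _ _ H g s Hin Hs) as [E|[_ [T|T]]].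
    + destruct Hq as [->| ->]; rewrite E in Him; unfold Im in *; simpl in Him; lra.
    + unfold Im in *. destruct Hq as [->| ->]; simpl in Him; lra.
    + destruct Hq as [->| ->]; rewrite T; reflexivity.
Qed.

Lemma wind_path (gam : chain) (g : C1path) a b : cycle gam -> a <= b ->
  (forall s, a <= s <= b -> ~ on_chain gam (g s)) -> wind gam (g a) = wind gam (g b).
Proof.
  intros Hc Hab Hoff. apply (wind_constant gam g (velocity g)); trivial. intros; apply path_derive.
Qed.

Lemma wind_linked gam P p q l : cycle gam -> linked P p q l -> (forall u, P u -> ~ on_chain gam u) ->
  wind gam p = wind gam q /\ forall g s, In g l -> 0 <= s <= 1 -> wind gam (g s) = wind gam q.
Proof.
  intros Hc Hl Hoff. induction Hl as [p Hp|g q l Hg _ [IH1 IH2]].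
  - split; [reflexivity|]. intros g s [].
  - assert (K : forall s, 0 <= s <= 1 -> wind gam (g s) = wind gam q).
    { intros s Hs. rewrite <- IH1. apply wind_path; [exact Hc|lra|]. intros; apply Hoff, Hg; lra. }
    split; [apply K; lra|]. intros h s [<-|Hin] Hs; auto.
Qed.

(** After its start the path never meets the cycle, so the winding number along the path can be read
    off at its real end point. *)
Lemma wind_path_to gam P z b l : cycle gam -> path_to P z b l -> (forall u, P u -> ~ on_chain gam u) ->
  forall g s, In g l -> 0 < s <= 1 -> wind gam (g s) = wind gam (RtoC b).
Proof.
  intros Hc (g0 & l' & -> & E0 & H0 & Hl) Hoff g s Hin Hs.
  assert (Hoff' : forall u, P u /\ touches b u -> ~ on_chain gam u) by (intros u [Hu _]; auto).
  destruct (wind_linked gam _ _ _ _ Hc Hl Hoff') as [W1 W2].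
  destruct Hin as [<-|Hin]; [|apply W2; [exact Hin|lra]].
  rewrite <- W1. apply wind_path; [exact Hc|lra|]. intros t Ht. apply Hoff, H0; lra.
Qed.

Lemma linked_impl (P Q : C -> Prop) p q l : (forall u, P u -> Q u) -> linked P p q l -> linked Q p q l.
Proof. intros H. induction 1; constructor; auto. Qed.

Lemma wind_conj_path_to gam P z b l : cycle gam -> path_to P z b l -> (forall u, P u -> ~ on_chain gam (Cconj u)) ->
  forall g s, In g l -> 0 < s <= 1 -> wind gam (Cconj (g s)) = wind gam (RtoC b).
Proof.
  intros Hc (g0 & l' & -> & E0 & H0 & Hl) Hoff g s Hin Hs.
  assert (Hl' := linked_conj _ _ _ _ Hl).
  assert (Hoff' : forall u, P (Cconj u) /\ touches b (Cconj u) -> ~ on_chain gam u).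
  { intros u [Hu _] Hon. apply (Hoff _ Hu). rewrite Cconj_conj. exact Hon. }
  destruct (wind_linked gam _ _ _ _ Hc Hl' Hoff') as [W1 W2].
  replace (Cconj (RtoC b)) with (RtoC b) in * by (unfold Cconj, RtoC; simpl; f_equal; ring).
  destruct Hin as [<-|Hin].
  - rewrite <- W1. apply (wind_path gam (conj_path g0)); [exact Hc|lra|]. intros t Ht. apply Hoff, H0; lra.
  - apply (W2 (conj_path g) s); [apply in_map, Hin|lra].
Qed.

Lemma chain_small (l : chain) (f : nat -> C -> C) :
  (forall c (g : C1path), In (c, g) l -> forall eps, 0 < eps -> exists N1, forall N, (N1 <= N)%nat ->
     forall V, isCint (fun s => f N (g s) * velocity g s)%C V -> Cmod V <= eps) ->
  forall eps, 0 < eps -> exists N1, forall N, (N1 <= N)%nat -> forall V, chain_int l (f N) V -> Cmod V <= eps.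
Proof.
  induction l as [|[c g] l IH]; intros H eps Heps.
  - exists O. intros N _ V ->. rewrite Cmod_0. lra.
  - destruct (IH (fun c' g' Hin => H c' g' (or_intror Hin)) (eps / 2)) as (N1 & H1); [lra|].
    pose proof (Rabs_pos c) as Hc.
    destruct (H c g (or_introl eq_refl) (eps / 2 / (Rabs c + 1))) as (N2 & H2); [apply Rdiv_lt_0_compat; lra|].
    exists (max N1 N2). intros N HN V (v1 & v2 & I1 & I2 & ->).
    specialize (H1 N ltac:(lia) _ I2). specialize (H2 N ltac:(lia) _ I1).
    apply Rle_trans with (1 := Cmod_triangle _ _). rewrite Cmod_mult, Cmod_R.
    assert (Rabs c * Cmod v1 <= Rabs c * (eps / 2 / (Rabs c + 1))) by (apply Rmult_le_compat_l; assumption).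
    assert (Rabs c * (eps / 2 / (Rabs c + 1)) <= eps / 2).
    { apply Rmult_le_reg_r with (Rabs c + 1); [lra|].
      replace (Rabs c * (eps / 2 / (Rabs c + 1)) * (Rabs c + 1)) with (Rabs c * (eps / 2)) by (field; lra). nra. }
    lra.
Qed.

Section Vanishing.
Variables (U : C -> R) (z : C) (b ai ao : R) (l gi go : list C1path).
Hypothesis U_conj : forall u, U (Cconj u) = U u.
Hypothesis Hz : 0 < Im z.
Hypothesis Hl : path_to (fun u => U u < U z) z b l.
Hypothesis Hgi : path_to (fun u => U z < U u) z ai gi.
Hypothesis Hgo : path_to (fun u => U z < U u) z ao go.
Hypothesis Hgood : forall c g, In c l -> In g gi \/ In g go -> good c g /\ good c (conj_path g).
Hypothesis U_cont : forall (c : C1path) s, In c l -> 0 <= s <= 1 -> continuous (fun s => U (c s)) s.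

(** The closed ridge: both arcs run from the conjugate of [z] to [z], through [ai] and through [ao],
    and are subtracted. *)
Definition ridge_chain : chain := diff_chain (arc_chain gi) (arc_chain go).

Lemma ridge_cycle : cycle ridge_chain.
Proof. exact (cycle_diff _ _ _ _ _ (path_to_crossing _ _ _ _ Hz Hgi) (path_to_crossing _ _ _ _ Hz Hgo)). Qed.

Lemma ridge_high u : on_chain ridge_chain u -> U z <= U u.
Proof.
  unfold ridge_chain. rewrite on_diff_chain, !on_arc_chain.
  assert (K : forall a g, path_to (fun u => U z < U u) z a g ->
    (exists h s, In h g /\ 0 <= s <= 1 /\ (u = h s \/ u = Cconj (h s))) -> U z <= U u).
  { intros a g H (h & s & Hin & Hs & Hu). assert (U z <= U (h s)).
    { destruct (path_to_points _ _ _ _ H h s Hin Hs) as [->|[H' _]]; lra. }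
    destruct Hu as [->| ->]; [|rewrite U_conj]; assumption. }
  intros [H|H]; eauto.
Qed.

Lemma in_ridge k g : In (k, g) ridge_chain -> exists h, (In h gi \/ In h go) /\ (g = h \/ g = conj_path h).
Proof.
  unfold ridge_chain, diff_chain. intros H. apply in_app_or in H as [H|H].
  - apply in_arc_chain in H as (_ & h & Hh & E). exists h; auto.
  - unfold scale_chain in H. apply in_map_iff in H as ([k' g'] & E & H). injection E as _ <-.
    apply in_arc_chain in H as (_ & h & Hh & E). exists h; auto.
Qed.

Lemma arc_good c k g h : In h l -> (c = h \/ c = conj_path h) -> In (k, g) ridge_chain -> good c g.
Proof.
  intros Hh Hc Hg. apply in_ridge in Hg as (g' & Hg' & Hg).
  destruct (Hgood h g' Hh Hg') as [G1 G2].
  destruct Hc as [->| ->], Hg as [->| ->]; trivial.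
  - apply good_conj_l, G2.
  - apply good_conj, G1.
Qed.

Variables (F : nat -> C -> C) (T : nat -> pfrac) (cut : nat -> R) (wl wh wb C0 : R).
Hypothesis HC0 : 0 <= C0.
Hypothesis wind_b : wind ridge_chain (RtoC b) = RtoC wb.
Hypothesis bounds : exists N0, forall N, (N0 <= N)%nat ->
  (forall u, on_chain (arc_chain l) u -> Cmod (F N u) <= C0 * exp (INR N * U u)) /\
  (forall u, on_chain ridge_chain u -> Cmod (pf_eval (T N) u) <= C0 * exp (- (INR N * U u))) /\
  pf_poles (T N) (fun p => ~ on_chain ridge_chain (RtoC p) /\
    (p < cut N -> wind ridge_chain (RtoC p) = RtoC wl) /\ (cut N <= p -> wind ridge_chain (RtoC p) = RtoC wh)).

(** The combination of low and high parts is exactly the Cauchy integral of [T N] over the ridge: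
    the weights are the ridge windings of the poles minus the winding [wb] of the ridge around the
    descent curve. [piece_limit] then applies to every piece. *)
Lemma vanishing : forall eps, 0 < eps -> exists N1, forall N, (N1 <= N)%nat ->
  forall V, chain_int (arc_chain l)
    (fun u => F N u * (RtoC (wl - wb) * pf_eval (low (cut N) (T N)) u + RtoC (wh - wb) * pf_eval (high (cut N) (T N)) u))%C V ->
  Cmod V <= eps.
Proof.
  apply (chain_small (arc_chain l) (fun N u => F N u * (RtoC (wl - wb) * pf_eval (low (cut N) (T N)) u + RtoC (wh - wb) * pf_eval (high (cut N) (T N)) u))%C).
  intros c g Hin. pose proof Hin as Hin'. apply in_arc_chain in Hin' as (_ & h & Hh & Hg).
  destruct bounds as (N0 & HN0).
  assert (Ug : forall s, U (g s) = U (h s)). { intros s. destruct Hg as [->| ->]; [reflexivity|apply U_conj]. }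
  assert (Uopen : forall s, 0 < s < 1 -> U (h s) < U z) by (intros; apply (path_to_open _ _ _ _ Hl); assumption).
  assert (Uend : forall s, 0 <= s <= 1 -> U (h s) <= U z).
  { intros s Hs. destruct (path_to_points _ _ _ _ Hl h s Hh Hs) as [->|[H _]]; lra. }
  assert (Upos : forall s, 0 < s <= 1 -> U (h s) < U z).
  { intros s Hs. destruct Hl as (g0 & l' & El & E0 & H0 & Hl'). rewrite El in Hh.
    destruct Hh as [<-|Hh]; [apply H0, Hs|]. apply (linked_points _ _ _ _ Hl' h s Hh); lra. }
  assert (Off : forall u, U u < U z -> ~ on_chain ridge_chain u).
  { intros u Hu Hon. apply ridge_high in Hon. lra. }
  apply (piece_limit ridge_chain g F (fun N => pf_eval (T N))
    (fun N u => (RtoC (wl - wb) * pf_eval (low (cut N) (T N)) u + RtoC (wh - wb) * pf_eval (high (cut N) (T N)) u)%C)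
    (2 * PI * Ci)%C (C0 * C0) (fun s => U z - U (h s))).
  - intros k g' Hg'. eapply arc_good; eassumption.
  - apply two_pi_i_neq_0.
  - nra.
  - intros s Hs. apply (continuous_minus (V := R_NormedModule)); [apply continuous_const|apply U_cont; assumption].
  - intros s Hs. specialize (Uend s Hs). lra.
  - intros s Hs. specialize (Upos s Hs). lra.
  - exists N0. intros N HN. destruct (HN0 N HN) as (BF & BT & HT). split; [|split].
    + intros s k g' t Hs Hg' Ht.
      assert (B1 : Cmod (F N (g s)) <= C0 * exp (INR N * U (g s))).
      { apply BF. exists c, g, s. split; [exact Hin|]. split; [lra|reflexivity]. }
      assert (On : on_chain ridge_chain (g' t)) by (exists k, g', t; auto).
      assert (B2 := BT _ On). apply ridge_high in On.
      apply Rle_trans with ((C0 * exp (INR N * U (g s))) * (C0 * exp (- (INR N * U (g' t))))).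
      { apply Rmult_le_compat; trivial; apply Cmod_ge_0. }
      replace (C0 * exp (INR N * U (g s)) * (C0 * exp (- (INR N * U (g' t))))) with (C0 * C0 * exp (INR N * U (g s) + - (INR N * U (g' t)))) by (rewrite exp_plus; ring).
      apply Rmult_le_compat_l; [nra|]. apply exp_le. rewrite Ug. pose proof (pos_INR N). nra.
    + intros s k g' t Hs Hg' Ht E. apply (Off (g s)); [rewrite Ug; apply Uopen, Hs|].
      exists k, g', t. auto.
    + intros s Hs.
      assert (W : wind ridge_chain (g s) = RtoC wb).
      { rewrite <- wind_b. destruct Hg as [->| ->].
        - apply (wind_path_to _ _ _ _ _ ridge_cycle Hl Off h s Hh); lra.
        - apply (wind_conj_path_to _ _ _ _ _ ridge_cycle Hl) ; [|exact Hh|lra].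
          intros u Hu. apply Off. rewrite U_conj. exact Hu. }
      assert (HG := Cauchy_pf ridge_chain (T N) (g s) ridge_cycle).
      rewrite (pf_weight_low_high (cut N) (T N) _ (RtoC (wl - wb)) (RtoC (wh - wb))) in HG.
      * apply HG; [apply Off; rewrite Ug; apply Uopen, Hs|].
        eapply pf_poles_impl; [|exact HT]. intros p Hp; apply Hp.
      * rewrite W. eapply pf_poles_impl; [|exact HT]. intros p (_ & K1 & K2). rewrite !RtoC_minus.
        split; intros Hp; [rewrite (K1 Hp)|rewrite (K2 Hp)]; reflexivity.
Qed.
End Vanishing.

(** * Moving the contours *)

Definition left_of (b p : R) : R := if Rlt_dec b p then 1 else 0.

Lemma crossing_at l z b p : 0 < Im z -> crossing l z (fun x => x = b) -> p <> b -> passes l z p (left_of b p).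
Proof.
  intros Hz Hl Hp. destruct (crossing_passes l z _ p Hz Hl) as [H1 H2]. unfold left_of.
  destruct (Rlt_dec b p); [apply H2; intros; lra|apply H1; intros; lra].
Qed.

Lemma crossing_off l z b u : crossing l z (fun x => x = b) -> on_chain l u -> forall p : R, p <> b -> u <> RtoC p.
Proof. intros [_ H] Hu p Hp E. apply Hp. specialize (H u Hu). rewrite E in H. apply H. reflexivity. Qed.

Lemma crossing_pf_int T1 T2 l z b : crossing l z (fun x => x = b) ->
  pf_poles T1 (fun p => p <> b) -> pf_poles T2 (fun p => p <> b) ->
  exists V, chain_int l (fun u => pf_eval T1 u * pf_eval T2 u)%C V.
Proof.
  intros Hl H1 H2. apply chain_int_exists. intros c g t Hin Ht.
  assert (Hon : on_chain l (g t)) by (exists c, g, t; auto).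
  apply continuous_Cmult; apply (pf_eval_continuous _ g); try apply path_continuous;
    (eapply pf_poles_impl; [|eassumption]); intros p Hp; apply (crossing_off l z b); assumption.
Qed.

Lemma pf_poles_and T P Q : pf_poles T P -> pf_poles T Q -> pf_poles T (fun p => P p /\ Q p).
Proof. intros H1 H2 a Ha. split; auto. Qed.

(** The closed contour and the difference of the two arcs have the same winding around every pole of
    the product, so the residue theorem gives them the same integral. *)
Lemma transfer_closed (g : C1path) T1 T2 l1 l2 z b1 b2 V : 0 < Im z -> g 0 = g 1 ->
  crossing l1 z (fun x => x = b1) -> crossing l2 z (fun x => x = b2) ->
  (forall T, T = T1 \/ T = T2 -> pf_poles T (fun p => p <> b1 /\ p <> b2 /\ ~ on_path g (RtoC p) /\
     winding g (RtoC p) = RtoC (left_of b2 p - left_of b1 p))) ->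
  chain_int (sing g) (fun u => pf_eval T1 u * pf_eval T2 u)%C V ->
  exists V1 V2, chain_int l1 (fun u => pf_eval T1 u * pf_eval T2 u)%C V1 /\
    chain_int l2 (fun u => pf_eval T1 u * pf_eval T2 u)%C V2 /\ V = (V1 - V2)%C.
Proof.
  intros Hz Hg Hl1 Hl2 HT HV.
  destruct (crossing_pf_int T1 T2 l1 z b1 Hl1) as [V1 H1]; [eapply pf_poles_impl; [|apply HT; auto]; intros p Hp; apply Hp..|].
  destruct (crossing_pf_int T1 T2 l2 z b2 Hl2) as [V2 H2]; [eapply pf_poles_impl; [|apply HT; auto]; intros p Hp; apply Hp..|].
  exists V1, V2. split; [exact H1|]. split; [exact H2|].
  apply (chain_int_unique (diff_chain l1 l2) (fun u => pf_eval T1 u * pf_eval T2 u)%C); [|apply chain_int_diff; assumption].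
  assert (G : forall p, p <> b1 /\ p <> b2 /\ ~ on_path g (RtoC p) /\ winding g (RtoC p) = RtoC (left_of b2 p - left_of b1 p) ->
    ~ on_chain (sing g) (RtoC p) /\ ~ on_chain (diff_chain l1 l2) (RtoC p) /\
    wind (sing g) (RtoC p) = (wind (diff_chain l1 l2) (RtoC p) + 0)%C).
  { intros p (N1 & N2 & Hp & W).
    destruct (wind_diff l1 l2 z p _ _ (crossing_at l1 z b1 p Hz Hl1 N1) (crossing_at l2 z b2 p Hz Hl2 N2)) as [O E].
    split; [rewrite on_sing; exact Hp|]. split; [exact O|]. rewrite wind_sing, E, W. ring. }
  apply (pf_mul_int T1 T2 (sing g) (diff_chain l1 l2) 0%C); [apply cycle_sing, Hg|eapply cycle_diff; eassumption| | |exact HV].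
  - eapply pf_poles_impl; [exact G|apply HT; auto].
  - eapply pf_poles_impl; [exact G|apply HT; auto].
Qed.

(** The difference of the arcs is a cycle that winds around no pole. *)
Lemma transfer_arc T1 T2 l1 l2 z b1 b2 : 0 < Im z ->
  crossing l1 z (fun x => x = b1) -> crossing l2 z (fun x => x = b2) ->
  (forall T, T = T1 \/ T = T2 -> pf_poles T (fun p => p <> b1 /\ p <> b2 /\ left_of b1 p = left_of b2 p)) ->
  exists V, chain_int l1 (fun u => pf_eval T1 u * pf_eval T2 u)%C V /\
    chain_int l2 (fun u => pf_eval T1 u * pf_eval T2 u)%C V.
Proof.
  intros Hz Hl1 Hl2 HT.
  destruct (crossing_pf_int T1 T2 l1 z b1 Hl1) as [V1 H1]; [eapply pf_poles_impl; [|apply HT; auto]; intros p Hp; apply Hp..|].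
  destruct (crossing_pf_int T1 T2 l2 z b2 Hl2) as [V2 H2]; [eapply pf_poles_impl; [|apply HT; auto]; intros p Hp; apply Hp..|].
  assert (E : (V1 - V2 = 0)%C).
  { assert (G : forall p, p <> b1 /\ p <> b2 /\ left_of b1 p = left_of b2 p ->
      ~ on_chain (diff_chain l1 l2) (RtoC p) /\ ~ on_chain nil (RtoC p) /\
      wind (diff_chain l1 l2) (RtoC p) = (wind nil (RtoC p) + 0)%C).
    { intros p (N1 & N2 & E).
      destruct (wind_diff l1 l2 z p _ _ (crossing_at l1 z b1 p Hz Hl1 N1) (crossing_at l2 z b2 p Hz Hl2 N2)) as [O W].
      split; [exact O|]. split; [intros (c & g & t & [] & _)|]. rewrite W, E, Rminus_diag.
      unfold wind; simpl. ring. }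
    assert (HD := chain_int_diff _ _ _ _ _ H1 H2).
    apply (pf_mul_int T1 T2 (diff_chain l1 l2) nil 0%C) in HD; [exact HD|eapply cycle_diff; eassumption|intros f; reflexivity| |].
    - eapply pf_poles_impl; [exact G|apply HT; auto].
    - eapply pf_poles_impl; [exact G|apply HT; auto]. }
  exists V1. split; [exact H1|]. replace V1 with (V1 - V2 + V2)%C by ring. rewrite E, Cplus_0_l. exact H2.
Qed.

Lemma low_high_int (T1 T2 : pfrac) b l V1 V2 :
  chain_int l (fun u => pf_eval T1 u * pf_eval (low b T2) u)%C V1 ->
  chain_int l (fun u => pf_eval T1 u * pf_eval (high b T2) u)%C V2 ->
  chain_int l (fun u => pf_eval T1 u * pf_eval T2 u)%C (V1 + V2)%C.
Proof.
  intros H1 H2. assert (H := chain_int_plus _ _ _ _ _ H1 H2). eapply chain_int_ext; [|exact H].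
  intros u _. simpl. rewrite (low_high_eval b T2 u). ring.
Qed.

(** [T1] plays the role of the integrand kept on the steepest descent curves,
    [T2] is split at [b].  The integral over [lG] is the one of the sine kernel. *)
Lemma core_low (g : C1path) T1 T2 b lR lL lG z bR bL bG V : 0 < Im z -> g 0 = g 1 ->
  crossing lR z (fun x => x = bR) -> crossing lL z (fun x => x = bL) -> crossing lG z (fun x => x = bG) ->
  (forall T, T = T1 \/ T = low b T2 -> pf_poles T (fun p => p <> bR /\ p <> bG /\ ~ on_path g (RtoC p) /\
     winding g (RtoC p) = RtoC (left_of bG p - left_of bR p))) ->
  (forall T, T = T1 \/ T = high b T2 -> pf_poles T (fun p => p <> bL /\ p <> bG /\ left_of bL p = left_of bG p)) ->
  chain_int (sing g) (fun u => pf_eval T1 u * pf_eval (low b T2) u)%C V ->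
  exists V1 V2 VG, chain_int lR (fun u => pf_eval T1 u * pf_eval (low b T2) u)%C V1 /\
    chain_int lL (fun u => pf_eval T1 u * pf_eval (high b T2) u)%C V2 /\
    chain_int lG (fun u => pf_eval T1 u * pf_eval T2 u)%C VG /\ V = (V1 + V2 - VG)%C.
Proof.
  intros Hz Hg HR HL HG H1 H2 HV.
  destruct (transfer_closed g T1 (low b T2) lR lG z bR bG V) as (V1 & VG1 & I1 & I2 & ->); trivial.
  destruct (transfer_arc T1 (high b T2) lL lG z bL bG) as (V2 & I3 & I4); trivial.
  exists V1, V2, (VG1 + V2)%C. repeat (split; trivial); [|ring].
  apply low_high_int with b; assumption.
Qed.

(** The kept part is now the high one, and its integral occurs with a minus sign in the double
    integral. The final expression agrees with that of [core_low], so the two nestings are not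
    distinguished afterwards. *)
Lemma core_high (g : C1path) T1 T2 b lR lL lG z bR bL bG V : 0 < Im z -> g 0 = g 1 ->
  crossing lR z (fun x => x = bR) -> crossing lL z (fun x => x = bL) -> crossing lG z (fun x => x = bG) ->
  (forall T, T = T1 \/ T = high b T2 -> pf_poles T (fun p => p <> bG /\ p <> bL /\ ~ on_path g (RtoC p) /\
     winding g (RtoC p) = RtoC (left_of bL p - left_of bG p))) ->
  (forall T, T = T1 \/ T = low b T2 -> pf_poles T (fun p => p <> bR /\ p <> bG /\ left_of bR p = left_of bG p)) ->
  chain_int (sing g) (fun u => pf_eval T1 u * pf_eval (high b T2) u)%C V ->
  exists V1 V2 VG, chain_int lR (fun u => pf_eval T1 u * pf_eval (low b T2) u)%C V1 /\
    chain_int lL (fun u => pf_eval T1 u * pf_eval (high b T2) u)%C V2 /\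
    chain_int lG (fun u => pf_eval T1 u * pf_eval T2 u)%C VG /\ (- V = V1 + V2 - VG)%C.
Proof.
  intros Hz Hg HR HL HG H1 H2 HV.
  destruct (transfer_closed g T1 (high b T2) lG lL z bG bL V) as (VG1 & V2 & I1 & I2 & ->); trivial.
  destruct (transfer_arc T1 (low b T2) lR lG z bR bG) as (V1 & I3 & I4); trivial.
  exists V1, V2, (V1 + VG1)%C. repeat (split; trivial); [|ring].
  apply low_high_int with b; assumption.
Qed.

Ltac left_of_tac := unfold left_of; repeat (destruct Rlt_dec); lra.

Section Core.
Variables (gu gv : C1path) (TA TB : pfrac) (alo blo : R) (z : C) (lR lL lG : chain) (bR bL bG : R).
Hypothesis gu_closed : gu 0 = gu 1.
Hypothesis gv_closed : gv 0 = gv 1.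
Hypothesis A_off : pf_poles TA (fun p => (p < alo -> excludes gu (RtoC p)) /\ (alo <= p -> encircles gu (RtoC p))).
Hypothesis B_off : pf_poles TB (fun p => (p < blo -> encircles gv (RtoC p)) /\ (blo <= p -> excludes gv (RtoC p))).
Hypothesis Hz : 0 < Im z.
Hypothesis HR : crossing lR z (fun x => x = bR).
Hypothesis HL : crossing lL z (fun x => x = bL).
Hypothesis HG : crossing lG z (fun x => x = bG).

(** The sine arc relative to the poles. With [gv] inside, only the low pole of [TA] (the point [x])
    is to its left; with [gu] inside, only the high poles of [TB] (the s^{-2} y) are to its
    right. *)
Definition arc_position : Prop :=
  lies_inside gv gu /\ pf_poles TA (fun p => (p < alo -> p < bG) /\ (alo <= p -> bG < p)) /\ pf_poles TB (fun p => bG < p) \/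
  lies_inside gu gv /\ pf_poles TA (fun p => p < bG) /\ pf_poles TB (fun p => (p < blo -> p < bG) /\ (blo <= p -> bG < p)).

Lemma core_A : arc_position ->
  pf_poles TA (fun p => p < alo /\ p < bL /\ p < bR \/ alo <= p /\ bL < p < bR) ->
  pf_poles TB (fun p => p < blo /\ p < bR \/ blo <= p /\ bL < p) ->
  exists V1 V2 VG, chain_int lR (fun u => pf_eval TA u * pf_eval (low blo TB) u)%C V1 /\
    chain_int lL (fun u => pf_eval TA u * pf_eval (high blo TB) u)%C V2 /\
    chain_int lG (fun u => pf_eval TA u * pf_eval TB u)%C VG /\
    double_int gu gv TA TB = (2 * PI * Ci * (V1 + V2 - VG))%C.
Proof.
  intros [(Hin & GA & GB)|(Hin & GA & GB)] PA PB.
  - destruct (double_int_inside gu gv gu_closed gv_closed TA TB alo blo A_off B_off Hin) as (E1 & E2 & V & -> & I1 & I2).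
    destruct (core_low gu TA TB blo lR lL lG z bR bL bG V) as (V1 & V2 & VG & J1 & J2 & J3 & ->); trivial.
    + intros T [-> | ->].
      * eapply pf_poles_impl; [|exact (pf_poles_and _ _ _ A_off (pf_poles_and _ _ _ GA PA))].
        intros p ((O1 & O2) & (Q1 & Q2) & [K|K]).
        -- destruct (O1 ltac:(lra)) as [N W]. specialize (Q1 ltac:(lra)). rewrite W. repeat split; [lra|lra|exact N|]. f_equal. left_of_tac.
        -- destruct (O2 ltac:(lra)) as [N W]. specialize (Q2 ltac:(lra)). rewrite W. repeat split; [lra|lra|exact N|]. f_equal. left_of_tac.
      * eapply pf_poles_impl; [|exact (pf_poles_and _ _ _ E1 (low_poles _ _ _ (pf_poles_and _ _ _ GB PB)))].
        intros p ([N W] & (Q & K) & Hp). rewrite W. repeat split; [lra|lra|exact N|]. f_equal. left_of_tac.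
    + intros T [-> | ->].
      * eapply pf_poles_impl; [|exact (pf_poles_and _ _ _ GA PA)].
        intros p ((Q1 & Q2) & [K|K]); [specialize (Q1 ltac:(lra))|specialize (Q2 ltac:(lra))]; repeat split; try lra; left_of_tac.
      * eapply pf_poles_impl; [|exact (high_poles _ _ _ (pf_poles_and _ _ _ GB PB))].
        intros p ((Q & K) & Hp). repeat split; try lra. left_of_tac.
    + exists V1, V2, VG; auto.
  - destruct (double_int_outside gu gv gu_closed gv_closed TA TB alo blo A_off B_off Hin) as (E1 & E2 & V & -> & I1 & I2).
    destruct (core_high gu TA TB blo lR lL lG z bR bL bG V) as (V1 & V2 & VG & J1 & J2 & J3 & E); trivial.
    + intros T [-> | ->].
      * eapply pf_poles_impl; [|exact (pf_poles_and _ _ _ A_off (pf_poles_and _ _ _ GA PA))].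
        intros p ((O1 & O2) & Q & [K|K]).
        -- destruct (O1 ltac:(lra)) as [N W]. rewrite W. repeat split; [lra|lra|exact N|]. f_equal. left_of_tac.
        -- destruct (O2 ltac:(lra)) as [N W]. rewrite W. repeat split; [lra|lra|exact N|]. f_equal. left_of_tac.
      * eapply pf_poles_impl; [|exact (pf_poles_and _ _ _ E1 (high_poles _ _ _ (pf_poles_and _ _ _ GB PB)))].
        intros p ([N W] & ((Q1 & Q2) & K) & Hp). specialize (Q2 Hp). rewrite W. repeat split; [lra|lra|exact N|]. f_equal. left_of_tac.
    + intros T [-> | ->].
      * eapply pf_poles_impl; [|exact (pf_poles_and _ _ _ GA PA)].
        intros p (Q & [K|K]); repeat split; try lra; left_of_tac.
      * eapply pf_poles_impl; [|exact (low_poles _ _ _ (pf_poles_and _ _ _ GB PB))].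
        intros p (((Q1 & Q2) & K) & Hp). specialize (Q1 Hp). repeat split; try lra. left_of_tac.
    + exists V1, V2, VG. repeat (split; trivial). rewrite <- E. ring.
Qed.

(** The version for alpha > 1: the double integral is represented over [gv], with [TA] split at
    [alo]. *)
Lemma core_B : arc_position ->
  pf_poles TB (fun p => p < blo /\ bL < p < bR \/ blo <= p /\ bL < p /\ bR < p) ->
  pf_poles TA (fun p => p < alo /\ p < bR \/ alo <= p /\ bL < p) ->
  exists V1 V2 VG, chain_int lR (fun u => pf_eval TB u * pf_eval (low alo TA) u)%C V1 /\
    chain_int lL (fun u => pf_eval TB u * pf_eval (high alo TA) u)%C V2 /\
    chain_int lG (fun u => pf_eval TA u * pf_eval TB u)%C VG /\
    double_int gu gv TA TB = (2 * PI * Ci * (V1 + V2 - VG))%C.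
Proof.
  intros HP PB PA.
  assert (K : exists V1 V2 VG, chain_int lR (fun u => pf_eval TB u * pf_eval (low alo TA) u)%C V1 /\
    chain_int lL (fun u => pf_eval TB u * pf_eval (high alo TA) u)%C V2 /\
    chain_int lG (fun u => pf_eval TB u * pf_eval TA u)%C VG /\
    double_int gu gv TA TB = (2 * PI * Ci * (V1 + V2 - VG))%C).
  2: { destruct K as (V1 & V2 & VG & J1 & J2 & J3 & E). exists V1, V2, VG. repeat (split; trivial).
       eapply chain_int_ext; [|exact J3]. intros; simpl; ring. }
  destruct HP as [(Hin & GA & GB)|(Hin & GA & GB)].
  - destruct (double_int_inside gu gv gu_closed gv_closed TA TB alo blo A_off B_off Hin) as (E1 & E2 & V & -> & I1 & I2).
    destruct (core_low gv TB TA alo lR lL lG z bR bL bG V) as (V1 & V2 & VG & J1 & J2 & J3 & ->); trivial.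
    + intros T [-> | ->].
      * eapply pf_poles_impl; [|exact (pf_poles_and _ _ _ B_off (pf_poles_and _ _ _ GB PB))].
        intros p ((O1 & O2) & Q & [K|K]).
        -- destruct (O1 ltac:(lra)) as [N W]. rewrite W. repeat split; [lra|lra|exact N|]. f_equal. left_of_tac.
        -- destruct (O2 ltac:(lra)) as [N W]. rewrite W. repeat split; [lra|lra|exact N|]. f_equal. left_of_tac.
      * eapply pf_poles_impl; [|exact (pf_poles_and _ _ _ E2 (low_poles _ _ _ (pf_poles_and _ _ _ GA PA)))].
        intros p ([N W] & ((Q & _) & K) & Hp). specialize (Q Hp). rewrite W. repeat split; [lra|lra|exact N|]. f_equal. left_of_tac.
    + intros T [-> | ->].
      * eapply pf_poles_impl; [|exact (pf_poles_and _ _ _ GB PB)].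
        intros p (Q & [K|K]); repeat split; try lra; left_of_tac.
      * eapply pf_poles_impl; [|exact (high_poles _ _ _ (pf_poles_and _ _ _ GA PA))].
        intros p (((_ & Q) & K) & Hp). specialize (Q Hp). repeat split; try lra. left_of_tac.
    + exists V1, V2, VG; auto.
  - destruct (double_int_outside gu gv gu_closed gv_closed TA TB alo blo A_off B_off Hin) as (E1 & E2 & V & -> & I1 & I2).
    destruct (core_high gv TB TA alo lR lL lG z bR bL bG V) as (V1 & V2 & VG & J1 & J2 & J3 & E); trivial.
    + intros T [-> | ->].
      * eapply pf_poles_impl; [|exact (pf_poles_and _ _ _ B_off (pf_poles_and _ _ _ GB PB))].
        intros p ((O1 & O2) & (Q1 & Q2) & [K|K]).
        -- destruct (O1 ltac:(lra)) as [N W]. specialize (Q1 ltac:(lra)). rewrite W. repeat split; [lra|lra|exact N|]. f_equal. left_of_tac.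
        -- destruct (O2 ltac:(lra)) as [N W]. specialize (Q2 ltac:(lra)). rewrite W. repeat split; [lra|lra|exact N|]. f_equal. left_of_tac.
      * eapply pf_poles_impl; [|exact (pf_poles_and _ _ _ E2 (high_poles _ _ _ (pf_poles_and _ _ _ GA PA)))].
        intros p ([N W] & (Q & K) & Hp). rewrite W. repeat split; [lra|lra|exact N|]. f_equal. left_of_tac.
    + intros T [-> | ->].
      * eapply pf_poles_impl; [|exact (pf_poles_and _ _ _ GB PB)].
        intros p ((Q1 & Q2) & [K|K]); [specialize (Q1 ltac:(lra))|specialize (Q2 ltac:(lra))]; repeat split; try lra; left_of_tac.
      * eapply pf_poles_impl; [|exact (low_poles _ _ _ (pf_poles_and _ _ _ GA PA))].
        intros p ((Q & K) & Hp). repeat split; try lra. left_of_tac.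
    + exists V1, V2, VG. repeat (split; trivial). rewrite <- E. ring.
Qed.
End Core.

(** * Arcs and circles *)

(** Arcs with the same passing number at each pole differ by a cycle that does not wind around any
    pole. *)
Lemma passes_int T1 T2 l1 l2 z P1 P2 V : crossing l1 z P1 -> crossing l2 z P2 ->
  (forall T, T = T1 \/ T = T2 -> pf_poles T (fun p => exists k, passes l1 z p k /\ passes l2 z p k)) ->
  chain_int l1 (fun u => pf_eval T1 u * pf_eval T2 u)%C V ->
  chain_int l2 (fun u => pf_eval T1 u * pf_eval T2 u)%C V.
Proof.
  intros Hl1 Hl2 HT H1.
  assert (On : forall l c (g : C1path) t p k, In (c, g) l -> 0 <= t <= 1 -> passes l z p k -> g t <> RtoC p).
  { intros l c g t p k Hin Ht [Hn _] E. apply Hn. exists c, g, t; auto. }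
  destruct (chain_int_exists l2 (fun u => pf_eval T1 u * pf_eval T2 u)%C) as [V2 H2].
  { intros c g t Hin Ht. apply continuous_Cmult; apply (pf_eval_continuous _ g); try apply path_continuous;
    (eapply pf_poles_impl; [|apply HT; auto]); intros p (k & _ & Hk); eapply On; eassumption. }
  replace V with V2; [exact H2|].
  assert (HD := chain_int_diff _ _ _ _ _ H1 H2).
  assert (G : forall p, (exists k, passes l1 z p k /\ passes l2 z p k) ->
      ~ on_chain (diff_chain l1 l2) (RtoC p) /\ ~ on_chain nil (RtoC p) /\
      wind (diff_chain l1 l2) (RtoC p) = (wind nil (RtoC p) + 0)%C).
  { intros p (k & K1 & K2). destruct (wind_diff l1 l2 z p _ _ K1 K2) as [O W].
    split; [exact O|]. split; [intros (c & g & t & [] & _)|]. rewrite W, Rminus_diag. unfold wind; simpl. ring. }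
  apply (pf_mul_int T1 T2 (diff_chain l1 l2) nil 0%C) in HD; [|eapply cycle_diff; eassumption|intros f; reflexivity| |].
  - simpl in HD. replace V with (V - V2 + V2)%C by ring. rewrite HD. ring.
  - eapply pf_poles_impl; [exact G|apply HT; auto].
  - eapply pf_poles_impl; [exact G|apply HT; auto].
Qed.

Section Arc.
Variables (z : C) (b : R).

(** A parabolic arc through the two conjugate points with vertex [b], its only real point. *)
Lemma arc_derive t : Cderive (fun t => (b + (Re z - b) * (2 * t - 1) ^ 2, Im z * (2 * t - 1)) : C) t
  ((Re z - b) * (4 * (2 * t - 1)), 2 * Im z).
Proof. apply Cderive_iff. simpl. split; auto_derive; trivial; ring. Qed.

Lemma arc_velocity t : continuous (fun t => ((Re z - b) * (4 * (2 * t - 1)), 2 * Im z) : C) t.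
Proof.
  apply continuous_C_iff. simpl. split; apply (ex_derive_continuous (V := R_NormedModule)); auto_derive; trivial.
Qed.

Definition arc : C1path := {| path := _; velocity := _; path_derive := arc_derive; velocity_continuous := arc_velocity |}.

Lemma arc_0 : arc 0 = Cconj z.
Proof. simpl. unfold Cconj, Re, Im. f_equal; ring. Qed.

Lemma arc_1 : arc 1 = z.
Proof. simpl. destruct z; unfold Re, Im; simpl. f_equal; ring. Qed.

Lemma arc_real t : 0 < Im z -> Im (arc t) = 0 -> Re (arc t) = b.
Proof. simpl. intros Hz H. assert (2 * t - 1 = 0) by nra. rewrite H0. ring. Qed.

Lemma arc_crossing : 0 < Im z -> crossing (sing arc) z (fun x => x = b).
Proof.
  intros Hz. split.
  - intros F. unfold sing. cbn [bdry]. rewrite arc_0, arc_1. ring.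
  - intros q Hq Him. apply on_sing in Hq as (t & Ht & <-). apply arc_real; assumption.
Qed.
End Arc.

Definition arc_zone (w theta y s : Z -> R) (t t' : Z) (x : R) : Prop :=
  ((0 <= t' - t)%Z -> forall i, x < w i) /\
  ((t' - t < 0)%Z -> (forall i, sqdiv (theta i) (w i) < x) /\ (forall j, x < sqdiv (s j) (y j))).

Lemma sine_arc_crossing w theta y s z t t' (g : C1path) : sine_arc w theta y s z t t' g ->
  crossing (sing g) z (arc_zone w theta y s t t').
Proof.
  intros (H0 & H1 & H). split.
  - intros F. unfold sing; cbn [bdry]. rewrite H0, H1. ring.
  - intros q Hq Him. apply on_sing in Hq as (r & Hr & <-). apply (H r Hr Him).
Qed.

(** Each pole lies on one definite side of the admissible zone, so every admissible arc passes it as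
    the parabola does. Thus the value described by [iota] is unique, and the parabola shows that it
    exists. *)
Lemma K_2d_value w theta y s z t a t' a' T1 T2 b V : 0 < Im z ->
  arc_zone w theta y s t t' b ->
  (forall T, T = T1 \/ T = T2 -> pf_poles T (fun p =>
     (forall x, arc_zone w theta y s t t' x -> x < p) \/ (forall x, arc_zone w theta y s t t' x -> p < x))) ->
  (forall u, (Im u = 0 -> arc_zone w theta y s t t' (Re u)) ->
     sine_integrand w theta y s t a t' a' u = (pf_eval T1 u * pf_eval T2 u)%C) ->
  chain_int (sing (arc z b)) (sine_integrand w theta y s t a t' a') V ->
  K_2d w theta y s z t a t' a' = (- / (2 * PI * Ci) * V)%C.
Proof.
  intros Hz Hb HT Hf HV.
  assert (Harc : crossing (sing (arc z b)) z (arc_zone w theta y s t t')).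
  { destruct (arc_crossing z b Hz) as [H1 H2]. split; [exact H1|]. intros q Hq Hi. rewrite (H2 q Hq Hi). exact Hb. }
  assert (Hint : chain_int (sing (arc z b)) (fun u => pf_eval T1 u * pf_eval T2 u)%C V).
  { eapply chain_int_ext; [|exact HV]. intros u Hu. apply Hf. intros Hi. apply (proj2 Harc u Hu Hi). }
  unfold K_2d. apply (iota_unique (V := C_R_CompleteNormedModule)).
  - intros v (g & Hg & ->). assert (Hc := sine_arc_crossing _ _ _ _ _ _ _ _ Hg).
    assert (I : chain_int (sing g) (fun u => pf_eval T1 u * pf_eval T2 u)%C V).
    { apply (passes_int T1 T2 (sing (arc z b)) (sing g) z _ _ V Harc Hc); [|exact Hint].
      intros T HTT. eapply pf_poles_impl; [|apply HT, HTT]. intros p [H|H].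
      - exists 1. split; eapply crossing_passes; eassumption.
      - exists 0. split; eapply crossing_passes; eassumption. }
    assert (I' : chain_int (sing g) (sine_integrand w theta y s t a t' a') V).
    { eapply chain_int_ext; [|exact I]. intros u Hu. symmetry. apply Hf. intros Hi. apply (proj2 Hc u Hu Hi). }
    apply sing_int in I'. unfold path_integral. rewrite (isCint_unique _ _ I'). reflexivity.
  - exists (arc z b). split.
    + split; [apply arc_0|]. split; [apply arc_1|]. intros r Hr Hi. rewrite arc_real by assumption. exact Hb.
    + apply sing_int in HV. unfold path_integral. rewrite (isCint_unique _ _ HV). reflexivity.
Qed.

(** * Circles as contours *)

Section Circle.
Variables (c r : R).
Hypothesis Hr : 0 < r.

Lemma circle_derive t : Cderive (fun t => (c + r * cos (2 * PI * t), r * sin (2 * PI * t)) : C) t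
  (- (r * (2 * PI) * sin (2 * PI * t)), r * (2 * PI) * cos (2 * PI * t)).
Proof. apply Cderive_iff. simpl. split; auto_derive; trivial; ring. Qed.

Lemma circle_velocity t : continuous (fun t => (- (r * (2 * PI) * sin (2 * PI * t)), r * (2 * PI) * cos (2 * PI * t)) : C) t.
Proof.
  apply continuous_C_iff. simpl. split; apply (ex_derive_continuous (V := R_NormedModule)); auto_derive; trivial.
Qed.

Definition circle : C1path := {| path := _; velocity := _; path_derive := circle_derive; velocity_continuous := circle_velocity |}.

Lemma circle_closed : circle 0 = circle 1.
Proof. simpl. rewrite Rmult_0_r, Rmult_1_r, cos_0, sin_0, cos_2PI, sin_2PI. reflexivity. Qed.

Lemma circle_dist t : Cmod (circle t - RtoC c) = r.
Proof.
  apply Rsqr_inj; [apply Cmod_ge_0|lra|]. rewrite !Rsqr_pow2. rewrite Cmod2_alt. simpl.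
  set (x := 2 * PI * t). pose proof (sin2_cos2 x) as T. unfold Rsqr in T.
  transitivity (r * r * (sin x * sin x + cos x * cos x)); [ring|rewrite T; ring].
Qed.

Lemma circle_simple : simple_closed circle.
Proof.
  split; [apply circle_closed|]. intros t1 t2 H1 H2 E. simpl in E. injection E as E1 E2.
  pose proof PI_RGT_0 as HPI.
  assert (E1' : cos (2 * PI * t1) = cos (2 * PI * t2)) by nra.
  assert (E2' : sin (2 * PI * t1) = sin (2 * PI * t2)) by nra.
  assert (D : cos (2 * PI * t1 - 2 * PI * t2) = 1).
  { rewrite cos_minus, E1', E2'. pose proof (sin2_cos2 (2 * PI * t2)) as T. unfold Rsqr in T. lra. }
  assert (G : forall x, 0 < x < 2 * PI -> cos x <> 1).
  { intros x Hx Hc. assert (0 < sin (x / 2)) by (apply sin_gt_0; lra).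
    replace x with (2 * (x / 2)) in Hc by field. rewrite cos_2a_sin in Hc. nra. }
  destruct (Rtotal_order t1 t2) as [L|[E|L]]; [|exact E|].
  - exfalso. apply (G (2 * PI * t2 - 2 * PI * t1)); [nra|]. rewrite <- D.
    replace (2 * PI * t2 - 2 * PI * t1) with (- (2 * PI * t1 - 2 * PI * t2)) by ring. apply cos_neg.
  - exfalso. apply (G (2 * PI * t1 - 2 * PI * t2)); [nra|exact D].
Qed.

Lemma circle_off u : Cmod (u - RtoC c) <> r -> ~ on_path circle u.
Proof. intros Hu (t & _ & <-). apply Hu, circle_dist. Qed.

Lemma circle_wind_center : winding circle (RtoC c) = RtoC 1.
Proof.
  unfold winding, path_integral.
  rewrite (isCint_unique _ (2 * PI * Ci)%C).
  - pose proof two_pi_i_neq_0. generalize dependent (2 * PI * Ci)%C. intros; field; assumption.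
  - assert (H : isCint (fun _ => (2 * PI * Ci)%C) (2 * PI * Ci)%C).
    { assert (K : isCint (fun _ => (2 * PI * Ci)%C) (RtoC 1 * (2 * PI * Ci) - RtoC 0 * (2 * PI * Ci))%C).
      { apply (isCint_derive (fun t => RtoC t * (2 * PI * Ci))%C).
        - intros t _. apply Cderive_iff. simpl. split; auto_derive; trivial; ring.
        - intros t _. apply continuous_const. }
      replace (RtoC 1 * (2 * PI * Ci) - RtoC 0 * (2 * PI * Ci))%C with (2 * PI * Ci)%C in K by ring. exact K. }
    eapply isCint_ext; [|exact H]. intros t Ht. simpl.
    set (x := 2 * PI * t). pose proof (sin2_cos2 x) as T. unfold Rsqr in T.
    assert (N : (circle t - c)%C <> RtoC 0).
    { intros E. pose proof (circle_dist t) as Hd. rewrite E, Cmod_0 in Hd. lra. }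
    simpl in N. fold x in N.
    set (q := (((c + r * cos x)%R, (r * sin x)%R) : C)) in *.
    replace ((- (r * (2 * PI) * sin x), r * (2 * PI) * cos x) : C) with (2 * PI * Ci * (q - c))%C.
    + clearbody q. field. exact N.
    + unfold q. apply injective_projections; simpl; ring.
Qed.

(** The winding number is constant on the segment from the centre, where it is computed directly. *)
Lemma circle_inside u : Cmod (u - RtoC c) < r -> encircles circle u.
Proof.
  intros Hu. split; [apply circle_off; lra|]. rewrite <- circle_wind_center, <- !wind_sing.
  symmetry. set (p := fun s : R => (RtoC c + RtoC s * (u - RtoC c))%C).
  replace (RtoC c) with (p 0) by (unfold p; ring). replace u with (p 1) by (unfold p; ring).
  apply (wind_constant (sing circle) p (fun _ => (u - RtoC c)%C)); [apply cycle_sing, circle_closed|lra| |].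
  - intros s _. unfold p. apply Cderive_iff. destruct u as [a b]. simpl. split; auto_derive; trivial; ring.
  - intros s Hs. rewrite on_sing. apply circle_off. unfold p.
    replace (c + s * (u - c) - c)%C with (RtoC s * (u - c))%C by ring. rewrite Cmod_mult, Cmod_R, Rabs_right by lra.
    pose proof (Cmod_ge_0 (u - c)). nra.
Qed.

(** The winding number is constant on the ray from [u] away from the centre, and the integral tends
    to 0 along it. *)
Lemma circle_outside u : r < Cmod (u - RtoC c) -> excludes circle u.
Proof.
  intros Hu. split; [apply circle_off; lra|].
  set (p := fun s : R => (RtoC c + RtoC s * (u - RtoC c))%C).
  assert (Far : forall s, 1 <= s -> wind (sing circle) u = wind (sing circle) (p s)).
  { intros s Hs. replace u with (p 1) at 1 by (unfold p; ring).
    apply (wind_constant (sing circle) p (fun _ => (u - RtoC c)%C)); [apply cycle_sing, circle_closed|exact Hs| |].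
    - intros k _. unfold p. apply Cderive_iff. destruct u as [a b]. simpl. split; auto_derive; trivial; ring.
    - intros k Hk. rewrite on_sing. apply circle_off. unfold p.
      replace (c + k * (u - c) - c)%C with (RtoC k * (u - c))%C by ring. rewrite Cmod_mult, Cmod_R, Rabs_right by lra. nra. }
  rewrite <- wind_sing. apply Cmod_eq_0.
  destruct (chain_bound (sing circle)) as (K & HK & HB).
  assert (Small : forall s, 2 <= s -> Cmod (2 * PI * Ci * wind (sing circle) u) <= / ((s - 1) * r) * K).
  { intros s Hs. rewrite (Far s) by lra.
    assert (Hd : forall q, on_chain (sing circle) q -> (s - 1) * r <= Cmod (q - p s)).
    { intros q Hq. apply on_sing in Hq as (t & _ & <-). pose proof (circle_dist t) as Hd.
      pose proof (Cmod_triangle (circle t - p s) (- (circle t - RtoC c))) as T. rewrite Cmod_opp, Hd in T.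
      replace (circle t - p s + - (circle t - RtoC c))%C with (- (RtoC s * (u - c)))%C in T by (unfold p; ring).
      rewrite Cmod_opp, Cmod_mult, Cmod_R, Rabs_right in T by lra. nra. }
    apply (HB (fun q => / (q - p s))%C).
    - left. apply Rinv_0_lt_compat. nra.
    - intros q Hq. specialize (Hd q Hq). assert (0 < (s - 1) * r) by nra.
      rewrite Cmod_inv by (intros E; rewrite E, Cmod_0 in Hd; lra). apply Rinv_le_contravar; lra.
    - apply wind_int. rewrite on_sing. apply circle_off. unfold p.
      replace (c + s * (u - c) - c)%C with (RtoC s * (u - c))%C by ring. rewrite Cmod_mult, Cmod_R, Rabs_right by lra. nra. }
  rewrite Cmod_mult in Small. assert (Ht : 0 < Cmod (2 * PI * Ci)) by (apply Cmod_gt_0, two_pi_i_neq_0).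
  set (W := Cmod (wind (sing circle) u)) in *. assert (0 <= W) by apply Cmod_ge_0.
  destruct (Req_dec_T W 0) as [|Hn]; [assumption|]. assert (Hpos : 0 < W) by lra.
  exfalso. set (e := Cmod (2 * PI * Ci) * W) in *. assert (He : 0 < e) by (apply Rmult_lt_0_compat; assumption).
  (* So far out that the upper bound K / ((s - 1) r) with (s - 1) r = K / e + r is smaller than
     [e]. *)
  specialize (Small (K / (e * r) + 2)).
  assert (HKe : 0 < K / (e * r)) by (apply Rdiv_lt_0_compat; [exact HK|apply Rmult_lt_0_compat; lra]).
  specialize (Small ltac:(lra)).
  set (X := (K / (e * r) + 2 - 1) * r) in *.
  assert (HX : 0 < X) by (apply Rmult_lt_0_compat; lra).
  assert (EX : e * X = K + e * r) by (unfold X; field; lra).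
  apply Rmult_le_compat_r with (r := X) in Small; [|lra].
  replace (/ X * K * X) with K in Small by (field; lra).
  pose proof (Rmult_lt_0_compat _ _ He Hr). lra.
Qed.
End Circle.

Lemma circles_nested c1 r1 c2 r2 : 0 < r1 -> 0 < r2 -> c2 - r2 < c1 - r1 -> c1 + r1 < c2 + r2 ->
  lies_inside (circle c1 r1) (circle c2 r2).
Proof.
  intros H1 H2 Ha Hb. assert (HD : Rabs (c1 - c2) < r2 - r1) by (apply Rabs_def1; lra).
  split; intros p (t & Ht & <-).
  - apply circle_inside; [exact H2|]. pose proof (circle_dist c1 r1 H1 t).
    pose proof (Cmod_triangle (circle c1 r1 t - RtoC c1) (RtoC (c1 - c2))) as T. rewrite Cmod_R in T.
    replace (circle c1 r1 t - c1 + RtoC (c1 - c2))%C with (circle c1 r1 t - c2)%C in T by (rewrite RtoC_minus; ring). lra.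
  - apply circle_outside; [exact H1|]. pose proof (circle_dist c2 r2 H2 t).
    pose proof (Cmod_triangle (circle c2 r2 t - RtoC c1) (RtoC (c1 - c2))) as T. rewrite Cmod_R in T.
    replace (circle c2 r2 t - c1 + RtoC (c1 - c2))%C with (circle c2 r2 t - c2)%C in T by (rewrite RtoC_minus; ring). lra.
Qed.

Definition diameter (a b : R) : C1path := circle ((a + b) / 2) ((b - a) / 2).

Lemma diameter_spec a b : a < b -> simple_closed (diameter a b) /\
  (forall p : R, a < p < b -> encircles (diameter a b) (RtoC p)) /\
  (forall p : R, p < a \/ b < p -> excludes (diameter a b) (RtoC p)).
Proof.
  intros Hab. assert (Hr : 0 < (b - a) / 2) by lra. split; [|split].
  - apply circle_simple, Hr.
  - intros p Hp. apply circle_inside; [exact Hr|]. rewrite <- RtoC_minus, Cmod_R. apply Rabs_def1; lra.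
  - intros p Hp. apply circle_outside; [exact Hr|]. rewrite <- RtoC_minus, Cmod_R.
    unfold Rabs. destruct Rcase_abs; lra.
Qed.

Lemma diameter_nested a b a' b' : a' < a -> a < b -> b < b' -> lies_inside (diameter a b) (diameter a' b').
Proof. intros H1 H2 H3. apply circles_nested; lra. Qed.

(** * Algebra of the kernels *)

Lemma Zrange_length m n : length (Zrange m n) = Z.to_nat (n - m + 1).
Proof. unfold Zrange. rewrite length_map, length_seq. reflexivity. Qed.

Lemma Zrange_In m n k : In k (Zrange m n) <-> (m <= k <= n)%Z.
Proof.
  unfold Zrange. rewrite in_map_iff. split.
  - intros (i & <- & Hi). apply in_seq in Hi. lia.
  - intros H. exists (Z.to_nat (k - m)). split; [lia|]. apply in_seq. lia.
Qed.

Lemma map_seq_offset (f : nat -> Z) c s n : map f (seq (c + s) n) = map (fun k => f (c + k)%nat) (seq s n).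
Proof. revert s; induction n as [|n IH]; intros s; simpl; [reflexivity|]. f_equal. rewrite <- IH. do 2 f_equal. lia. Qed.

Lemma Zrange_split m k n : (m - 1 <= k <= n)%Z -> Zrange m n = Zrange m k ++ Zrange (k + 1) n.
Proof.
  intros H. unfold Zrange. replace (Z.to_nat (n - m + 1)) with (Z.to_nat (k - m + 1) + Z.to_nat (n - (k + 1) + 1))%nat by lia.
  rewrite seq_app, map_app. f_equal. rewrite Nat.add_0_l, <- (Nat.add_0_r (Z.to_nat (k - m + 1))) at 1.
  rewrite map_seq_offset. apply map_ext. intros; lia.
Qed.

Lemma Zrange_shift m n d : Zrange (m + d) (n + d) = map (fun k => (k + d)%Z) (Zrange m n).
Proof.
  unfold Zrange. rewrite map_map. replace (n + d - (m + d) + 1)%Z with (n - m + 1)%Z by ring.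
  apply map_ext. intros; ring.
Qed.

Lemma Cprod_ext m n f g : (forall k, f k = g k) -> Cprod m n f = Cprod m n g.
Proof. intros H. unfold Cprod. f_equal. apply map_ext, H. Qed.

Lemma Cprod_mult m n f g : Cprod m n (fun k => f k * g k)%C = (Cprod m n f * Cprod m n g)%C.
Proof. unfold Cprod. induction (Zrange m n); simpl; [ring|rewrite IHl; ring]. Qed.

Lemma Cprod_inv m n f : Cprod m n (fun k => / f k)%C = (/ Cprod m n f)%C.
Proof.
  unfold Cprod. induction (Zrange m n); simpl; [field; apply RtoC_neq; lra|].
  rewrite IHl, Cinv_mul. reflexivity.
Qed.

Lemma Cprod_div m n f g : Cprod m n (fun k => f k / g k)%C = (Cprod m n f * / Cprod m n g)%C.
Proof. unfold Cdiv. rewrite Cprod_mult, Cprod_inv. reflexivity. Qed.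

Lemma Cprod_split m k n f : (m - 1 <= k <= n)%Z -> Cprod m n f = (Cprod m k f * Cprod (k + 1) n f)%C.
Proof.
  intros H. unfold Cprod. rewrite (Zrange_split m k n H), map_app.
  induction (map f (Zrange m k)); simpl; [ring|rewrite IHl; ring].
Qed.

Lemma Cprod_one m f : Cprod m m f = f m.
Proof.
  unfold Cprod, Zrange. replace (Z.to_nat (m - m + 1)) with 1%nat by lia. simpl. rewrite Z.add_0_r. ring.
Qed.

Lemma Cprod_last m n f : (m <= n)%Z -> Cprod m n f = (Cprod m (n - 1) f * f n)%C.
Proof.
  intros H. rewrite (Cprod_split m (n - 1) n f) by lia. replace (n - 1 + 1)%Z with n by ring. rewrite Cprod_one. reflexivity.
Qed.

Lemma Cprod_shift m n d f : Cprod (m + d) (n + d) f = Cprod m n (fun k => f (k + d)%Z).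
Proof. unfold Cprod. rewrite Zrange_shift, map_map. reflexivity. Qed.

Lemma Cprod_neq_0 m n f : (forall k, f k <> RtoC 0) -> Cprod m n f <> RtoC 0.
Proof.
  intros H. unfold Cprod. induction (Zrange m n); simpl; [apply RtoC_neq; lra|]. apply Cmult_neq_0; auto.
Qed.

Definition linear_prod (l : list R) (u : C) : C := fold_right Cmult (RtoC 1) (map (fun q => u - RtoC q)%C l).

Lemma linear_prod_app l l' u : linear_prod (l ++ l') u = (linear_prod l u * linear_prod l' u)%C.
Proof. unfold linear_prod. induction l; simpl; [ring|rewrite IHl; ring]. Qed.

Lemma linear_prod_map m n (f : Z -> R) u : linear_prod (map f (Zrange m n)) u = Cprod m n (fun k => u - RtoC (f k))%C.
Proof. unfold linear_prod, Cprod. rewrite map_map. reflexivity. Qed.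

Section Factors.
Variables (N : nat) (x : R) (w kap y sig : Z -> R).
Notation n := (Z.of_nat N).

Definition factor_A (t a : Z) (u : C) : C :=
  (Cprod 1 n (fun k => (u - y k) / (u - x)) * / (u - y a)
   * Cprod 1 (a - 1) (fun j => (u - sig j) / (u - y j))
   * Cprod 1 t (fun c => (u - w c) / (u - kap c)))%C.

Definition factor_B (t a : Z) (v : C) : C :=
  (Cprod 1 n (fun k => (v - x) / (v - y k)) * / (v - sig a)
   * Cprod 1 (a - 1) (fun j => (v - y j) / (v - sig j))
   * Cprod 1 t (fun d => (v - kap d) / (v - w d)))%C.

(** For [N = 0] the point [x] does not occur. This case is used to write the sine integrand with the
    same two factors. *)
Definition generic (u : C) : Prop :=
  ((0 < N)%nat -> u <> RtoC x) /\ (forall j, u <> RtoC (w j)) /\ (forall j, u <> RtoC (kap j)) /\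
  (forall j, u <> RtoC (y j)) /\ (forall j, u <> RtoC (sig j)).

Lemma generic_neq u : generic u -> Cprod 1 n (fun _ => u - x)%C <> RtoC 0 /\ (forall j, (u - w j)%C <> RtoC 0) /\
  (forall j, (u - kap j)%C <> RtoC 0) /\ (forall j, (u - y j)%C <> RtoC 0) /\ (forall j, (u - sig j)%C <> RtoC 0).
Proof.
  intros (H1 & H2 & H3 & H4 & H5). split; [|repeat split; intros; apply Csub_neq; auto].
  destruct N as [|N']; [apply RtoC_neq; lra|]. apply Cprod_neq_0. intros _. apply Csub_neq, H1. lia.
Qed.

Definition generic_A (u : C) : Prop :=
  ((0 < N)%nat -> u <> RtoC x) /\ (forall j, u <> RtoC (kap j)) /\ (forall j, u <> RtoC (y j)).

Definition generic_B (u : C) : Prop :=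
  (forall j, u <> RtoC (w j)) /\ (forall j, u <> RtoC (y j)) /\ (forall j, u <> RtoC (sig j)).

(** For [a <= N] the factors [u - y j] of the denominator cancel; for [B] this
    happens when [N < a]. *)
Lemma factor_A_pf t a : (1 <= a)%Z -> (0 <= t)%Z -> exists T,
  pf_poles T (fun p => (p = x /\ (0 < N)%nat) \/ (exists j, p = kap j) \/ ((n < a)%Z /\ exists j, p = y j)) /\
  forall u, generic_A u -> pf_eval T u = factor_A t a u.
Proof.
  intros Ha Ht. destruct (Z_lt_le_dec n a) as [Hna|Hna].
  - set (zs := map y (Zrange 1 n) ++ map sig (Zrange 1 (a - 1)) ++ map w (Zrange 1 t)).
    set (ps := map (fun _ => x) (Zrange 1 n) ++ map y (Zrange 1 a) ++ map kap (Zrange 1 t)).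
    destruct (ratf_pf zs ps) as (T & HT & HE).
    { unfold zs, ps. rewrite !length_app, !length_map, !Zrange_length. lia. }
    exists T. split.
    + eapply pf_poles_impl; [|exact HT]. intros p Hp. unfold ps in Hp. rewrite !in_app_iff, !in_map_iff in Hp.
      destruct Hp as [(k & <- & Hk)|[(k & <- & Hk)|(k & <- & Hk)]]; apply Zrange_In in Hk.
      * left. split; [reflexivity|lia].
      * right; right. split; [exact Hna|exists k; reflexivity].
      * right; left. exists k; reflexivity.
    + intros u Hu. pose proof Hu as (H1 & H3 & H4). rewrite HE.
      * change (ratf zs ps u) with (linear_prod zs u * / linear_prod ps u)%C. unfold zs, ps, factor_A.
        rewrite !linear_prod_app, !linear_prod_map, !Cprod_div, !Cinv_mul.
        rewrite (Cprod_last 1 a) by lia. rewrite !Cinv_mul. ring.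
      * intros p Hp. unfold ps in Hp. rewrite !in_app_iff, !in_map_iff in Hp.
        destruct Hp as [(k & <- & Hk)|[(k & <- & Hk)|(k & <- & Hk)]]; auto. apply H1. apply Zrange_In in Hk. lia.
  - set (zs := map y (Zrange (a + 1) n) ++ map sig (Zrange 1 (a - 1)) ++ map w (Zrange 1 t)).
    set (ps := map (fun _ => x) (Zrange 1 n) ++ map kap (Zrange 1 t)).
    destruct (ratf_pf zs ps) as (T & HT & HE).
    { unfold zs, ps. rewrite !length_app, !length_map, !Zrange_length. lia. }
    exists T. split.
    + eapply pf_poles_impl; [|exact HT]. intros p Hp. unfold ps in Hp. rewrite !in_app_iff, !in_map_iff in Hp.
      destruct Hp as [(k & <- & Hk)|(k & <- & Hk)]; apply Zrange_In in Hk.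
      * left. split; [reflexivity|lia].
      * right; left. exists k; reflexivity.
    + intros u Hu. pose proof Hu as (H1 & H3 & H4). rewrite HE.
      * change (ratf zs ps u) with (linear_prod zs u * / linear_prod ps u)%C. unfold zs, ps, factor_A.
        rewrite !linear_prod_app, !linear_prod_map, !Cprod_div, !Cinv_mul.
        rewrite (Cprod_split 1 a n (fun k => u - y k)%C) by lia. rewrite (Cprod_last 1 a) by lia.
        assert (Y1 := Csub_neq _ _ (H4 a)). assert (Y2 := Cprod_neq_0 1 (a - 1) (fun k => u - y k)%C (fun k => Csub_neq _ _ (H4 k))).
        generalize dependent (Cprod 1 (a - 1) (fun k => u - y k)%C). intros q Hq.
        generalize (/ Cprod 1 t (fun k => u - kap k))%C, (/ Cprod 1 n (fun _ : Z => u - x))%C. intros.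
        field. split; assumption.
      * intros p Hp. unfold ps in Hp. rewrite !in_app_iff, !in_map_iff in Hp.
        destruct Hp as [(k & <- & Hk)|(k & <- & Hk)]; auto. apply H1. apply Zrange_In in Hk. lia.
Qed.

Lemma factor_B_pf t a : (1 <= a)%Z -> (0 <= t)%Z -> exists T,
  pf_poles T (fun p => (exists j, p = w j) \/ (exists j, p = sig j) \/ ((a <= n)%Z /\ exists j, p = y j)) /\
  forall u, generic_B u -> pf_eval T u = factor_B t a u.
Proof.
  intros Ha Ht. destruct (Z_lt_le_dec n a) as [Hna|Hna].
  - set (zs := map (fun _ => x) (Zrange 1 n) ++ map y (Zrange (n + 1) (a - 1)) ++ map kap (Zrange 1 t)).
    set (ps := map sig (Zrange 1 a) ++ map w (Zrange 1 t)).
    destruct (ratf_pf zs ps) as (T & HT & HE).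
    { unfold zs, ps. rewrite !length_app, !length_map, !Zrange_length. lia. }
    exists T. split.
    + eapply pf_poles_impl; [|exact HT]. intros p Hp. unfold ps in Hp. rewrite !in_app_iff, !in_map_iff in Hp.
      destruct Hp as [(k & <- & Hk)|(k & <- & Hk)].
      * right; left. exists k; reflexivity.
      * left. exists k; reflexivity.
    + intros u Hu. pose proof Hu as (H2 & H4 & H5). rewrite HE.
      * change (ratf zs ps u) with (linear_prod zs u * / linear_prod ps u)%C. unfold zs, ps, factor_B.
        rewrite !linear_prod_app, !linear_prod_map, !Cprod_div, !Cinv_mul.
        rewrite (Cprod_last 1 a (fun k => u - sig k)%C) by lia. rewrite Cinv_mul.
        rewrite (Cprod_split 1 n (a - 1) (fun k => u - y k)%C) by lia.
        assert (Y2 := Cprod_neq_0 1 n (fun k => u - y k)%C (fun k => Csub_neq _ _ (H4 k))).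
        generalize dependent (Cprod 1 n (fun k => u - y k)%C). intros q Hq.
        generalize (/ Cprod 1 t (fun k => u - w k))%C, (/ Cprod 1 (a - 1) (fun k : Z => u - sig k))%C, (/ (u - sig a))%C. intros.
        field. assumption.
      * intros p Hp. unfold ps in Hp. rewrite !in_app_iff, !in_map_iff in Hp.
        destruct Hp as [(k & <- & Hk)|(k & <- & Hk)]; auto.
  - set (zs := map (fun _ => x) (Zrange 1 n) ++ map y (Zrange 1 (a - 1)) ++ map kap (Zrange 1 t)).
    set (ps := map y (Zrange 1 n) ++ map sig (Zrange 1 a) ++ map w (Zrange 1 t)).
    destruct (ratf_pf zs ps) as (T & HT & HE).
    { unfold zs, ps. rewrite !length_app, !length_map, !Zrange_length. lia. }
    exists T. split.
    + eapply pf_poles_impl; [|exact HT]. intros p Hp. unfold ps in Hp. rewrite !in_app_iff, !in_map_iff in Hp.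
      destruct Hp as [(k & <- & Hk)|[(k & <- & Hk)|(k & <- & Hk)]].
      * right; right. split; [exact Hna|exists k; reflexivity].
      * right; left. exists k; reflexivity.
      * left. exists k; reflexivity.
    + intros u Hu. pose proof Hu as (H2 & H4 & H5). rewrite HE.
      * change (ratf zs ps u) with (linear_prod zs u * / linear_prod ps u)%C. unfold zs, ps, factor_B.
        rewrite !linear_prod_app, !linear_prod_map, !Cprod_div, !Cinv_mul.
        rewrite (Cprod_last 1 a (fun k => u - sig k)%C) by lia. rewrite !Cinv_mul. ring.
      * intros p Hp. unfold ps in Hp. rewrite !in_app_iff, !in_map_iff in Hp.
        destruct Hp as [(k & <- & Hk)|[(k & <- & Hk)|(k & <- & Hk)]]; auto.
Qed.

(** Both orders of the indices become one formula with products starting at 1, which removes the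
    case distinction of [P_ratio]. *)
Lemma P_ratio_quot a a' u b c : (0 <= a)%Z -> (0 <= a')%Z ->
  (forall j, (u - RtoC (b j))%C <> RtoC 0) -> (forall j, (u - RtoC (c j))%C <> RtoC 0) ->
  P_ratio a a' u b c = (Cprod 1 a' (fun j => u - RtoC (b j)) * / Cprod 1 a' (fun j => u - RtoC (c j)) *
    (Cprod 1 a (fun j => u - RtoC (c j)) * / Cprod 1 a (fun j => u - RtoC (b j))))%C.
Proof.
  intros Ha Ha' Hb Hc. unfold P_ratio.
  assert (Q1 := Cprod_neq_0 1 a _ Hb). assert (Q2 := Cprod_neq_0 1 a _ Hc).
  assert (Q3 := Cprod_neq_0 1 a' _ Hb). assert (Q4 := Cprod_neq_0 1 a' _ Hc).
  destruct (Z.ltb_spec a a') as [H|H]; [|destruct (Z.eqb_spec a a') as [->|H']].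
  - rewrite Cprod_div. assert (R1 := Cprod_neq_0 (a + 1) a' _ Hb). assert (R2 := Cprod_neq_0 (a + 1) a' _ Hc).
    rewrite (Cprod_split 1 a a' (fun j => u - RtoC (b j))%C), (Cprod_split 1 a a' (fun j => u - RtoC (c j))%C) by lia.
    field. repeat split; assumption.
  - field. split; assumption.
  - rewrite Cprod_div. assert (R1 := Cprod_neq_0 (a' + 1) a _ Hb). assert (R2 := Cprod_neq_0 (a' + 1) a _ Hc).
    rewrite (Cprod_split 1 a' a (fun j => u - RtoC (b j))%C), (Cprod_split 1 a' a (fun j => u - RtoC (c j))%C) by lia.
    field. repeat split; assumption.
Qed.

(** The products over k = 1, ..., N in the two factors are reciprocal and cancel; this is why A B
    does not depend on [N] after the shift. *)
Lemma factors_sine t a t' a' u : (1 <= a)%Z -> (1 <= a')%Z -> (0 <= t)%Z -> (0 <= t')%Z -> generic u ->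
  (factor_A t' a' u * factor_B t a u)%C =
  (/ ((u - y a) * (u - sig a')) * P_ratio a a' u sig y * P_ratio t t' u w kap)%C.
Proof.
  intros Ha Ha' Ht Ht' Hu. destruct (generic_neq u Hu) as (N1 & N2 & N3 & N4 & N5).
  rewrite (P_ratio_quot a a'), (P_ratio_quot t t') by (trivial; lia).
  unfold factor_A, factor_B. rewrite !Cprod_div, (Cprod_last 1 a), (Cprod_last 1 a), (Cprod_last 1 a'), (Cprod_last 1 a') by lia.
  assert (A1 := Cprod_neq_0 1 n _ N4). assert (A2 := N1).
  assert (A3 := Cprod_neq_0 1 (a - 1) _ N4). assert (A4 := Cprod_neq_0 1 (a - 1) _ N5).
  assert (A5 := Cprod_neq_0 1 (a' - 1) _ N4). assert (A6 := Cprod_neq_0 1 (a' - 1) _ N5).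
  assert (A7 := Cprod_neq_0 1 t _ N2). assert (A8 := Cprod_neq_0 1 t _ N3).
  assert (A9 := Cprod_neq_0 1 t' _ N2). assert (A10 := Cprod_neq_0 1 t' _ N3).
  assert (B1 := N4 a). assert (B2 := N4 a'). assert (B3 := N5 a). assert (B4 := N5 a').
  clear N1 N2 N3 N4 N5 Hu. cbv beta in *.
  repeat match goal with H : ?q <> RtoC 0 |- _ => generalize dependent q; intro; intro end.
  field. repeat split; assumption.
Qed.
End Factors.

Lemma AP_integrand_factors N x w theta y s t a t' a' u v :
  AP_integrand N (fun _ => x) w theta y s t a t' a' u v =
  (RtoC (y a * (1 - / s a ^ 2)) * (/ (u - v) *
    factor_A N x w (fun j => sqdiv (theta j) (w j)) y (fun j => sqdiv (s j) (y j)) t' a' u *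
    factor_B N x w (fun j => sqdiv (theta j) (w j)) y (fun j => sqdiv (s j) (y j)) t a v))%C.
Proof.
  unfold AP_integrand, factor_A, factor_B.
  rewrite (Cprod_ext 1 (Z.of_nat N) (fun k => (u - y k) * (v - x) / ((u - x) * (v - y k)))%C
    (fun k => ((u - y k) / (u - x)) * ((v - x) / (v - y k)))%C).
  - rewrite Cprod_mult. unfold Cdiv. ring.
  - intros k. unfold Cdiv. rewrite Cinv_mul. ring.
Qed.

Lemma P_ratio_shift n n' d u (b c b' c' : Z -> R) : (forall j, b' (j + d)%Z = b j) -> (forall j, c' (j + d)%Z = c j) ->
  P_ratio (n + d) (n' + d) u b' c' = P_ratio n n' u b c.
Proof.
  intros Hb Hc. unfold P_ratio.
  replace (n + d <? n' + d)%Z with (n <? n')%Z by (destruct (Z.ltb_spec n n'), (Z.ltb_spec (n + d) (n' + d)); lia || reflexivity).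
  replace (n + d =? n' + d)%Z with (n =? n')%Z by (destruct (Z.eqb_spec n n'), (Z.eqb_spec (n + d) (n' + d)); lia || reflexivity).
  replace (n + d + 1)%Z with (n + 1 + d)%Z by ring. replace (n' + d + 1)%Z with (n' + 1 + d)%Z by ring.
  rewrite !Cprod_shift. destruct (n <? n')%Z; [|destruct (n =? n')%Z; [reflexivity|]];
    apply Cprod_ext; intros k; rewrite Hb, Hc; reflexivity.
Qed.

Lemma sine_integrand_shift w theta y s t a t' a' m d u :
  sine_integrand (shift_seq m w) (shift_seq m theta) (shift_seq d y) (shift_seq d s) (t + m) (a + d) (t' + m) (a' + d) u =
  sine_integrand w theta y s t a t' a' u.
Proof.
  assert (E : forall A (f : Z -> A) k e, f (k + e - e)%Z = f k) by (intros; f_equal; ring).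
  unfold sine_integrand. rewrite (P_ratio_shift a a' d u (fun j => sqdiv (s j) (y j)) y), (P_ratio_shift t t' m u w (fun i => sqdiv (theta i) (w i)));
    unfold shift_seq; intros; rewrite ?E; reflexivity.
Qed.

(** * Size of the integrands *)

Lemma Cinv_neq_0 u : u <> RtoC 0 -> (/ u)%C <> RtoC 0.
Proof.
  intros Hu E. apply (RtoC_neq 1 0); [lra|]. replace (RtoC 1) with (u * / u)%C by (field; exact Hu). rewrite E. ring.
Qed.

Lemma ln_Cmod_mult u v : u <> RtoC 0 -> v <> RtoC 0 -> ln (Cmod (u * v)) = ln (Cmod u) + ln (Cmod v).
Proof. intros Hu Hv. rewrite Cmod_mult. apply ln_mult; apply Cmod_gt_0; assumption. Qed.

Lemma ln_Cmod_inv u : u <> RtoC 0 -> ln (Cmod (/ u)) = - ln (Cmod u).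
Proof. intros Hu. rewrite Cmod_inv by exact Hu. apply ln_Rinv, Cmod_gt_0, Hu. Qed.

Definition Rsum (l : list Z) (g : Z -> R) : R := fold_right Rplus 0 (map g l).

Lemma ln_Cmod_Cprod m n f : (forall k, f k <> RtoC 0) ->
  ln (Cmod (Cprod m n f)) = Rsum (Zrange m n) (fun k => ln (Cmod (f k))).
Proof.
  intros H. unfold Cprod, Rsum. induction (Zrange m n) as [|k l IH]; simpl.
  - rewrite Cmod_1, ln_1. reflexivity.
  - rewrite ln_Cmod_mult, IH; [reflexivity|apply H|].
    clear IH. induction l; simpl; [apply RtoC_neq; lra|apply Cmult_neq_0; auto].
Qed.

Lemma Rsum_const_diff l g c : Rsum l g - INR (length l) * c = Rsum l (fun k => g k - c).
Proof.
  induction l as [|k l IH]; [unfold Rsum; simpl; ring|].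
  unfold Rsum in *. cbn [map fold_right length] in *. rewrite S_INR, <- IH. ring.
Qed.

Lemma Rsum_supported l g M (sel : Z -> bool) : 0 <= M -> (forall k, Rabs (g k) <= M) -> (forall k, sel k = false -> g k = 0) ->
  Rabs (Rsum l g) <= INR (length (filter sel l)) * M.
Proof.
  intros HM HB H0. induction l as [|k l IH]; [unfold Rsum; simpl; rewrite Rabs_R0; lra|].
  unfold Rsum in *. cbn [map fold_right filter] in *. destruct (sel k) eqn:E.
  - cbn [length]. rewrite S_INR. specialize (HB k). eapply Rle_trans; [apply Rabs_triang|]. lra.
  - rewrite H0, Rplus_0_l by exact E. exact IH.
Qed.

Lemma Zrange_NoDup m n : NoDup (Zrange m n).
Proof. unfold Zrange. apply Injective_map_NoDup; [intros a b H; lia|apply seq_NoDup]. Qed.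

Section Estimate.
Variable L : Z.
Hypothesis HL : (1 <= L)%Z.

(** At most 2 L + 1 indices have a factor other than u - fs, each changing the logarithm by at most
    2 M; replacing the length [n] by [c] costs a further D M. *)
Lemma ln_Cprod_shift (f : Z -> R) fs m n u M c D :
  (forall j, (L < Z.abs j)%Z -> f j = fs) ->
  (forall j, u <> RtoC (f j)) -> (forall j, Rabs (ln (Cmod (u - f j))) <= M) ->
  (0 <= n)%Z -> Rabs (IZR n - c) <= D ->
  Rabs (ln (Cmod (Cprod 1 n (fun k => u - RtoC (shift_seq m f k))%C)) - c * ln (Cmod (u - fs)))
    <= (IZR (2 * L + 1) * 2 + D) * M.
Proof.
  intros Hout Hu HB Hn HD.
  assert (HBs : Rabs (ln (Cmod (u - fs))) <= M). { rewrite <- (Hout (L + 1)%Z) by lia. apply HB. }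
  assert (HM : 0 <= M) by (eapply Rle_trans; [apply Rabs_pos|exact HBs]).
  rewrite ln_Cmod_Cprod by (intros k; apply Csub_neq, Hu).
  set (g := fun k => ln (Cmod (u - RtoC (shift_seq m f k)))).
  set (l0 := ln (Cmod (u - fs))) in *.
  assert (E : INR (length (Zrange 1 n)) = IZR n).
  { rewrite Zrange_length, INR_IZR_INZ. f_equal. lia. }
  replace (Rsum (Zrange 1 n) g - c * l0) with ((Rsum (Zrange 1 n) g - INR (length (Zrange 1 n)) * l0) + (IZR n - c) * l0) by (rewrite E; ring).
  rewrite Rsum_const_diff. eapply Rle_trans; [apply Rabs_triang|].
  rewrite (Rmult_plus_distr_r (IZR (2 * L + 1) * 2) D M). apply Rplus_le_compat.
  - set (sel := fun k : Z => (Z.abs (k - m) <=? L)%Z).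
    apply Rle_trans with (INR (length (filter sel (Zrange 1 n))) * (2 * M)).
    + apply Rsum_supported; [lra| |].
      * intros k. eapply Rle_trans; [apply Rabs_triang|]. rewrite Rabs_Ropp. unfold g, shift_seq. specialize (HB (k - m)%Z). lra.
      * intros k Hk. apply Z.leb_gt in Hk. unfold g, shift_seq. rewrite Hout by exact Hk. fold l0. ring.
    + replace (IZR (2 * L + 1) * 2 * M) with (IZR (2 * L + 1) * (2 * M)) by ring. apply Rmult_le_compat_r; [lra|].
      assert (Hlen : (length (filter sel (Zrange 1 n)) <= length (Zrange (m - L) (m + L)))%nat).
      { apply NoDup_incl_length; [apply NoDup_filter, Zrange_NoDup|]. intros k Hk. apply filter_In in Hk as [_ Hk].
        apply Z.leb_le in Hk. apply Zrange_In. lia. }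
      rewrite Zrange_length in Hlen. apply le_INR in Hlen. eapply Rle_trans; [exact Hlen|].
      rewrite INR_IZR_INZ. apply IZR_le. lia.
  - rewrite Rabs_mult. apply Rmult_le_compat; trivial; apply Rabs_pos.
Qed.

Lemma ln_x_power N x u : u <> RtoC x ->
  ln (Cmod (Cprod 1 (Z.of_nat N) (fun _ => u - RtoC x)%C)) = INR N * ln (Cmod (u - x)).
Proof.
  intros Hu. rewrite ln_Cmod_Cprod by (intros; apply Csub_neq, Hu).
  assert (E := Rsum_const_diff (Zrange 1 (Z.of_nat N)) (fun _ => ln (Cmod (u - x))) (ln (Cmod (u - x)))).
  rewrite Zrange_length in E. replace (Z.to_nat (Z.of_nat N - 1 + 1)) with N in E by lia.
  assert (Z0 : forall l : list Z, Rsum l (fun _ => ln (Cmod (u - x)) - ln (Cmod (u - x))) = 0).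
  { induction l as [|k l IH]; [reflexivity|]. unfold Rsum in *. cbn [map fold_right]. rewrite IH. ring. }
  rewrite Z0 in E. lra.
Qed.

Lemma floor_mult_close c N : Rabs (IZR (floor_mult c N) - c * INR N) <= 1.
Proof. unfold floor_mult. destruct (base_Int_part (c * INR N)) as [H1 H2]. apply Rabs_le. lra. Qed.

Variables (w kap y sig : Z -> R) (ws ks ys ss x alpha tau : R).
Hypothesis outside : forall j, (L < Z.abs j)%Z -> w j = ws /\ kap j = ks /\ y j = ys /\ sig j = ss.

Definition action (u : C) : R :=
  - ln (Cmod (u - x)) + (1 - alpha) * ln (Cmod (u - ys)) + alpha * ln (Cmod (u - ss))
  + tau * ln (Cmod (u - ws)) - tau * ln (Cmod (u - ks)).

(** The logarithmic distances to all parameters are bounded; on a compact curve that avoids them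
    this holds with one [M]. *)
Definition tame (M : R) (u : C) : Prop := forall p, p = x \/ (exists j, p = w j \/ p = kap j \/ p = y j \/ p = sig j) ->
  u <> RtoC p /\ Rabs (ln (Cmod (u - p))) <= M.

Section Bound.
Variables (M : R) (N : nat) (u : C) (t a : Z).
Hypothesis Hu : tame M u.
Let m := floor_mult tau N.
Let d := floor_mult alpha N.
Hypothesis Ha : (1 <= a + d)%Z.
Hypothesis Ht : (0 <= t + m)%Z.

Let W := Cprod 1 (t + m) (fun k => u - RtoC (shift_seq m w k))%C.
Let K := Cprod 1 (t + m) (fun k => u - RtoC (shift_seq m kap k))%C.
Let Y := Cprod 1 (a + d - 1) (fun k => u - RtoC (shift_seq d y k))%C.
Let S := Cprod 1 (a + d - 1) (fun k => u - RtoC (shift_seq d sig k))%C.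
Let YN := Cprod 1 (Z.of_nat N) (fun k => u - RtoC (shift_seq d y k))%C.
Let XN := Cprod 1 (Z.of_nat N) (fun _ => u - RtoC x)%C.

(** Five products with up to 2 L + 1 exceptional factors give 10; two have their length off by at
    most |t| + 1, two by at most |a| + 2; the last 1 is for the separate factor with index a. *)
Definition estimate_bound : R :=
  (10 * IZR (2 * L + 1) + 2 * (Rabs (IZR t) + 1) + 2 * (Rabs (IZR a) + 2) + 1) * M.

Lemma product_bounds : W <> RtoC 0 /\ K <> RtoC 0 /\ Y <> RtoC 0 /\ S <> RtoC 0 /\ YN <> RtoC 0 /\ XN <> RtoC 0 /\
  Rabs ((ln (Cmod YN) - ln (Cmod XN) + (ln (Cmod S) - ln (Cmod Y)) + (ln (Cmod W) - ln (Cmod K))) - INR N * action u)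
  <= estimate_bound - M.
Proof.
  assert (Nw : forall j, u <> RtoC (w j)) by (intros j; apply Hu; right; exists j; auto).
  assert (Nk : forall j, u <> RtoC (kap j)) by (intros j; apply Hu; right; exists j; auto).
  assert (Ny : forall j, u <> RtoC (y j)) by (intros j; apply Hu; right; exists j; auto).
  assert (Ns : forall j, u <> RtoC (sig j)) by (intros j; apply Hu; right; exists j; auto).
  assert (Nx : u <> RtoC x) by (apply Hu; left; reflexivity).
  assert (Bw : forall j, Rabs (ln (Cmod (u - w j))) <= M) by (intros j; apply Hu; right; exists j; auto).
  assert (Bk : forall j, Rabs (ln (Cmod (u - kap j))) <= M) by (intros j; apply Hu; right; exists j; auto).
  assert (By : forall j, Rabs (ln (Cmod (u - y j))) <= M) by (intros j; apply Hu; right; exists j; auto).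
  assert (Bs : forall j, Rabs (ln (Cmod (u - sig j))) <= M) by (intros j; apply Hu; right; exists j; auto).
  repeat (split; [apply Cprod_neq_0; intros; apply Csub_neq; unfold shift_seq; auto|]).
  assert (Dt : Rabs (IZR (t + m) - INR N * tau) <= Rabs (IZR t) + 1).
  { rewrite plus_IZR. replace (IZR t + IZR m - INR N * tau) with (IZR t + (IZR m - tau * INR N)) by ring.
    eapply Rle_trans; [apply Rabs_triang|]. pose proof (floor_mult_close tau N). unfold m. lra. }
  assert (Da : Rabs (IZR (a + d - 1) - INR N * alpha) <= Rabs (IZR a) + 2).
  { rewrite minus_IZR, plus_IZR. replace (IZR a + IZR d - 1 - INR N * alpha) with (IZR a + ((IZR d - alpha * INR N) + -1)) by ring.
    eapply Rle_trans; [apply Rabs_triang|]. pose proof (floor_mult_close alpha N) as H.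
    pose proof (Rabs_triang (IZR d - alpha * INR N) (-1)) as T. rewrite (Rabs_left (-1)) in T by lra. unfold d in *. lra. }
  assert (DN : Rabs (IZR (Z.of_nat N) - INR N) <= 0).
  { rewrite <- INR_IZR_INZ, Rminus_diag, Rabs_R0. lra. }
  assert (EW := ln_Cprod_shift w ws m (t + m) u M _ _ (fun j H => proj1 (outside j H)) Nw Bw Ht Dt).
  assert (EK := ln_Cprod_shift kap ks m (t + m) u M _ _ (fun j H => proj1 (proj2 (outside j H))) Nk Bk Ht Dt).
  assert (EY := ln_Cprod_shift y ys d (a + d - 1) u M _ _ (fun j H => proj1 (proj2 (proj2 (outside j H)))) Ny By ltac:(lia) Da).
  assert (ES := ln_Cprod_shift sig ss d (a + d - 1) u M _ _ (fun j H => proj2 (proj2 (proj2 (outside j H)))) Ns Bs ltac:(lia) Da).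
  assert (EN := ln_Cprod_shift y ys d (Z.of_nat N) u M _ _ (fun j H => proj1 (proj2 (proj2 (outside j H)))) Ny By ltac:(lia) DN).
  fold W in EW. fold K in EK. fold Y in EY. fold S in ES. fold YN in EN.
  assert (EX : ln (Cmod XN) = INR N * ln (Cmod (u - x))) by (apply ln_x_power, Nx).
  rewrite EX. unfold action, estimate_bound.
  apply Rabs_le_between in EW, EK, EY, ES, EN. apply Rabs_le_between.
  set (lw := ln (Cmod (u - ws))) in *. set (lk := ln (Cmod (u - ks))) in *. set (ly := ln (Cmod (u - ys))) in *.
  set (ls := ln (Cmod (u - ss))) in *. set (lx := ln (Cmod (u - x))) in *.
  set (BL := IZR (2 * L + 1)) in *. set (Bt := Rabs (IZR t)) in *. set (Ba := Rabs (IZR a)) in *.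
  split; lra.
Qed.

Lemma factor_A_estimate :
  Cmod (factor_A N x (shift_seq m w) (shift_seq m kap) (shift_seq d y) (shift_seq d sig) (t + m) (a + d) u)
  <= exp estimate_bound * exp (INR N * action u).
Proof.
  destruct product_bounds as (NW & NK & NY & NS & NN & NX & HB).
  assert (Ny : u <> RtoC (y a)) by (apply Hu; right; exists a; auto).
  assert (By : Rabs (ln (Cmod (u - y a))) <= M) by (apply Hu; right; exists a; auto).
  assert (Nya := Csub_neq _ _ Ny).
  unfold factor_A. rewrite !Cprod_div. fold W K Y S YN XN.
  assert (Ea : shift_seq d y (a + d) = y a) by (unfold shift_seq; f_equal; ring). rewrite Ea.
  assert (HI := fun v (H : v <> RtoC 0) => Cinv_neq_0 v H).
  rewrite <- exp_plus, <- (exp_ln (Cmod _)).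
  - apply exp_le. rewrite !ln_Cmod_mult, !ln_Cmod_inv by (repeat apply Cmult_neq_0; auto).
    apply Rabs_le_between in HB, By. lra.
  - apply Cmod_gt_0. repeat apply Cmult_neq_0; auto.
Qed.

Lemma factor_B_estimate :
  Cmod (factor_B N x (shift_seq m w) (shift_seq m kap) (shift_seq d y) (shift_seq d sig) (t + m) (a + d) u)
  <= exp estimate_bound * exp (- (INR N * action u)).
Proof.
  destruct product_bounds as (NW & NK & NY & NS & NN & NX & HB).
  assert (Ny : u <> RtoC (sig a)) by (apply Hu; right; exists a; auto).
  assert (By : Rabs (ln (Cmod (u - sig a))) <= M) by (apply Hu; right; exists a; auto).
  assert (Nya := Csub_neq _ _ Ny).
  unfold factor_B. rewrite !Cprod_div. fold W K Y S YN XN.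
  assert (Ea : shift_seq d sig (a + d) = sig a) by (unfold shift_seq; f_equal; ring). rewrite Ea.
  assert (HI := fun v (H : v <> RtoC 0) => Cinv_neq_0 v H).
  rewrite <- exp_plus, <- (exp_ln (Cmod _)).
  - apply exp_le. rewrite !ln_Cmod_mult, !ln_Cmod_inv by (repeat apply Cmult_neq_0; auto).
    apply Rabs_le_between in HB, By. lra.
  - apply Cmod_gt_0. repeat apply Cmult_neq_0; auto.
Qed.
End Bound.
End Estimate.

(** * Global location *)

(** With a nonreal root (p, q) the cubic is (u^2 - 2 p u + p^2 + q^2) (c3 u + e), and its
    discriminant is -4 q^2 times the squared square-modulus of the linear factor at the root, up to
    an explicit sum of squares. *)
Lemma discriminant_root c3 c2 c1 c0 p q : q <> 0 -> cubic c3 c2 c1 c0 (p, q) = RtoC 0 ->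
  (c3 <> 0 \/ c2 <> 0 \/ c1 <> 0 \/ c0 <> 0) -> cubic_discriminant c3 c2 c1 c0 < 0.
Proof.
  intros Hq H Hn.
  set (e := c2 + 2 * p * c3).
  assert (ER : c3 * (p ^ 3 - 3 * p * q ^ 2) + c2 * (p ^ 2 - q ^ 2) + c1 * p + c0 = 0).
  { apply (f_equal Re) in H. unfold cubic, Re in H. simpl in H. lra. }
  assert (EI : q * (c3 * (3 * p ^ 2 - q ^ 2) + c2 * (2 * p) + c1) = 0).
  { apply (f_equal Im) in H. unfold cubic, Im in H. simpl in H. lra. }
  apply Rmult_integral in EI as [EI|EI]; [contradiction|].
  assert (E1 : c1 = c3 * (p ^ 2 + q ^ 2) - 2 * p * e) by (unfold e; lra).
  assert (E0 : c0 = e * (p ^ 2 + q ^ 2)).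
  { assert (c0 = - (c3 * (p ^ 3 - 3 * p * q ^ 2) + c2 * (p ^ 2 - q ^ 2) + c1 * p)) by lra. rewrite H0, E1. unfold e. ring. }
  assert (E2 : c2 = e - 2 * p * c3) by (unfold e; ring).
  assert (D : cubic_discriminant c3 c2 c1 c0 = - (4 * q ^ 2 * ((c3 * p + e) ^ 2 + c3 ^ 2 * q ^ 2) ^ 2)).
  { unfold cubic_discriminant. rewrite E1, E0, E2. ring. }
  rewrite D. apply Ropp_lt_gt_0_contravar.
  assert (0 < q ^ 2) by (apply pow2_gt_0, Hq).
  assert (0 < (c3 * p + e) ^ 2 + c3 ^ 2 * q ^ 2).
  { destruct (Req_dec_T c3 0) as [H3|H3].
    - assert (e <> 0). { intros He. rewrite He, H3 in *. destruct Hn as [|[|[]]]; lra. }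
      rewrite H3. assert (0 < e ^ 2) by (apply pow2_gt_0; assumption). lra.
    - assert (0 < c3 ^ 2) by (apply pow2_gt_0, H3). pose proof (pow2_ge_0 (c3 * p + e)).
      assert (0 < c3 ^ 2 * q ^ 2) by (apply Rmult_lt_0_compat; assumption). lra. }
  apply Rmult_gt_0_compat; [lra|]. apply pow_lt. assumption.
Qed.

(** Seen from the point at height b above the origin, [w, y] and [k, s] subtend angles whose sines
    and cosines are proportional to b (y - w), b^2 + w y and b (s - k), b^2 + k s. The expression is
    a positive multiple of the sine of their sum, which is below PI because the intervals are
    disjoint. *)
Lemma angle_sum_pos b w y k s : 0 < b -> w < y -> y < k -> k < s ->
  0 < (s - k) * (b ^ 2 + w * y) + (y - w) * (b ^ 2 + k * s).
Proof.
  intros Hb H1 H2 H3. assert (Hb2 : 0 < b ^ 2) by (apply pow_lt, Hb).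
  assert (E : (s - k) * (b ^ 2 + w * y) + (y - w) * (b ^ 2 + k * s)
      = (s - k + (y - w)) * b ^ 2 + (s * ((- w) * (k - y)) + k * y * (s - w))) by ring.
  assert (E1 : 0 < (s - k + (y - w)) * b ^ 2) by (apply Rmult_lt_0_compat; lra).
  destruct (Rle_lt_dec 0 (w * y)) as [Hwy|Hwy]; destruct (Rle_lt_dec 0 (k * s)) as [Hks|Hks].
  - apply Rplus_lt_0_compat; apply Rmult_lt_0_compat; lra.
  - assert (k < 0 /\ 0 < s) as [Hk Hs] by (split; nra).
    assert (0 < s * ((- w) * (k - y))) by (repeat apply Rmult_lt_0_compat; lra).
    assert (0 < k * y * (s - w)) by (apply Rmult_lt_0_compat; nra). lra.
  - assert (w < 0 /\ 0 < y) as [Hw Hy] by (split; nra).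
    assert (0 < s * ((- w) * (k - y))) by (repeat apply Rmult_lt_0_compat; lra).
    assert (0 < k * y * (s - w)) by (repeat apply Rmult_lt_0_compat; lra). lra.
  - exfalso. assert (w < 0 /\ 0 < y) as [Hw Hy] by (split; nra). nra.
Qed.

Lemma cramer a1 b1 c1 a2 b2 c2 al ta A B : a1 * b2 - a2 * b1 <> 0 ->
  c1 * b2 - c2 * b1 = A * (a1 * b2 - a2 * b1) -> a1 * c2 - a2 * c1 = B * (a1 * b2 - a2 * b1) ->
  (a1 * al + b1 * ta = c1 /\ a2 * al + b2 * ta = c2 <-> al = A /\ ta = B).
Proof.
  intros HD HA HB. set (D := a1 * b2 - a2 * b1) in *. split.
  - intros [E1 E2]. split; apply Rmult_eq_reg_r with D; trivial.
    + rewrite <- HA, <- E1, <- E2. unfold D. ring.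
    + rewrite <- HB, <- E1, <- E2. unfold D. ring.
  - intros [-> ->]. split; apply Rmult_eq_reg_r with D; trivial.
    + transitivity (a1 * (A * D) + b1 * (B * D)); [ring|]. rewrite <- HA, <- HB. unfold D. ring.
    + transitivity (a2 * (A * D) + b2 * (B * D)); [ring|]. rewrite <- HA, <- HB. unfold D. ring.
Qed.

Section Location.
Variables (x w theta y s : R) (p b : R).
Notation kap := (sqdiv theta w).
Notation sig := (sqdiv s y).
Hypothesis order : x < w /\ w < y /\ y < kap /\ kap < sig.
Hypothesis Hb : 0 < b.
(** This holds for [x] close to [-oo]; it says that [alpha > 0]. *)
Hypothesis x_far : 0 < (kap - x) * (b ^ 2 + (w - p) * (y - p)) - (y - w) * (b ^ 2 + (kap - p) * (x - p)).

Notation z := ((p, b) : C).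

(** The determinant of the linear system for (alpha, tau), up to a positive factor. *)
Definition location_det : R :=
  (sig - kap) * (b ^ 2 + (w - p) * (y - p)) + (y - w) * (b ^ 2 + (kap - p) * (sig - p)).

Lemma location_det_pos : 0 < location_det.
Proof.
  unfold location_det. pose proof (angle_sum_pos b (w - p) (y - p) (kap - p) (sig - p) Hb). 
  replace (sig - kap) with (sig - p - (kap - p)) by ring. replace (y - w) with (y - p - (w - p)) by ring. lra.
Qed.

Definition sq_dist (q : R) : R := (p - q) ^ 2 + b ^ 2.

Lemma sq_dist_pos q : 0 < sq_dist q.
Proof. unfold sq_dist. pose proof (pow2_ge_0 (p - q)). pose proof (pow_lt b 2 Hb). lra. Qed.

Definition alpha_sol : R :=
  (y - x) * sq_dist sig * ((kap - x) * (b ^ 2 + (w - p) * (y - p)) - (y - w) * (b ^ 2 + (kap - p) * (x - p)))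
  / ((sig - y) * sq_dist x * location_det).

Definition tau_sol : R :=
  (y - x) * (sig - x) * sq_dist w * sq_dist kap / ((kap - w) * sq_dist x * location_det).

Lemma sols_pos : 0 < alpha_sol /\ 0 < tau_sol.
Proof.
  pose proof location_det_pos. pose proof (sq_dist_pos x). pose proof (sq_dist_pos w).
  pose proof (sq_dist_pos kap). pose proof (sq_dist_pos sig).
  split; apply Rdiv_lt_0_compat; repeat apply Rmult_lt_0_compat; lra.
Qed.

Lemma S_deriv_parts alpha tau :
  Re (S_deriv x w theta y s alpha tau z) =
    - (p - x) / sq_dist x + (1 - alpha) * (p - y) / sq_dist y + alpha * (p - sig) / sq_dist sig
    + tau * (p - w) / sq_dist w - tau * (p - kap) / sq_dist kap /\
  Im (S_deriv x w theta y s alpha tau z) =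
    - b * (- / sq_dist x + (1 - alpha) / sq_dist y + alpha / sq_dist sig + tau / sq_dist w - tau / sq_dist kap).
Proof.
  pose proof (sq_dist_pos x). pose proof (sq_dist_pos w). pose proof (sq_dist_pos y).
  pose proof (sq_dist_pos kap). pose proof (sq_dist_pos sig).
  unfold S_deriv, sq_dist, Re, Im in *. set (k := kap) in *. set (g := sig) in *. clearbody k g. split; simpl; field; lra.
Qed.

(** For fixed z the equation S'(z) = 0 amounts to two real equations, linear in alpha and tau;
    Cramer's rule gives [alpha_sol] and [tau_sol]. *)
Lemma S_deriv_sol alpha tau : S_deriv x w theta y s alpha tau z = RtoC 0 <-> alpha = alpha_sol /\ tau = tau_sol.
Proof.
  destruct (S_deriv_parts alpha tau) as [ER EI].
  pose proof (sq_dist_pos x) as Dx. pose proof (sq_dist_pos w) as Dw. pose proof (sq_dist_pos y) as Dy.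
  pose proof (sq_dist_pos kap) as Dk. pose proof (sq_dist_pos sig) as Ds. pose proof location_det_pos as Dd.
  assert (E : S_deriv x w theta y s alpha tau z = RtoC 0 <->
    (Re (S_deriv x w theta y s alpha tau z) = 0 /\ Im (S_deriv x w theta y s alpha tau z) = 0)).
  { split; [intros ->; simpl; auto|]. intros [H1 H2]. apply injective_projections; assumption. }
  rewrite E, ER, EI. clear E ER EI.

  assert (Key : (- (p - x) / sq_dist x + (1 - alpha) * (p - y) / sq_dist y + alpha * (p - sig) / sq_dist sig
    + tau * (p - w) / sq_dist w - tau * (p - kap) / sq_dist kap = 0 /\
    - b * (- / sq_dist x + (1 - alpha) / sq_dist y + alpha / sq_dist sig + tau / sq_dist w - tau / sq_dist kap) = 0) <->
    ((/ sq_dist sig - / sq_dist y) * alpha + (/ sq_dist w - / sq_dist kap) * tau = / sq_dist x - / sq_dist y /\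
     ((sig - p) / sq_dist sig - (y - p) / sq_dist y) * alpha + ((w - p) / sq_dist w - (kap - p) / sq_dist kap) * tau
       = (x - p) / sq_dist x - (y - p) / sq_dist y)).
  { split.
    - intros [E1 E2]. apply Rmult_integral in E2 as [E2|E2]; [lra|]. unfold Rdiv in *. split; lra.
    - intros [E1 E2]. split; [unfold Rdiv in *; lra|]. apply Rmult_eq_0_compat_l. unfold Rdiv in *; lra. }
  rewrite Key. clear Key. apply cramer.
  - replace ((/ sq_dist sig - / sq_dist y) * ((w - p) / sq_dist w - (kap - p) / sq_dist kap) -
     ((sig - p) / sq_dist sig - (y - p) / sq_dist y) * (/ sq_dist w - / sq_dist kap))
     with ((sig - y) * (kap - w) * location_det / (sq_dist sig * sq_dist y * sq_dist w * sq_dist kap)).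
    + apply Rgt_not_eq, Rdiv_lt_0_compat; repeat apply Rmult_lt_0_compat; lra.
    + unfold location_det, sq_dist in *. field. repeat split; lra.
  - unfold alpha_sol. set (D := location_det) in *. assert (ED : D = location_det) by reflexivity. clearbody D.
    field_simplify_eq; [|repeat split; lra]. subst D. unfold location_det, sq_dist. ring.
  - unfold tau_sol. set (D := location_det) in *. assert (ED : D = location_det) by reflexivity. clearbody D.
    field_simplify_eq; [|repeat split; lra]. subst D. unfold location_det, sq_dist. ring.
Qed.

Lemma nonreal_neq q : (z - RtoC q)%C <> RtoC 0.
Proof. intros E. apply (f_equal Im) in E. unfold Im in E; simpl in E. lra. Qed.

(** The coefficients are combinations of elementary symmetric functions of the poles; the terms in
    u^4 cancel because the residues of S' sum to 0. *)
Lemma critical_cubic_exists alpha tau : exists c3 c2 c1 c0, critical_cubic x w theta y s alpha tau c3 c2 c1 c0 /\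
  (c3 <> 0 \/ c2 <> 0 \/ c1 <> 0 \/ c0 <> 0).
Proof.
  set (k := kap) in *. set (g := sig) in *.
  set (e1 := fun a b c d : R => a + b + c + d).
  set (e2 := fun a b c d : R => a * b + a * c + a * d + b * c + b * d + c * d).
  set (e3 := fun a b c d : R => a * b * c + a * b * d + a * c * d + b * c * d).
  set (e4 := fun a b c d : R => a * b * c * d).
  set (c3 := e1 y g w k - (1 - alpha) * e1 x g w k - alpha * e1 x y w k + tau * (w - k)).
  set (c2 := - e2 y g w k + (1 - alpha) * e2 x g w k + alpha * e2 x y w k - tau * (w - k) * (x + y + g)).
  set (c1 := e3 y g w k - (1 - alpha) * e3 x g w k - alpha * e3 x y w k + tau * (w - k) * (x * y + x * g + y * g)).
  set (c0 := - e4 y g w k + (1 - alpha) * e4 x g w k + alpha * e4 x y w k - tau * (w - k) * (x * y * g)).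
  exists c3, c2, c1, c0. split.
  - intros u Hu. unfold S_denominator in Hu. fold k g in Hu.
    assert (N : (u - x <> 0 /\ u - y <> 0 /\ u - g <> 0 /\ u - w <> 0 /\ u - k <> 0)%C).
    { repeat split; intros E; apply Hu; rewrite E; ring. }
    destruct N as (N1 & N2 & N3 & N4 & N5).
    unfold S_deriv, S_denominator, cubic. fold k g. unfold c3, c2, c1, c0, e1, e2, e3, e4. clearbody k g.
    rewrite ?RtoC_plus, ?RtoC_minus, ?RtoC_mult, ?RtoC_opp, ?RtoC_plus, ?RtoC_minus, ?RtoC_mult, ?RtoC_opp, ?RtoC_plus, ?RtoC_minus, ?RtoC_mult.
    field. repeat split; assumption.
  - apply NNPP. intros Hn.
    assert (c3 = 0) by (apply NNPP; tauto). assert (c2 = 0) by (apply NNPP; tauto).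
    assert (c1 = 0) by (apply NNPP; tauto). assert (c0 = 0) by (apply NNPP; tauto).
    (* At u = x only the term of S' with residue -1 at [x] survives clearing denominators, so the
       cubic is not identically zero. *)
    assert (E : c3 * x ^ 3 + c2 * x ^ 2 + c1 * x + c0 = - ((y - x) * (g - x) * (w - x) * (k - x))).
    { unfold c3, c2, c1, c0, e1, e2, e3, e4. ring. }
    assert (0 < (y - x) * (g - x) * (w - x) * (k - x)) by (repeat apply Rmult_lt_0_compat; lra).
    rewrite H, H0, H1, H2 in E. lra.
Qed.

(** No denominator vanishes at the nonreal z, so roots of the cubic and zeros of S' are the same
    there. The negative discriminant then comes for free from [discriminant_root]. *)
Lemma global_location_iff alpha tau :
  is_global_location x w theta y s z alpha tau <-> alpha = alpha_sol /\ tau = tau_sol.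
Proof.
  assert (HD : S_denominator x w theta y s z <> RtoC 0).
  { unfold S_denominator. repeat apply Cmult_neq_0; apply nonreal_neq. }
  rewrite <- S_deriv_sol. split.
  - intros (_ & _ & c3 & c2 & c1 & c0 & HC & _ & H0 & _). specialize (HC z HD). rewrite H0 in HC.
    apply NNPP. intros Hn. exact (Cmult_neq_0 _ _ Hn HD HC).
  - intros HS. pose proof (proj1 (S_deriv_sol alpha tau) HS) as [-> ->]. pose proof sols_pos as [H1 H2].
    split; [lra|]. split; [lra|].
    destruct (critical_cubic_exists alpha_sol tau_sol) as (c3 & c2 & c1 & c0 & HC & Hn).
    exists c3, c2, c1, c0.
    assert (H0 : cubic c3 c2 c1 c0 z = RtoC 0). { rewrite <- (HC z HD), HS. ring. }
    split; [exact HC|]. split; [|split; [exact H0|exact Hb]].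
    apply (discriminant_root c3 c2 c1 c0 p b); trivial. lra.
Qed.

Lemma alpha_of_sol : alpha_of x w theta y s z = alpha_sol.
Proof.
  apply (iota_unique (V := R_CompleteNormedModule)).
  - intros v (tau & H). apply global_location_iff in H. apply H.
  - exists tau_sol. apply global_location_iff. auto.
Qed.

Lemma tau_of_sol : tau_of x w theta y s z = tau_sol.
Proof.
  apply (iota_unique (V := R_CompleteNormedModule)).
  - intros v (al & H). apply global_location_iff in H. apply H.
  - exists alpha_sol. apply global_location_iff. auto.
Qed.

Lemma location_spec : 0 < alpha_of x w theta y s z /\ 0 < tau_of x w theta y s z /\
  S_deriv x w theta y s (alpha_of x w theta y s z) (tau_of x w theta y s z) z = RtoC 0.
Proof.
  rewrite alpha_of_sol, tau_of_sol, S_deriv_sol. pose proof sols_pos as [H1 H2]. auto.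
Qed.
End Location.

(** The expression is affine in [x] with slope -E, where E = b^2 + (y - p)^2 + (y - w) (k - y) >
    0. *)
Lemma x_far_exists w y k p b : 0 < b -> w < y -> y < k -> exists X, forall x, x < X ->
  0 < (k - x) * (b ^ 2 + (w - p) * (y - p)) - (y - w) * (b ^ 2 + (k - p) * (x - p)).
Proof.
  intros Hb H1 H2.
  set (E := b ^ 2 + (w - p) * (y - p) + (k - p) * (y - w)).
  assert (HE : 0 < E).
  { unfold E. assert (0 < (y - w) * (k - y)) by (apply Rmult_lt_0_compat; lra). pose proof (pow2_ge_0 (y - p)).
    assert (0 < b ^ 2) by (apply pow_lt, Hb).
    replace (b ^ 2 + (w - p) * (y - p) + (k - p) * (y - w)) with (b ^ 2 + (y - p) ^ 2 + (y - w) * (k - y)) by ring. lra. }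
  set (Cst := k * (b ^ 2 + (w - p) * (y - p)) - (y - w) * (b ^ 2 - (k - p) * p)).
  exists (Cst / E). intros x Hx.
  replace ((k - x) * (b ^ 2 + (w - p) * (y - p)) - (y - w) * (b ^ 2 + (k - p) * (x - p))) with (Cst - x * E) by (unfold Cst, E; ring).
  apply Rmult_lt_compat_r with (r := E) in Hx; [|exact HE]. replace (Cst / E * E) with Cst in Hx by (field; lra). lra.
Qed.

(** * The saddle equations *)

Lemma Im_minus_R u (p : R) : Im (u - p) = Im u.
Proof. destruct u; unfold Im; simpl; ring. Qed.

Section Transform.
Variables P0 Pinf q1 q2 q3 c1 c2 c3 t0 : R.
Hypothesis HP : Pinf < P0.
Hypothesis Hq : q1 <> Pinf /\ q2 <> Pinf /\ q3 <> Pinf.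
Notation tinf := (c1 + c2 + c3 - t0).
Notation zeta q := ((q - P0) / (q - Pinf)).
Notation p1 := (zeta q1).
Notation p2 := (zeta q2).
Notation p3 := (zeta q3).

(** The charges sum to zero, so in the coordinate zeta the factors u - Pinf cancel and the potential
    equals the energy up to a constant. *)
Definition potential (u : C) : R :=
  c1 * ln (Cmod (u - q1)) + c2 * ln (Cmod (u - q2)) + c3 * ln (Cmod (u - q3))
  - t0 * ln (Cmod (u - P0)) - tinf * ln (Cmod (u - Pinf)).

Lemma potential_conj u : potential (Cconj u) = potential u.
Proof.
  assert (E : forall q : R, Cmod (Cconj u - q) = Cmod (u - q)).
  { intros q. replace (Cconj u - q)%C with (Cconj (u - q)); [apply Cmod_conj|].
    assert (Ec : Cconj (RtoC q) = RtoC q) by (apply injective_projections; simpl; ring).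
    unfold Cminus. rewrite Cplus_conj, Copp_conj, Ec. reflexivity. }
  unfold potential. rewrite !E. reflexivity.
Qed.

Lemma ell_Cmod p r x : ell p r (cos x) = Cmod (polar r x - p) ^ 2.
Proof.
  rewrite Cmod2_alt. unfold ell, polar, Re, Im; simpl. pose proof (sin2_cos2 x) as T. unfold Rsqr in T.
  transitivity (r * r * (sin x * sin x + cos x * cos x) + p * p - 2 * p * r * cos x); [rewrite T; ring|ring].
Qed.

Lemma half_ln_ell p r x : 0 < ell p r (cos x) -> ln (ell p r (cos x)) = 2 * ln (Cmod (polar r x - p)).
Proof.
  intros H. rewrite ell_Cmod in *. assert (0 < Cmod (polar r x - p)).
  { pose proof (Cmod_ge_0 (polar r x - p)). destruct (Req_dec_T (Cmod (polar r x - p)) 0) as [E|]; [rewrite E in H; lra|lra]. }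
  simpl. rewrite Rmult_1_r, ln_mult by assumption. ring.
Qed.

Lemma moebius_factor v q : v <> RtoC 1 -> q <> Pinf ->
  (moebius_inv P0 Pinf v - q = (moebius_inv P0 Pinf v - Pinf) * (v - RtoC (zeta q)) * RtoC ((q - Pinf) / (P0 - Pinf)))%C.
Proof.
  intros Hv Hqi. assert (N := Csub_neq _ _ Hv).
  assert (Nq : (RtoC q - RtoC Pinf)%C <> RtoC 0) by (apply Csub_neq, RtoC_neq, Hqi).
  assert (NP : (RtoC P0 - RtoC Pinf)%C <> RtoC 0) by (apply Csub_neq, RtoC_neq; lra).
  unfold moebius_inv, Rdiv. rewrite !RtoC_mult, !RtoC_inv, !RtoC_minus by lra. field. repeat split; assumption.
Qed.

Lemma moebius_P0 v : v <> RtoC 1 -> (moebius_inv P0 Pinf v - P0 = (moebius_inv P0 Pinf v - Pinf) * v)%C.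
Proof.
  intros Hv. assert (N := Csub_neq _ _ Hv). unfold moebius_inv. rewrite !RtoC_minus. field. assumption.
Qed.

Lemma ln_Cmod_prod a b : a <> RtoC 0 -> b <> RtoC 0 -> ln (Cmod (a * b)) = ln (Cmod a) + ln (Cmod b).
Proof. intros Ha Hb. rewrite Cmod_mult. apply ln_mult; apply Cmod_gt_0; assumption. Qed.

Lemma potential_energy r x : regular p1 p2 p3 r (cos x) -> polar r x <> RtoC 1 ->
  potential (moebius_inv P0 Pinf (polar r x)) = energy p1 p2 p3 c1 c2 c3 t0 r (cos x) +
   (c1 * ln (Rabs ((q1 - Pinf) / (P0 - Pinf))) + c2 * ln (Rabs ((q2 - Pinf) / (P0 - Pinf)))
     + c3 * ln (Rabs ((q3 - Pinf) / (P0 - Pinf)))).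
Proof.
  intros (Hr & _ & L1 & L2 & L3) Hv. unfold energy, potential.
  assert (Nv : polar r x <> RtoC 0).
  { intros E. pose proof (ell_Cmod 0 r x) as K. rewrite E in K. unfold ell in K.
    replace (RtoC 0 - RtoC 0)%C with (RtoC 0) in K by ring. rewrite Cmod_0 in K. nra. }
  assert (Er : Cmod (polar r x) = r).
  { apply Rsqr_inj; [apply Cmod_ge_0|lra|]. rewrite !Rsqr_pow2. replace (polar r x) with (polar r x - RtoC 0)%C by ring.
    rewrite <- ell_Cmod. unfold ell. ring. }
  assert (NI : (moebius_inv P0 Pinf (polar r x) - Pinf)%C <> RtoC 0).
  { intros E. assert (K := moebius_P0 _ Hv). rewrite E in K.
    assert (E2 : (RtoC P0 - RtoC Pinf)%C = RtoC 0).
    { replace (RtoC P0 - RtoC Pinf)%C with ((moebius_inv P0 Pinf (polar r x) - Pinf) - (moebius_inv P0 Pinf (polar r x) - P0))%C by ring.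
      rewrite K, E. ring. }
    apply (Csub_neq P0 Pinf); [apply RtoC_neq; lra|exact E2]. }
  assert (G : forall q, q <> Pinf -> 0 < ell (zeta q) r (cos x) ->
    ln (Cmod (moebius_inv P0 Pinf (polar r x) - q)) =
    ln (Cmod (moebius_inv P0 Pinf (polar r x) - Pinf)) + ln (ell (zeta q) r (cos x)) / 2 + ln (Rabs ((q - Pinf) / (P0 - Pinf)))).
  { intros q Hqi HL. rewrite half_ln_ell by exact HL.
    assert (N2 : (polar r x - RtoC (zeta q))%C <> RtoC 0).
    { intros E. rewrite ell_Cmod, E, Cmod_0 in HL. lra. }
    assert (N3 : RtoC ((q - Pinf) / (P0 - Pinf)) <> RtoC 0).
    { apply RtoC_neq. unfold Rdiv. apply Rmult_integral_contrapositive_currified; [lra|apply Rinv_neq_0_compat; lra]. }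
    rewrite (moebius_factor _ q Hv Hqi). rewrite !ln_Cmod_prod, Cmod_R by (repeat apply Cmult_neq_0; assumption). field. }
  destruct Hq as (Q1 & Q2 & Q3). rewrite (G q1), (G q2), (G q3) by assumption.
  rewrite (moebius_P0 _ Hv), ln_Cmod_prod, Er by assumption. field.
Qed.

Section Saddle_point.
Variable z : C.
Hypothesis Hz : 0 < Im z.
Hypothesis critical : (RtoC c1 / (z - q1) + RtoC c2 / (z - q2) + RtoC c3 / (z - q3) - RtoC t0 / (z - P0)
  - RtoC tinf / (z - Pinf) = 0)%C.

Lemma upper_neq (q : R) : (z - q)%C <> RtoC 0.
Proof. intros E. apply (f_equal Im) in E. unfold Im in *; simpl in E. lra. Qed.

(** The critical equation is carried to Z = zeta(z), where the charge at [Pinf] disappears. Its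
    imaginary part, divided by Im Z, is the radial condition; its real part combined with this one
    is the angular condition. *)
Lemma saddle_point : exists r0 x0, 0 < r0 /\ 0 < x0 < PI /\ -1 < cos x0 < 1 /\
  z = moebius_inv P0 Pinf (polar r0 x0) /\
  angular p1 p2 p3 c1 c2 c3 r0 (cos x0) = 0 /\
  c1 / ell p1 r0 (cos x0) + c2 / ell p2 r0 (cos x0) + c3 / ell p3 r0 (cos x0) = t0 / r0 ^ 2.
Proof.
  set (Z := ((z - P0) / (z - Pinf))%C).
  assert (NI := upper_neq Pinf). assert (N0 := upper_neq P0).
  assert (NP : (RtoC P0 - RtoC Pinf)%C <> RtoC 0) by (apply Csub_neq, RtoC_neq; lra).
  assert (Z1 : (Z - 1)%C = ((Pinf - P0) / (z - Pinf))%C) by (unfold Z; field; exact NI).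
  assert (NZ1 : Z <> RtoC 1).
  { intros E. rewrite E in Z1. apply NP. replace (RtoC P0 - RtoC Pinf)%C with (- ((Pinf - P0) / (z - Pinf) * (z - Pinf)))%C by (field; exact NI).
    rewrite <- Z1. ring. }
  assert (Ez : moebius_inv P0 Pinf Z = z).
  { unfold moebius_inv. rewrite Z1, RtoC_minus. field. split; [exact NI|].
    intros E. apply NP. replace (RtoC P0 - RtoC Pinf)%C with (- (Pinf - P0))%C by ring. rewrite E. ring. }
  assert (HY : 0 < Im Z).
  { assert (K := moebius_inv_im P0 Pinf Z NZ1). rewrite Ez in K. rewrite K in Hz.
    assert (Hm : 0 < Cmod (Z - 1) ^ 2) by (apply pow_lt, Cmod_gt_0, Csub_neq, NZ1).
    destruct (Rlt_le_dec 0 (Im Z)) as [|Hle]; [assumption|exfalso].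
    assert ((P0 - Pinf) * Im Z <= 0) by (rewrite <- (Rmult_0_r (P0 - Pinf)); apply Rmult_le_compat_l; lra).
    assert ((P0 - Pinf) * Im Z / Cmod (Z - 1) ^ 2 <= 0); [|lra].
    unfold Rdiv. rewrite <- (Rmult_0_l (/ Cmod (Z - 1) ^ 2)). apply Rmult_le_compat_r; [left; apply Rinv_0_lt_compat, Hm|assumption]. }
  assert (ZN : forall p : R, (Z - p)%C <> RtoC 0).
  { intros p E. apply (f_equal Im) in E. rewrite Im_minus_R in E. change (Im (RtoC 0)) with 0 in E. lra. }
  assert (Zeq : (RtoC c1 / (Z - RtoC p1) + RtoC c2 / (Z - RtoC p2) + RtoC c3 / (Z - RtoC p3) - RtoC t0 / Z = 0)%C).
  (* Each simple fraction in Z is a multiple of the one in z minus a constant term; the constant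
     terms add up to the one of the charge [tinf]. *)
  { assert (G : forall (c q : R), q <> Pinf -> (RtoC c / (Z - RtoC (zeta q)) = (z - Pinf) ^ 2 / (P0 - Pinf) * (RtoC c / (z - q)) - RtoC c * ((z - Pinf) / (P0 - Pinf)))%C).
    { intros c q Hqi. assert (Nq : (RtoC q - RtoC Pinf)%C <> RtoC 0) by (apply Csub_neq, RtoC_neq, Hqi).
      assert (M := upper_neq q). assert (K := moebius_factor Z q NZ1 Hqi). rewrite Ez in K.
      assert (E : (Z - RtoC (zeta q))%C = ((z - q) * (P0 - Pinf) / ((z - Pinf) * (q - Pinf)))%C).
      { rewrite K. set (Zp := (Z - RtoC (zeta q))%C) in *. unfold Rdiv. rewrite RtoC_mult, RtoC_inv, !RtoC_minus by lra. field. repeat split; assumption. }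
      rewrite E. field. repeat split; assumption. }
    destruct Hq as (Q1 & Q2 & Q3). rewrite (G c1 q1 Q1), (G c2 q2 Q2), (G c3 q3 Q3).
    assert (E0 : (RtoC t0 / Z = (z - Pinf) ^ 2 / (P0 - Pinf) * (RtoC t0 / (z - P0)) - RtoC t0 * ((z - Pinf) / (P0 - Pinf)))%C).
    { unfold Z. field. repeat split; assumption. }
    assert (Et : ((z - Pinf) ^ 2 / (P0 - Pinf) * (RtoC tinf / (z - Pinf)) = RtoC tinf * ((z - Pinf) / (P0 - Pinf)))%C) by (field; split; assumption).
    rewrite E0.
    transitivity ((z - Pinf) ^ 2 / (P0 - Pinf) * (RtoC c1 / (z - q1) + RtoC c2 / (z - q2) + RtoC c3 / (z - q3) - RtoC t0 / (z - P0)
      - RtoC tinf / (z - Pinf)) + (z - Pinf) ^ 2 / (P0 - Pinf) * (RtoC tinf / (z - Pinf)) - RtoC tinf * ((z - Pinf) / (P0 - Pinf)))%C.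
    - rewrite RtoC_minus, !RtoC_plus. ring.
    - rewrite critical, Et. ring. }
  set (X := Re Z) in *. set (Y := Im Z) in *.
  set (r0 := Cmod Z). assert (Hr0 : 0 < r0).
  { apply Cmod_gt_0. specialize (ZN 0). intros E; apply ZN. rewrite E. ring. }
  assert (Er : r0 ^ 2 = X ^ 2 + Y ^ 2) by apply Cmod2_alt.
  assert (HX : -1 < X / r0 < 1).
  { assert (0 < Y ^ 2) by (apply pow_lt, HY).
    assert (- r0 < X < r0) by (split; nra).
    split; apply Rmult_lt_reg_r with r0; trivial; unfold Rdiv; rewrite Rmult_assoc, Rinv_l; lra. }
  set (x0 := acos (X / r0)).
  assert (Hc : cos x0 = X / r0) by (apply cos_acos; lra).
  assert (Hx0 : 0 < x0 < PI).
  { destruct (acos_bound (X / r0)) as [B1 B2]. fold x0 in B1, B2. split.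
    - destruct (Req_dec_T x0 0) as [E|]; [|lra]. rewrite E, cos_0 in Hc. lra.
    - destruct (Req_dec_T x0 PI) as [E|]; [|lra]. rewrite E, cos_PI in Hc. lra. }
  assert (Hs : r0 * sin x0 = Y).
  { assert (0 < sin x0) by (apply sin_gt_0; lra). apply Rsqr_inj; [apply Rmult_le_pos; lra|lra|].
    unfold Rsqr. pose proof (sin2_cos2 x0) as T. unfold Rsqr in T. rewrite Hc in T.
    replace (r0 * sin x0 * (r0 * sin x0)) with (r0 ^ 2 * (sin x0 * sin x0)) by ring.
    replace (sin x0 * sin x0) with (1 - X / r0 * (X / r0)) by lra.
    replace (r0 ^ 2 * (1 - X / r0 * (X / r0))) with (r0 ^ 2 - X ^ 2) by (field; lra). rewrite Er. ring. }
  assert (EZ : polar r0 x0 = Z).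
  { unfold polar. rewrite Hc, Hs. replace (r0 * (X / r0)) with X by (field; lra). unfold X, Y. destruct Z; reflexivity. }
  assert (EL : forall p, ell p r0 (cos x0) = (X - p) ^ 2 + Y ^ 2).
  { intros p. unfold ell. rewrite Hc, Er. replace (2 * p * r0 * (X / r0)) with (2 * p * X) by (field; lra). ring. }
  assert (HY2 : 0 < Y ^ 2) by (apply pow_lt, HY).
  assert (DP : forall p, 0 < (X - p) ^ 2 + Y ^ 2) by (intros p; pose proof (pow2_ge_0 (X - p)); lra).
  assert (Parts : forall (c p : R), (RtoC c / (Z - RtoC p))%C = (c * (X - p) / ((X - p) ^ 2 + Y ^ 2), - (c * Y / ((X - p) ^ 2 + Y ^ 2)))).
  { intros c p. specialize (DP p). unfold X, Y, Re, Im in *. destruct Z as [ZX ZY]. simpl in *.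
    apply injective_projections; simpl; field; lra. }
  assert (P00 : (RtoC t0 / Z)%C = (t0 * X / r0 ^ 2, - (t0 * Y / r0 ^ 2))).
  { replace (RtoC t0 / Z)%C with (RtoC t0 / (Z - RtoC 0))%C by (f_equal; f_equal; ring). rewrite Parts, Rminus_0_r, Er. reflexivity. }
  rewrite !Parts, P00 in Zeq. 
  assert (ER := f_equal fst Zeq). assert (EI := f_equal snd Zeq). cbn [fst snd Cplus Cminus Copp RtoC] in ER, EI. clear Zeq Parts P00.
  exists r0, x0. split; [exact Hr0|]. split; [exact Hx0|]. split; [rewrite Hc; exact HX|].
  split; [rewrite EZ; auto|].
  assert (R2 : 0 < r0 ^ 2) by (apply pow_lt, Hr0).
  pose proof (DP p1) as D1. pose proof (DP p2) as D2. pose proof (DP p3) as D3.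
  unfold angular. rewrite !EL.
  set (d1 := (X - p1) ^ 2 + Y ^ 2) in *. set (d2 := (X - p2) ^ 2 + Y ^ 2) in *. set (d3 := (X - p3) ^ 2 + Y ^ 2) in *.
  set (e1 := (p1 : R)) in *. set (e2 := (p2 : R)) in *. set (e3 := (p3 : R)) in *.
  clearbody d1 d2 d3 e1 e2 e3.
  assert (EQ : c1 / d1 + c2 / d2 + c3 / d3 = t0 / r0 ^ 2).
  { apply Rmult_eq_reg_l with Y; [|lra]. unfold Rdiv in *. lra. }
  split; [|exact EQ].
  replace (c1 * e1 / d1 + c2 * e2 / d2 + c3 * e3 / d3) with
    (X * (c1 / d1 + c2 / d2 + c3 / d3) - (c1 * (X - e1) / d1 + c2 * (X - e2) / d2 + c3 * (X - e3) / d3)) by (field; lra).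
  rewrite EQ. unfold Rdiv in *. lra.
Qed.
End Saddle_point.
End Transform.

(** * The limit for given curves *)

Lemma seq_extrema L (f : Z -> R) fs : (forall j, (L < Z.abs j)%Z -> f j = fs) ->
  exists i1 i2, forall j, f i1 <= f j <= f i2.
Proof.
  intros Hout.
  assert (G : forall l : list Z, exists i1 i2, (forall j, In j l -> f i1 <= f j <= f i2) /\ f i1 <= fs <= f i2).
  { induction l as [|k l (i1 & i2 & H & Hs)].
    - exists (Z.abs L + 1)%Z, (Z.abs L + 1)%Z. split; [intros j []|]. rewrite Hout by lia. lra.
    - exists (if Rle_dec (f i1) (f k) then i1 else k), (if Rle_dec (f k) (f i2) then i2 else k). split.
      + intros j [<-|Hj]; [|specialize (H j Hj)]; destruct Rle_dec, Rle_dec; lra.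
      + destruct Rle_dec, Rle_dec; lra. }
  destruct (G (Zrange (- L) L)) as (i1 & i2 & H & Hs). exists i1, i2. intros j.
  destruct (Z_lt_le_dec L (Z.abs j)) as [Hj|Hj]; [rewrite (Hout j Hj); exact Hs|]. apply H, Zrange_In. lia.
Qed.

Lemma floor_mult_large c K : 0 < c -> exists N0, forall N, (N0 <= N)%nat -> (K <= floor_mult c N)%Z.
Proof.
  intros Hc. destruct (INR_unbounded (IZR (K + 1) / c)) as [N0 HN0]. exists N0. intros N HN. apply le_INR in HN.
  pose proof (floor_mult_close c N) as H. apply Rabs_le_between in H.
  assert (IZR (K + 1) < c * INR N).
  { apply Rmult_lt_compat_r with (r := c) in HN0; [|exact Hc].
    replace (IZR (K + 1) / c * c) with (IZR (K + 1)) in HN0 by (field; lra). nra. }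
  rewrite plus_IZR in H0. apply le_IZR. lra.
Qed.

Lemma path_integral_ext (g : C1path) f h : (forall t, 0 <= t <= 1 -> f (g t) = h (g t)) -> path_integral g f = path_integral g h.
Proof.
  intros H. unfold path_integral. apply (RInt_ext (V := C_R_CompleteNormedModule)).
  rewrite Rmin_left, Rmax_right by lra. intros t Ht. rewrite H by lra. reflexivity.
Qed.

Lemma chain_upper (l : chain) : exists B, forall u, on_chain l u -> Cmod u <= B.
Proof.
  induction l as [|[c g] l (B & HB)].
  - exists 0. intros u (c & g & t & [] & _).
  - destruct (continuous_bounded (fun t => Cmod (g t))) as [M HM].
    { intros t _. apply continuous_Cmod, path_continuous. }
    exists (Rmax M B). intros u Hu. apply on_chain_cons in Hu as [(t & Ht & <-)|Hu].
    + eapply Rle_trans; [apply HM, Ht|apply Rmax_l].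
    + eapply Rle_trans; [apply HB, Hu|apply Rmax_r].
Qed.

Lemma chain_log_bound (l : chain) (Q : list R) : (forall q, In q Q -> ~ on_chain l (RtoC q)) ->
  exists M, forall q u, In q Q -> on_chain l u -> Rabs (ln (Cmod (u - q))) <= M.
Proof.
  intros HQ. destruct (chain_upper l) as [B HB].
  induction Q as [|q Q IH]; [exists 0; intros q u []|].
  destruct IH as [M HM]; [intros p Hp; apply HQ; right; exact Hp|].
  destruct (chain_dist l (RtoC q)) as (d & Hd & Hdist); [apply HQ; left; reflexivity|].
  exists (M + Rabs (ln d) + Rabs (ln (Rmax B 0 + Rabs q + 1)) + Rabs M).
  intros p u [<-|Hp] Hu.
  - specialize (Hdist u Hu). replace (q - u)%C with (- (u - q))%C in Hdist by ring. rewrite Cmod_opp in Hdist.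
    assert (Hup : Cmod (u - q) <= Rmax B 0 + Rabs q + 1).
    { pose proof (Cmod_triangle u (- q)) as T. rewrite Cmod_opp, Cmod_R in T. specialize (HB u Hu). pose proof (Rmax_l B 0).
      unfold Cminus. lra. }
    assert (L1 : ln d <= ln (Cmod (u - q))) by (apply ln_le; assumption).
    assert (L2 : ln (Cmod (u - q)) <= ln (Rmax B 0 + Rabs q + 1)) by (apply ln_le; lra).
    pose proof (RRle_abs (ln (Rmax B 0 + Rabs q + 1))). pose proof (RRle_abs (- ln d)) as K. rewrite Rabs_Ropp in K.
    pose proof (RRle_abs (- M)) as K2. rewrite Rabs_Ropp in K2.
    pose proof (Rabs_pos (ln d)). pose proof (Rabs_pos (ln (Rmax B 0 + Rabs q + 1))).
    apply Rabs_le. lra.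
  - specialize (HM p u Hp Hu). pose proof (Rabs_pos (ln d)). pose proof (Rabs_pos (ln (Rmax B 0 + Rabs q + 1))). pose proof (Rabs_pos M). lra.
Qed.

Lemma path_to_impl (P Q : C -> Prop) z b l : (forall u, P u -> Q u) -> path_to P z b l -> path_to Q z b l.
Proof.
  intros H (g & l' & E & E0 & H0 & Hl). exists g, l'. split; [exact E|]. split; [exact E0|]. split.
  - intros s Hs. destruct (H0 s Hs). auto.
  - eapply linked_impl; [|exact Hl]. intros u [H1 H2]. auto.
Qed.

Lemma action_conj ws ks ys ss x alpha tau u : action ws ks ys ss x alpha tau (Cconj u) = action ws ks ys ss x alpha tau u.
Proof.
  assert (E : forall q : R, Cmod (Cconj u - q) = Cmod (u - q)).
  { intros q. replace (Cconj u - q)%C with (Cconj (u - q)); [apply Cmod_conj|].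
    assert (Ec : Cconj (RtoC q) = RtoC q) by (apply injective_projections; simpl; ring).
    unfold Cminus. rewrite Cplus_conj, Copp_conj, Ec. reflexivity. }
  unfold action. rewrite !E. reflexivity.
Qed.

Lemma continuous_ln_dist (c : C1path) s q : c s <> RtoC q -> continuous (fun s => ln (Cmod (c s - q))) s.
Proof.
  intros H. apply (continuous_comp (fun s => Cmod (c s - q)) ln).
  - apply continuous_Cmod, continuous_Cminus; [apply path_continuous|apply continuous_const].
  - apply continuous_ln, Cmod_gt_0, Csub_neq, H.
Qed.

Lemma action_continuous ws ks ys ss x alpha tau (c : C1path) s :
  c s <> RtoC x -> c s <> RtoC ws -> c s <> RtoC ks -> c s <> RtoC ys -> c s <> RtoC ss ->
  continuous (fun s => action ws ks ys ss x alpha tau (c s)) s.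
Proof.
  assert (G : forall k q, c s <> RtoC q -> continuous (fun s => k * ln (Cmod (c s - q))) s).
  { intros k q Hq. apply (continuous_mult (K := R_AbsRing)); [apply continuous_const|apply continuous_ln_dist, Hq]. }
  intros Nx Nw Nk Ny Ns. unfold action.
  apply (continuous_minus (V := R_NormedModule)); [|apply G, Nk].
  apply (continuous_plus (V := R_NormedModule)); [|apply G, Nw].
  apply (continuous_plus (V := R_NormedModule)); [|apply G, Ns].
  apply (continuous_plus (V := R_NormedModule)); [|apply G, Ny].
  apply (continuous_opp (V := R_NormedModule)), continuous_ln_dist, Nx.
Qed.

Section Limit.
Variables (L : Z) (w theta y s : Z -> R) (ws thetas ys ss x : R).
Notation kap := (fun j : Z => sqdiv (theta j) (w j)).
Notation sig := (fun j : Z => sqdiv (s j) (y j)).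
Hypothesis HL : (1 <= L)%Z.
Hypothesis outside : forall i : Z, (L < Z.abs i)%Z -> w i = ws /\ theta i = thetas /\ y i = ys /\ s i = ss.
Hypothesis ordered : forall i j : Z, w i < y j /\ y j < kap i /\ kap i < sig j.
Variables (z : C) (alpha tau : R) (t a t' a' : Z).
Hypothesis Hz : 0 < Im z.
Hypothesis alpha_pos : 0 < alpha.
Hypothesis tau_pos : 0 < tau.
Notation m N := (floor_mult tau N).
Notation n N := (floor_mult alpha N).
Notation cB := (y a * (1 - / s a ^ 2)).

Lemma outside_params j : (L < Z.abs j)%Z -> w j = ws /\ kap j = sqdiv thetas ws /\ y j = ys /\ sig j = sqdiv ss ys.
Proof. intros H. destruct (outside j H) as (-> & -> & -> & ->). auto. Qed.

Definition A_pole (N : nat) (p : R) : Prop :=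
  (p = x /\ (0 < N)%nat) \/ (exists j, p = kap j) \/ ((Z.of_nat N < a' + n N)%Z /\ exists j, p = y j).

Definition B_pole (N : nat) (p : R) : Prop :=
  (exists j, p = w j) \/ (exists j, p = sig j) \/ ((a + n N <= Z.of_nat N)%Z /\ exists j, p = y j).

Definition FA N := factor_A N x (shift_seq (m N) w) (shift_seq (m N) kap) (shift_seq (n N) y) (shift_seq (n N) sig) (t' + m N) (a' + n N).
Definition FB N := factor_B N x (shift_seq (m N) w) (shift_seq (m N) kap) (shift_seq (n N) y) (shift_seq (n N) sig) (t + m N) (a + n N).

Definition off_A (u : C) : Prop := u <> RtoC x /\ (forall j, u <> RtoC (kap j)) /\ (forall j, u <> RtoC (y j)).
Definition off_B (u : C) : Prop := (forall j, u <> RtoC (w j)) /\ (forall j, u <> RtoC (y j)) /\ (forall j, u <> RtoC (sig j)).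

Definition kernel_parts (N : nat) (T : pfrac * pfrac) : Prop :=
  pf_poles (fst T) (A_pole N) /\ pf_poles (snd T) (B_pole N) /\
  (forall u, off_A u -> pf_eval (fst T) u = FA N u) /\
  (forall u, off_B u -> pf_eval (snd T) u = (RtoC cB * FB N u)%C).

Lemma kernel_parts_exist N : (1 <= a + n N)%Z -> (1 <= a' + n N)%Z -> (0 <= t + m N)%Z -> (0 <= t' + m N)%Z ->
  exists T, kernel_parts N T.
Proof.
  intros H1 H2 H3 H4.
  destruct (factor_A_pf N x (shift_seq (m N) w) (shift_seq (m N) kap) (shift_seq (n N) y) (shift_seq (n N) sig) (t' + m N) (a' + n N) H2 H4) as (TA & PA & EA).
  destruct (factor_B_pf N x (shift_seq (m N) w) (shift_seq (m N) kap) (shift_seq (n N) y) (shift_seq (n N) sig) (t + m N) (a + n N) H1 H3) as (TB & PB & EB).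
  exists (TA, pf_scale (RtoC cB) TB). repeat split; simpl.
  - eapply pf_poles_impl; [|exact PA]. unfold shift_seq, A_pole. intros p [H|[(j & H)|(Hn & j & H)]]; eauto 7.
  - apply pf_scale_poles. eapply pf_poles_impl; [|exact PB]. unfold shift_seq, B_pole. intros p [(j & H)|[(j & H)|(Hn & j & H)]]; eauto 7.
  - intros u (O1 & O2 & O3). apply EA. unfold generic_A, shift_seq. auto.
  - intros u (O1 & O2 & O3). rewrite pf_scale_eval. f_equal. apply EB. unfold generic_B, shift_seq. auto.
Qed.

Lemma parts_sine N T u : kernel_parts N T -> (1 <= a + n N)%Z -> (1 <= a' + n N)%Z -> (0 <= t + m N)%Z -> (0 <= t' + m N)%Z ->
  off_A u -> off_B u -> (pf_eval (fst T) u * pf_eval (snd T) u)%C = sine_integrand w theta y s t a t' a' u.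
Proof.
  intros (_ & _ & EA & EB) H1 H2 H3 H4 OA OB. rewrite EA, EB by assumption.
  replace (FA N u * (RtoC cB * FB N u))%C with (RtoC cB * (FA N u * FB N u))%C by ring.
  unfold FA, FB. rewrite factors_sine; trivial.
  - rewrite <- (sine_integrand_shift w theta y s t a t' a' (m N) (n N)). unfold sine_integrand.
    assert (Ea : forall f : Z -> R, shift_seq (n N) f (a + n N) = f a) by (intros; unfold shift_seq; f_equal; ring).
    rewrite !Ea. unfold Cdiv.
    change (shift_seq (n N) sig) with (fun j => sqdiv (shift_seq (n N) s j) (shift_seq (n N) y j)).
    change (shift_seq (m N) kap) with (fun j => sqdiv (shift_seq (m N) theta j) (shift_seq (m N) w j)).
    cbv beta. ring.
  - destruct OA as (A1 & A2 & A3), OB as (B1 & B2 & B3). unfold generic, shift_seq. auto.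
Qed.

(** The factors with [N = 0] and shifts large enough to make all indices admissible: their product
    is the sine integrand, and no [x] appears. *)
Lemma sine_parts_exist : exists T1 T2,
  pf_poles T1 (fun p => (exists j, p = kap j) \/ exists j, p = y j) /\
  pf_poles T2 (fun p => (exists j, p = w j) \/ exists j, p = sig j) /\
  forall u, (forall j, u <> RtoC (w j) /\ u <> RtoC (kap j) /\ u <> RtoC (y j) /\ u <> RtoC (sig j)) ->
    sine_integrand w theta y s t a t' a' u = (pf_eval T1 u * pf_eval T2 u)%C.
Proof.
  set (m0 := (Z.abs t + Z.abs t')%Z). set (n0 := (Z.abs a + Z.abs a' + 1)%Z).
  destruct (factor_A_pf 0 x (shift_seq m0 w) (shift_seq m0 kap) (shift_seq n0 y) (shift_seq n0 sig) (t' + m0) (a' + n0)) as (TA & PA & EA); [lia|lia|].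
  destruct (factor_B_pf 0 x (shift_seq m0 w) (shift_seq m0 kap) (shift_seq n0 y) (shift_seq n0 sig) (t + m0) (a + n0)) as (TB & PB & EB); [lia|lia|].
  exists TA, (pf_scale (RtoC cB) TB). split; [|split].
  - eapply pf_poles_impl; [|exact PA]. unfold shift_seq. intros p [[_ H]|[(j & H)|(_ & j & H)]]; [lia|eauto 7..].
  - apply pf_scale_poles. eapply pf_poles_impl; [|exact PB]. unfold shift_seq. intros p [(j & H)|[(j & H)|(Hn & j & H)]]; [eauto 7..|lia].
  - intros u Hu.
    rewrite pf_scale_eval, EA, EB by (unfold generic_A, generic_B, shift_seq; repeat split; intros; try apply Hu; lia).
    match goal with |- _ = (?p * (?c * ?q))%C => replace (p * (c * q))%C with (c * (p * q))%C by ring end.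
    rewrite factors_sine; [|lia..|unfold generic, shift_seq; repeat split; intros; try apply Hu; lia].
    rewrite <- (sine_integrand_shift w theta y s t a t' a' m0 n0). unfold sine_integrand.
    assert (Ea : forall f : Z -> R, shift_seq n0 f (a + n0) = f a) by (intros; unfold shift_seq; f_equal; ring).
    rewrite !Ea. unfold Cdiv.
    change (shift_seq n0 sig) with (fun j => sqdiv (shift_seq n0 s j) (shift_seq n0 y j)).
    change (shift_seq m0 kap) with (fun j => sqdiv (shift_seq m0 theta j) (shift_seq m0 w j)).
    cbv beta. ring.
Qed.

Variables (mw Mw my My mk Mk ms : R).
Hypothesis Bw : forall j, mw <= w j <= Mw.
Hypothesis By : forall j, my <= y j <= My.
Hypothesis Bk : forall j, mk <= kap j <= Mk.
Hypothesis Bs : forall j, ms <= sig j.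
Hypothesis Bord : x < mw /\ Mw < my /\ My < mk /\ Mk < ms.

Lemma bounds_chain : x < mw /\ mw <= Mw /\ Mw < my /\ my <= My /\ My < mk /\ mk <= Mk /\ Mk < ms.
Proof. specialize (Bw 0%Z). specialize (By 0%Z). specialize (Bk 0%Z). lra. Qed.

Definition arc_cross : R := if Z_le_gt_dec t t' then (x + mw) / 2 else (Mk + ms) / 2.

Lemma arc_cross_zone : arc_zone w theta y s t t' arc_cross.
Proof.
  pose proof bounds_chain as HB. unfold arc_cross, arc_zone. destruct (Z_le_gt_dec t t') as [H|H]; split; intros H'; try lia.
  - intros i. specialize (Bw i). lra.
  - split; intros i; [specialize (Bk i)|specialize (Bs i)]; simpl in *; lra.
Qed.

Lemma arc_off u : on_chain (sing (arc z arc_cross)) u -> off_A u /\ off_B u.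
Proof.
  intros Hu. pose proof bounds_chain as HB.
  assert (G : forall p, p <> arc_cross -> u <> RtoC p) by (intros p Hp; apply (crossing_off (sing (arc z arc_cross)) z arc_cross); [apply arc_crossing, Hz|exact Hu|exact Hp]).
  assert (C0 : x < arc_cross < mw \/ Mk < arc_cross < ms) by (unfold arc_cross; destruct Z_le_gt_dec; lra).
  split; repeat split; intros; apply G; try specialize (Bw j); try specialize (By j); try specialize (Bk j); try specialize (Bs j); simpl in *; lra.
Qed.

Lemma K_2d_arc V : chain_int (sing (arc z arc_cross)) (sine_integrand w theta y s t a t' a') V ->
  K_2d w theta y s z t a t' a' = (- / (2 * PI * Ci) * V)%C.
Proof.
  intros HV. destruct sine_parts_exist as (T1 & T2 & P1 & P2 & ET). pose proof bounds_chain as HB.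
  apply (K_2d_value w theta y s z t a t' a' T1 T2 arc_cross); trivial; [apply arc_cross_zone| |].
  - assert (G : forall p, (exists j, p = kap j) \/ (exists j, p = y j) \/ (exists j, p = w j) \/ (exists j, p = sig j) ->
      (forall x, arc_zone w theta y s t t' x -> x < p) \/ (forall x, arc_zone w theta y s t t' x -> p < x)).
    { intros p Hp. destruct (Z_le_gt_dec t t') as [H|H].
      - left. intros q [Hq _]. specialize (Hq ltac:(lia)).
        destruct Hp as [(j & ->)|[(j & ->)|[(j & ->)|(j & ->)]]].
        + pose proof (ordered j 0). specialize (Hq j). lra.
        + pose proof (ordered 0 j). specialize (Hq 0%Z). lra.
        + apply Hq.
        + pose proof (ordered 0 j). specialize (Hq 0%Z). simpl. lra.
      - destruct Hp as [(j & ->)|[(j & ->)|[(j & ->)|(j & ->)]]]; [right|right|right|left];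
          intros q [_ Hq]; specialize (Hq ltac:(lia)); destruct Hq as [Hq1 Hq2].
        + apply Hq1.
        + pose proof (ordered 0 j). specialize (Hq1 0%Z). lra.
        + pose proof (ordered j 0). specialize (Hq1 j). lra.
        + apply Hq2. }
    intros T [-> | ->]; [eapply pf_poles_impl; [|exact P1]|eapply pf_poles_impl; [|exact P2]]; intros p [H|H]; apply G; auto.
  - intros u Hu. apply ET. intros j.
    assert (K : forall p, Im u = 0 -> Re u <> p -> u <> RtoC p) by (intros p _ Hn E; apply Hn; rewrite E; reflexivity).
    destruct (Req_dec_T (Im u) 0) as [Hi|Hi].
    + specialize (Hu Hi). destruct (Z_le_gt_dec t t') as [H|H].
      * destruct Hu as [Hq _]. specialize (Hq ltac:(lia) j). pose proof (ordered j j). repeat split; apply K; trivial; simpl in *; lra.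
      * destruct Hu as [_ Hq]. destruct (Hq ltac:(lia)) as [Hq1 Hq2]. specialize (Hq1 j). specialize (Hq2 j).
        pose proof (ordered j j). repeat split; apply K; trivial; simpl in *; lra.
    + repeat split; intros E; apply Hi; rewrite E; reflexivity.
Qed.

Notation contours N := (AP_contours N (fun _ => x) (shift_seq (m N) w) (shift_seq (m N) theta)
  (shift_seq (n N) y) (shift_seq (n N) s) (t + m N) (t' + m N)).

(** The contour conditions concern only indices j >= 1. After a shift by at least L + 2 the window
    |j| <= L lies in that range, and index 1 already shows the constant outer value. *)
Lemma shift_reach (f : Z -> R) fs d j : (forall i, (L < Z.abs i)%Z -> f i = fs) -> (L + 2 <= d)%Z ->
  exists j', (1 <= j')%Z /\ shift_seq d f j' = f j.
Proof.
  intros Hf Hd. destruct (Z_lt_le_dec L (Z.abs j)) as [Hj|Hj].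
  - exists 1%Z. split; [lia|]. unfold shift_seq. rewrite !Hf by lia. reflexivity.
  - exists (j + d)%Z. split; [lia|]. unfold shift_seq. f_equal. ring.
Qed.

Lemma contour_facts N gu gv : (1 <= N)%nat -> (L + 2 <= m N)%Z -> (L + 2 <= n N)%Z -> contours N gu gv ->
  gu 0 = gu 1 /\ gv 0 = gv 1 /\ ((t <= t')%Z -> lies_inside gv gu) /\ ((t' < t)%Z -> lies_inside gu gv) /\
  (forall j, encircles gu (RtoC (y j))) /\ (forall j, encircles gu (RtoC (kap j))) /\ excludes gu (RtoC x) /\
  (forall j, encircles gv (RtoC (y j))) /\ (forall j, encircles gv (RtoC (w j))) /\ (forall j, excludes gv (RtoC (sig j))).
Proof.
  intros HN Hm Hn ((U0 & _) & (V0 & _) & H1 & H2 & H3 & H4 & H5 & H6 & H7 & H8).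
  split; [exact U0|]. split; [exact V0|]. split; [intros; apply H1; lia|]. split; [intros; apply H2; lia|].
  assert (Ow := fun j H => proj1 (outside_params j H)).
  assert (Ok := fun j H => proj1 (proj2 (outside_params j H))).
  assert (Oy := fun j H => proj1 (proj2 (proj2 (outside_params j H)))).
  assert (Os := fun j H => proj2 (proj2 (proj2 (outside_params j H)))).
  split; [|split; [|split; [|split; [|split]]]].
  - intros j. destruct (shift_reach y _ (n N) j Oy Hn) as (k & Hk & <-). apply H3, Hk.
  - intros j. destruct (shift_reach kap _ (m N) j Ok Hm) as (k & Hk & E). simpl in E. rewrite <- E. apply (H4 k Hk).
  - apply (H5 1%Z). lia.
  - intros j. destruct (shift_reach y _ (n N) j Oy Hn) as (k & Hk & <-). apply H6, Hk.
  - intros j. destruct (shift_reach w _ (m N) j Ow Hm) as (k & Hk & <-). apply H7, Hk.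
  - intros j. destruct (shift_reach sig _ (n N) j Os Hn) as (k & Hk & E). simpl in E. rewrite <- E. apply (H8 k Hk).
Qed.

Lemma contours_exist N : exists gu gv, contours N gu gv.
Proof.
  pose proof bounds_chain as HB.
  assert (W : forall j, mw <= shift_seq (m N) w j <= Mw) by (intros; apply Bw).
  assert (Y : forall j, my <= shift_seq (n N) y j <= My) by (intros; apply By).
  assert (K : forall j, mk <= sqdiv (shift_seq (m N) theta j) (shift_seq (m N) w j) <= Mk) by (intros; apply Bk).
  assert (S : forall j, ms <= sqdiv (shift_seq (n N) s j) (shift_seq (n N) y j)) by (intros; apply Bs).
  assert (G : forall c1 d1 c2 d2, x < c1 < mw -> Mk < d1 -> c2 < mw -> Mk < d2 < ms ->
    ((t <= t')%Z -> c1 < c2 /\ d2 < d1) -> ((t' < t)%Z -> c2 < c1 /\ d1 < d2) ->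
    contours N (diameter c1 d1) (diameter c2 d2)).
  { intros c1 d1 c2 d2 C1 D1 C2 D2 I1 I2.
    destruct (diameter_spec c1 d1) as (S1 & E1 & X1); [lra|]. destruct (diameter_spec c2 d2) as (S2 & E2 & X2); [lra|].
    split; [exact S1|]. split; [exact S2|].
    split; [intros H; apply diameter_nested; destruct I1; lia || lra|].
    split; [intros H; apply diameter_nested; destruct I2; lia || lra|].
    split; [intros i _; apply E1; specialize (Y i); lra|]. split; [intros i _; apply E1; specialize (K i); lra|].
    split; [intros i _; apply X1; lra|]. split; [intros i _; apply E2; specialize (Y i); lra|].
    split; [intros i _; apply E2; specialize (W i); lra|]. intros i _; apply X2; specialize (S i); lra. }
  destruct (Z_le_gt_dec t t') as [H|H].
  (* The left ends divide the gap between [x] and [mw] into thirds. The outer circle is [gu], which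
     is allowed to contain the points s^{-2} y and so may extend beyond [ms]. *)
  - exists (diameter ((2 * x + mw) / 3) (ms + 1)), (diameter ((x + 2 * mw) / 3) ((Mk + ms) / 2)).
    apply G; try lra; intros; lra || lia.
  - exists (diameter ((x + 2 * mw) / 3) ((2 * Mk + ms) / 3)), (diameter ((2 * x + mw) / 3) ((Mk + 2 * ms) / 3)).
    apply G; try lra; intros; lra || lia.
Qed.

Notation alo := my.
Notation blo := ms.

(** For every admissible pair of contours the double integral is V1 + V2 - VG up to a factor, with
    none of the three depending on the contours. This determines [K_AP], and VG is the integral that
    determines [K_2d]. *)
Lemma kernel_difference N T (lR lL : chain) (f1 f2 : C -> C) : (1 <= N)%nat -> (L + 2 <= m N)%Z -> (L + 2 <= n N)%Z ->
  (1 <= a + n N)%Z -> (1 <= a' + n N)%Z -> (0 <= t + m N)%Z -> (0 <= t' + m N)%Z ->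
  kernel_parts N T ->
  (forall gu gv : C1path, gu 0 = gu 1 -> gv 0 = gv 1 ->
    pf_poles (fst T) (fun p => (p < alo -> excludes gu (RtoC p)) /\ (alo <= p -> encircles gu (RtoC p))) ->
    pf_poles (snd T) (fun p => (p < blo -> encircles gv (RtoC p)) /\ (blo <= p -> excludes gv (RtoC p))) ->
    arc_position gu gv (fst T) (snd T) alo blo arc_cross ->
    exists V1 V2 VG, chain_int lR f1 V1 /\ chain_int lL f2 V2 /\
      chain_int (sing (arc z arc_cross)) (fun u => pf_eval (fst T) u * pf_eval (snd T) u)%C VG /\
      double_int gu gv (fst T) (snd T) = (2 * PI * Ci * (V1 + V2 - VG))%C) ->
  exists V1 V2, chain_int lR f1 V1 /\ chain_int lL f2 V2 /\
    (K_AP N (fun _ => x) (shift_seq (m N) w) (shift_seq (m N) theta) (shift_seq (n N) y) (shift_seq (n N) s)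
       (t + m N) (a + n N) (t' + m N) (a' + n N) - K_2d w theta y s z t a t' a' = / (2 * PI * Ci) * (V1 + V2))%C.
Proof.
  intros HN Hm Hn H1 H2 H3 H4 HT Hcore. pose proof bounds_chain as HB. pose proof two_pi_i_neq_0 as Hpi.
  assert (Each : forall gu gv, contours N gu gv -> exists V1 V2 VG, chain_int lR f1 V1 /\ chain_int lL f2 V2 /\
      chain_int (sing (arc z arc_cross)) (fun u => pf_eval (fst T) u * pf_eval (snd T) u)%C VG /\
      AP_integral N (fun _ => x) (shift_seq (m N) w) (shift_seq (m N) theta) (shift_seq (n N) y) (shift_seq (n N) s)
       (t + m N) (a + n N) (t' + m N) (a' + n N) gu gv = (/ (2 * PI * Ci) * (V1 + V2 - VG))%C).
  { intros gu gv Hc. destruct (contour_facts N gu gv HN Hm Hn Hc) as (U0 & V0 & I1 & I2 & UY & UK & UX & VY & VW & VS).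
    destruct HT as (PA & PB & EA & EB).
    destruct (Hcore gu gv U0 V0) as (V1 & V2 & VG & J1 & J2 & J3 & ED).
    - eapply pf_poles_impl; [|exact PA]. intros p [[-> _]|[(j & ->)|(_ & j & ->)]]; split; intros Hp; auto; exfalso;
        try specialize (Bk j); try specialize (By j); simpl in *; lra.
    - eapply pf_poles_impl; [|exact PB]. intros p [(j & ->)|[(j & ->)|(_ & j & ->)]]; split; intros Hp; auto; exfalso;
        try specialize (Bw j); try specialize (Bs j); try specialize (By j); simpl in *; lra.
    - unfold arc_position, arc_cross. destruct (Z_le_gt_dec t t') as [H|H]; [left; split; [apply I1, H|split]|right; split; [apply I2; lia|split]].
      + eapply pf_poles_impl; [|exact PA]. intros p [[-> _]|[(j & ->)|(_ & j & ->)]]; split; intros Hp;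
          try specialize (Bk j); try specialize (By j); simpl in *; lra.
      + eapply pf_poles_impl; [|exact PB]. intros p [(j & ->)|[(j & ->)|(_ & j & ->)]];
          try specialize (Bw j); try specialize (Bs j); try specialize (By j); simpl in *; lra.
      + eapply pf_poles_impl; [|exact PA]. intros p [[-> _]|[(j & ->)|(_ & j & ->)]];
          try specialize (Bk j); try specialize (By j); simpl in *; lra.
      + eapply pf_poles_impl; [|exact PB]. intros p [(j & ->)|[(j & ->)|(_ & j & ->)]]; split; intros Hp;
          try specialize (Bw j); try specialize (Bs j); try specialize (By j); simpl in *; lra.
    - exists V1, V2, VG. repeat (split; trivial). unfold AP_integral.
      replace (path_integral gu (fun u => path_integral gv (fun v => AP_integrand N (fun _ => x) (shift_seq (m N) w) (shift_seq (m N) theta)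
        (shift_seq (n N) y) (shift_seq (n N) s) (t + m N) (a + n N) (t' + m N) (a' + n N) u v))) with (double_int gu gv (fst T) (snd T)).
      + rewrite ED. clear ED. simpl Cpow. revert Hpi. generalize (2 * PI * Ci)%C. intros q Hq. match goal with |- ?l = ?r => change (@eq C l r) end. field. exact Hq.
      + unfold double_int. apply path_integral_ext. intros r Hr. apply path_integral_ext. intros r' Hr'.
        rewrite AP_integrand_factors. rewrite EA, EB.
        * unfold FA, FB. assert (Ea : forall f : Z -> R, shift_seq (n N) f (a + n N) = f a) by (intros; unfold shift_seq; f_equal; ring).
          rewrite !Ea.
          change (shift_seq (n N) sig) with (fun j => sqdiv (shift_seq (n N) s j) (shift_seq (n N) y j)).
          change (shift_seq (m N) kap) with (fun j => sqdiv (shift_seq (m N) theta j) (shift_seq (m N) w j)).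
          ring.
        * assert (On : on_path gv (gv r')) by (exists r'; auto).
          repeat split; intros j E; rewrite E in On; [apply (proj1 (VW j) On)|apply (proj1 (VY j) On)|apply (proj1 (VS j) On)].
        * assert (On : on_path gu (gu r)) by (exists r; auto).
          split; [|split]; intros; intros E; rewrite E in On; [apply (proj1 UX On)|apply (proj1 (UK j) On)|apply (proj1 (UY j) On)]. }
  destruct (contours_exist N) as (gu0 & gv0 & Hc0).
  destruct (Each gu0 gv0 Hc0) as (V1 & V2 & VG & J1 & J2 & J3 & E0).
  exists V1, V2. split; [exact J1|]. split; [exact J2|].
  assert (EK : K_AP N (fun _ => x) (shift_seq (m N) w) (shift_seq (m N) theta) (shift_seq (n N) y) (shift_seq (n N) s)
       (t + m N) (a + n N) (t' + m N) (a' + n N) = (/ (2 * PI * Ci) * (V1 + V2 - VG))%C).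
  { unfold K_AP. apply (iota_unique (V := C_R_CompleteNormedModule)).
    - intros v (gu & gv & Hc & ->). destruct (Each gu gv Hc) as (V1' & V2' & VG' & J1' & J2' & J3' & E').
      rewrite E', (chain_int_unique _ _ _ _ J1' J1), (chain_int_unique _ _ _ _ J2' J2), (chain_int_unique _ _ _ _ J3' J3). reflexivity.
    - exists gu0, gv0. split; [exact Hc0|]. symmetry; exact E0. }
  assert (ES : K_2d w theta y s z t a t' a' = (- / (2 * PI * Ci) * VG)%C).
  { apply K_2d_arc. eapply chain_int_ext; [|exact J3]. intros u Hu. destruct (arc_off u Hu) as [OA OB].
    apply (parts_sine N T u HT); assumption. }
  rewrite EK, ES. ring.
Qed.

(** A finite list of all poles: the index L + 1 represents the constant values outside the
    window. *)
Definition params : list R :=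
  x :: flat_map (fun j => w j :: kap j :: y j :: sig j :: nil) (Zrange (- (L + 1)) (L + 1)).

Lemma params_all p : p = x \/ (exists j, p = w j \/ p = kap j \/ p = y j \/ p = sig j) -> In p params.
Proof.
  intros [->|(j & Hj)]; [left; reflexivity|right]. apply in_flat_map.
  destruct (Z_lt_le_dec L (Z.abs j)) as [Hl|Hl].
  - exists (L + 1)%Z. split; [apply Zrange_In; lia|].
    destruct (outside_params j Hl) as (E1 & E2 & E3 & E4). destruct (outside_params (L + 1)) as (F1 & F2 & F3 & F4); [lia|].
    simpl in *. rewrite E2, E4, E1, E3, <- F2, <- F4, <- F1, <- F3 in Hj.
    destruct Hj as [->|[->|[->| ->]]]; auto 6.
  - exists j. split; [apply Zrange_In; lia|]. simpl. destruct Hj as [->|[->|[->| ->]]]; auto 6.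
Qed.

Notation ks := (sqdiv thetas ws).
Notation sigs := (sqdiv ss ys).
Notation S := (action ws ks ys sigs x alpha tau).
Notation tameS := (tame w kap y sig x).

Lemma chain_tame (l : chain) : (forall q, In q params -> ~ on_chain l (RtoC q)) -> exists M, forall u, on_chain l u -> tameS M u.
Proof.
  intros H. destruct (chain_log_bound l params H) as [M HM]. exists M. intros u Hu p Hp. apply params_all in Hp.
  split; [intros E; apply (H p Hp); rewrite <- E; exact Hu|apply HM; assumption].
Qed.

Lemma tame_off M u : tameS M u -> off_A u /\ off_B u.
Proof.
  intros H. assert (G : forall p, p = x \/ (exists j, p = w j \/ p = kap j \/ p = y j \/ p = sig j) -> u <> RtoC p) by (intros p Hp; apply H, Hp).
  unfold off_A, off_B. repeat split; intros; apply G; auto; right; exists j; auto.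
Qed.

Lemma star_params p : p = x \/ p = ws \/ p = ks \/ p = ys \/ p = sigs -> In p params.
Proof.
  intros Hp. apply params_all. destruct (outside_params (L + 1)) as (F1 & F2 & F3 & F4); [lia|].
  destruct Hp as [->|Hp]; [auto|right; exists (L + 1)%Z]. rewrite <- F2, <- F4, <- F1, <- F3 in Hp. cbv beta in Hp. tauto.
Qed.

Lemma eventually_large : exists N0, forall N, (N0 <= N)%nat ->
  (1 <= N)%nat /\ (L + 2 <= m N)%Z /\ (L + 2 <= n N)%Z /\ (1 <= a + n N)%Z /\ (1 <= a' + n N)%Z /\ (0 <= t + m N)%Z /\ (0 <= t' + m N)%Z.
Proof.
  destruct (floor_mult_large tau (Z.abs L + 2 + Z.abs t + Z.abs t') tau_pos) as [N1 H1].
  destruct (floor_mult_large alpha (Z.abs L + 2 + Z.abs a + Z.abs a') alpha_pos) as [N2 H2].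
  exists (1 + N1 + N2)%nat. intros N HN. specialize (H1 N ltac:(lia)). specialize (H2 N ltac:(lia)). lia.
Qed.

(** Choice turns the partial fractions, which exist for each large [N], into sequences; below [N0]
    the value is a dummy. *)
Lemma parts_sequence : exists (TT : nat -> pfrac * pfrac) N0, forall N, (N0 <= N)%nat -> kernel_parts N (TT N).
Proof.
  destruct eventually_large as [N0 HN0].
  assert (H : forall N, exists T, (N0 <= N)%nat -> kernel_parts N T).
  { intros N. destruct (le_lt_dec N0 N) as [HN|HN].
    - destruct (HN0 N HN) as (_ & _ & _ & H1 & H2 & H3 & H4). destruct (kernel_parts_exist N H1 H2 H3 H4) as [T HT]. exists T; auto.
    - exists (nil, nil). lia. }
  exists (fun N => proj1_sig (constructive_indefinite_description _ (H N))), N0.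
  intros N HN. apply (proj2_sig (constructive_indefinite_description _ (H N))), HN.
Qed.

Lemma FA_estimate M : exists C0, 0 <= C0 /\ exists N0, forall N u, (N0 <= N)%nat -> tameS M u ->
  Cmod (FA N u) <= C0 * exp (INR N * S u).
Proof.
  exists (exp (estimate_bound L M t' a')). split; [left; apply exp_pos|].
  destruct eventually_large as [N0 HN0]. exists N0. intros N u HN Hu. destruct (HN0 N HN) as (_ & _ & _ & H1 & H2 & H3 & H4).
  apply (factor_A_estimate L HL w kap y sig ws ks ys sigs x alpha tau outside_params M N u t' a' Hu H2 H4).
Qed.

Lemma FB_estimate M : exists C0, 0 <= C0 /\ exists N0, forall N u, (N0 <= N)%nat -> tameS M u ->
  Cmod (RtoC cB * FB N u) <= C0 * exp (- (INR N * S u)).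
Proof.
  exists (Rabs cB * exp (estimate_bound L M t a)). split; [apply Rmult_le_pos; [apply Rabs_pos|left; apply exp_pos]|].
  destruct eventually_large as [N0 HN0]. exists N0. intros N u HN Hu. destruct (HN0 N HN) as (_ & _ & _ & H1 & H2 & H3 & H4).
  rewrite Cmod_mult, Cmod_R, Rmult_assoc. apply Rmult_le_compat_l; [apply Rabs_pos|].
  apply (factor_B_estimate L HL w kap y sig ws ks ys sigs x alpha tau outside_params M N u t a Hu H1 H3).
Qed.

Section Curves.
Variables (sg : R) (lR lL gi go : list C1path) (bR bL ai ao : R).
Notation U := (fun u => sg * S u).
Hypothesis HpR : path_to (fun u => U u < U z) z bR lR.
Hypothesis HpL : path_to (fun u => U u < U z) z bL lL.
Hypothesis Hgi : path_to (fun u => U z < U u) z ai gi.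
Hypothesis Hgo : path_to (fun u => U z < U u) z ao go.
Hypothesis Hgood : forall c g, In c lR \/ In c lL -> In g gi \/ In g go -> good c g /\ good c (conj_path g).
Hypothesis Havoid : forall q, In q params -> bR <> q /\ bL <> q /\ ai <> q /\ ao <> q.
Notation ridge := (ridge_chain gi go).

Lemma U_conj u : U (Cconj u) = U u.
Proof. simpl. rewrite action_conj. reflexivity. Qed.

Lemma curve_off P b l q : path_to P z b l -> b <> q -> ~ on_chain (arc_chain l) (RtoC q).
Proof.
  intros Hl Hb Hon. apply Hb. symmetry. apply (proj2 (path_to_crossing P z b l Hz Hl) (RtoC q) Hon). reflexivity.
Qed.

Lemma all_tame : exists M, (forall u, on_chain (arc_chain lR) u -> tameS M u) /\
  (forall u, on_chain (arc_chain lL) u -> tameS M u) /\ (forall u, on_chain ridge u -> tameS M u).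
Proof.
  destruct (chain_tame (arc_chain lR ++ arc_chain lL ++ ridge)) as [M HM].
  - intros q Hq. destruct (Havoid q Hq) as (A1 & A2 & A3 & A4). unfold ridge_chain.
    rewrite !on_chain_app, on_diff_chain. intros [H|[H|[H|H]]]; revert H; eapply curve_off; eassumption.
  - exists M. split; [|split]; intros u Hu; apply HM; rewrite !on_chain_app; auto.
Qed.

Lemma U_path_continuous b l c r : path_to (fun u => U u < U z) z b l -> (forall q, In q params -> b <> q) ->
  In c l -> 0 <= r <= 1 -> continuous (fun r => U (c r)) r.
Proof.
  intros Hl Hb Hc Hr.
  assert (G : forall q, In q params -> c r <> RtoC q).
  { intros q Hq E. apply (curve_off _ b l q Hl (Hb q Hq)). apply on_arc_chain. exists c, r. auto. }
  apply (continuous_mult (K := R_AbsRing)); [apply continuous_const|].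
  apply action_continuous; apply G, star_params; auto 6.
Qed.

Lemma ridge_wind p : p <> ai -> p <> ao -> ~ on_chain ridge (RtoC p) /\ wind ridge (RtoC p) = RtoC (left_of ao p - left_of ai p).
Proof.
  intros Hi Ho. unfold ridge_chain.
  apply (wind_diff _ _ z); apply crossing_at; trivial; eapply path_to_crossing; eassumption.
Qed.

Lemma part_vanishes b l (F : nat -> C -> C) (T : nat -> pfrac) cut wl wh wb C0 :
  (b = bR /\ l = lR \/ b = bL /\ l = lL) -> 0 <= C0 -> RtoC wb = RtoC (left_of ao b - left_of ai b) -> b <> ai -> b <> ao ->
  (exists N0, forall N, (N0 <= N)%nat ->
    (forall u, on_chain (arc_chain l) u -> Cmod (F N u) <= C0 * exp (INR N * U u)) /\
    (forall u, on_chain ridge u -> Cmod (pf_eval (T N) u) <= C0 * exp (- (INR N * U u))) /\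
    pf_poles (T N) (fun p => p <> ai /\ p <> ao /\ (p < cut -> left_of ao p - left_of ai p = wl) /\ (cut <= p -> left_of ao p - left_of ai p = wh))) ->
  forall eps, 0 < eps -> exists N1, forall N, (N1 <= N)%nat -> forall V, chain_int (arc_chain l)
    (fun u => F N u * (RtoC (wl - wb) * pf_eval (low cut (T N)) u + RtoC (wh - wb) * pf_eval (high cut (T N)) u))%C V -> Cmod V <= eps.
Proof.
  intros Hbl HC0 Hwb Hbi Hbo (N0 & HN0).
  assert (Hl : path_to (fun u => U u < U z) z b l) by (destruct Hbl as [[-> ->]|[-> ->]]; assumption).
  assert (Hb : forall q, In q params -> b <> q) by (intros q Hq; destruct (Havoid q Hq) as (A1 & A2 & _); destruct Hbl as [[-> _]|[-> _]]; assumption).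
  apply (vanishing U z b ai ao l gi go U_conj Hz Hl Hgi Hgo) with (T := T) (F := F) (cut := fun _ => cut) (C0 := C0); trivial.
  - intros c g Hc Hg. apply Hgood; [destruct Hbl as [[_ ->]|[_ ->]]; auto|exact Hg].
  - intros c r Hc Hr. apply (U_path_continuous b l); assumption.
  - rewrite (proj2 (ridge_wind b Hbi Hbo)), Hwb. reflexivity.
  - exists N0. intros N HN. destruct (HN0 N HN) as (B1 & B2 & B3). split; [exact B1|]. split; [exact B2|].
    eapply pf_poles_impl; [|exact B3]. intros p (Hi & Ho & W1 & W2). destruct (ridge_wind p Hi Ho) as [Hoff ->].
    split; [exact Hoff|]. split; intros Hp; [rewrite (W1 Hp)|rewrite (W2 Hp)]; reflexivity.
Qed.

(** [A] is kept on the descent curves and [B] is split at [ms]. The ridge encloses all w and y and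
    no s^{-2} y. The left descent curve ends inside the ridge, the right one outside. *)
Lemma limit_case_A : sg = 1 -> (alpha < 1 \/ bL < my) -> x < bL < mk -> Mk < bR -> ao < mw -> My < ai < ms -> ao < bL < ai -> ai < bR ->
  forall eps, 0 < eps -> exists N1, forall N, (N1 <= N)%nat ->
    Cmod (K_AP N (fun _ => x) (shift_seq (m N) w) (shift_seq (m N) theta) (shift_seq (n N) y) (shift_seq (n N) s)
       (t + m N) (a + n N) (t' + m N) (a' + n N) - K_2d w theta y s z t a t' a') <= eps.
Proof.
  intros Hsg Hal HbL HbR Hao Hai HbL' HbR' eps Heps. pose proof bounds_chain as HB.
  destruct parts_sequence as (TT & N0 & HTT). destruct eventually_large as [N1 HN1]. destruct all_tame as (M & MR & ML & MG).
  destruct (FA_estimate M) as (CA & HCA & NA & EA). destruct (FB_estimate M) as (CB & HCB & NB & EB).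
  (* Eventually a' + floor (alpha N) <= N, so [A] has no pole at any y, and [bL] may lie among or
     beyond them. *)
  assert (HN2 : exists N2, forall N, (N2 <= N)%nat -> alpha < 1 -> (a' + n N <= Z.of_nat N)%Z).
  { destruct (Rlt_dec alpha 1) as [Hlt|]; [|exists O; intros; contradiction].
    destruct (INR_unbounded ((IZR a' + 1) / (1 - alpha))) as [N2 H2]. exists N2. intros N HN _. apply le_INR in HN.
    pose proof (floor_mult_close alpha N) as Hf. apply Rabs_le_between in Hf.
    apply le_IZR. rewrite plus_IZR, <- INR_IZR_INZ.
    assert (IZR a' + 1 < (1 - alpha) * INR N).
    { apply Rmult_lt_compat_r with (r := 1 - alpha) in H2; [|lra].
      replace ((IZR a' + 1) / (1 - alpha) * (1 - alpha)) with (IZR a' + 1) in H2 by (field; lra). nra. }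
    lra. }
  destruct HN2 as [N2 HN2].
  set (C0 := CA + CB). assert (HC0 : 0 <= C0) by (unfold C0; lra).
  assert (Poles : forall N, (N0 + N1 + N2 <= N)%nat ->
    pf_poles (snd (TT N)) (fun p => p <> ai /\ p <> ao /\ (p < ms -> left_of ao p - left_of ai p = 1) /\ (ms <= p -> left_of ao p - left_of ai p = 0)) /\
    pf_poles (fst (TT N)) (fun p => p < my /\ p < bL /\ p < bR \/ my <= p /\ bL < p < bR) /\
    pf_poles (snd (TT N)) (fun p => p < ms /\ p < bR \/ ms <= p /\ bL < p)).
  { intros N HN. destruct (HTT N ltac:(lia)) as (PA & PB & _). split; [|split].
    - eapply pf_poles_impl; [|exact PB]. intros p [(j & ->)|[(j & ->)|(_ & j & ->)]];
        try specialize (Bw j); try specialize (Bs j); try specialize (By j); simpl in *; repeat split; try lra; intros; left_of_tac.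
    - eapply pf_poles_impl; [|exact PA]. intros p [[-> _]|[(j & ->)|(Hn & j & ->)]]; try specialize (Bk j); try specialize (By j); simpl in *; try lra.
      destruct Hal as [Hal|Hal]; [|lra]. specialize (HN2 N ltac:(lia) Hal). lia.
    - eapply pf_poles_impl; [|exact PB]. intros p [(j & ->)|[(j & ->)|(_ & j & ->)]];
        try specialize (Bw j); try specialize (Bs j); try specialize (By j); simpl in *; lra. }
  assert (Bounds : forall l, l = lR \/ l = lL -> exists N3, forall N, (N3 <= N)%nat ->
    (forall u, on_chain (arc_chain l) u -> Cmod (pf_eval (fst (TT N)) u) <= C0 * exp (INR N * (sg * S u))) /\
    (forall u, on_chain ridge u -> Cmod (pf_eval (snd (TT N)) u) <= C0 * exp (- (INR N * (sg * S u)))) /\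
    pf_poles (snd (TT N)) (fun p => p <> ai /\ p <> ao /\ (p < ms -> left_of ao p - left_of ai p = 1) /\ (ms <= p -> left_of ao p - left_of ai p = 0))).
  { intros l Hl. exists (N0 + N1 + N2 + NA + NB)%nat. intros N HN. destruct (HTT N ltac:(lia)) as (_ & _ & FAe & FBe).
    split; [|split; [|apply Poles; lia]].
    - intros u Hu. assert (Hu' : tameS M u) by (destruct Hl as [-> | ->]; auto).
      rewrite FAe by (apply (tame_off M u Hu')). eapply Rle_trans; [apply EA; [lia|exact Hu']|].
      rewrite Hsg, Rmult_1_l. apply Rmult_le_compat_r; [left; apply exp_pos|unfold C0; lra].
    - intros u Hu. assert (Hu' := MG u Hu).
      rewrite FBe by (apply (tame_off M u Hu')). eapply Rle_trans; [apply EB; [lia|exact Hu']|].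
      rewrite Hsg, Rmult_1_l. apply Rmult_le_compat_r; [left; apply exp_pos|unfold C0; lra]. }
  set (k := Cmod (/ (2 * PI * Ci))). assert (Hk : 0 <= k) by apply Cmod_ge_0.
  set (e := eps / (2 * (k + 1))). assert (He : 0 < e) by (apply Rdiv_lt_0_compat; lra).
  (* The ridge does not wind around [bR]: only the low part remains, with weight 1. *)
  destruct (part_vanishes bR lR (fun N => pf_eval (fst (TT N))) (fun N => snd (TT N)) ms 1 0 0 C0) with (eps := e) as [NR VR]; trivial; try lra.
  { left; auto. } { f_equal. left_of_tac. } { apply Bounds; auto. }
  (* The ridge winds once around [bL]: the low part drops out and the high part has weight -1. *)
  destruct (part_vanishes bL lL (fun N => pf_eval (fst (TT N))) (fun N => snd (TT N)) ms 1 0 1 C0) with (eps := e) as [NL VL]; trivial; try lra.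
  { right; auto. } { f_equal. left_of_tac. } { apply Bounds; auto. }
  exists (N0 + N1 + N2 + NR + NL)%nat. intros N HN.
  destruct (HN1 N ltac:(lia)) as (G1 & G2 & G3 & G4 & G5 & G6 & G7). destruct (Poles N ltac:(lia)) as (_ & PA & PB).
  destruct (kernel_difference N (TT N) (arc_chain lR) (arc_chain lL)
    (fun u => pf_eval (fst (TT N)) u * pf_eval (low ms (snd (TT N))) u)%C (fun u => pf_eval (fst (TT N)) u * pf_eval (high ms (snd (TT N))) u)%C)
    as (V1 & V2 & I1 & I2 & E); trivial.
  { apply HTT; lia. }
  { intros gu gv U0 V0 AO BO Hpos. apply (core_A gu gv (fst (TT N)) (snd (TT N)) my ms z _ _ _ bR bL arc_cross); trivial;
      try (eapply path_to_crossing; eassumption). apply arc_crossing, Hz. }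
  rewrite E, Cmod_mult. fold k.
  assert (B1 : Cmod V1 <= e).
  { apply (VR N ltac:(lia)). eapply chain_int_ext; [|exact I1]. intros u _. simpl. rewrite !Rminus_0_r. ring. }
  assert (B2 : Cmod V2 <= e).
  { replace V2 with (- (- (1) * V2))%C by ring. rewrite Cmod_opp. apply (VL N ltac:(lia)).
    eapply chain_int_ext; [|apply chain_int_scal, I2]. intros u _. simpl. rewrite Rminus_diag, Rminus_0_l, RtoC_opp. ring. }
  assert (B3 := Cmod_triangle V1 V2).
  apply Rle_trans with (k * (e + e)); [apply Rmult_le_compat_l; lra|].
  replace (e + e) with (eps / (k + 1)) by (unfold e; field; lra).
  apply Rmult_le_reg_r with (k + 1); [lra|]. replace (k * (eps / (k + 1)) * (k + 1)) with (k * eps) by (field; lra). nra.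
Qed.
(** [B] is kept on curves descending for -S and [A] is split at [my]. The ridge encloses all y and
    theta^{-2} w but not [x]; now the right descent curve ends inside it and the left one
    outside. *)
Lemma limit_case_B : sg = - 1 -> 1 < alpha -> Mw < bR < ms -> bL < mw -> x < ao < my -> Mk < ai -> ao < bR < ai -> bL < ao ->
  forall eps, 0 < eps -> exists N1, forall N, (N1 <= N)%nat ->
    Cmod (K_AP N (fun _ => x) (shift_seq (m N) w) (shift_seq (m N) theta) (shift_seq (n N) y) (shift_seq (n N) s)
       (t + m N) (a + n N) (t' + m N) (a' + n N) - K_2d w theta y s z t a t' a') <= eps.
Proof.
  intros Hsg Hal HbR HbL Hao Hai HbR' HbL' eps Heps. pose proof bounds_chain as HB.
  destruct parts_sequence as (TT & N0 & HTT). destruct eventually_large as [N1 HN1]. destruct all_tame as (M & MR & ML & MG).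
  destruct (FA_estimate M) as (CA & HCA & NA & EA). destruct (FB_estimate M) as (CB & HCB & NB & EB).
  (* From here on [B] has no pole at any y, so its descent curve may cross the real line on either
     side of them. *)
  assert (HN2 : exists N2, forall N, (N2 <= N)%nat -> (Z.of_nat N < a + n N)%Z).
  { destruct (INR_unbounded ((1 - IZR a) / (alpha - 1))) as [N2 H2]. exists N2. intros N HN. apply le_INR in HN.
    pose proof (floor_mult_close alpha N) as Hf. apply Rabs_le_between in Hf.
    apply lt_IZR. rewrite plus_IZR, <- INR_IZR_INZ.
    assert (1 - IZR a < (alpha - 1) * INR N).
    { apply Rmult_lt_compat_r with (r := alpha - 1) in H2; [|lra].
      replace ((1 - IZR a) / (alpha - 1) * (alpha - 1)) with (1 - IZR a) in H2 by (field; lra). nra. }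
    lra. }
  destruct HN2 as [N2 HN2].
  set (C0 := CA + CB). assert (HC0 : 0 <= C0) by (unfold C0; lra).
  assert (Poles : forall N, (N0 + N1 + N2 <= N)%nat ->
    pf_poles (fst (TT N)) (fun p => p <> ai /\ p <> ao /\ (p < my -> left_of ao p - left_of ai p = 0) /\ (my <= p -> left_of ao p - left_of ai p = 1)) /\
    pf_poles (snd (TT N)) (fun p => p < ms /\ bL < p < bR \/ ms <= p /\ bL < p /\ bR < p) /\
    pf_poles (fst (TT N)) (fun p => p < my /\ p < bR \/ my <= p /\ bL < p)).
  { intros N HN. destruct (HTT N ltac:(lia)) as (PA & PB & _). split; [|split].
    - eapply pf_poles_impl; [|exact PA]. intros p [[-> _]|[(j & ->)|(_ & j & ->)]];
        try specialize (Bk j); try specialize (By j); simpl in *; repeat split; try lra; intros; left_of_tac.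
    - eapply pf_poles_impl; [|exact PB]. intros p [(j & ->)|[(j & ->)|(Hn & j & ->)]];
        try specialize (Bw j); try specialize (Bs j); try specialize (By j); simpl in *; try lra.
      specialize (HN2 N ltac:(lia)). lia.
    - eapply pf_poles_impl; [|exact PA]. intros p [[-> _]|[(j & ->)|(_ & j & ->)]];
        try specialize (Bk j); try specialize (By j); simpl in *; lra. }
  assert (Bounds : forall l, l = lR \/ l = lL -> exists N3, forall N, (N3 <= N)%nat ->
    (forall u, on_chain (arc_chain l) u -> Cmod (pf_eval (snd (TT N)) u) <= C0 * exp (INR N * (sg * S u))) /\
    (forall u, on_chain ridge u -> Cmod (pf_eval (fst (TT N)) u) <= C0 * exp (- (INR N * (sg * S u)))) /\
    pf_poles (fst (TT N)) (fun p => p <> ai /\ p <> ao /\ (p < my -> left_of ao p - left_of ai p = 0) /\ (my <= p -> left_of ao p - left_of ai p = 1))).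
  { intros l Hl. exists (N0 + N1 + N2 + NA + NB)%nat. intros N HN. destruct (HTT N ltac:(lia)) as (_ & _ & FAe & FBe).
    split; [|split; [|apply Poles; lia]].
    - intros u Hu. assert (Hu' : tameS M u) by (destruct Hl as [-> | ->]; auto).
      rewrite FBe by (apply (tame_off M u Hu')). eapply Rle_trans; [apply EB; [lia|exact Hu']|].
      rewrite Hsg. replace (INR N * (- 1 * S u)) with (- (INR N * S u)) by ring. apply Rmult_le_compat_r; [left; apply exp_pos|unfold C0; lra].
    - intros u Hu. assert (Hu' := MG u Hu).
      rewrite FAe by (apply (tame_off M u Hu')). eapply Rle_trans; [apply EA; [lia|exact Hu']|].
      rewrite Hsg. replace (- (INR N * (- 1 * S u))) with (INR N * S u) by ring. apply Rmult_le_compat_r; [left; apply exp_pos|unfold C0; lra]. }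
  set (k := Cmod (/ (2 * PI * Ci))). assert (Hk : 0 <= k) by apply Cmod_ge_0.
  set (e := eps / (2 * (k + 1))). assert (He : 0 < e) by (apply Rdiv_lt_0_compat; lra).
  destruct (part_vanishes bR lR (fun N => pf_eval (snd (TT N))) (fun N => fst (TT N)) my 0 1 1 C0) with (eps := e) as [NR VR]; trivial; try lra.
  { left; auto. } { f_equal. left_of_tac. } { apply Bounds; auto. }
  destruct (part_vanishes bL lL (fun N => pf_eval (snd (TT N))) (fun N => fst (TT N)) my 0 1 0 C0) with (eps := e) as [NL VL]; trivial; try lra.
  { right; auto. } { f_equal. left_of_tac. } { apply Bounds; auto. }
  exists (N0 + N1 + N2 + NR + NL)%nat. intros N HN.
  destruct (HN1 N ltac:(lia)) as (G1 & G2 & G3 & G4 & G5 & G6 & G7). destruct (Poles N ltac:(lia)) as (_ & PB & PA).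
  destruct (kernel_difference N (TT N) (arc_chain lR) (arc_chain lL)
    (fun u => pf_eval (snd (TT N)) u * pf_eval (low my (fst (TT N))) u)%C (fun u => pf_eval (snd (TT N)) u * pf_eval (high my (fst (TT N))) u)%C)
    as (V1 & V2 & I1 & I2 & E); trivial.
  { apply HTT; lia. }
  { intros gu gv U0 V0 AO BO Hpos. apply (core_B gu gv (fst (TT N)) (snd (TT N)) my ms z _ _ _ bR bL arc_cross); trivial;
      try (eapply path_to_crossing; eassumption). apply arc_crossing, Hz. }
  rewrite E, Cmod_mult. fold k.
  assert (B1 : Cmod V1 <= e).
  { replace V1 with (- (- (1) * V1))%C by ring. rewrite Cmod_opp. apply (VR N ltac:(lia)).
    eapply chain_int_ext; [|apply chain_int_scal, I1]. intros u _. simpl. rewrite Rminus_diag, Rminus_0_l, RtoC_opp. ring. }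
  assert (B2 : Cmod V2 <= e).
  { apply (VL N ltac:(lia)). eapply chain_int_ext; [|exact I2]. intros u _. simpl. rewrite !Rminus_0_r. ring. }
  assert (B3 := Cmod_triangle V1 V2).
  apply Rle_trans with (k * (e + e)); [apply Rmult_le_compat_l; lra|].
  replace (e + e) with (eps / (k + 1)) by (unfold e; field; lra).
  apply Rmult_le_reg_r with (k + 1); [lra|]. replace (k * (eps / (k + 1)) * (k + 1)) with (k * eps) by (field; lra). nra.
Qed.
End Curves.
End Limit.

(** * Choice of the curves *)

Section Moebius.
Variables P0 Pinf : R.
Hypothesis HP : Pinf < P0.
Notation zeta q := ((q - P0) / (q - Pinf)).
Notation mob := (moebius_real P0 Pinf).

Lemma zeta_mob r : r <> 1 -> mob r - Pinf = (P0 - Pinf) / (1 - r).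
Proof. intros Hr. unfold moebius_real. field. lra. Qed.

Lemma mob_gt_inf r : r < 1 -> Pinf < mob r.
Proof.
  intros Hr. assert (0 < (P0 - Pinf) / (1 - r)) by (apply Rdiv_lt_0_compat; lra). rewrite <- zeta_mob in H by lra. lra.
Qed.

Lemma mob_increasing r r' : r < r' -> (r' < 1 \/ 1 < r) -> mob r < mob r'.
Proof.
  intros Hr Hs. assert (E : mob r' - mob r = (P0 - Pinf) * (r' - r) / ((1 - r) * (1 - r'))) by (unfold moebius_real; field; lra).
  assert (0 < (1 - r) * (1 - r')).
  { destruct Hs; [apply Rmult_lt_0_compat; lra|]. apply Rmult_neg_neg; lra. }
  assert (0 < (P0 - Pinf) * (r' - r) / ((1 - r) * (1 - r'))) by (apply Rdiv_lt_0_compat; [apply Rmult_lt_0_compat; lra|assumption]).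
  lra.
Qed.

Lemma mob_zeta q : q <> Pinf -> mob (zeta q) = q.
Proof. intros Hq. unfold moebius_real. field. repeat split; lra. Qed.

Lemma zeta_lt_1 q : Pinf < q -> zeta q < 1.
Proof.
  intros Hq. assert (E : 1 - zeta q = (P0 - Pinf) / (q - Pinf)) by (field; lra).
  assert (0 < (P0 - Pinf) / (q - Pinf)) by (apply Rdiv_lt_0_compat; lra). lra.
Qed.

Lemma zeta_gt_1 q : q < Pinf -> 1 < zeta q.
Proof.
  intros Hq. assert (E : zeta q - 1 = (P0 - Pinf) / (Pinf - q)) by (field; lra).
  assert (0 < (P0 - Pinf) / (Pinf - q)) by (apply Rdiv_lt_0_compat; lra). lra.
Qed.

Lemma zeta_increasing q q' : q < q' -> (q' < Pinf \/ Pinf < q) -> zeta q < zeta q'.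
Proof.
  intros Hq Hs. assert (E : zeta q' - zeta q = (P0 - Pinf) * (q' - q) / ((q - Pinf) * (q' - Pinf))) by (field; lra).
  assert (0 < (q - Pinf) * (q' - Pinf)).
  { destruct Hs; [apply Rmult_neg_neg; lra|apply Rmult_lt_0_compat; lra]. }
  assert (0 < (P0 - Pinf) * (q' - q) / ((q - Pinf) * (q' - Pinf))) by (apply Rdiv_lt_0_compat; [apply Rmult_lt_0_compat; lra|assumption]).
  lra.
Qed.

Lemma zeta_neg q : Pinf < q < P0 -> zeta q < 0.
Proof. intros Hq. apply Rdiv_neg_pos; lra. Qed.

Lemma zeta_nonpos q : Pinf < q <= P0 -> zeta q <= 0.
Proof.
  intros [Hq [H| ->]]; [left; apply zeta_neg; lra|]. rewrite Rminus_diag. unfold Rdiv. lra.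
Qed.

Lemma zeta_pos q : P0 < q -> 0 < zeta q.
Proof. intros Hq. apply Rdiv_lt_0_compat; lra. Qed.

Lemma zeta_nonneg q : P0 <= q -> 0 <= zeta q.
Proof.
  intros [H| <-]; [left; apply zeta_pos; lra|]. rewrite Rminus_diag. unfold Rdiv. lra.
Qed.

Lemma mob_lt r q : r < 1 -> Pinf < q -> r < zeta q -> mob r < q.
Proof. intros Hr Hq H. rewrite <- (mob_zeta q) by lra. apply mob_increasing; [exact H|left; apply zeta_lt_1, Hq]. Qed.

Lemma mob_gt r q : r < 1 -> Pinf < q -> zeta q < r -> q < mob r.
Proof. intros Hr Hq H. rewrite <- (mob_zeta q) at 1 by lra. apply mob_increasing; [exact H|left; exact Hr]. Qed.

Lemma mob_lt_beyond r q : 1 < r -> q < Pinf -> r < zeta q -> mob r < q.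
Proof. intros Hr Hq H. rewrite <- (mob_zeta q) by lra. apply mob_increasing; [exact H|right; exact Hr]. Qed.
End Moebius.

Section Final.
Variables (L : Z) (w theta y s : Z -> R) (ws thetas ys ss x : R).
Notation kap := (fun j : Z => sqdiv (theta j) (w j)).
Notation sig := (fun j : Z => sqdiv (s j) (y j)).
Notation ks := (sqdiv thetas ws).
Notation sigs := (sqdiv ss ys).
Hypothesis HL : (1 <= L)%Z.
Hypothesis outside : forall i : Z, (L < Z.abs i)%Z -> w i = ws /\ theta i = thetas /\ y i = ys /\ s i = ss.
Hypothesis ordered : forall i j : Z, w i < y j /\ y j < kap i /\ kap i < sig j.
Variables (z : C) (alpha tau : R).
Hypothesis Hz : 0 < Im z.
Hypothesis alpha_pos : 0 < alpha.
Hypothesis tau_pos : 0 < tau.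
Hypothesis critical : S_deriv x ws thetas ys ss alpha tau z = RtoC 0.
Variables (mw Mw my My mk Mk ms : R).
Hypothesis Bw : forall j, mw <= w j <= Mw.
Hypothesis By : forall j, my <= y j <= My.
Hypothesis Bk : forall j, mk <= kap j <= Mk.
Hypothesis Bs : forall j, ms <= sig j.
Hypothesis Bord : x < mw /\ Mw < my /\ My < mk /\ Mk < ms.
Hypothesis Bstar : mw < ws < Mw.

Lemma star_bounds : x < mw /\ mw < ws /\ ws < Mw /\ Mw < my /\ my <= ys /\ ys <= My /\ My < mk /\ mk <= ks /\ ks <= Mk /\ Mk < ms /\ ms <= sigs.
Proof.
  destruct (outside (L + 1)) as (E1 & E2 & E3 & E4); [lia|].
  pose proof (By (L + 1)%Z) as H1. pose proof (Bk (L + 1)%Z) as H2. pose proof (Bs (L + 1)%Z) as H3. cbv beta in *.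
  rewrite E3 in H1. rewrite E1, E2 in H2. rewrite E3, E4 in H3. lra.
Qed.

Definition kernel_error (t a t' a' : Z) (N : nat) : R :=
  Cmod (K_AP N (fun _ => x) (shift_seq (floor_mult tau N) w) (shift_seq (floor_mult tau N) theta)
    (shift_seq (floor_mult alpha N) y) (shift_seq (floor_mult alpha N) s)
    (t + floor_mult tau N) (a + floor_mult alpha N) (t' + floor_mult tau N) (a' + floor_mult alpha N)
    - K_2d w theta y s z t a t' a').

(** Covers alpha < 1 and alpha = 1. The pairs (c1, ws) and (c2, q2) represent the charges tau at w_*
    and 1 - alpha at y_*, and [b0] bounds the crossing of the left descent curve. *)
Lemma below_one (q2 c1 c2 b0 : R) : 0 < c1 -> 0 < c2 -> c1 + c2 = tau + 1 - alpha ->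
  (forall u, c1 * ln (Cmod (u - ws)) + c2 * ln (Cmod (u - q2)) = tau * ln (Cmod (u - ws)) + (1 - alpha) * ln (Cmod (u - ys))) ->
  (RtoC c1 / (z - ws) + RtoC c2 / (z - q2) = RtoC tau / (z - ws) + RtoC (1 - alpha) / (z - ys))%C ->
  ws <= q2 < b0 -> b0 <= mk -> (alpha < 1 \/ b0 <= my) ->
  forall t a t' a' eps, 0 < eps -> exists N1, forall N, (N1 <= N)%nat -> kernel_error t a t' a' N <= eps.
Proof.
  intros Hc1 Hc2 Hsum Hpot Hcrit Hq2 Hb0 Hal t a t' a' eps Heps. pose proof star_bounds as SB.
  assert (HP : x < ks) by lra.
  destruct (saddle_point ks x ws q2 sigs c1 c2 alpha tau HP ltac:(repeat split; lra) z Hz) as (r0 & x0 & Hr0 & Hx0 & HX0 & Ez & Ang & Rad).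
  { replace (c1 + c2 + alpha - tau) with 1 by lra. rewrite Hcrit. rewrite <- critical. unfold S_deriv.
    assert (Nx := upper_neq z Hz x). unfold Cdiv. ring. }
  assert (Epot : forall u, potential ks x ws q2 sigs c1 c2 alpha tau u = 1 * action ws ks ys sigs x alpha tau u).
  { intros u. unfold potential, action. specialize (Hpot u). replace (c1 + c2 + alpha - tau) with 1 by lra. lra. }
  assert (Z1 := zeta_increasing ks x HP). assert (Z2 := zeta_neg ks x). assert (Z3 := zeta_lt_1 ks x HP).
  assert (Z4 := zeta_pos ks x HP). assert (Z5 := zeta_nonneg ks x HP). assert (Z6 := zeta_nonpos ks x).
  (* The windows are [zeta] images of the required ranges: bR > Mk, bL < b0, ai > My, ao < mw. The
     value 1 is the image of infinity, and [khim] only has to exceed the position of the outermost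
     charge. *)
  destruct (steepest_curves ((ws - ks) / (ws - x)) ((q2 - ks) / (q2 - x)) ((sigs - ks) / (sigs - x)) c1 c2 alpha tau r0 (cos x0))
    with (P0 := ks) (Pinf := x) (U := potential ks x ws q2 sigs c1 c2 alpha tau)
      (k0 := c1 * ln (Rabs ((ws - x) / (ks - x))) + c2 * ln (Rabs ((q2 - x) / (ks - x))) + alpha * ln (Rabs ((sigs - x) / (ks - x))))
      (x0 := x0) (Q := params L w theta y s x) (klop := (Mk - ks) / (Mk - x)) (khip := 1) (klom := - ((b0 - ks) / (b0 - x)))
      (khim := - ((ws - ks) / (ws - x)) + 1) (eps := - ((My - ks) / (My - x))) (M := - ((mw - ks) / (mw - x)))
    as (lp & lm & gi & go & rp & rm & ri & ro & Hrp & Hrm & Hri & Hro & Hord & Pp & Pm & Pi & Po & Hrp1 & Hav & Hgood); trivial.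
  - split; [split|apply Z4; lra]; [|apply Z2; lra]. destruct (Req_dec_T ws q2) as [<-|]; [lra|]. left. apply Z1; lra.
  - lra.
  - intros r xx HR Hn. apply potential_energy; trivial. repeat split; lra.
  - apply potential_conj.
  - apply Z5; lra.
  - split; [apply Z1; lra|apply Z3; lra].
  - specialize (Z6 b0 ltac:(lra)). lra.
  - apply Ropp_lt_contravar, Z1; lra.
  - lra.
  - specialize (Z2 My ltac:(lra)). lra.
  - rewrite <- Ez in *.
    set (bR := moebius_real ks x rp) in *. set (bL := moebius_real ks x (- rm)) in *.
    set (ai := moebius_real ks x (- ri)) in *. set (ao := moebius_real ks x (- ro)) in *.
    assert (K1 : Mk < bR) by (apply mob_gt; lra).
    assert (K2 : x < bL) by (apply mob_gt_inf; lra).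
    assert (K3 : bL < b0) by (apply mob_lt; lra).
    assert (K4 : ao < mw) by (apply mob_lt; lra).
    assert (K5 : My < ai) by (apply mob_gt; lra).
    assert (K6 : ai < ms) by (apply mob_lt; try lra; specialize (Z4 ms ltac:(lra)); lra).
    assert (K7 : ao < bL) by (apply mob_increasing; lra).
    assert (K8 : bL < ai) by (apply mob_increasing; lra).
    assert (K9 : 0 <= (Mk - ks) / (Mk - x)) by (apply Z5; lra).
    assert (K10 : ai < bR) by (apply mob_increasing; lra).
    assert (Conv : forall b l, path_to (fun u => potential ks x ws q2 sigs c1 c2 alpha tau u < potential ks x ws q2 sigs c1 c2 alpha tau z) z b l ->
      path_to (fun u => 1 * action ws ks ys sigs x alpha tau u < 1 * action ws ks ys sigs x alpha tau z) z b l).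
    { intros b l. apply path_to_impl. intros u. rewrite !Epot. trivial. }
    assert (Conv' : forall b l, path_to (fun u => potential ks x ws q2 sigs c1 c2 alpha tau z < potential ks x ws q2 sigs c1 c2 alpha tau u) z b l ->
      path_to (fun u => 1 * action ws ks ys sigs x alpha tau z < 1 * action ws ks ys sigs x alpha tau u) z b l).
    { intros b l. apply path_to_impl. intros u. rewrite !Epot. trivial. }
    unfold kernel_error.
    apply (limit_case_A L w theta y s ws thetas ys ss x HL outside ordered z alpha tau t a t' a' Hz alpha_pos tau_pos mw Mw my My mk Mk ms
      Bw By Bk Bs Bord 1 lp lm gi go bR bL ai ao); auto; lra.
Qed.

(** For -S the charges alpha - 1, tau and 1 at y_*, theta_*^{-2} w_* and x_* are positive. This is
    why s_*^{-2} y_* and w_* become 0 and infinity. *)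
Lemma above_one : 1 < alpha ->
  forall t a t' a' eps, 0 < eps -> exists N1, forall N, (N1 <= N)%nat -> kernel_error t a t' a' N <= eps.
Proof.
  intros Hal t a t' a' eps Heps. pose proof star_bounds as SB.
  assert (HP : ws < sigs) by lra.
  set (c1 := alpha - 1).
  destruct (saddle_point sigs ws ys ks x c1 tau 1 alpha HP ltac:(repeat split; lra) z Hz) as (r0 & x0 & Hr0 & Hx0 & HX0 & Ez & Ang & Rad).
  { unfold c1. replace (alpha - 1 + tau + 1 - alpha) with tau by lra.
    transitivity (- S_deriv x ws thetas ys ss alpha tau z)%C; [|rewrite critical; ring]. unfold S_deriv.
    rewrite !RtoC_minus. unfold Cdiv. ring. }
  assert (Epot : forall u, potential sigs ws ys ks x c1 tau 1 alpha u = - 1 * action ws ks ys sigs x alpha tau u).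
  { intros u. unfold potential, action, c1. replace (alpha - 1 + tau + 1 - alpha) with tau by lra. ring. }
  assert (Z1 := zeta_increasing sigs ws HP). assert (Z2 := zeta_neg sigs ws). assert (Z3 := zeta_lt_1 sigs ws HP).
  assert (Z6 := zeta_nonpos sigs ws). assert (Z7 := zeta_gt_1 sigs ws HP).
  (* Here zeta > 1 is the half-line to the left of w_*. The curve ending on the positive axis is
     therefore the left one, crossing below all w. *)
  destruct (steepest_curves ((ys - sigs) / (ys - ws)) ((ks - sigs) / (ks - ws)) ((x - sigs) / (x - ws)) c1 tau 1 alpha r0 (cos x0))
    with (P0 := sigs) (Pinf := ws) (U := potential sigs ws ys ks x c1 tau 1 alpha)
      (k0 := c1 * ln (Rabs ((ys - ws) / (sigs - ws))) + tau * ln (Rabs ((ks - ws) / (sigs - ws))) + 1 * ln (Rabs ((x - ws) / (sigs - ws))))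
      (x0 := x0) (Q := params L w theta y s x) (klop := 1) (khip := (mw - sigs) / (mw - ws)) (klom := - ((ms - sigs) / (ms - ws)))
      (khim := - ((Mw - sigs) / (Mw - ws))) (eps := - ((Mk - sigs) / (Mk - ws))) (M := - ((my - sigs) / (my - ws)))
    as (lp & lm & gi & go & rp & rm & ri & ro & Hrp & Hrm & Hri & Hro & Hord & Pp & Pm & Pi & Po & Hrp1 & Hav & Hgood); trivial.
  - split; [split|]; [left; apply Z1; lra|apply Z2; lra|]. specialize (Z7 x ltac:(lra)). lra.
  - unfold c1. lra.
  - intros r xx HR Hn. apply potential_energy; trivial. repeat split; lra.
  - apply potential_conj.
  - lra.
  - split; [apply Z7; lra|apply Z1; lra].
  - specialize (Z6 ms ltac:(lra)). lra.
  - apply Ropp_lt_contravar, Z1; lra.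
  - apply Ropp_lt_contravar, Z1; lra.
  - specialize (Z2 Mk ltac:(lra)). lra.
  - rewrite <- Ez in *.
    set (bL := moebius_real sigs ws rp) in *. set (bR := moebius_real sigs ws (- rm)) in *.
    set (ai := moebius_real sigs ws (- ri)) in *. set (ao := moebius_real sigs ws (- ro)) in *.
    assert (K0 : 0 < rm) by lra.
    assert (K1 : bR < ms) by (apply mob_lt; lra).
    assert (K2 : Mw < bR) by (apply mob_gt; lra).
    assert (K3 : bL < mw) by (apply mob_lt_beyond; lra).
    assert (K4 : ws < ao) by (apply mob_gt_inf; lra).
    assert (K5 : ao < my) by (apply mob_lt; lra).
    assert (K6 : Mk < ai) by (apply mob_gt; lra).
    assert (K7 : ao < bR) by (apply mob_increasing; lra).
    assert (K8 : bR < ai) by (apply mob_increasing; lra).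
    assert (Conv : forall b l, path_to (fun u => potential sigs ws ys ks x c1 tau 1 alpha u < potential sigs ws ys ks x c1 tau 1 alpha z) z b l ->
      path_to (fun u => - 1 * action ws ks ys sigs x alpha tau u < - 1 * action ws ks ys sigs x alpha tau z) z b l).
    { intros b l. apply path_to_impl. intros u. rewrite !Epot. trivial. }
    assert (Conv' : forall b l, path_to (fun u => potential sigs ws ys ks x c1 tau 1 alpha z < potential sigs ws ys ks x c1 tau 1 alpha u) z b l ->
      path_to (fun u => - 1 * action ws ks ys sigs x alpha tau z < - 1 * action ws ks ys sigs x alpha tau u) z b l).
    { intros b l. apply path_to_impl. intros u. rewrite !Epot. trivial. }
    unfold kernel_error.
    apply (limit_case_B L w theta y s ws thetas ys ss x HL outside ordered z alpha tau t a t' a' Hz alpha_pos tau_pos mw Mw my My mk Mk ms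
      Bw By Bk Bs Bord (- 1) lm lp gi go bR bL ai ao); auto; try lra.
    + intros c g [Hc|Hc] Hg; apply Hgood; auto.
    + intros q Hq. destruct (Hav q Hq) as (A1 & A2 & A3 & A4). auto.
Qed.

Lemma kernel_error_small t a t' a' eps : 0 < eps -> exists N1, forall N, (N1 <= N)%nat -> kernel_error t a t' a' N <= eps.
Proof.
  pose proof star_bounds as SB.
  destruct (Rtotal_order alpha 1) as [Hal|[Hal|Hal]]; [| |apply above_one; assumption].
  - apply (below_one ys tau (1 - alpha) mk); try lra; reflexivity.
  (* At alpha = 1 the charge at y_* vanishes and tau is split into two coinciding halves. [A] may
     have poles at y for arbitrarily large [N], so the left curve must cross below [my]. *)
  - apply (below_one ws (tau / 2) (tau / 2) my); try lra.
    + intros u. rewrite Hal. field.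
    + rewrite Hal, Rminus_diag. unfold Rdiv. rewrite RtoC_mult. unfold Cdiv.
      assert (E : (RtoC (/ 2) + RtoC (/ 2))%C = RtoC 1) by (rewrite <- RtoC_plus; f_equal; field).
      transitivity (RtoC tau * / (z - ws) * (RtoC (/ 2) + RtoC (/ 2)))%C; [ring|rewrite E; ring].
Qed.
End Final.

Lemma range_min_attained L f : exists i, range_min L f = f i.
Proof.
  unfold range_min. induction (Zrange (- L) L) as [|k l (i & IH)]; simpl; [exists 0%Z; reflexivity|].
  unfold Rmin at 1. destruct Rle_dec; [exists k; reflexivity|exists i; exact IH].
Qed.

Lemma range_max_attained L f : exists i, range_max L f = f i.
Proof.
  unfold range_max. induction (Zrange (- L) L) as [|k l (i & IH)]; simpl; [exists 0%Z; reflexivity|].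
  unfold Rmax at 1. destruct Rle_dec; [exists i; exact IH|exists k; reflexivity].
Qed.

Lemma filterlim_C_of_Cmod (f : nat -> C) (l : C) :
  (forall eps, 0 < eps -> exists N1, forall N, (N1 <= N)%nat -> Cmod (f N - l) <= eps) ->
  filterlim f eventually (locally l).
Proof.
  intros H. apply filterlim_locally. intros eps. destruct (H (eps / 2)) as [N1 HN1].
  { destruct eps as [e He]; simpl; lra. }
  exists N1. intros N HN. specialize (HN1 N HN). pose proof (cond_pos eps) as He.
  assert (HR : Rabs (Re (f N - l)) <= Cmod (f N - l)) by apply re_le_Cmod.
  assert (HI : Rabs (Im (f N - l)) <= Cmod (f N - l)) by (eapply Rle_trans; [apply Rmax_r|apply (Rmax_Cmod (f N - l)%C)]).
  split; unfold AbsRing_ball, abs, minus, plus, opp; simpl.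
  - apply Rle_lt_trans with (eps / 2); [eapply Rle_trans; [|exact HN1]; exact HR|lra].
  - apply Rle_lt_trans with (eps / 2); [eapply Rle_trans; [|exact HN1]; exact HI|lra].
Qed.

Theorem theorem1p11
  (L : Z) (L_ge1 : (1 <= L)%Z)
  (w theta y s : Z -> R) (w_star theta_star y_star s_star : R)
  (w_between : range_min L w < w_star < range_max L w)
  (theta_between : range_min L theta < theta_star < range_max L theta)
  (y_between : range_min L y < y_star < range_max L y)
  (s_between : range_min L s < s_star < range_max L s)
  (outside : forall i : Z, (L < Z.abs i)%Z ->
     w i = w_star /\ theta i = theta_star /\ y i = y_star /\ s i = s_star)
  (theta_neq0 : forall i : Z, theta i <> 0)
  (s_neq0 : forall j : Z, s j <> 0)
  (ordered : forall i j : Z,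
     w i < y j /\ y j < sqdiv (theta i) (w i) /\
     sqdiv (theta i) (w i) < sqdiv (s j) (y j))
  (z : C) (z_upper : 0 < Im z) :
  exists X : R, X <= w_star /\
    forall x_star : R, x_star < X ->
      let alpha := alpha_of x_star w_star theta_star y_star s_star z in
      let tau := tau_of x_star w_star theta_star y_star s_star z in
      forall t a t' a' : Z,
        filterlim
          (fun N : nat =>
             let m := floor_mult tau N in
             let n := floor_mult alpha N in
             K_AP N (fun _ : Z => x_star) (shift_seq m w) (shift_seq m theta)
               (shift_seq n y) (shift_seq n s)
               (t + m)%Z (a + n)%Z (t' + m)%Z (a' + n)%Z)
          eventually
          (locally (K_2d w theta y s z t a t' a')).
Proof.
  assert (Ow : forall j, (L < Z.abs j)%Z -> w j = w_star) by (intros j Hj; apply (outside j Hj)).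
  assert (Oy : forall j, (L < Z.abs j)%Z -> y j = y_star) by (intros j Hj; apply (outside j Hj)).
  assert (Ok : forall j, (L < Z.abs j)%Z -> sqdiv (theta j) (w j) = sqdiv theta_star w_star).
  { intros j Hj. destruct (outside j Hj) as (-> & -> & _). reflexivity. }
  assert (Os : forall j, (L < Z.abs j)%Z -> sqdiv (s j) (y j) = sqdiv s_star y_star).
  { intros j Hj. destruct (outside j Hj) as (_ & _ & -> & ->). reflexivity. }
  destruct (seq_extrema L w w_star Ow) as (iw & jw & Bw).
  destruct (seq_extrema L y y_star Oy) as (iy & jy & By).
  destruct (seq_extrema L (fun j => sqdiv (theta j) (w j)) _ Ok) as (ik & jk & Bk).
  destruct (seq_extrema L (fun j => sqdiv (s j) (y j)) _ Os) as (is & js & Bs).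
  assert (Bstar : w iw < w_star < w jw).
  { destruct (range_min_attained L w) as (i1 & E1). destruct (range_max_attained L w) as (i2 & E2).
    rewrite E1, E2 in w_between. pose proof (Bw i1). pose proof (Bw i2). lra. }
  destruct (outside (L + 1)%Z ltac:(lia)) as (E1 & E2 & E3 & E4).
  assert (Bord : w jw < y iy /\ y jy < sqdiv (theta ik) (w ik) /\ sqdiv (theta jk) (w jk) < sqdiv (s is) (y is)).
  { pose proof (ordered jw iy). pose proof (ordered ik jy). pose proof (ordered jk is). lra. }
  assert (Hstar : w_star < y_star /\ y_star < sqdiv theta_star w_star /\ sqdiv theta_star w_star < sqdiv s_star y_star).
  { pose proof (ordered (L + 1) (L + 1))%Z as H. rewrite E1, E2, E3, E4 in H. exact H. }
  destruct z as [p b]. unfold Im in z_upper; simpl in z_upper.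
  destruct (x_far_exists w_star y_star (sqdiv theta_star w_star) p b z_upper) as [X HX]; [lra|lra|].
  (* [X] makes alpha positive, and the minimum of the w_i keeps x_* to the left of all other
     parameters. *)
  exists (Rmin X (w iw)). split; [eapply Rle_trans; [apply Rmin_r|lra]|].
  intros x Hx alpha tau t a t' a'.
  assert (Hx1 : x < X) by (eapply Rlt_le_trans; [exact Hx|apply Rmin_l]).
  assert (Hx2 : x < w iw) by (eapply Rlt_le_trans; [exact Hx|apply Rmin_r]).
  destruct (location_spec x w_star theta_star y_star s_star p b ltac:(lra) z_upper (HX x Hx1)) as (Ha & Ht & Hcrit).
  fold alpha in Ha, Hcrit. fold tau in Ht, Hcrit.
  apply filterlim_C_of_Cmod. intros eps Heps.
  apply (kernel_error_small L w theta y s w_star theta_star y_star s_star x L_ge1 outside ordered (p, b) alpha tau z_upper Ha Ht Hcrit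
    (w iw) (w jw) (y iy) (y jy) (sqdiv (theta ik) (w ik)) (sqdiv (theta jk) (w jk)) (sqdiv (s is) (y is)) Bw By Bk); trivial.
  - intros j. apply Bs.
  - lra.
Qed.
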